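(* Let $(c_0,\rho_0,\theta_0,u_0)\in L^\infty(\mathbb T)^3\times H^1(\mathbb T)$ and suppose there exist positive constants $\underline{\rho_0},\overline{\rho_0},\underline{\theta_0},\overline{\theta_0}$ such that for a.e. $x\in\mathbb T$, $\underline{\rho_0}\le\rho_0(x)\le\overline{\rho_0}$, $\underline{\theta_0}\le\theta_0(x)\le\overline{\theta_0}$ and $0\le c_0(x)\le1$. Then for every $T>0$ there exists at most one solution à la Hoff on $[0,T]$ of (NS) with initial data $(c_0,\rho_0,\theta_0,u_0)$.
   Context: $\mathbb T=\mathbb R/\mathbb Z$ is identified with $[0,1)$. Fix constants $\mu_\pm>0$, $\gamma_\pm>1$, $c_{v,\pm}>0$, and for $c\in[0,1]$ set $\mu(c)=c\mu_++(1-c)\mu_-$, $\gamma(c)=c\gamma_++(1-c)\gamma_-$, $c_v(c)=c\,c_{v,+}+(1-c)c_{v,-}$. For unknowns $c,\rho,\theta,u$ on $[0,T]\times\mathbb T$, write $p=(\gamma(c)-1)\rho\theta$, $\sigma=\mu(c)\partial_xu-p$, $E=u^2/2+c_v(c)\theta$. The mesoscopic system (NS) is $\partial_t\rho+\partial_x(\rho u)=0$, $\partial_t(\rho c)+\partial_x(\rho c u)=0$, $\partial_t(\rho u)+\partial_x(\rho u^2)=\partial_x\sigma$, $\partial_t(\rho E)+\partial_x(\rho E u)=\partial_x(\sigma u)$, with initial data $\rho|_{t=0}=\rho_0$, $(\rho c)|_{t=0}=\rho_0c_0$, $(\rho u)|_{t=0}=\rho_0u_0$, $(\rho E)|_{t=0}=\rho_0E_0$,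 $E_0=u_0^2/2+c_v(c_0)\theta_0$. A weak solution on $[0,T]$ is $(c,\rho,\theta,u)\in L^\infty(0,T;L^\infty(\mathbb T))\times L^\infty(0,T;L^1(\mathbb T))^2\times L^1(0,T;W^{1,1}(\mathbb T))$ satisfying these equations in distributions and the initial data weakly. Write $\dot f=\partial_tf+u\partial_xf$, $\kappa(t)=\min(1,t)$. A solution à la Hoff on $[0,T]$ is a weak solution for which there exist positive constants $\underline\rho,\overline\rho,\underline\theta,\overline\theta,C_5,C_6,C_8,C_9,C_{11}$ such that: $\underline\rho\le\rho\le\overline\rho$, $\underline\theta\le\theta\le\overline\theta$ a.e.; for a.e. $t$, $\int_0^1\sigma^2+\int_0^t\int_0^1(\partial_x\sigma)^2\le C_5$ and $\int_0^1(\partial_xu)^2\le C_8$; $\int_0^T\|\sigma\|_{L^\infty}^2\le C_6$, $\int_0^T\|\partial_xu\|_{L^\infty}^2\le C_9$; for a.e. $t$, $\kappa(t)\int_0^1(\partial_x\sigma)^2+\int_0^t\kappa(s)\int_0^1\dot\sigma^2\le C_{11}$. *)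

(* Defs.v *)
(* R : realType, Lebesgue measure/integral.
   The torus T = R/Z is identified with [0,1); functions on [0,T] x T are
   represented as f : R -> R -> R (f t x), only the values on
   [0,T] x [0,1) matter; test functions are 1-periodic in x. *)
From HB Require Import structures.
From mathcomp Require Import all_boot all_order all_algebra.
From mathcomp Require Import all_classical all_reals all_analysis.
Import Order.TTheory GRing.Theory Num.Theory.
Import numFieldNormedType.Exports.

Set Implicit Arguments.
Unset Strict Implicit.
Unset Printing Implicit Defensive.

Local Open Scope classical_set_scope.
Local Open Scope ring_scope.

Definition leb (R : realType) := @lebesgue_measure R.
Definition leb2 (R : realType) := ((@lebesgue_measure R) \x (@lebesgue_measure R))%E.
Arguments leb : clear implicits.
Arguments leb2 : clear implicits.

(* the torus T identified with [0,1) *)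
Definition I01 (R : realType) : set R := `[0, 1[.
Arguments I01 : clear implicits.
Definition Icc (R : realType) (a b : R) : set R := `[a, b].
Definition Dom (R : realType) (T : R) : set (R * R) := Icc 0 T `*` I01 R.

Definition unc (R : realType) (f : R -> R -> R) : R * R -> R :=
  fun z => f z.1 z.2.

Definition pdt (R : realType) (f : R -> R -> R) : R -> R -> R :=
  fun t x => derive1 (fun s => f s x) t.
Definition pdx (R : realType) (f : R -> R -> R) : R -> R -> R :=
  fun t x => derive1 (f t) x.

Definition smooth2 (R : realType) (f : R -> R -> R) : Prop :=
  forall n m : nat,
    continuous (unc (iter n (@pdt R) (iter m (@pdx R) f))) /\
    (forall t x, derivable (fun s => iter n (@pdt R) (iter m (@pdx R) f) s x) t 1) /\
    (forall t x, derivable (iter n (@pdt R) (iter m (@pdx R) f) t) x 1).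

Definition xperiodic (R : realType) (f : R -> R -> R) : Prop :=
  forall t x, f t (x + 1) = f t x.

(* test functions in C_c^infty([0,T) x T) (used with the initial data) *)
Definition test_init (R : realType) (T : R) (phi : R -> R -> R) : Prop :=
  smooth2 phi /\ xperiodic phi /\
  exists t1, t1 < T /\ forall t x, t1 <= t -> phi t x = 0.

(* test functions in C_c^infty((0,T) x T) *)
Definition test_int (R : realType) (T : R) (phi : R -> R -> R) : Prop :=
  smooth2 phi /\ xperiodic phi /\
  exists t0 t1, 0 < t0 /\ t1 < T /\
    forall t x, (t <= t0 \/ t1 <= t) -> phi t x = 0.

Definition test1 (R : realType) (psi : R -> R) : Prop :=
  (forall n : nat, continuous (iter n (@derive1 R R) psi) /\
                   forall x, derivable (iter n (@derive1 R R) psi) x 1) /\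
  (forall x, psi (x + 1) = psi x).

Definition weak_dx (R : realType) (T : R) (f g : R -> R -> R) : Prop :=
  forall phi, test_int T phi ->
    (leb2 R).-integrable (Dom T) (fun z => (f z.1 z.2 * pdx phi z.1 z.2)%:E) /\
    (leb2 R).-integrable (Dom T) (fun z => (g z.1 z.2 * phi z.1 z.2)%:E) /\
    (\int[leb2 R]_(z in Dom T) (f z.1 z.2 * pdx phi z.1 z.2)%:E
     = - (\int[leb2 R]_(z in Dom T) (g z.1 z.2 * phi z.1 z.2)%:E))%E.

(* g = d_t f + u fx (material derivative of f, with fx = d_x f) in the
   sense of distributions on (0,T) x T *)
Definition weak_mat (R : realType) (T : R) (u f fx g : R -> R -> R) : Prop :=
  forall phi, test_int T phi ->
    (leb2 R).-integrable (Dom T) (fun z => (f z.1 z.2 * pdt phi z.1 z.2)%:E) /\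
    (leb2 R).-integrable (Dom T)
       (fun z => (u z.1 z.2 * fx z.1 z.2 * phi z.1 z.2)%:E) /\
    (leb2 R).-integrable (Dom T) (fun z => (g z.1 z.2 * phi z.1 z.2)%:E) /\
    (- (\int[leb2 R]_(z in Dom T) (f z.1 z.2 * pdt phi z.1 z.2)%:E)
     + \int[leb2 R]_(z in Dom T) (u z.1 z.2 * fx z.1 z.2 * phi z.1 z.2)%:E
     = \int[leb2 R]_(z in Dom T) (g z.1 z.2 * phi z.1 z.2)%:E)%E.

(* d_t q + d_x F = 0 in distributions on [0,T) x T with q|_{t=0} = q0
   weakly:  int int (q d_t phi + F d_x phi) + int q0 phi(0,.) = 0 *)
Definition cons_law (R : realType) (T : R) (q F : R -> R -> R) (q0 : R -> R)
  : Prop :=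
  forall phi, test_init T phi ->
    (leb2 R).-integrable (Dom T)
      (fun z => (q z.1 z.2 * pdt phi z.1 z.2 + F z.1 z.2 * pdx phi z.1 z.2)%:E) /\
    (leb R).-integrable (I01 R) (fun x => (q0 x * phi 0 x)%:E) /\
    (\int[leb2 R]_(z in Dom T)
        (q z.1 z.2 * pdt phi z.1 z.2 + F z.1 z.2 * pdx phi z.1 z.2)%:E
     + \int[leb R]_(x in I01 R) (q0 x * phi 0 x)%:E = 0)%E.

Definition Linf_Linf (R : realType) (T : R) (f : R -> R -> R) : Prop :=
  measurable_fun (Dom T) (unc f) /\
  exists M : R, {ae leb2 R, forall z, Dom T z -> `|f z.1 z.2| <= M}.

Definition Linf_L1 (R : realType) (T : R) (f : R -> R -> R) : Prop :=
  measurable_fun (Dom T) (unc f) /\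
  exists M : R, {ae leb R, forall t, Icc 0 T t ->
     (\int[leb R]_(x in I01 R) `|f t x|%:E <= M%:E)%E}.

Definition L1_W11 (R : realType) (T : R) (u ux : R -> R -> R) : Prop :=
  (leb2 R).-integrable (Dom T) (fun z => (u z.1 z.2)%:E) /\
  (leb2 R).-integrable (Dom T) (fun z => (ux z.1 z.2)%:E) /\
  weak_dx T u ux.

Definition Linf1 (R : realType) (f : R -> R) : Prop :=
  measurable_fun (I01 R) f /\
  exists M : R, {ae leb R, forall x, I01 R x -> `|f x| <= M}.

Definition H1per (R : realType) (u0 : R -> R) : Prop :=
  measurable_fun (I01 R) u0 /\
  (\int[leb R]_(x in I01 R) (u0 x ^+ 2)%:E < +oo)%E /\
  exists u0x : R -> R,
    measurable_fun (I01 R) u0x /\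
    (\int[leb R]_(x in I01 R) (u0x x ^+ 2)%:E < +oo)%E /\
    forall psi, test1 psi ->
      (\int[leb R]_(x in I01 R) (u0 x * derive1 psi x)%:E
       = - (\int[leb R]_(x in I01 R) (u0x x * psi x)%:E))%E.

Definition esssupx (R : realType) (f : R -> R -> R) (t : R) : \bar R :=
  ereal_inf [set y : \bar R |
     {ae leb R, forall x, I01 R x -> (`|f t x|%:E <= y)%E}].

Record params (R : realType) := Params {
  mu_p : R; mu_m : R; gam_p : R; gam_m : R; cv_p : R; cv_m : R }.

Definition params_ok (R : realType) (P : params R) : Prop :=
  0 < mu_p P /\ 0 < mu_m P /\ 1 < gam_p P /\ 1 < gam_m P /\
  0 < cv_p P /\ 0 < cv_m P.

Definition muc (R : realType) (P : params R) (c : R) : R :=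
  c * mu_p P + (1 - c) * mu_m P.
Definition gamc (R : realType) (P : params R) (c : R) : R :=
  c * gam_p P + (1 - c) * gam_m P.
Definition cvc (R : realType) (P : params R) (c : R) : R :=
  c * cv_p P + (1 - c) * cv_m P.

Definition pres (R : realType) (P : params R) (c rho th : R -> R -> R) :
  R -> R -> R := fun t x => (gamc P (c t x) - 1) * rho t x * th t x.
Definition sigma (R : realType) (P : params R) (c rho th ux : R -> R -> R) :
  R -> R -> R := fun t x => muc P (c t x) * ux t x - pres P c rho th t x.
Definition energy (R : realType) (P : params R) (c th u : R -> R -> R) :
  R -> R -> R := fun t x => u t x ^+ 2 / 2 + cvc P (c t x) * th t x.
Definition energy0 (R : realType) (P : params R) (c0 th0 u0 : R -> R) :
  R -> R := fun x => u0 x ^+ 2 / 2 + cvc P (c0 x) * th0 x.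

Definition weak_solution (R : realType) (P : params R) (T : R)
  (c0 rho0 th0 u0 : R -> R) (c rho th u ux : R -> R -> R) : Prop :=
  let sig := sigma P c rho th ux in
  let E := energy P c th u in
  Linf_Linf T c /\ Linf_L1 T rho /\ Linf_L1 T th /\ L1_W11 T u ux /\
  cons_law T rho (fun t x => rho t x * u t x) rho0 /\
  cons_law T (fun t x => rho t x * c t x) (fun t x => rho t x * c t x * u t x)
    (fun x => rho0 x * c0 x) /\
  cons_law T (fun t x => rho t x * u t x)
    (fun t x => rho t x * u t x ^+ 2 - sig t x) (fun x => rho0 x * u0 x) /\
  cons_law T (fun t x => rho t x * E t x)
    (fun t x => rho t x * E t x * u t x - sig t x * u t x)
    (fun x => rho0 x * energy0 P c0 th0 u0 x).

Definition kappa (R : realType) (t : R) : R := Order.min 1 t.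

Definition hoff_solution (R : realType) (P : params R) (T : R)
  (c0 rho0 th0 u0 : R -> R) (c rho th u : R -> R -> R) : Prop :=
  exists ux sx sd : R -> R -> R,
  let sig := sigma P c rho th ux in
  weak_solution P T c0 rho0 th0 u0 c rho th u ux /\
  measurable_fun (Dom T) (unc sx) /\ weak_dx T sig sx /\
  measurable_fun (Dom T) (unc sd) /\ weak_mat T u sig sx sd /\
  exists rl rh tl th' C5 C6 C8 C9 C11 : R,
    0 < rl /\ 0 < rh /\ 0 < tl /\ 0 < th' /\
    0 < C5 /\ 0 < C6 /\ 0 < C8 /\ 0 < C9 /\ 0 < C11 /\
    {ae leb2 R, forall z, Dom T z ->
        rl <= rho z.1 z.2 <= rh /\ tl <= th z.1 z.2 <= th'} /\
    {ae leb R, forall t, Icc 0 T t ->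
        (\int[leb R]_(x in I01 R) (sig t x ^+ 2)%:E
         + \int[leb2 R]_(z in Icc 0 t `*` (I01 R)) (sx z.1 z.2 ^+ 2)%:E
         <= C5%:E)%E} /\
    {ae leb R, forall t, Icc 0 T t ->
        (\int[leb R]_(x in I01 R) (ux t x ^+ 2)%:E <= C8%:E)%E} /\
    (\int[leb R]_(t in Icc 0 T) (esssupx sig t * esssupx sig t) <= C6%:E)%E /\
    (\int[leb R]_(t in Icc 0 T) (esssupx ux t * esssupx ux t) <= C9%:E)%E /\
    {ae leb R, forall t, Icc 0 T t ->
        ((kappa t)%:E * \int[leb R]_(x in I01 R) (sx t x ^+ 2)%:E
         + \int[leb2 R]_(z in Icc 0 t `*` (I01 R))
              (kappa z.1 * sd z.1 z.2 ^+ 2)%:E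
         <= C11%:E)%E}.

(* Main.v *)
(** Two solutions are compared in mass Lagrangian coordinates.  Let [J] be the density divided by
    the total mass and [m(t,x)] the mass coordinate, normalised so that [m_t = - J u]; its inverse
    [X(t,.)] is the flow.  A conservation law [q_t + (q u)_x = s_x] becomes, along the flow,
    [(q/J)(t,X) = (q0/J0)(X0) + int_0^t (s_x/J)(.,X)].  This needs no regularity of [J]: the law is
    integrated once in [x], its increments over a length [h] are multiplied by a function of [m],
    the product rule in [t] is applied for a.e. [x], and [h] tends to [0].

    Applied to [1], [J c], [J u] and [J E], this gives the Lagrangian system for the volume [v], the
    velocity [U] and the temperature [Th], with [c] constant in time.  The stress [S] is bounded by
    a function [a] of time with [a^2] integrable, since [S] and [S_x] are square integrable.  For the
    difference of two solutions, [v1 (S1 - S2) = mu (P1 - P2) - S2 (v1 - v2) - k (Th1 - Th2)] with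
    [P = U_y], so the viscous term absorbs [P1 - P2] and the energy
    [e = int (U1 - U2)^2 + (v1 - v2)^2 + (cv (Th1 - Th2))^2] satisfies
    [e(t) <= C int_0^t (1 + a^2) e]; by Gronwall's inequality [e = 0].

    Finally [cos (2 pi X)] and [sin (2 pi X)] obey the transport equation along the common velocity
    [U], for which [|e^(2 pi i X1) - e^(2 pi i X2)|^2] is constant in time; hence [X1 = X2] and the
    solutions agree in the original coordinates as well. *)
Require Import Defs.
From HB Require Import structures.
From mathcomp Require Import all_boot all_order all_algebra.
From mathcomp Require Import all_classical all_reals all_analysis.
From mathcomp Require Import measurable_realfun ring lra.
Import Order.TTheory GRing.Theory Num.Theory.
Import numFieldNormedType.Exports.
Set Implicit Arguments.
Unset Strict Implicit.
Unset Printing Implicit Defensive.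
Local Open Scope classical_set_scope.
Local Open Scope ring_scope.


(** * Integrals against finite measures *)

Section finite_integral.
Context d (T : measurableType d) (R : realType).
Variable mu : {finite_measure set T -> \bar R}.
Implicit Types f g h : T -> R.

(** In Eulerian coordinates the density is merely bounded, while the difference of two densities
    solves a transport equation whose source contains a derivative of the density; no estimate of it
    closes. In mass coordinates this derivative is gone: [v_t = U_y], and as [c] is frozen, two
    solutions have the same [mu], [gamma] and [cv] at each point, so every difference is a time
    integral. The one space derivative left, that of the stress, is tested with [U1 - U2] and
    produces the dissipation. The temperature equation with source [S U_y] is not one of the laws:
    it is the energy law minus the velocity equation multiplied by [U]. Dividing by the total mass
    puts both coordinates on the same circle of length one, with the same test functions; stress and
    viscosity are divided by the mass as well. As all properties of a solution hold almost
    everywhere, it is replaced by periodic, truncated representatives with bounds at every point.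
    The bound [a] of the stress depends on time, which is why Gronwall's inequality is stated with
    an integrable weight. *)

Definition L1 f : Prop := mu.-integrable setT (fun x => (f x)%:E).
Definition Int f : R := \int[mu]_x f x.

Lemma aeS (P Q : T -> Prop) : (forall x, P x -> Q x) ->
  {ae mu, forall x, P x} -> {ae mu, forall x, Q x}.
Proof. by move=> PQ; apply: filterS. Qed.

Lemma aeS2 (P Q S : T -> Prop) : (forall x, P x -> Q x -> S x) ->
  {ae mu, forall x, P x} -> {ae mu, forall x, Q x} -> {ae mu, forall x, S x}.
Proof. by move=> PQS; apply: filterS2. Qed.

Lemma aeS3 (P Q S U : T -> Prop) : (forall x, P x -> Q x -> S x -> U x) ->
  {ae mu, forall x, P x} -> {ae mu, forall x, Q x} -> {ae mu, forall x, S x} ->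
  {ae mu, forall x, U x}.
Proof. by move=> PQS; apply: filterS3. Qed.

Lemma ae_nat (P : nat -> T -> Prop) : (forall n, {ae mu, forall x, P n x}) ->
  {ae mu, forall x, forall n, P n x}.
Proof. exact: ae_foralln. Qed.

Lemma L1_meas f : L1 f -> measurable_fun setT f.
Proof. by move=> /measurable_int /measurable_EFinP. Qed.

Lemma L1_fin f : L1 f -> (\int[mu]_x (f x)%:E)%E = (Int f)%:E.
Proof. by move=> Lf; rewrite /Int /Rintegral fineK// integrable_fin_num. Qed.

Lemma L1D f g : L1 f -> L1 g -> L1 (fun x => f x + g x).
Proof. by move=> Lf Lg; exact: (integrableD measurableT Lf Lg). Qed.

Lemma L1B f g : L1 f -> L1 g -> L1 (fun x => f x - g x).
Proof. by move=> Lf Lg; exact: (integrableB measurableT Lf Lg). Qed.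

Lemma L1N f : L1 f -> L1 (fun x => - f x).
Proof. by move=> Lf; exact: (integrableN Lf). Qed.

Lemma L1Z k f : L1 f -> L1 (fun x => k * f x).
Proof. by move=> Lf; exact: (integrableZl measurableT k Lf). Qed.

Lemma L1_le f g : measurable_fun setT f -> L1 g -> (forall x, `|f x| <= g x) -> L1 f.
Proof.
move=> mf Lg fg; apply: (le_integrable measurableT _ _ Lg).
  exact/measurable_EFinP.
by move=> x _ /=; rewrite lee_fin (le_trans (fg x))// ler_norm.
Qed.

Lemma L1_abs f : L1 f -> L1 (fun x => `|f x|).
Proof. by move=> Lf; exact: (integrable_norm Lf). Qed.

Lemma L1_cst k : L1 (fun=> k).
Proof. exact: finite_measure_integrable_cst. Qed.

Lemma L1_bnd f k : measurable_fun setT f -> (forall x, `|f x| <= k) -> L1 f.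
Proof. by move=> mf fk; apply: L1_le mf (L1_cst k) fk. Qed.

Lemma L1M f g k : measurable_fun setT f -> (forall x, `|f x| <= k) -> L1 g ->
  L1 (fun x => f x * g x).
Proof.
move=> mf fk Lg; apply: (@L1_le _ (fun x => k * `|g x|)).
- exact: (measurable_funM mf (L1_meas Lg)).
- exact/L1Z/L1_abs.
- by move=> x; rewrite normrM ler_wpM2r.
Qed.

Lemma L1_ae f g : measurable_fun setT g -> L1 f -> {ae mu, forall x, f x = g x} ->
  L1 g.
Proof.
move=> mg Lf fg; apply/integrableP; split; first exact/measurable_EFinP.
have /integrableP[_] := Lf; apply: le_lt_trans.
rewrite le_eqVlt; apply/orP; left; apply/eqP; apply: ge0_ae_eq_integral => //.
- exact/measurable_EFinP/measurableT_comp.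
- by apply/measurable_EFinP/measurableT_comp => //; exact: L1_meas.
- by apply: aeS fg => x /= ->.
Qed.

Lemma IntD f g : L1 f -> L1 g -> Int (fun x => f x + g x) = Int f + Int g.
Proof. by move=> Lf Lg; exact: RintegralD. Qed.

Lemma IntB f g : L1 f -> L1 g -> Int (fun x => f x - g x) = Int f - Int g.
Proof. by move=> Lf Lg; exact: RintegralB. Qed.

Lemma IntZ k f : L1 f -> Int (fun x => k * f x) = k * Int f.
Proof. by move=> Lf; exact: RintegralZl. Qed.

Lemma IntZr k f : L1 f -> Int (fun x => f x * k) = Int f * k.
Proof. by move=> Lf; exact: RintegralZr. Qed.

Lemma Int0 : Int (fun=> 0) = 0.
Proof. by rewrite /Int /Rintegral integral0. Qed.

Lemma IntN f : L1 f -> Int (fun x => - f x) = - Int f.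
Proof.
move=> Lf; rewrite -[RHS]mulN1r -IntZ//; apply: eq_Rintegral => x _.
by rewrite mulN1r.
Qed.

Lemma Int_cst k : Int (fun=> k) = k * fine (mu setT).
Proof. by rewrite /Int Rintegral_cst. Qed.

Lemma Int_eq f g : f =1 g -> Int f = Int g.
Proof. by move=> fg; congr Int; apply/funext. Qed.

Lemma Int_ge0 f : (forall x, 0 <= f x) -> 0 <= Int f.
Proof. by move=> f0; apply: Rintegral_ge0 => x _. Qed.

Lemma Int_le f g : L1 f -> L1 g -> (forall x, f x <= g x) -> Int f <= Int g.
Proof. by move=> Lf Lg fg; apply: le_Rintegral => // x _. Qed.

Lemma Int_abs f : L1 f -> `|Int f| <= Int (fun x => `|f x|).
Proof. by move=> Lf; exact: le_normr_Rintegral. Qed.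

Lemma Int_ae f g : measurable_fun setT f -> measurable_fun setT g ->
  {ae mu, forall x, f x = g x} -> Int f = Int g.
Proof.
move=> mf mg fg; rewrite /Int /Rintegral; congr fine; apply: ae_eq_integral => //.
- exact/measurable_EFinP.
- exact/measurable_EFinP.
- by apply: aeS fg => x /= ->.
Qed.

Lemma Int_le_ae f g : L1 f -> L1 g -> {ae mu, forall x, f x <= g x} ->
  Int f <= Int g.
Proof.
move=> Lf Lg fg; have mf := L1_meas Lf; have mg := L1_meas Lg.
(* The maximum differs from [g] on a null set only and makes the inequality hold everywhere. *)
rewrite (@Int_ae g (fun x => Num.max (f x) (g x)))//.
- apply: Int_le => //; last by move=> x; rewrite le_max lexx.
  apply: (@L1_le _ (fun x => `|f x| + `|g x|)).
  + exact: measurable_maxr.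
  + by apply: L1D; exact: L1_abs.
  + move=> x; rewrite maxEle; case: ifP => _; [by rewrite lerDr|by rewrite lerDl].
- exact: measurable_maxr.
- by apply: aeS fg => x fgx; rewrite max_r.
Qed.

Lemma Int_eq0_ae f : L1 f -> (forall x, 0 <= f x) -> Int f <= 0 ->
  {ae mu, forall x, f x = 0}.
Proof.
move=> Lf f0 If.
have : (\int[mu]_x `|(f x)%:E| = 0)%E.
  under eq_integral do rewrite gee0_abs ?lee_fin//.
  by rewrite L1_fin//; congr EFin; apply/eqP; rewrite eq_le If Int_ge0.
move/(ae_eq_integral_abs mu measurableT (proj2 (measurable_EFinP _ _) (L1_meas Lf))).1.
by apply: aeS => x /(_ Logic.I) [].
Qed.

Lemma L1_dct (f_ : nat -> T -> R) f g :
  (forall n, measurable_fun setT (f_ n)) -> measurable_fun setT f -> L1 g ->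
  {ae mu, forall x, f_ ^~ x @ \oo --> f x} ->
  {ae mu, forall x, forall n, `|f_ n x| <= g x} ->
  L1 f /\ Int (f_ n) @[n --> \oo] --> Int f.
Proof.
move=> mf_ mf Lg ff fg.
have mf_E n : measurable_fun setT (fun x => (f_ n x)%:E) by exact/measurable_EFinP.
have mfE : measurable_fun setT (fun x => (f x)%:E) by exact/measurable_EFinP.
have [] := @dominated_convergence _ _ _ mu _ measurableT
  (fun n x => (f_ n x)%:E) (fun x => (f x)%:E) (fun x => (g x)%:E) mf_E mfE.
- by apply: aeS ff => x cx _; apply: cvg_EFin => //; exact: nearW.
- exact: Lg.
- by apply: aeS fg => x cx n _; rewrite lee_fin.
move=> Lf _ cI; split=> //; move: cI; rewrite L1_fin// => /fine_cvg.
by apply: cvg_trans; apply: cvg_refl.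
Qed.

End finite_integral.

(** Inversion is continuous on each open half-line; the remaining point [0], where the inverse is
    [0] by convention, is a measurable singleton. *)
Lemma measurable_invr (R : realType) : measurable_fun setT (@GRing.inv R).
Proof.
have -> : [set: R] = `]-oo, 0[ `|` `[0, 0] `|` `]0, +oo[.
  apply/seteqP; split=> // x _ /=; rewrite !in_itv/= andbT.
  by have [?|?|?] := ltgtP x 0; [left; left|right|left; right].
apply/measurable_funU => //; first exact: measurableU.
split; last first.
  apply: open_continuous_measurable_fun => //.
  by move=> x; rewrite inE/= in_itv/= andbT => x0; apply: inv_continuous; rewrite gt_eqF.
apply/measurable_funU => //; split.
  apply: open_continuous_measurable_fun => //.
  by move=> x; rewrite inE/= in_itv/= => x0; apply: inv_continuous; rewrite lt_eqF.
by rewrite set_itv1; exact: measurable_fun_set1.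
Qed.

(** * Joint measurability *)

Section measurability.
Context (R : realType).

Local Notation RR := (measurableTypeR R).

Definition M1 (f : R -> R) := measurable_fun [set: RR] f.
Definition M2 (f : R -> R -> R) :=
  measurable_fun [set: RR * RR] (fun z => f z.1 z.2).

Lemma M1_comp d (T : measurableType d) (f : R -> R) (a : T -> R) :
  M1 f -> measurable_fun setT a -> measurable_fun setT (fun w => f (a w)).
Proof.
move=> mf ma.
exact: (@measurableT_comp _ _ _ T RR R f setT a mf (ma : measurable_fun setT (a : T -> RR))).
Qed.

Lemma M2_comp d (T : measurableType d) (f : R -> R -> R) (a b : T -> R) :
  M2 f -> measurable_fun setT a -> measurable_fun setT b ->
  measurable_fun setT (fun w => f (a w) (b w)).
Proof.
move=> mf ma mb.
have mp : measurable_fun setT ((fun w => (a w, b w)) : T -> RR * RR)%type.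
  exact: (@measurable_fun_pair _ _ _ T RR RR a b).
exact: (@measurableT_comp _ _ _ _ _ _ (fun z : RR * RR => f z.1 z.2) _ _ mf mp).
Qed.

Lemma measurable_abs d (T : measurableType d) (a : T -> R) :
  measurable_fun setT a -> measurable_fun setT (fun w => `|a w|).
Proof. by move=> ma; exact: (measurableT_comp (@normr_measurable R setT) ma). Qed.

Lemma measurable_inv d (T : measurableType d) (a : T -> R) :
  measurable_fun setT a -> measurable_fun setT (fun w => (a w)^-1).
Proof. by move=> ma; exact: (measurableT_comp (@measurable_invr R) ma). Qed.

Lemma measurable_opp d (T : measurableType d) (a : T -> R) :
  measurable_fun setT a -> measurable_fun setT (fun w => - a w).
Proof. exact: measurable_funN. Qed.

(** A variable domain of integration is moved into the integrand, so that the measure stays fixed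
    while the bounds vary and Fubini's theorem applies as it stands. *)
Definition when (b : bool) (x : R) : R := if b then x else 0.

Lemma measurable_when d (T : measurableType d) (a b f : T -> R) :
  measurable_fun setT a -> measurable_fun setT b -> measurable_fun setT f ->
  measurable_fun setT (fun w => when (a w < b w) (f w)).
Proof.
by move=> ma mb mf; apply: measurable_fun_ifT => //; exact: measurable_fun_ltr.
Qed.

(* Where the integral is not finite, [Int] takes the junk value [0]. *)
Lemma measurable_Int d d' (T : measurableType d) (T' : measurableType d')
    (mu : {finite_measure set T' -> \bar R}) (f : T -> T' -> R) :
  measurable_fun setT (fun z : T * T' => f z.1 z.2) ->
  measurable_fun setT (fun w => Int mu (f w)).
Proof.
move=> mf.
have mfE : measurable_fun setT (fun z : T * T' => (f z.1 z.2)%:E).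
  exact/measurable_EFinP.
apply: (@measurableT_comp _ _ _ _ _ _ fine _ (fun w => (\int[mu]_x (f w x)%:E)%E)) => //.
pose F z := (f z.1 z.2)%:E.
have Hp : measurable_fun setT (fun w => (\int[mu]_x F^\+ (w, x))%E).
  exact: (measurable_fun_fubini_tonelli_F (m2 := mu) (F^\+)%E (measurable_funepos mfE)).
have Hn : measurable_fun setT (fun w => (\int[mu]_x F^\- (w, x))%E).
  exact: (measurable_fun_fubini_tonelli_F (m2 := mu) (F^\-)%E (measurable_funeneg mfE)).
rewrite [X in measurable_fun _ X](_ : _ = fun w =>
  (\int[mu]_x F^\+ (w, x) - \int[mu]_x F^\- (w, x))%E); first exact: emeasurable_funB.
by apply/funext => w; rewrite integralE; congr (_ - _)%E; apply: eq_integral => x _; rewrite ?funeposE ?funenegE.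
Qed.

End measurability.

(* Redefined once primitives are available. *)
Ltac meas_prim := fail.

(** Recursion on the syntax of the function. Unknown functions are recognised through an [M1], [M2]
    or [L1] fact in the context, hence the many such facts introduced just before a call. *)
Ltac meas := repeat match goal with
  | H : measurable_fun setT ?f |- measurable_fun setT ?f => exact: H
  | |- measurable_fun setT (fun w => w) => exact: measurable_id
  | |- measurable_fun setT (fun w => ?c) => exact: measurable_cst
  | |- measurable_fun setT (fun w => @fst _ _ w) => exact: measurable_fst
  | |- measurable_fun setT (fun w => @snd _ _ w) => exact: measurable_snd
  | |- measurable_fun setT (fun w => @fst _ _ (@fst _ _ w)) =>
      exact: (measurableT_comp measurable_fst measurable_fst)
  | |- measurable_fun setT (fun w => @snd _ _ (@fst _ _ w)) =>
      exact: (measurableT_comp measurable_snd measurable_fst)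
  | |- measurable_fun setT (fun w => @GRing.add _ (@?a w) (@?b w)) =>
      apply: (@measurable_funD _ _ _ setT a b)
  | |- measurable_fun setT (fun w => @GRing.opp _ (@?a w)) =>
      apply: (@measurable_opp _ _ _ a)
  | |- measurable_fun setT (fun w => @GRing.mul _ (@?a w) (@?b w)) =>
      apply: (@measurable_funM _ _ _ setT a b)
  | |- measurable_fun setT (fun w => @GRing.inv _ (@?a w)) =>
      apply: (@measurable_inv _ _ _ a)
  | |- measurable_fun setT (fun w => @Num.norm _ _ (@?a w)) =>
      apply: (@measurable_abs _ _ _ a)
  | |- measurable_fun setT (fun w => (@?a w) ^+ ?n) =>
      apply: (@measurable_funX _ _ _ setT a n)
  | |- measurable_fun setT (fun w => when (@?a w < @?b w)%O (@?f w)) =>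
      apply: (@measurable_when _ _ _ a b f)
  | |- measurable_fun setT (fun w => Num.max (@?a w) (@?b w)) =>
      apply: (@measurable_maxr _ _ _ setT a b)
  | |- measurable_fun setT (fun w => Num.min (@?a w) (@?b w)) =>
      apply: (@measurable_minr _ _ _ setT a b)
  | |- measurable_fun setT (fun w => ?f (@?a w) (@?b w)) =>
      match goal with H : M2 ?g |- _ => constr_eq f g; apply: (@M2_comp _ _ _ f a b H) end
  | |- measurable_fun setT (fun w => ?f (@?a w)) =>
      match goal with
      | H : M1 ?g |- _ => constr_eq f g; apply: (@M1_comp _ _ _ f a H)
      | H : L1 _ ?g |- _ => constr_eq f g; apply: (@M1_comp _ _ _ f a (L1_meas H))
      end
  | |- measurable_fun setT ?f =>
      match goal with
      | H : M1 ?g |- _ => constr_eq f g; exact: H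
      | H : L1 _ ?g |- _ => constr_eq f g; exact: (L1_meas H)
      end
  | |- measurable_fun setT (fun w => Int ?mu (@?f w)) =>
      apply: (@measurable_Int _ _ _ _ _ mu f)
  | |- M1 _ => rewrite /M1 /=
  | |- M2 _ => rewrite /M2 /=
  | |- measurable_fun setT _ => meas_prim
  end.

(** * Products of finite measures *)

Section product.
Context d1 d2 (T1 : measurableType d1) (T2 : measurableType d2) (R : realType).
Variables (m1 : {finite_measure set T1 -> \bar R})
  (m2 : {finite_measure set T2 -> \bar R}).
Implicit Types f : T1 -> T2 -> R.

Definition pr := (m1 \x m2)%E.

Let pr_fin : fin_num_fun pr.
Proof.
move=> A mA; rewrite ge0_fin_numE; last exact: measure_ge0.
apply: (@le_lt_trans _ _ (pr setT)); first by apply: le_measure; rewrite ?inE.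
rewrite /pr -setXTT product_measure1E//=.
by apply: lte_mul_pinfty; rewrite ?fin_num_measure ?ltey_eq ?fin_num_measure.
Qed.

HB.instance Definition _ := Measure.on pr.
HB.instance Definition _ := Measure_isFinite.Build _ _ _ pr pr_fin.

Definition LL f : Prop := L1 pr (fun z => f z.1 z.2).
Definition IInt f := Int pr (fun z => f z.1 z.2).

Lemma LL1 f : LL f -> {ae m1, forall x, L1 m2 (f x)}.
Proof. by move=> Lf; exact: (ae_integrable1 Lf). Qed.

Lemma LL2 f : LL f -> {ae m2, forall y, L1 m1 (f ^~ y)}.
Proof. by move=> Lf; exact: (ae_integrable2 Lf). Qed.

Lemma LL_Int1 f : LL f -> L1 m1 (fun x => Int m2 (f x)) /\
  Int m1 (fun x => Int m2 (f x)) = IInt f.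
Proof.
move=> Lf; have mf : measurable_fun setT (fun z : T1 * T2 => f z.1 z.2) := L1_meas Lf.
have LF := integrable_fubini_F Lf.
have E := integral12_prod_meas1 Lf.
have eqF : {ae m1, forall x, (\int[m2]_y (f x y)%:E)%E = (Int m2 (f x))%:E}.
  by apply: aeS (LL1 Lf) => x; exact: L1_fin.
have mI : measurable_fun setT (fun x => Int m2 (f x)) by exact: measurable_Int.
have mIE : measurable_fun setT (fun x => (Int m2 (f x))%:E) by exact/measurable_EFinP.
split; last first.
  rewrite /IInt {1}/Int {2}/Int /Rintegral; congr fine; rewrite -E.
  apply: ae_eq_integral => //; first exact: measurable_int LF.
  by apply: aeS eqF => x <-.
apply/integrableP; split => //.
have /integrableP[_] := LF; apply: le_lt_trans.
rewrite le_eqVlt; apply/orP; left; apply/eqP; apply: ge0_ae_eq_integral => //.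
- exact: measurableT_comp.
- by apply: measurableT_comp => //; exact: measurable_int LF.
- by apply: aeS eqF => x <-.
Qed.

Lemma LL_abs f : LL f -> LL (fun x y => `|f x y|).
Proof. by move=> Lf; exact: (L1_abs Lf). Qed.

Lemma LLD f g : LL f -> LL g -> LL (fun x y => f x y + g x y).
Proof. by move=> Lf Lg; exact: (L1D Lf Lg). Qed.

Lemma LLB f g : LL f -> LL g -> LL (fun x y => f x y - g x y).
Proof. by move=> Lf Lg; exact: (L1B Lf Lg). Qed.

Lemma LLN f : LL f -> LL (fun x y => - f x y).
Proof. by move=> Lf; exact: (L1N Lf). Qed.

Lemma LLZ k f : LL f -> LL (fun x y => k * f x y).
Proof. by move=> Lf; exact: (L1Z k Lf). Qed.

Lemma LL_le f g : measurable_fun setT (fun z : T1 * T2 => f z.1 z.2) -> LL g ->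
  (forall x y, `|f x y| <= g x y) -> LL f.
Proof. by move=> mf Lg fg; exact: (L1_le mf Lg (fun z => fg z.1 z.2)). Qed.

Lemma LLM f g k : measurable_fun setT (fun z : T1 * T2 => f z.1 z.2) ->
  (forall x y, `|f x y| <= k) -> LL g -> LL (fun x y => f x y * g x y).
Proof. by move=> mf fk Lg; exact: (L1M mf (fun z => fk z.1 z.2) Lg). Qed.

Lemma LL_ae f g : measurable_fun setT (fun z : T1 * T2 => g z.1 z.2) -> LL f ->
  {ae pr, forall z, f z.1 z.2 = g z.1 z.2} -> LL g.
Proof. by move=> mg Lf fg; exact: (L1_ae mg Lf fg). Qed.

Lemma LL_bnd f k : measurable_fun setT (fun z : T1 * T2 => f z.1 z.2) ->
  (forall x y, `|f x y| <= k) -> LL f.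
Proof. by move=> mf fk; apply: L1_bnd mf (fun z => fk z.1 z.2). Qed.

(** Tonelli's criterion. It is the way to integrability on the product when only bounds on almost
    every slice are known. *)
Lemma LL_iter f g : measurable_fun setT (fun z : T1 * T2 => f z.1 z.2) ->
  {ae m1, forall x, L1 m2 (f x) /\ Int m2 (fun y => `|f x y|) <= g x} -> L1 m1 g ->
  LL f.
Proof.
move=> mf fg Lg.
have mfE : measurable_fun setT (fun z : T1 * T2 => (f z.1 z.2)%:E).
  exact/measurable_EFinP.
apply/(integrable12ltyP m1 m2 mfE).
have mI : measurable_fun setT (fun x => (\int[m2]_y `|(f x y)%:E|)%E).
  exact: (measurable_fun_fubini_tonelli_F (m2 := m2)
    (fun z : T1 * T2 => `|(f z.1 z.2)%:E|%E) (measurableT_comp _ mfE)).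
apply: (@le_lt_trans _ _ (\int[m1]_x `|(g x)%:E|)%E).
  apply: ae_ge0_le_integral => //.
  - by move=> x _; exact: integral_ge0.
  - by apply: measurableT_comp => //; exact: measurable_int Lg.
  apply: aeS fg => x [Lfx fgx] _ /=.
  rewrite (L1_fin (L1_abs Lfx)) lee_fin; exact: le_trans fgx (ler_norm _).
by case/integrableP: Lg.
Qed.

Lemma LL_prod (a : T1 -> R) (b : T2 -> R) : L1 m1 a -> L1 m2 b ->
  LL (fun x y => a x * b y).
Proof.
move=> La Lb; have ma := L1_meas La; have mb := L1_meas Lb.
apply: (@LL_iter _ (fun x => Int m2 (fun y => `|b y|) * `|a x|)).
- apply: measurable_funM; [exact: (measurableT_comp ma measurable_fst)|].
  exact: (measurableT_comp mb measurable_snd).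
- apply: aeW => x; split; first exact: L1Z.
  rewrite (@Int_eq _ _ _ m2 _ (fun y => `|a x| * `|b y|)); last by move=> y; rewrite normrM.
  by rewrite IntZ; [rewrite mulrC|exact: L1_abs].
- exact/L1Z/L1_abs.
Qed.

(** The indicator of the exceptional set has double integral zero, so almost every slice of it has
    integral zero. *)
Lemma ae_pr1 (P : T1 * T2 -> Prop) : {ae pr, forall z, P z} ->
  {ae m1, forall x, {ae m2, forall y, P (x, y)}}.
Proof.
move=> [N [mN N0 PN]].
pose f x y := (\1_N (x, y) : R).
have Lf : LL f.
  apply: (@LL_bnd f 1); last by move=> x y; rewrite /f indicE; case: (_ \in _); rewrite ?normr1 ?normr0.
  rewrite (_ : (fun z => _) = \1_N); first exact: measurable_indic.
  by apply/funext => -[].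
have I0 : IInt f = 0.
  rewrite /IInt /Int (_ : (fun z => _) = \1_N); last by apply/funext => -[].
  by rewrite /Rintegral integral_indic// setIT [X in fine X]N0.
have [LI II] := LL_Int1 Lf.
have f0 x y : 0 <= f x y by rewrite /f indicE; case: (_ \in _).
have := Int_eq0_ae LI (fun x => Int_ge0 m2 (f0 x)).
rewrite II I0 lexx => /(_ isT) aex.
apply: aeS2 aex (LL1 Lf) => x Ix0 Lfx.
have := @Int_eq0_ae _ _ _ m2 _ Lfx (f0 x); rewrite Ix0 lexx => /(_ isT).
apply: aeS => y; rewrite /f indicE => fxy; apply: contrapT => nP.
have : N (x, y) by exact: PN.
by move/mem_set => Nxy; move: fxy; rewrite Nxy/= => /eqP; rewrite oner_eq0.
Qed.

(** A converse of [ae_pr1] for equalities of measurable functions, whose exceptional set is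
    measurable. The truncated distance [min 1 |f - g|] is integrable whatever [f] and [g] are, and
    its iterated integral vanishes. *)
Lemma ae_pr_eq f g : measurable_fun setT (fun z : T1 * T2 => f z.1 z.2) ->
  measurable_fun setT (fun z : T1 * T2 => g z.1 z.2) ->
  {ae m1, forall x, {ae m2, forall y, f x y = g x y}} ->
  {ae pr, forall z, f z.1 z.2 = g z.1 z.2}.
Proof.
move=> mf mg fg.
pose h z : R := Num.min 1 `|f z.1 z.2 - g z.1 z.2|.
have mh : measurable_fun setT h.
  apply: measurable_minr => //; apply: measurable_abs; exact: measurable_funB.
have h0 z : 0 <= h z by rewrite /h le_min ler01 normr_ge0.
have Lh : LL (fun x y => h (x, y)).
  apply: (@LL_bnd _ 1); first by rewrite (_ : (fun z => _) = h)//; apply/funext => -[].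
  by move=> x y; rewrite ger0_norm// /h ge_min lexx.
have Lh' : L1 pr h by move: Lh; rewrite /LL (_ : (fun z => _) = h)//; apply/funext => -[].
have := Int_eq0_ae Lh' h0; rewrite (_ : Int pr h = 0) ?lexx.
  move=> /(_ isT); apply: aeS => z /eqP; rewrite /h minEle; case: ifP => _.
    by rewrite oner_eq0.
  by rewrite normr_eq0 subr_eq0 => /eqP.
have [_] := LL_Int1 Lh; rewrite /IInt (_ : (fun z => h (z.1, z.2)) = h); last by apply/funext => -[].
move=> <-; rewrite (@Int_ae _ _ _ m1 _ (fun=> 0)) ?Int0//.
  apply: measurable_Int; rewrite (_ : (fun z => _) = h)//; apply/funext => -[//].
apply: aeS fg => x fgx; rewrite (@Int_ae _ _ _ m2 _ (fun=> 0)) ?Int0//.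
  exact: (measurableT_comp mh (pair1_measurable x)).
by apply: aeS fgx => y; rewrite /h /= => ->; rewrite subrr normr0 min_r.
Qed.

End product.

Section product_swap.
Context d1 d2 (T1 : measurableType d1) (T2 : measurableType d2) (R : realType).
Variables (m1 : {finite_measure set T1 -> \bar R})
  (m2 : {finite_measure set T2 -> \bar R}).
Implicit Types f : T1 -> T2 -> R.

Lemma LL_swap f : LL m1 m2 f -> LL m2 m1 (fun y x => f x y).
Proof.
move=> Lf; have mf : measurable_fun setT (fun z : T1 * T2 => f z.1 z.2) := L1_meas Lf.
have mfE : measurable_fun setT (fun z : T1 * T2 => (f z.1 z.2)%:E) by exact/measurable_EFinP.
have mf' : measurable_fun setT (fun z : T2 * T1 => f z.2 z.1).
  exact: (@measurableT_comp _ _ _ _ _ _ (fun z : T1 * T2 => f z.1 z.2) _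
    (fun z : T2 * T1 => (z.2, z.1)) mf (measurable_fun_pair measurable_snd measurable_fst)).
have mfE' : measurable_fun setT (fun z : T2 * T1 => (f z.2 z.1)%:E) by exact/measurable_EFinP.
apply/(integrable12ltyP m2 m1 mfE').
by have /(integrable21ltyP m1 m2 mfE) := Lf.
Qed.

Lemma Int_swap f : LL m1 m2 f ->
  Int m1 (fun x => Int m2 (f x)) = Int m2 (fun y => Int m1 (f ^~ y)).
Proof.
move=> Lf; have [_ ->] := LL_Int1 Lf; have [_ ->] := LL_Int1 (LL_swap Lf).
have E1 := integral12_prod_meas1 Lf; have E2 := integral21_prod_meas1 Lf.
have E3 := integral12_prod_meas1 (LL_swap Lf).
rewrite /IInt /Int /Rintegral; congr fine.
by rewrite -[LHS]E2 -[RHS]E3.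
Qed.

Lemma ae_pr2 (P : T1 * T2 -> Prop) : {ae (pr m1 m2), forall z, P z} ->
  {ae m2, forall y, {ae m1, forall x, P (x, y)}}.
Proof.
move=> [N [mN N0 PN]].
pose f x y := (\1_N (x, y) : R).
have f0 x y : 0 <= f x y by rewrite /f indicE; case: (_ \in _).
have Lf : LL m1 m2 f.
  apply: (@LL_bnd _ _ _ _ _ _ _ f 1).
    rewrite (_ : (fun z => _) = \1_N); first exact: measurable_indic.
    by apply/funext => -[].
  by move=> x y; rewrite ger0_norm// /f indicE; case: (_ \in _).
have I0 : IInt m1 m2 f = 0.
  rewrite /IInt /Int (_ : (fun z => _) = \1_N); last by apply/funext => -[].
  by rewrite /Rintegral integral_indic// setIT [X in fine X]N0.
have [LI _] := LL_Int1 (LL_swap Lf).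
have := Int_eq0_ae LI (fun y => Int_ge0 m1 (f0 ^~ y)).
rewrite -(Int_swap Lf); have [_ ->] := LL_Int1 Lf; rewrite I0 lexx => /(_ isT) aey.
apply: aeS2 aey (LL2 Lf) => y Iy0 Lfy.
have := Int_eq0_ae Lfy (f0 ^~ y); rewrite Iy0 lexx => /(_ isT).
apply: aeS => x; rewrite /f indicE => fxy; apply: contrapT => nP.
have : N (x, y) by exact: PN.
by move/mem_set => Nxy; move: fxy; rewrite Nxy/= => /eqP; rewrite oner_eq0.
Qed.

End product_swap.

(** * Primitives on an interval *)

Section lebesgue_interval.
Context (R : realType).
Local Notation RR := (measurableTypeR R).
Implicit Types (L : R) (f g : R -> R).

Let lebI_lty L : (@lebesgue_measure R `[0%R, L[%classic < +oo)%E.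
Proof.
by rewrite lebesgue_measure_itv/=; case: ifP => _; rewrite ltry.
Qed.

Let mI L : measurable (`[0%R, L[ : set (measurableTypeR R)).
Proof. exact: measurable_itv. Qed.

(** A finite measure on the whole line rather than integration over a subset: functions remain total
    and no domain has to be carried through the statements. *)
Definition lebI L : {finite_measure set (measurableTypeR R) -> \bar R} :=
  mfrestr (mI L) (lebI_lty L).

Lemma lebIE L A : lebI L A = lebesgue_measure (A `&` `[0%R, L[).
Proof. by []. Qed.

Lemma ae_lebI L (P : R -> Prop) :
  {ae lebesgue_measure, forall x, 0 <= x < L -> P x} -> {ae lebI L, forall x, P x}.
Proof.
move=> [N [mN N0 PN]]; exists (N `|` ~` `[0%R, L[); split.
- by apply: measurableU => //; exact: measurableC.
- rewrite [LHS]lebIE setIUl setICl setU0; apply/eqP; rewrite eq_le measure_ge0 andbT.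
  by rewrite -N0 le_measure// ?inE//; exact: measurableI.
- move=> x /= nP; have [xL|xL] := boolP (0 <= x < L).
    by left; apply: PN => /= /(_ xL).
  by right => /=; rewrite in_itv/=; apply/negP.
Qed.

Lemma lebI_ae L (P : R -> Prop) : {ae lebI L, forall x, P x} ->
  {ae lebesgue_measure, forall x, 0 <= x < L -> P x}.
Proof.
move=> [N [mN N0 PN]]; exists (N `&` `[0%R, L[); split => //.
- exact: measurableI.
- by move=> x /= /not_implyP[xL nP]; split; [exact: PN|rewrite /= in_itv].
Qed.

Lemma lebI_in L : {ae lebI L, forall x, 0 <= x < L}.
Proof. by apply: ae_lebI; apply: aeW. Qed.

Lemma lebI_neq L (a : R) : {ae lebI L, forall x, x != a}.
Proof.
apply: ae_lebI; exists [set a]; split => //; first by rewrite lebesgue_measure_set1.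
by move=> x /= /not_implyP[_] /negP; rewrite negbK => /eqP.
Qed.

Lemma lebI_integral L (f : R -> \bar R) : measurable_fun [set: RR] f ->
  (\int[lebI L]_x f x = \int[lebesgue_measure]_(x in `[0%R, L[) f x)%E.
Proof.
move=> mf; have D0 : lebI L (~` `[0%R, L[) = 0%E by rewrite [LHS]lebIE setICl measure0.
have h (k : R -> \bar R) : measurable_fun [set: RR] k -> (forall x, 0 <= k x)%E ->
    (\int[lebI L]_x k x = \int[lebesgue_measure]_(x in `[0%R, L[) k x)%E.
  move=> mk k0; rewrite (ge0_negligible_integral _ _ _ _ D0)//; last first.
    exact: measurableC.
  rewrite setDE setCK setTI; apply: eq_measure_integral => A mA AD.
  by rewrite [LHS]lebIE; congr (lebesgue_measure _); apply/setIidPl.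
rewrite integralE [RHS]integralE; congr (_ - _)%E; apply: h => //.
- exact: measurable_funepos.
- exact: measurable_funeneg.
Qed.

Lemma lebI_L1 L f : M1 f ->
  L1 (lebI L) f <-> lebesgue_measure.-integrable `[0%R, L[ (fun x => (f x)%:E).
Proof.
move=> mf; have mfE : measurable_fun [set: RR] (fun x => (f x)%:E) by exact/measurable_EFinP.
have E : (\int[lebI L]_x `|(f x)%:E| =
    \int[lebesgue_measure]_(x in `[0%R, L[) `|(f x)%:E|)%E.
  by rewrite lebI_integral//; exact: measurableT_comp.
split=> /integrableP[_ fi]; apply/integrableP; split => //.
- exact: measurable_funTS.
- by rewrite -E.
- by rewrite E.
Qed.

Lemma lebI_IntE L f : M1 f ->
  Int (lebI L) f = \int[lebesgue_measure]_(x in `[0%R, L[) f x.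
Proof.
by move=> mf; rewrite /Int /Rintegral lebI_integral//; exact/measurable_EFinP.
Qed.

Lemma lebI_setT L : 0 <= L -> fine (lebI L setT) = L.
Proof.
move=> L0; rewrite [X in fine X]lebIE setTI.
rewrite lebesgue_measure_itv/= lte_fin; case: ltP => /=; rewrite ?subr0// => L0'.
by apply/eqP; rewrite eq_le L0 L0'.
Qed.

Lemma Int_lebI_cst L k : 0 <= L -> Int (lebI L) (fun=> k) = k * L.
Proof. by move=> L0; rewrite Int_cst lebI_setT. Qed.

(** The integral of [f] from [0] to [t], frozen at [0] for [t <= 0] and at the full integral for
    [t >= L]; it is thus defined, continuous and measurable on the whole line. *)
Definition prim L f (t : R) : R := Int (lebI L) (fun s => when (s < t) (f s)).

Lemma L1_when d (T : measurableType d) (mu : {finite_measure set T -> \bar R})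
    (a b : T -> R) (f : T -> R) : measurable_fun setT a -> measurable_fun setT b ->
  L1 mu f -> L1 mu (fun s => when (a s < b s) (f s)).
Proof.
move=> ma mb Lf; apply: L1_le (L1_abs Lf) _.
  by apply: measurable_when => //; exact: L1_meas Lf.
by move=> x; rewrite /when; case: ifP; rewrite ?normr0.
Qed.

Lemma L1_when1 L f t : L1 (lebI L) f -> L1 (lebI L) (fun s => when (s < t) (f s)).
Proof. by move=> Lf; apply: L1_when => //; meas. Qed.

Lemma prim_abs L f t : L1 (lebI L) f ->
  `|prim L f t| <= Int (lebI L) (fun s => `|f s|).
Proof.
move=> Lf; apply: le_trans (Int_abs (L1_when1 t Lf)) _; apply: Int_le.
- exact/L1_abs/L1_when1.
- exact/L1_abs.
- by move=> s; rewrite /when; case: ifP; rewrite ?normr0.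
Qed.

Lemma prim_le0 L f t : M1 f -> t <= 0 -> prim L f t = 0.
Proof.
move=> mf t0; rewrite /prim (@Int_ae _ _ _ _ _ (fun=> 0)) ?Int0//; first by meas.
apply: aeS (lebI_in L) => x /andP[x0 _].
by rewrite /when ltNge (le_trans t0 x0).
Qed.

Lemma prim_ge L f t : M1 f -> L <= t ->
  prim L f t = Int (lebI L) f.
Proof.
move=> mf Lt; apply: Int_ae => //; first by meas.
by apply: aeS (lebI_in L) => x /andP[_ xL]; rewrite /when (lt_le_trans xL Lt).
Qed.

Lemma primD L f g t : L1 (lebI L) f -> L1 (lebI L) g ->
  prim L (fun s => f s + g s) t = prim L f t + prim L g t.
Proof.
move=> Lf Lg; rewrite /prim -IntD; [|exact: L1_when1..].
by apply: Int_eq => s; rewrite /when; case: ifP; rewrite ?addr0.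
Qed.

Lemma primB L f g t : L1 (lebI L) f -> L1 (lebI L) g ->
  prim L (fun s => f s - g s) t = prim L f t - prim L g t.
Proof.
move=> Lf Lg; rewrite /prim -IntB; [|exact: L1_when1..].
by apply: Int_eq => s; rewrite /when; case: ifP; rewrite ?subr0.
Qed.

Lemma primZ L k f t : L1 (lebI L) f -> prim L (fun s => k * f s) t = k * prim L f t.
Proof.
move=> Lf; rewrite /prim -IntZ; last exact: L1_when1.
by apply: Int_eq => s; rewrite /when; case: ifP; rewrite ?mulr0.
Qed.

Lemma primN L f t : L1 (lebI L) f -> prim L (fun s => - f s) t = - prim L f t.
Proof.
move=> Lf; rewrite -[RHS]mulN1r -primZ//; congr (prim L _ t).
by apply/funext => s; rewrite mulN1r.
Qed.

Lemma prim_ae L f g t : M1 f -> M1 g ->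
  {ae lebI L, forall s, f s = g s} -> prim L f t = prim L g t.
Proof.
move=> mf mg fg; apply: Int_ae; [by meas|by meas|].
by apply: aeS fg => s ->.
Qed.

Lemma prim_le_ae L f g t : L1 (lebI L) f -> L1 (lebI L) g ->
  {ae lebI L, forall s, s < t -> f s <= g s} -> prim L f t <= prim L g t.
Proof.
move=> Lf Lg fg; apply: Int_le_ae; [exact: L1_when1..|].
by apply: aeS fg => s; rewrite /when; case: ifP => // _; exact.
Qed.

Lemma measurable_prim L f : M1 f -> M1 (prim L f).
Proof. by move=> mf; rewrite /prim; meas. Qed.

Lemma measurable_prim2 d (T : measurableType d) L (f : T -> R -> R) (a : T -> R) :
  measurable_fun [set: T * RR] (fun z => f z.1 z.2) -> measurable_fun setT a ->
  measurable_fun setT (fun w => prim L (f w) (a w)).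
Proof.
move=> mf ma; rewrite /prim; apply: measurable_Int => /=; apply: measurable_when.
- exact: measurable_snd.
- exact: (measurableT_comp ma measurable_fst).
- exact: mf.
Qed.

Lemma prim_sub L f (a b : R) : L1 (lebI L) f -> a <= b ->
  prim L f b - prim L f a = prim L (fun s => when (a < s) (f s)) b.
Proof.
move=> Lf ab; rewrite /prim -IntB; [|exact: L1_when1..].
apply: Int_ae.
- by apply: measurable_funB; [have := L1_meas (L1_when1 b Lf)|have := L1_meas (L1_when1 a Lf)].
- by meas.
apply: aeS (lebI_neq L a) => s sa; rewrite /when.
have [asa|asa] := ltP a s; first by rewrite [s < a]ltNge (ltW asa)/= subr0.
have {}asa : s < a by rewrite lt_neqAle sa asa.
by rewrite asa (lt_le_trans asa ab) subrr.
Qed.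

Lemma Int_when_itv L (a b : R) : a <= b ->
  Int (lebI L) (fun s => when (s < b) (when (a < s) 1)) <= b - a.
Proof.
move=> ab; rewrite (_ : (fun s => _) = \1_(`]a, b[)); last first.
  apply/funext => s; rewrite /when indicE mem_setE in_itv/=.
  by case: (s < b); case: (a < s).
rewrite /Int /Rintegral integral_indic// setIT [X in fine X <= _]lebIE.
apply: (@le_trans _ _ (fine (@lebesgue_measure R `]a, b[%classic))).
  apply: fine_le.
  - by rewrite ge0_fin_numE// (le_lt_trans _ (lebI_lty L))// le_measure// ?inE//; exact: measurableI.
  - by rewrite lebesgue_measure_itv/=; case: ifP.
  - by rewrite le_measure// ?inE//; exact: measurableI.
by rewrite lebesgue_measure_itv/=; case: ifP => //= _; rewrite subr_ge0.
Qed.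

Lemma prim_lip L f K (a b : R) : M1 f -> (forall s, `|f s| <= K) ->
  a <= b -> `|prim L f b - prim L f a| <= K * (b - a).
Proof.
move=> mf fK ab; have K0 : 0 <= K by exact: le_trans (fK 0).
have Lf : L1 (lebI L) f := L1_bnd _ mf fK.
have Lw : L1 (lebI L) (fun s => when (s < b) (when (a < s) (1 : R))).
  apply: (@L1_bnd _ _ _ _ _ 1); first by meas.
  by move=> s; rewrite /when; case: (s < b); case: (a < s); rewrite ?normr0 ?normr1.
rewrite prim_sub//; apply: le_trans (Int_abs _) _.
  by apply: L1_when1; apply: L1_when => //; meas.
apply: (@le_trans _ _ (Int (lebI L) (fun s => K * when (s < b) (when (a < s) 1)))).
  apply: Int_le.
  - by apply/L1_abs/L1_when1/L1_when => //; meas.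
  - exact: L1Z.
  - by move=> s; rewrite /when; case: (s < b); case: (a < s); rewrite ?normr0 ?mulr0 ?mulr1.
by rewrite IntZ//; apply: ler_wpM2l => //; exact: Int_when_itv.
Qed.

Lemma L1_mul_prim L f g : L1 (lebI L) f -> L1 (lebI L) g ->
  L1 (lebI L) (fun s => f s * prim L g s).
Proof.
move=> Lf Lg; have mf : M1 f := L1_meas Lf; have mg : M1 g := L1_meas Lg.
apply: (@L1_le _ _ _ (lebI L) _ (fun s => Int (lebI L) (fun r => `|g r|) * `|f s|)).
- by apply: measurable_funM => //; exact: measurable_prim.
- exact/L1Z/L1_abs.
- by move=> s; rewrite normrM mulrC ler_wpM2r// prim_abs.
Qed.

(* Fubini on the square [s, r < t], cut along its diagonal. *)
Lemma prim_mul L f g t : L1 (lebI L) f -> L1 (lebI L) g ->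
  prim L f t * prim L g t =
  prim L (fun s => f s * prim L g s + g s * prim L f s) t.
Proof.
move=> Lf Lg; have mf : M1 f := L1_meas Lf; have mg : M1 g := L1_meas Lg.
have half (p q : R -> R) : L1 (lebI L) p -> L1 (lebI L) q ->
    LL (lebI L) (lebI L) (fun s r => when (s < t) (p s) * when (r < s) (q r)) /\
    Int (lebI L) (fun s => Int (lebI L) (fun r => when (s < t) (p s) * when (r < s) (q r)))
     = prim L (fun s => p s * prim L q s) t /\
    L1 (lebI L) (fun s => p s * prim L q s).
  move=> Lp Lq; have mp : M1 p := L1_meas Lp; have mq : M1 q := L1_meas Lq.
  split.
    have Labs := L1_abs (LL_prod (L1_when1 t Lp) Lq).
    apply: (L1_le _ Labs); first by meas.
    move=> [s r] /=; rewrite !normrM ler_wpM2l// /when.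
    by case: (r < s); rewrite ?normr0.
  split.
    apply: Int_eq => s; rewrite IntZ; last exact: L1_when1.
    by rewrite /when /prim; case: (s < t); rewrite ?mul0r.
  exact: L1_mul_prim.
have [LLfg [Ifg Lfg]] := half f g Lf Lg.
have [LLgf [Igf Lgf]] := half g f Lg Lf.
rewrite primD// -Ifg -Igf (Int_swap LLgf).
have [LI1 _] := LL_Int1 LLfg; have [LI2 _] := LL_Int1 (LL_swap LLgf).
rewrite -IntD//.
rewrite [LHS](_ : _ = Int (lebI L) (fun s => Int (lebI L) (fun r =>
    when (s < t) (f s) * when (r < t) (g r)))); last first.
  under [RHS]Int_eq => s.
    rewrite IntZ; last exact: L1_when1.
    over.
  by rewrite IntZr//; exact: L1_when1.
apply: Int_ae.
- by meas.
- apply: measurable_funD; first exact: (L1_meas LI1).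
  exact: (L1_meas LI2).
apply: aeS2 (LL1 LLfg) (LL1 (LL_swap LLgf)) => s L1s L2s.
rewrite -IntD//; apply: Int_ae.
- by meas.
- by apply: measurable_funD; [exact: L1_meas L1s|exact: L1_meas L2s].
apply: aeS (lebI_neq L s) => r rs; rewrite /when.
case: (ltgtP r s) rs => // rs _.
- have [st|st] := ltP s t; first by rewrite (lt_trans rs st) !mulr0 addr0.
  by rewrite !mul0r mulr0 addr0.
- rewrite mulr0 add0r mulrC; have [rt|rt] := ltP r t; first by rewrite (lt_trans rs rt).
  by rewrite !mul0r.
Qed.

End lebesgue_interval.

Ltac meas_prim ::= match goal with
  | |- measurable_fun setT (fun w => prim ?L (@?f w) (@?a w)) =>
      apply: (@measurable_prim2 _ _ _ L f a) => /=
  end.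

(** * Derivatives of primitives and the chain rule *)

Section calculus.
Context (R : realType).
Local Notation RR := (measurableTypeR R).
Implicit Types (L : R) (f g : R -> R).

(** Lebesgue differentiation: on [[0, L)] the function [prim L f] is the primitive from minus
    infinity of [f] extended by zero. *)
Lemma prim_is_derive L f : L1 (lebI L) f ->
  {ae lebI L, forall x, is_derive x (1 : R) (prim L f) (f x)}.
Proof.
move=> Lf; have mf : M1 f := L1_meas Lf.
pose D : set R := `[0, L[%classic.
pose g : R -> R := f \_ D.
have gi : lebesgue_measure.-integrable [set: RR] (fun x => (g x)%:E).
  have /(lebI_L1 L mf) := Lf; rewrite integrable_mkcond//= (restrict_EFin f).
  exact.
have giy y : lebesgue_measure.-integrable `]-oo, y] (EFin \o g).
  by apply: integrableS gi.
have gl : locally_integrable [set: R] g by apply: open_integrable_locally gi => //; exact: openT.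
have FE : (fun y => \int[lebesgue_measure]_(t in `]-oo, y]) g t) = prim L f.
  apply/funext => y; rewrite -Rintegral_itv_bndo_bndc; last first.
    by apply: integrableS gi.
  rewrite /prim lebI_IntE; last by meas.
  rewrite Rintegral_mkcond [RHS]Rintegral_mkcond; apply: eq_Rintegral => x _.
  rewrite /g !patchE /when !mem_setE /D !in_itv/=.
  by case: (x < y) => //; case: (_ && _).
have := FTC1Ny giy gl; rewrite FE => /= H; apply: ae_lebI.
apply: filterS H; first exact: (ae_filter_ringOfSetsType lebesgue_measure).
move=> x [dx fx] /andP[x0 xL]; apply: DeriveDef => //.
by rewrite -derive1E fx /g patchE mem_set//= /D /= in_itv/= x0.
Qed.

(** Continuity is tested on sequences [u n], where dominated convergence applies: for [s] different
    from [t] the guard [s < u n] is eventually constant. *)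
Lemma prim_continuous L f : L1 (lebI L) f -> continuous (prim L f).
Proof.
move=> Lf t; apply/(@cvg_nbhsP _ R^o) => u ut.
have [] := @L1_dct _ _ _ (lebI L) (fun n s => when (s < u n) (f s))
  (fun s => when (s < t) (f s)) (fun s => `|f s|); last by move=> _ cI; exact: cI.
- by move=> n; meas.
- by meas.
- exact: L1_abs.
- apply: aeS (lebI_neq L t) => s st; apply: cvg_near_cst.
  have [lt_st|lt_ts|eq_st] := ltgtP s t; last by rewrite eq_st eqxx in st.
  + move/cvgrPdist_lt : ut => /(_ (t - s)); rewrite subr_gt0 => /(_ lt_st).
    apply: filterS => n H; rewrite /when (_ : s < u n)//.
    have := ler_norm (t - u n); lra.
  + move/cvgrPdist_lt : ut => /(_ (s - t)); rewrite subr_gt0 => /(_ lt_ts).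
    apply: filterS => n H; rewrite /when ltNge (_ : u n <= s)//.
    by have := ler_norm (u n - t); rewrite distrC in H; lra.
- by apply: aeW => s n; rewrite /when; case: ifP; rewrite ?normr0.
Qed.

(** Rational endpoints make the hypothesis a countable one, so that it can be drawn from
    almost-everywhere statements. Continuity extends it to all endpoints, and differentiation gives
    [f]. *)
Lemma prim_eq0_ae L f : L1 (lebI L) f ->
  (forall q : rat, (0 : R) < ratr q < L -> prim L f (ratr q) = 0) ->
  {ae lebI L, forall x, f x = 0}.
Proof.
move=> Lf H; have cF := prim_continuous Lf.
have F0 x : 0 < x < L -> prim L f x = 0.
  move=> /andP[x0 xL]; apply/eqP; apply: contraT => Fx.
  have /cvgrPdist_lt /(_ `|prim L f x|) := cF x; rewrite normr_gt0 => /(_ Fx).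
  move=> /nbhs_ballP[e /= e0 He].
  pose d := Num.min e (L - x).
  have d0 : 0 < d by rewrite lt_min e0 subr_gt0.
  have /rat_in_itvoo[q] : x < x + d by rewrite ltrDl.
  rewrite in_itv/= => /andP[xq qd].
  have dL : d <= L - x by rewrite /d ge_min lexx orbT.
  have de : d <= e by rewrite /d ge_min lexx.
  have : ball x e (ratr q : R) by rewrite /ball/= ltr0_norm; lra.
  move=> /He; rewrite H ?subr0 ?ltxx//; apply/andP; split; lra.
apply: aeS3 (prim_is_derive Lf) (lebI_in L) (lebI_neq L 0) => x dx /andP[x0 xL] x0'.
have {}x0 : 0 < x by rewrite lt_neqAle eq_sym x0' x0.
have d0 : is_derive x (1 : R) (prim L f) 0.
  apply: (@near_eq_is_derive _ R R (cst 0) _ x 1 0).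
  near=> y; rewrite F0//=; apply/andP; split.
  - by near: y; exact: lt_nbhsr.
  - by near: y; exact: lt_nbhsl.
by have := @derive_val _ _ _ _ _ _ _ dx; rewrite (@derive_val _ _ _ _ _ _ _ d0).
Unshelve. all: by end_near. Qed.

Lemma is_derive_seq (F : R -> R) (x l : R) (h : nat -> R) :
  is_derive x (1 : R) F l -> h @ \oo --> (0 : R) -> (forall n, h n != 0) ->
  (F (x + h n) - F x) / h n @[n --> \oo] --> l.
Proof.
move=> [dF eF] h0 hn.
have c : (fun r => r^-1 *: ((F \o shift x) (r *: 1) - F x)) @ 0^' --> l.
  by rewrite -eF; exact: dF.
have := @cvg_comp _ _ _ h (fun r => r^-1 *: ((F \o shift x) (r *: 1) - F x))
  \oo 0^' (nbhs l).
have h0' : h @ \oo --> 0^'.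
  move=> A /h0 Ah; apply: (@filterS _ \oo _ _ _ _ Ah) => n /= An.
  by apply: An; exact: hn.
move=> /(_ h0' c); rewrite (_ : _ \o h = fun n => (F (x + h n) - F x) / h n)//.
by apply/funext => n /=; rewrite /GRing.scale/= mulr1 mulrC [h n + x]addrC.
Qed.

(** Cut [[a, b]] into [n] equal pieces: the increments add up to at most [C (b - a)^2 / n], which is
    below any [e] for [n] large. *)
Lemma quadratic_cst (D : R -> R) (C : R) :
  (forall a b, a <= b -> `|D b - D a| <= C * (b - a) ^+ 2) ->
  forall a b, D a = D b.
Proof.
move=> H; have main a b : a <= b -> D a = D b.
  move=> ab; apply/eqP; rewrite eq_sym -subr_eq0 -normr_le0; apply/ler_addgt0Pr => e e0.
  rewrite add0r.
  have C0 : 0 <= C.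
    have := H 0 1 ler01; rewrite subr0 expr1n mulr1; exact: le_trans.
  pose n := (Num.truncn (C * (b - a) ^+ 2 / e)).+1.
  pose h := (b - a) / n%:R.
  have n0 : 0 < n%:R :> R by rewrite ltr0n.
  have h0 : 0 <= h by rewrite /h divr_ge0 ?subr_ge0// ltW.
  have steps k : `|D (a + k%:R * h) - D a| <= k%:R * (C * h ^+ 2).
    elim: k => [|k IH]; first by rewrite !mul0r addr0 subrr normr0.
    have := H (a + k%:R * h) (a + k.+1%:R * h).
    rewrite -natr1 (_ : a + (k%:R + 1) * h - (a + k%:R * h) = h); last by ring.
    move=> H1; rewrite -(subrKA (D (a + k%:R * h))).
    apply: le_trans (ler_normD _ _) _.
    rewrite (_ : (k%:R + 1) * (C * h ^+ 2) = C * h ^+ 2 + k%:R * (C * h ^+ 2)); last by ring.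
    by apply: lerD => //; apply: H1; lra.
  have := steps n; rewrite /h mulrCA divff ?gt_eqF// mulr1 subrKC => /le_trans; apply.
  rewrite (_ : n%:R * _ = C * (b - a) ^+ 2 / n%:R); last by field; rewrite gt_eqF.
  rewrite ler_pdivrMr// -ler_pdivrMl// mulrC ltW// /n.
  exact: truncnS_gt.
by move=> a b; have [/main|/ltW/main] := leP a b.
Qed.

(** A chain rule along a Lipschitz path that avoids pointwise derivatives: the difference [D] of the
    two sides changes by [O((b - a)^2)] on [[a, b]], hence is constant by [quadratic_cst]. It holds
    for every [t]. *)
Lemma prim_chain L f K (g g' : R -> R) (C c : R) :
  M1 f -> (forall s, `|f s| <= K) -> M1 g' ->
  (forall x, `|g' x| <= C) ->
  (forall x y, `|g' x - g' y| <= C * `|x - y|) ->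
  (forall x y, `|g x - g y - g' y * (x - y)| <= C * (x - y) ^+ 2) ->
  forall t, g (c + prim L f t) = g c + prim L (fun s => g' (c + prim L f s) * f s) t.
Proof.
move=> mf fK mg' g'C g'L gT t.
have K0 : 0 <= K by exact: le_trans (fK 0).
have C0 : 0 <= C by exact: le_trans (g'C 0).
have Lf : L1 (lebI L) f := L1_bnd _ mf fK.
pose n s := c + prim L f s.
have mn : M1 n by rewrite /n; have ? := measurable_prim L mf; meas.
have mgf : M1 (fun s => g' (n s) * f s) by meas.
have gfK s : `|g' (n s) * f s| <= C * K by rewrite normrM ler_pM.
have Lgf : L1 (lebI L) (fun s => g' (n s) * f s) := L1_bnd _ mgf gfK.
pose D s := g (n s) - prim L (fun s => g' (n s) * f s) s.
suff DE : forall a b, D a = D b.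
  have := DE t 0; rewrite /D /n (prim_le0 _ mf (lexx _)) (prim_le0 _ mgf (lexx _)) addr0 subr0.
  by move=> /eqP; rewrite subr_eq => /eqP.
apply: (@quadratic_cst _ (C * K ^+ 2 + C * K ^+ 2)) => a b ab.
have nba x y : x <= y -> `|n y - n x| <= K * (y - x).
  by move=> xy; rewrite /n (_ : _ - _ = prim L f y - prim L f x); [exact: prim_lip|ring].
have nab : `|n b - n a| <= K * (b - a) := nba _ _ ab.
(* The first bracket is the Taylor remainder of [g]; the second is the error of freezing [g' (n s)]
   at [s = a] under the integral. Each is at most [C K^2 (b - a)^2]. *)
rewrite (_ : D b - D a = (g (n b) - g (n a) - g' (n a) * (n b - n a)) +
  (g' (n a) * (n b - n a) - (prim L (fun s => g' (n s) * f s) b -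
    prim L (fun s => g' (n s) * f s) a))); last by rewrite /D; ring.
apply: le_trans (ler_normD _ _) _; rewrite mulrDl; apply: lerD.
  apply: le_trans (gT _ _) _; rewrite -mulrA ler_wpM2l// -exprMn -real_normK ?num_real//.
  by rewrite ler_sqr ?nnegrE// mulr_ge0// subr_ge0.
pose f2 s := when (a < s) (g' (n a) * f s - g' (n s) * f s).
have mf1 : M1 (fun s => when (s < b) (f2 s)) by rewrite /f2; meas.
rewrite (_ : _ - _ = prim L f2 b); last first.
  rewrite /n (_ : _ + _ - (_ + _) = prim L f b - prim L f a); last by ring.
  rewrite prim_sub// prim_sub// -primZ; last by apply: L1_when => //; meas.
  rewrite -primB.
  - congr (prim L _ b); apply/funext => s; rewrite /f2 /n /when; case: ifP => //.
    by rewrite mulr0 subr0.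
  - by apply/L1Z/L1_when => //; meas.
  - by apply: L1_when => //; meas.
have bnd s : `|when (s < b) (f2 s)| <= C * (K * (b - a)) * K * when (s < b) (when (a < s) 1).
  rewrite /f2 /when; case: ifP => sb; last by rewrite normr0 mulr0.
  case: ifP => sa; last by rewrite normr0 mulr0.
  rewrite mulr1 -mulrBl normrM ler_pM//.
  apply: le_trans (g'L _ _) _; apply: ler_wpM2l => //.
  rewrite distrC; apply: le_trans (nba _ _ (ltW sa)) _.
  by rewrite ler_wpM2l// lerD2r ltW.
have Lw : L1 (lebI L) (fun s => when (s < b) (when (a < s) (1 : R))).
  apply: (@L1_bnd _ _ _ _ _ 1); first by meas.
  by move=> s; rewrite /when; case: (s < b); case: (a < s); rewrite ?normr0 ?normr1.
have Lf2 : L1 (lebI L) (fun s => when (s < b) (f2 s)).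
  exact: (L1_le mf1 (L1Z (C * (K * (b - a)) * K) Lw) bnd).
apply: le_trans (Int_abs Lf2) _.
apply: le_trans (Int_le (L1_abs Lf2) (L1Z _ Lw) bnd) _; rewrite IntZ//.
have := Int_when_itv L ab => H.
apply: (@le_trans _ _ (C * (K * (b - a)) * K * (b - a))).
  by apply: ler_wpM2l => //; rewrite !mulr_ge0// subr_ge0.
by rewrite le_eqVlt; apply/orP; left; apply/eqP; ring.
Qed.

End calculus.

(** * Smooth bump functions *)

Section smooth_functions.
Context (R : realType).
Implicit Types (f g : R -> R).

Definition der f g := forall x, is_derive x (1 : R) f (g x).

Lemma derD f g f' g' : der f f' -> der g g' ->
  der (fun x => f x + g x) (fun x => f' x + g' x).
Proof. by move=> df dg x; have := df x; have := dg x => ? ?; exact: is_deriveD. Qed.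

Lemma derM f g f' g' : der f f' -> der g g' ->
  der (fun x => f x * g x) (fun x => f' x * g x + f x * g' x).
Proof.
move=> df dg x; have := df x; have := dg x => dgx dfx.
apply: (is_derive_eq (is_deriveM dfx dgx)).
by rewrite /GRing.scale/= addrC [g x * _]mulrC.
Qed.

Lemma is_derive_exp f (x l : R) k : is_derive x (1 : R) f l ->
  is_derive x (1 : R) (fun s => f s ^+ k) (k%:R * f x ^+ k.-1 * l).
Proof.
move=> df; elim: k => [|k IH]; first by rewrite !mul0r; exact: is_derive_cst.
have -> : (fun s => f s ^+ k.+1) = (fun s => f s * f s ^+ k).
  by apply/funext => s; rewrite exprS.
apply: (is_derive_eq (is_deriveM df IH)); rewrite /GRing.scale/=.
case: k {IH} => [|k]; first by rewrite !mul0r mulr0 add0r mulr1 !expr0 !mul1r.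
by rewrite /= -[k.+2%:R]natr1 exprS; ring.
Qed.

Lemma der_comp f g f' g' : der f f' -> der g g' ->
  der (fun x => f (g x)) (fun x => f' (g x) * g' x).
Proof. by move=> df dg x; exact: (is_derive1_comp (df (g x)) (dg x)). Qed.

Lemma der_cst (c : R) : der (fun=> c) (fun=> 0).
Proof. by move=> x; exact: is_derive_cst. Qed.

Lemma der_id : der (fun x => x) (fun=> 1).
Proof. by move=> x; exact: is_derive_id. Qed.

Lemma der_derive1 f f' : der f f' -> derive1 f = f'.
Proof.
by move=> df; apply/funext => x; rewrite derive1E; have [_] := df x.
Qed.

Lemma der_derivable f f' x : der f f' -> derivable f x 1.
Proof. by move=> df; have [] := df x. Qed.

Lemma der_continuous f f' : der f f' -> continuous f.
Proof.
by move=> df x; apply/differentiable_continuous/derivable1_diffP; exact: der_derivable df.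
Qed.

(* [t^-k exp (-1/t)] on the positive half-line, extended by zero: the family is
   closed under derivation, including at the origin. *)
Definition flat (k : nat) (t : R) : R :=
  if 0 < t then t^-1 ^+ k * expR (- t^-1) else 0.

(** The exponential series gives [(1/t)^(k+2) <= (k+2)! exp (1/t)]. The quadratic decay is what
    makes the derivative at the origin exist and vanish. *)
Lemma flat_quad k (t : R) : `|flat k t| <= (k.+2)`!%:R * t ^+ 2.
Proof.
rewrite /flat; case: ifPn => t0; last by rewrite normr0 mulr_ge0// sqr_ge0.
have s0 : 0 <= t^-1 by rewrite invr_ge0 ltW.
rewrite ger0_norm; last by rewrite mulr_ge0 ?expR_ge0// exprn_ge0.
have := expR_ge1Dxn k.+1 s0; set F := _`!%:R => H.
have F0 : 0 < F by rewrite ltr0n fact_gt0.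
have {}H : t^-1 ^+ k.+2 <= F * expR t^-1.
  rewrite mulrC -ler_pdivrMr//; apply: le_trans H; lra.
have e0 : 0 < expR t^-1 by exact: expR_gt0.
rewrite expRN ler_pdivrMr// -(ler_pM2r (_ : 0 < t^-1 ^+ 2)); last first.
  by rewrite exprn_gt0// invr_gt0.
rewrite -exprD addn2 (le_trans H)// le_eqVlt; apply/orP; left; apply/eqP.
by field; rewrite gt_eqF.
Qed.

Lemma is_derive_quad f (C : R) : (forall t, `|f t| <= C * t ^+ 2) ->
  is_derive (0 : R) (1 : R) f 0.
Proof.
move=> H; have f0 : f 0 = 0.
  by apply/eqP; rewrite -normr_le0; have := H 0; rewrite expr0n/= mulr0.
have C0 : 0 <= C by have := H 1; rewrite expr1n mulr1; exact: le_trans.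
have c : (fun r => r^-1 *: ((f \o shift 0) (r *: (1 : R)) - f 0)) @ 0^' --> (0 : R).
  apply/cvgrPdist_lt => e e0; near=> r.
  have r0 : r != 0 by near: r; exact: nbhs_dnbhs_neq.
  rewrite f0 sub0r normrN /= addr0 subr0 /GRing.scale/= mulr1 normrM normfV.
  rewrite mulrC ltr_pdivrMr ?normr_gt0//; apply: le_lt_trans (H r) _.
  rewrite -real_normK ?num_real// expr2 mulrA ltr_pM2r ?normr_gt0//.
  apply: (@le_lt_trans _ _ ((C + 1) * `|r|)); first by rewrite ler_wpM2r// lerDl.
  rewrite mulrC -ltr_pdivlMr; last by lra.
  by near: r; apply: dnbhs0_lt; rewrite divr_gt0//; lra.
apply: DeriveDef; first by apply/cvg_ex; exists 0.
exact/cvg_lim.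
Unshelve. all: by end_near. Qed.

Lemma der_flat k : der (flat k) (fun t => flat k.+2 t - k%:R * flat k.+1 t).
Proof.
move=> t; have [t0|t0|->] := ltgtP t 0.
- rewrite /flat ltNge (ltW t0)/= mulr0 subr0.
  apply: (@near_eq_is_derive _ R R (cst 0) _ t 1 0).
  by near=> s; rewrite ltNge (_ : s <= 0)//; apply: ltW; near: s; exact: lt_nbhsl.
- have tN0 : t != 0 by rewrite gt_eqF.
  have -> : flat k.+2 t - k%:R * flat k.+1 t =
      (k%:R * t^-1 ^+ k.-1) * (- t ^- 2) * expR (- t^-1) +
      t^-1 ^+ k * (expR (- t^-1) * t ^- 2).
    rewrite /flat t0; case: k => [|k].
      by rewrite !mul0r subr0 add0r expr0 mul1r mulrC exprVn.
    rewrite /= !exprVn.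
    have tk : t ^+ k != 0 by rewrite expf_neq0.
    by rewrite !exprS; field; rewrite tN0.
  apply: (@near_eq_is_derive _ R R (fun s => s^-1 ^+ k * expR (- s^-1)) _ t 1).
    by near=> s; rewrite /flat (_ : 0 < s)//; near: s; exact: lt_nbhsr.
  have dV : is_derive t (1 : R) (fun s => s^-1) (- t ^- 2).
    apply: (is_derive_eq (@is_deriveV _ id t 1 1 tN0 (is_derive_id t 1))).
    by rewrite /GRing.scale/= mulr1.
  have dX : is_derive t (1 : R) (fun s => s^-1 ^+ k) (k%:R * t^-1 ^+ k.-1 * (- t ^- 2)).
    exact: is_derive_exp.
  have dE : is_derive t (1 : R) (fun s => expR (- s^-1)) (expR (- t^-1) * t ^- 2).
    apply: (@is_derive1_comp _ expR (fun s => - s^-1)).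
    by apply: (is_derive_eq (is_deriveN dV)); rewrite opprK.
  apply: (is_derive_eq (is_deriveM dX dE)).
  by rewrite /GRing.scale/= addrC [_ * expR _]mulrC.
- rewrite /flat ltxx mulr0 subr0; exact: is_derive_quad (flat_quad k).
Unshelve. all: by end_near. Qed.

Definition smooth1 f := forall n : nat, continuous (iter n (@derive1 R R) f) /\
  forall x, derivable (iter n (@derive1 R R) f) x 1.

Lemma smooth_der f : smooth1 f -> der f (derive1 f).
Proof. by move=> sf x; rewrite derive1E; apply: derivableP; have [_] := sf 0%N. Qed.

Lemma smooth_derive1 f : smooth1 f -> smooth1 (derive1 f).
Proof. by move=> sf n; have := sf n.+1; rewrite iterSr. Qed.

(** A syntactic class closed under derivation. Smoothness of every order then follows by induction
    on the order, without computing any higher derivative. *)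
Inductive sm : (R -> R) -> Prop :=
| sm_base f : smooth1 f -> sm f
| sm_cst c : sm (fun=> c)
| sm_id : sm (fun x => x)
| sm_add f g : sm f -> sm g -> sm (fun x => f x + g x)
| sm_mul f g : sm f -> sm g -> sm (fun x => f x * g x)
| sm_sin f : sm f -> sm (fun x => sin (f x))
| sm_cos f : sm f -> sm (fun x => cos (f x))
| sm_flat k f : sm f -> sm (fun x => flat k (f x)).

Lemma sm_der f : sm f -> exists2 f', sm f' & der f f'.
Proof.
elim=> [{}f sf|c||{}f g _ [f' sf' df] _ [g' sg' dg]|{}f g sf [f' sf' df] sg [g' sg' dg]
  |{}f sf [f' sf' df]|{}f sf [f' sf' df]|k {}f sf [f' sf' df]].
- by exists (derive1 f); [apply: sm_base; exact: smooth_derive1|exact: smooth_der].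
- by exists (fun=> 0); [exact: sm_cst|exact: der_cst].
- by exists (fun=> 1); [exact: sm_cst|exact: der_id].
- by exists (fun x => f' x + g' x); [exact: sm_add|exact: derD].
- exists (fun x => f' x * g x + f x * g' x); last exact: derM.
  by apply: sm_add; exact: sm_mul.
- exists (fun x => cos (f x) * f' x); first by apply: sm_mul => //; exact: sm_cos.
  by apply: (@der_comp sin f cos f') => // x; exact: is_derive_sin.
- exists (fun x => (-1 * sin (f x)) * f' x).
    by apply: sm_mul => //; apply: sm_mul; [exact: sm_cst|exact: sm_sin].
  apply: (@der_comp cos f (fun x => -1 * sin x) f') => // x.
  by rewrite mulN1r; exact: is_derive_cos.
- exists (fun x => (flat k.+2 (f x) + (- k%:R) * flat k.+1 (f x)) * f' x).
    apply: sm_mul => //; apply: sm_add; first exact: sm_flat.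
    by apply: sm_mul; [exact: sm_cst|exact: sm_flat].
  apply: (@der_comp (flat k) f (fun x => flat k.+2 x + (- k%:R) * flat k.+1 x) f') => // x.
  by rewrite mulNr; exact: der_flat.
Qed.

Lemma sm_smooth f : sm f -> smooth1 f.
Proof.
move=> sf n; have [g sg ->] : exists2 g, sm g & iter n (@derive1 R R) f = g.
  elim: n => [|n [g sg gE]]; first by exists f.
  have [g' sg' dg] := sm_der sg; exists g' => //.
  by rewrite iterS gE (der_derive1 dg).
have [g' sg' dg] := sm_der sg; split; first exact: der_continuous dg.
by move=> x; exact: der_derivable dg.
Qed.

Lemma smooth_cont f : smooth1 f -> continuous f.
Proof. by move=> sf; have [] := sf 0%N. Qed.

Lemma smooth_anti f g : der f g -> smooth1 g -> smooth1 f.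
Proof.
move=> df sg [|n]; last by rewrite iterSr (der_derive1 df); exact: sg.
by split; [exact: der_continuous df|move=> x; exact: der_derivable df].
Qed.

Lemma smooth_iter n f : smooth1 f -> smooth1 (iter n (@derive1 R R) f).
Proof.
elim: n => [|n IH] sf; first exact: sf.
rewrite iterS; exact: smooth_derive1 (IH sf).
Qed.

(** The space-time test functions used below are all products, whose mixed partial derivatives
    factor. *)
Lemma smooth2_mul f g : smooth1 f -> smooth1 g -> smooth2 (fun t x => f t * g x).
Proof.
move=> sf sg n m.
have pdxE p q : smooth1 q -> pdx (fun t x => p t * q x) = fun t x => p t * derive1 q x.
  move=> sq; apply/funext => t; apply/funext => x.
  rewrite /pdx (der_derive1 (derM (der_cst (p t)) (smooth_der sq))) mul0r add0r.
  by [].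
have pdtE p q : smooth1 p -> pdt (fun t x => p t * q x) = fun t x => derive1 p t * q x.
  move=> sp; apply/funext => t; apply/funext => x.
  by rewrite /pdt (der_derive1 (derM (smooth_der sp) (der_cst (q x)))) mulr0 addr0.
have E : iter n (@pdt R) (iter m (@pdx R) (fun t x => f t * g x)) =
    fun t x => iter n (@derive1 R R) f t * iter m (@derive1 R R) g x.
  have -> : iter m (@pdx R) (fun t x => f t * g x) =
      fun t x => f t * iter m (@derive1 R R) g x.
    elim: m => [|m IH]; first by [].
    by rewrite iterS IH pdxE; last exact: smooth_iter.
  elim: n => [|n IH]; first by [].
  by rewrite iterS IH pdtE; last exact: smooth_iter.
have dF := smooth_der (smooth_iter n sf); have dG := smooth_der (smooth_iter m sg).
rewrite E; split; last split=> t x.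
- move=> [t x]; rewrite /unc/=; apply: cvgM.
    apply: (@continuous_comp _ _ _ fst (iter n (@derive1 R R) f)); first exact: cvg_fst.
    by have [cf _] := sf n; exact: cf.
  apply: (@continuous_comp _ _ _ snd (iter m (@derive1 R R) g)); first exact: cvg_snd.
  by have [cg _] := sg m; exact: cg.
- exact: (der_derivable (derM dF (der_cst (iter m (@derive1 R R) g x)))).
- exact: (der_derivable (derM (der_cst (iter n (@derive1 R R) f t)) dG)).
Qed.

Lemma pdt_mul f g : smooth1 f -> pdt (fun t x => f t * g x) = fun t x => derive1 f t * g x.
Proof.
move=> sp; apply/funext => t; apply/funext => x.
by rewrite /pdt (der_derive1 (derM (smooth_der sp) (der_cst (g x)))) mulr0 addr0.
Qed.

Lemma pdx_mul f g : smooth1 g -> pdx (fun t x => f t * g x) = fun t x => f t * derive1 g x.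
Proof.
move=> sq; apply/funext => t; apply/funext => x.
by rewrite /pdx (der_derive1 (derM (der_cst (f t)) (smooth_der sq))) mul0r add0r.
Qed.

(** Since [exp (-1/(n s))] tends to [1] for [s > 0], these smooth functions with values in [[0, 1]]
    converge pointwise to the indicator of the open interval. *)
Definition bump (a b : R) (n : nat) (x : R) : R := flat 0 (n%:R * ((x - a) * (b - x))).

(** The periodic analogue: both sines change sign under [x -> x + 1], so their product is
    1-periodic, and on [[0, 1)] it is positive exactly between [a] and [b] when
    [0 <= a < b <= 1]. *)
Definition pbump (a b : R) (n : nat) (x : R) : R :=
  flat 0 (n%:R * (sin (pi * (x - a)) * sin (pi * (b - x)))).

Lemma flat0_bnd (t : R) : 0 <= flat 0 t <= 1.
Proof.
rewrite /flat expr0 mul1r; case: ifP => [t0|_]; last by rewrite lexx ler01.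
by rewrite expR_ge0 expR_le1 oppr_le0 invr_ge0 ltW.
Qed.

Lemma flat0_cvg (y : R) : flat 0 (n%:R * y) @[n --> \oo] --> ((0 < y)%R%:R : R).
Proof.
have [y0|y0] := ltP 0 y; last first.
  apply: cvg_near_cst; apply: nearW => n; rewrite /flat ltNge mulr_ge0_le0//.
have c : - (n.+1%:R * y)^-1 @[n --> \oo] --> (0 : R).
  have H : (fun n => (@harmonic R) n * (- y^-1)) @ \oo --> 0 * (- y^-1).
    by apply: cvgM; [exact: cvg_harmonic|exact: cvg_cst].
  move: H; rewrite mul0r; apply: cvg_trans; apply: near_eq_cvg; apply: nearW => n.
  by rewrite /harmonic/= invfM mulrN.
rewrite -(cvg_shiftn 1).
have := cvg_comp _ _ c (@continuous_expR R 0).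
rewrite expR0; apply: cvg_trans; apply: near_eq_cvg; apply: nearW => n.
by rewrite /= /flat ?addn1 mulr_gt0 ?ltr0n// expr0 mul1r ?addn1.
Qed.

Lemma bump_smooth a b n : smooth1 (bump a b n).
Proof.
apply: sm_smooth; apply: sm_flat; apply: (@sm_mul (fun=> n%:R)); first exact: sm_cst.
apply: (@sm_mul (fun x => x - a) (fun x => b - x)).
  by apply: (@sm_add (fun x => x) (fun=> - a)); [exact: sm_id|exact: sm_cst].
apply: (@sm_add (fun=> b) (fun x => - x)); first exact: sm_cst.
have -> : (fun x : R => - x) = fun x => -1 * x by apply/funext => x; rewrite mulN1r.
by apply: sm_mul; [exact: sm_cst|exact: sm_id].
Qed.

Lemma pbump_test a b n : test1 (pbump a b n).
Proof.
split.
  apply: sm_smooth; apply: sm_flat; apply: (@sm_mul (fun=> n%:R)); first exact: sm_cst.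
  apply: sm_mul; apply: sm_sin; apply: (@sm_mul (fun=> pi)); try exact: sm_cst.
    by apply: (@sm_add (fun x => x) (fun=> - a)); [exact: sm_id|exact: sm_cst].
  apply: (@sm_add (fun=> b) (fun x => - x)); first exact: sm_cst.
  have -> : (fun x : R => - x) = fun x => -1 * x by apply/funext => x; rewrite mulN1r.
  by apply: sm_mul; [exact: sm_cst|exact: sm_id].
move=> x; rewrite /pbump; congr (flat 0 (_ * _)).
rewrite (_ : pi * (x + 1 - a) = pi * (x - a) + pi); last by ring.
rewrite sinDpi -[pi * (b - x)](subrK pi) sinDpi.
by rewrite (_ : pi * (b - x) - pi = pi * (b - (x + 1))); [rewrite mulrN mulNr|ring].
Qed.

Lemma bump_cvg a b (x : R) : a <= b ->
  bump a b n x @[n --> \oo] --> ((a < x < b)%R%:R : R).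
Proof.
move=> ab; rewrite (_ : (a < x < b)%R%:R = (0 < (x - a) * (b - x))%R%:R); first exact: flat0_cvg.
congr (nat_of_bool _)%:R; apply/idP/idP => [/andP[ax xb]|].
  by rewrite mulr_gt0 ?subr_gt0.
have [ax|ax] := ltP a x; have [xb|xb] := ltP x b => //=; rewrite ltNge => /negP[].
- by rewrite mulr_ge0_le0 ?subr_ge0 ?subr_le0// ltW.
- by rewrite mulr_le0_ge0 ?subr_ge0 ?subr_le0// ltW.
- by have -> : x = a; [apply/eqP; rewrite eq_le ax (le_trans ab xb)|rewrite subrr mul0r].
Qed.

Lemma sin_pi_gt0 (y : R) : -1 < y <= 1 -> (0 < sin (pi * y)) = (0 < y < 1).
Proof.
move=> /andP[y1 y2]; have p0 := @pi_gt0 R.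
have [y0|y0] := ltP 0 y; last first.
  apply/negbTE; rewrite -leNgt -oppr_ge0 -sinN sin_ge0_pi// -mulrN; apply/andP; split.
    by rewrite mulr_ge0 ?oppr_ge0// ltW.
  by rewrite ger_pMr//; lra.
move: y2; rewrite le_eqVlt => /predU1P[->|y2]; first by rewrite mulr1 sinpi ltxx.
rewrite y2 sin_gt0_pi//; apply/andP; split; first by rewrite mulr_gt0.
by rewrite gtr_pMr.
Qed.

Lemma pbump_cvg a b (x : R) : 0 <= a -> a < b -> b <= 1 -> 0 <= x < 1 ->
  pbump a b n x @[n --> \oo] --> ((a < x < b)%R%:R : R).
Proof.
move=> a0 ab b1 /andP[x0 x1]; set s1 := sin (pi * (x - a)); set s2 := sin (pi * (b - x)).
have E1 : (0 < s1) = (a < x).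
  rewrite sin_pi_gt0; last by apply/andP; split; lra.
  by rewrite subr_gt0 (_ : x - a < 1) ?andbT//; lra.
have E2 : (0 < s2) = (0 < b - x < 1) by rewrite sin_pi_gt0//; apply/andP; split; lra.
rewrite (_ : (a < x < b)%R%:R = (0 < s1 * s2)%R%:R); first exact: flat0_cvg.
congr (nat_of_bool _)%:R; apply/idP/idP => [/andP[ax xb]|].
  by rewrite mulr_gt0 ?E1 ?E2//; apply/andP; split; lra.
have [ax|ax] := ltP a x; have [xb|xb] := ltP x b => //=; rewrite ltNge => /negP[].
- have s10 : 0 < s1 by rewrite E1.
  by rewrite pmulr_rle0// leNgt E2; apply/negP => /andP[]; lra.
- have s10 : s1 <= 0 by rewrite leNgt E1 -leNgt.
  rewrite mulr_le0_ge0//; have : b - x <= 1 by lra.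
  (* The second sine also vanishes at the far end of its range, [b - x = 1], that is at [x = 0] with
     [b = 1]. *)
  rewrite le_eqVlt => /predU1P[e|e]; first by rewrite /s2 e mulr1 sinpi.
  by rewrite ltW// E2 e andbT; lra.
- by exfalso; lra.
Qed.

Lemma FTC f f' L (x : R) : der f f' -> continuous f' -> 0 <= x <= L ->
  prim L f' x = f x - f 0.
Proof.
move=> df cf' /andP[x0 xL]; have mf' : M1 f' by exact: continuous_measurable_fun.
move: x0; rewrite le_eqVlt => /predU1P[<-|x0]; first by rewrite prim_le0// subrr.
have cf := der_continuous df.
have H : (\int[lebesgue_measure]_(y in `[0%R, x]) (f' y)%:E = (f x)%:E - (f 0%R)%:E)%E.
  apply: continuous_FTC2 => //.
  - exact: continuous_subspaceT.
  - split; first by move=> y _; exact: der_derivable df.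
    + exact/cvg_at_right_filter/cf.
    + exact/cvg_at_left_filter/cf.
  - by move=> y _; rewrite (der_derive1 df).
rewrite /prim lebI_IntE; last by meas.
rewrite /Rintegral -[RHS]/(fine ((f x)%:E - (f 0%R)%:E)%E) -H; congr fine.
rewrite -integral_itv_bndo_bndc; last first.
  by apply/measurable_EFinP/measurable_funTS; exact: continuous_measurable_fun.
rewrite integral_mkcond [RHS]integral_mkcond; apply: eq_integral => y _.
rewrite !patchE !mem_setE !in_itv/= /when.
have [y0|y0] //= := leP 0 y; have [yx|yx] := ltP y x; last by case: ifP.
by rewrite (lt_le_trans yx xL).
Qed.

(** The integral from minus infinity may not exist, so the base point moves with [x], always left of
    [x] and of [0]. Subtracting the integral up to [0] makes the result independent of it. *)
Lemma antiderivative f : continuous f -> exists F, der F f.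
Proof.
move=> cf; pose mu := @lebesgue_measure R.
have fi (a b : R) : mu.-integrable `[a, b] (EFin \o f).
  apply: continuous_compact_integrable; first exact: segment_compact.
  exact: continuous_subspaceT.
pose G (a x : R) := (\int[mu]_(t in `[a, x]) f t)%R.
have GE (a b x : R) : a <= b -> b <= x -> G a x = G a b + G b x.
  move=> ab bx; have := @Rintegral_itvB R f (BLeft a) (BRight x) b (fi a x).
  rewrite !bnd_simp => /(_ ab bx) E; rewrite (Rintegral_itv_obnd_cbnd _) in E.
    by rewrite /G /mu -E addrC subrK.
  by apply: integrableS (fi b x) => //; apply: subset_itvr; rewrite bnd_simp.
have dG (a x : R) : a < x -> is_derive x (1 : R) (G a) (f x).
  move=> ax; have xx1 : x < x + 1 by rewrite ltrDl.
  have [dx fx] := @continuous_FTC1 R f (BLeft a) x (x + 1) xx1 (fi a (x + 1)) ax (cf x).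
  by apply: DeriveDef; [exact: dx|rewrite -derive1E; exact: fx].
exists (fun x => G (- `|x| - 1) x - G (- `|x| - 1) 0) => x.
have xn := ler_norm x; have xn' := ler_norm (- x); rewrite normrN in xn'.
(* One fixed base point for all [y] within distance [1] of [x]. *)
pose a := - `|x| - 2.
apply: (@near_eq_is_derive _ R R (fun y => G a y + (- G a 0)) _ x 1); last first.
  apply: (@is_derive_eq _ _ _ _ _ _ _ (f x + 0)); last by rewrite addr0.
  by apply: is_deriveD; apply: dG; rewrite /a; lra.
near=> y; have yx : `|x - y| < 1.
  by near: y; apply: (@cvgr_dist_lt _ _ _ _ _ id x); [exact: cvg_id|].
have yn := ler_norm y; have yn' := ler_norm (- y); rewrite normrN in yn'.
have tri : `|y| <= `|x| + 1.
  rewrite -[y](subKr x); apply: le_trans (ler_normB _ _) _; lra.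
rewrite (GE a (- `|y| - 1) y) /a; [|by lra..].
rewrite (GE a (- `|y| - 1) 0) /a; [|by have := normr_ge0 y; lra..].
by ring.
Unshelve. all: by end_near. Qed.

(** Removing the mean makes the antiderivative periodic: [G (x + 1) - G x] is constant, and at
    [x = 0] it is the integral of [psi - c] over one period. Derivatives of test functions are thus
    all test functions up to a constant. *)
Lemma mean_zero_primitive (psi : R -> R) : test1 psi ->
  exists2 Psi, test1 Psi & derive1 Psi = fun x => psi x - Int (lebI 1) psi.
Proof.
move=> [spsi ppsi]; set c := Int _ _.
have cpsi := smooth_cont spsi.
have mpsi : M1 psi by exact: continuous_measurable_fun.
have [F dF] := antiderivative cpsi.
pose G x := F x + (- c) * x.
have dG : der G (fun x => psi x - c).
  move=> x; apply: (is_derive_eq (derD dF (derM (der_cst (- c)) der_id) x)).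
  by rewrite mul0r add0r mulr1.
have sG : smooth1 G.
  apply: smooth_anti dG _ => n.
  case: n => [|n].
    split; first by move=> x; apply: cvgD; [exact: cpsi|exact: cvg_cst].
    by move=> x; exact: (der_derivable (derD (smooth_der spsi) (der_cst (- c)))).
  rewrite iterSr (der_derive1 (derD (smooth_der spsi) (der_cst (- c)))).
  rewrite (_ : (fun x => derive1 psi x + 0) = derive1 psi); last by apply/funext => x; rewrite addr0.
  by rewrite -iterSr; exact: spsi.
exists G; last exact: der_derive1 dG.
split=> // x.
have d0 y : is_derive y (1 : R) (fun z => G (z + 1) + (-1) * G z) 0.
  apply: (is_derive_eq (derD (der_comp dG (derD der_id (der_cst 1)))
    (derM (der_cst (-1)) dG) y)).
  by rewrite ppsi addr0 mulr1 mul0r add0r; ring.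
have E := is_derive_0_is_cst x 0 d0.
have : prim 1 psi 1 = F 1 - F 0 by apply: FTC => //; rewrite ler01 lexx.
rewrite prim_ge// -/c => cE; move: E; rewrite /= add0r {3 4}/G mulr0 addr0 mulr1 cE => E.
by apply/eqP; rewrite -subr_eq0 -mulN1r E; apply/eqP; ring.
Qed.

End smooth_functions.

(** * Periodic extension of functions on the domain *)

Section domain.
Context (R : realType).
Local Notation RR := (measurableTypeR R).
Local Notation mT := (lebI _).
Local Notation mX := (@lebI R 1).

Definition frac (x : R) : R := x - (Num.floor x)%:~R.

Lemma frac_itv x : 0 <= frac x < 1.
Proof.
rewrite /frac subr_ge0; have /andP[-> ] := floor_itv x; rewrite intrD /=; lra.
Qed.

Lemma fracE x : 0 <= x < 1 -> frac x = x.
Proof. by move=> x01; rewrite /frac (@floor_def _ x 0) ?subr0. Qed.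

Lemma fracD1 x : frac (x + 1) = frac x.
Proof.
rewrite /frac (@floor_def _ (x + 1) (Num.floor x + 1)).
  by rewrite intrD /=; ring.
have /andP[xl] := floor_itv x; rewrite !intrD /= => xr.
by apply/andP; split; lra.
Qed.

Lemma M1_frac : M1 frac.
Proof.
rewrite /M1 /frac; apply: measurable_funB => //.
apply: nondecreasing_measurable => // x y xy.
by rewrite ler_int; exact: le_floor.
Qed.

Lemma frac_ae : {ae mX, forall x, frac x = x}.
Proof. by apply: aeS (lebI_in 1) => x; exact: fracE. Qed.

(** The time interval is half-open like the support of [lebI T]; the edge [t = T] of [Dom T] is a
    null set. Periodicity in [x] makes the result a function on the circle. *)
Definition ext (T : R) (f : R -> R -> R) (t x : R) : R :=
  if 0 <= t < T then f t (frac x) else 0.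

Definition ext1 (f : R -> R) (x : R) : R := f (frac x).



Definition Box (T : R) : set (RR * RR) := `[0, T[%classic `*` `[0, 1[%classic.

Lemma measurable_Box T : measurable (Box T).
Proof. by apply: measurableX; exact: measurable_itv. Qed.
Local Hint Resolve measurable_Box : core.

Lemma measurable_Dom T : measurable (Dom T : set (RR * RR)).
Proof. by apply: measurableX; exact: measurable_itv. Qed.

Lemma BoxP T (z : RR * RR) : Box T z <-> (0 <= z.1 < T) /\ (0 <= z.2 < 1).
Proof. by rewrite /Box /=; split=> -[] /=; rewrite !in_itv/= => ? ?; split. Qed.

Lemma Box_Dom T : Box T `<=` Dom T.
Proof.
move=> z /BoxP[/andP[z0 zT] z1]; split => /=; last by rewrite /I01 /= in_itv.
by rewrite /Icc /= in_itv/= z0 ltW.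
Qed.

Lemma M2_restrict T f : measurable_fun (Dom T) (unc f) ->
  M2 (fun t x => (unc f \_ (Box T)) (t, x)).
Proof.
move=> mf; rewrite /M2.
have -> : (fun z : RR * RR => (unc f \_ (Box T)) (z.1, z.2)) = unc f \_ (Box T).
  by apply/funext => -[].
apply/(measurable_restrictT (unc f) (measurable_Box T)).
by apply: measurable_funS mf; [exact: measurable_Dom|exact: Box_Dom].
Qed.

Lemma extE T f t x : ext T f t x = (unc f \_ (Box T)) (t, frac x).
Proof.
rewrite /ext patchE; case: ifPn => h.
  by rewrite mem_set//; apply/BoxP; split => //; exact: frac_itv.
by rewrite memNset// => /BoxP[/=]; rewrite (negbTE h).
Qed.

Lemma M2_ext T f : measurable_fun (Dom T) (unc f) -> M2 (ext T f).
Proof.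
move=> /M2_restrict mf; have ? := M1_frac.
rewrite /M2.
have -> : (fun z : RR * RR => ext T f z.1 z.2) =
    fun z => (unc f \_ (Box T)) (z.1, frac z.2).
  by apply/funext => z; exact: extE.
exact: (@M2_comp _ _ _ (fun t x => (unc f \_ (Box T)) (t, x)) (fun z => z.1)
    (fun z => frac z.2) mf measurable_fst (M1_comp M1_frac measurable_snd)).
Qed.

(** Both sides are measures that agree on rectangles, which determines the product measure. *)
Lemma pr_Box T (A : set (RR * RR)) : measurable A ->
  pr (lebI T) mX A = leb2 R (A `&` Box T).
Proof.
move=> mA.
apply: (@product_measure_unique _ _ _ _ _ (lebI T) mX
  (mrestr (leb2 R) (measurable_Box T))) => // B C mB mC.
rewrite /= /mrestr /Box -setXI /leb2 product_measure1E//=.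
- exact: (measurableI _ _ mB (measurable_itv _)).
- exact: (measurableI _ _ mC (measurable_itv _)).
Qed.

Lemma leb2_edge T : leb2 R ([set T] `*` `[0, 1[%classic) = 0%E.
Proof.
have m1 : measurable ([set T] : set RR) by exact: measurable_set1.
have m2 : measurable (`[0%R, 1%R[%classic : set RR) by exact: measurable_itv.
rewrite /leb2 (product_measure1E _ _ m1 m2) [X in (X * _)%E](_ : _ = 0%E) ?mul0e//.
exact: lebesgue_measure_set1.
Qed.

Lemma Dom_edge T z : 0 < T -> Dom T z -> ~ Box T z -> ([set T] `*` `[0, 1[%classic) z.
Proof.
move=> T0 [/=]; rewrite /Icc /I01 /= !in_itv/= => /andP[z0 zT] z1 nB.
split => /=; last by [].
apply: contrapT => zT'; apply: nB; apply/BoxP; split => //.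
by rewrite z0 lt_neqAle zT andbT; apply/eqP.
Qed.

Lemma ae_Dom T (P : R * R -> Prop) :
  {ae leb2 R, forall z, Dom T z -> P z} -> {ae pr (lebI T) mX, forall z, P z}.
Proof.
move=> [N [mN N0 PN]]; exists (N `|` ~` Box T); split.
- by apply: measurableU => //; exact: measurableC.
- rewrite [LHS]pr_Box; last by apply: measurableU => //; exact: measurableC.
  rewrite setIUl setICl setU0; apply/eqP; rewrite eq_le measure_ge0 andbT.
  rewrite -[X in (_ <= X)%E]N0 le_measure// ?inE//; exact: measurableI.
- move=> z nP; have [Bz|Bz] := pselect (Box T z); last by right.
  by left; apply: PN => /= /(_ (Box_Dom Bz)).
Qed.

Lemma Dom_ae T (P : R * R -> Prop) : 0 < T ->
  {ae pr (lebI T) mX, forall z, P z} -> {ae leb2 R, forall z, Dom T z -> P z}.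
Proof.
move=> T0 [N [mN N0 PN]]; exists ((N `&` Box T) `|` [set T] `*` `[0, 1[%classic); split.
- apply: measurableU; first exact: measurableI.
  by apply: measurableX => //; exact: measurable_itv.
- transitivity (leb2 R (N `&` Box T)); last by rewrite -[RHS]N0; exact/esym/pr_Box.
  apply: measureU0; [exact: measurableI| |exact: leb2_edge].
  by apply: measurableX => //; exact: measurable_itv.
- move=> z /= /not_implyP[Dz nP]; have [Bz|Bz] := pselect (Box T z).
    by left; split => //; exact: PN.
  by right; exact: Dom_edge.
Qed.

Lemma pr_integral T (h : RR * RR -> \bar R) : measurable_fun setT h ->
  (\int[pr (lebI T) mX]_z h z = \int[leb2 R]_(z in Box T) h z)%E.
Proof.
move=> mh; have D0 : pr (lebI T) mX (~` Box T) = 0%E.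
  by rewrite [LHS]pr_Box ?setICl ?measure0//; exact: measurableC.
have H (k : RR * RR -> \bar R) : measurable_fun setT k -> (forall z, 0 <= k z)%E ->
    (\int[pr (lebI T) mX]_z k z = \int[leb2 R]_(z in Box T) k z)%E.
  move=> mk k0.
  rewrite (@ge0_negligible_integral _ _ _ (pr (lebI T) mX) setT (~` Box T) k
    (measurableC (measurable_Box T)) measurableT mk (fun z _ => k0 z) D0).
  rewrite setDE setCK setTI; apply: eq_measure_integral => A mA AD.
  by rewrite [LHS]pr_Box//; congr (leb2 R _); apply/setIidPl.
have Hp := H _ (measurable_funepos mh) (funepos_ge0 h).
have Hn := H _ (measurable_funeneg mh) (funeneg_ge0 h).
have E1 := @integralE _ _ _ (pr (lebI T) mX) setT h.
have E2 := @integralE _ _ _ (leb2 R) (Box T) h.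
exact (etrans E1 (etrans (congr2 (fun a b => (a - b)%E) Hp Hn) (esym E2))).
Qed.

Lemma ext_LL T f : 0 < T ->
  (leb2 R).-integrable (Dom T) (fun z => (f z.1 z.2)%:E) ->
  LL (lebI T) mX (ext T f) /\
  (\int[leb2 R]_(z in Dom T) (f z.1 z.2)%:E = (IInt (lebI T) mX (ext T f))%:E)%E.
Proof.
move=> T0 fi.
have mfE := measurable_int _ fi.
have mf : measurable_fun (Dom T) (unc f) by move/measurable_EFinP : mfE.
have me := M2_ext mf.
have meE : measurable_fun [set: RR * RR] (fun z => (ext T f z.1 z.2)%:E).
  exact/measurable_EFinP.
have eqB z : z \in Box T -> (ext T f z.1 z.2)%:E = (f z.1 z.2)%:E.
  by move/set_mem => /BoxP[z1 z2]; rewrite /ext z1 fracE.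
have fiB := integrableS (measurable_Dom T) (measurable_Box T) (@Box_Dom T) fi.
have Lf : LL (lebI T) mX (ext T f).
  apply/integrableP; split => //.
  rewrite pr_integral; last exact: measurableT_comp.
  have /integrableP[_] := fiB; congr (_ < _)%E.
  by apply: eq_integral => z /eqB ->.
split; first exact: Lf.
rewrite /IInt -(L1_fin Lf) (pr_integral T meE).
have -> : (\int[leb2 R]_(z in Box T) (ext T f z.1 z.2)%:E =
    \int[leb2 R]_(z in Box T) (f z.1 z.2)%:E)%E by apply: eq_integral => z /eqB ->.
have mE : measurable ([set T] `*` `[0%R, 1%R[%classic : set (RR * RR)).
  by apply: measurableX; [exact: measurable_set1|exact: measurable_itv].
rewrite (@negligible_integral _ _ _ (leb2 R) _ _ _ mE (measurable_Dom T) fi (leb2_edge T)).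
rewrite (@negligible_integral _ _ _ (leb2 R) _ _ _ mE (measurable_Box T) fiB (leb2_edge T)).
congr (\int[leb2 R]_(z in _) _)%E; apply/seteqP; split => z [Dz Ez]; split => //.
  by apply: contrapT => nB; apply: Ez; exact: Dom_edge.
exact: Box_Dom.
Qed.

Lemma M1_ext1 f : measurable_fun (I01 R) f -> M1 (ext1 f).
Proof.
move=> mf; have mI : measurable (`[0, 1[%classic : set R) by exact: measurable_itv.
have mr : M1 (f \_ `[0, 1[%classic).
  by apply/(measurable_restrictT f mI).
rewrite (_ : ext1 f = fun x => (f \_ `[0, 1[%classic) (frac x)).
  exact: (M1_comp mr M1_frac).
apply/funext => x; rewrite /ext1 patchE mem_set//= in_itv/=; exact: frac_itv.
Qed.

Lemma ext1_L1 f : lebesgue_measure.-integrable (I01 R) (fun x => (f x)%:E) ->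
  L1 mX (ext1 f) /\
  (\int[lebesgue_measure]_(x in I01 R) (f x)%:E = (Int mX (ext1 f))%:E)%E.
Proof.
move=> fi; have mf : measurable_fun (I01 R) f.
  by have /measurable_EFinP := measurable_int _ fi.
have me := M1_ext1 mf.
have eqI : {in I01 R, (fun x => (ext1 f x)%:E) =1 (fun x => (f x)%:E)}.
  by move=> x /set_mem; rewrite /I01 /= in_itv/= => x01; rewrite /ext1 fracE.
have Lf : L1 mX (ext1 f).
  apply/(lebI_L1 1 me); apply: eq_integrable fi => //; first exact: measurable_itv.
  by move=> x /eqI.
split=> //; rewrite -L1_fin// lebI_integral//; last exact/measurable_EFinP.
by apply: eq_integral => x /eqI.
Qed.

End domain.
#[global] Hint Resolve measurable_Box : core.

(** * Slicing the weak formulations in time *)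

Section weak_slices.
Context (R : realType).
Local Notation RR := (measurableTypeR R).
Local Notation mX := (@lebI R 1).
Implicit Types (T : R).

Lemma smooth_M1 (f : R -> R) : smooth1 f -> M1 f.
Proof. by move=> sf; apply: continuous_measurable_fun; exact: smooth_cont. Qed.

Lemma periodic_frac (f : R -> R) : (forall x, f (x + 1) = f x) -> forall x, f (frac x) = f x.
Proof.
move=> pf x; rewrite /frac.
have nat_per (n : nat) y : f (y + n%:R) = f y.
  by elim: n => [|n IH]; rewrite ?addr0// -natr1 addrA pf.
case: (Num.floor x) => n.
  by rewrite -(nat_per n (x - _)) /= -[n%:~R]/(n%:R) subrK.
by rewrite NegzE mulrNz opprK nat_per.
Qed.

Lemma continuous_bounded (f : R -> R) (L : R) : 0 <= L -> continuous f ->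
  exists2 C, 0 <= C & forall x, 0 <= x <= L -> `|f x| <= C.
Proof.
move=> L0 cf; have cn : {within `[0, L], continuous (fun x => `|f x|)}.
  by apply: continuous_subspaceT => x; apply: cvg_norm; exact: cf.
have [c _ Hc] := EVT_max L0 cn; exists `|f c|; first exact: normr_ge0.
by move=> x xL; apply: Hc; rewrite in_itv.
Qed.

Lemma periodic_bounded (f : R -> R) : continuous f -> (forall x, f (x + 1) = f x) ->
  exists2 C, 0 <= C & forall x, `|f x| <= C.
Proof.
move=> cf pf; have [C C0 HC] := continuous_bounded ler01 cf.
exists C => // x; rewrite -(periodic_frac pf); apply: HC.
by have /andP[-> /ltW ->] := frac_itv x.
Qed.

Lemma derive1_periodic (f : R -> R) : smooth1 f -> (forall x, f (x + 1) = f x) ->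
  forall x, derive1 f (x + 1) = derive1 f x.
Proof.
move=> sf pf x; have df := smooth_der sf.
have E : (fun y => f (y + 1)) = f by apply/funext => y; exact: pf.
have := der_derive1 (der_comp df (derD (@der_id R) (der_cst 1))).
by rewrite E => /(congr1 (fun h => h x)); rewrite addr0 mulr1 => ->.
Qed.

Lemma test1_bounded (f : R -> R) : test1 f -> exists2 C, 0 <= C & forall x, `|f x| <= C.
Proof. by move=> [sf pf]; apply: periodic_bounded => //; exact: smooth_cont. Qed.

Lemma test1_derive1 (f : R -> R) : test1 f -> test1 (derive1 f).
Proof. by move=> [sf pf]; split; [exact: smooth_derive1|exact: derive1_periodic]. Qed.

Lemma test1_M1 (f : R -> R) : test1 f -> M1 f.
Proof. by move=> [sf _]; exact: smooth_M1. Qed.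

Lemma test1_cst (c : R) : test1 (fun=> c).
Proof. by split => //; apply: sm_smooth; exact: sm_cst. Qed.

Lemma L1_test L (f psi : R -> R) : test1 psi -> L1 (lebI L) f ->
  L1 (lebI L) (fun x => f x * psi x).
Proof.
move=> tp Lf; have [C C0 HC] := test1_bounded tp.
rewrite (_ : (fun x => _) = fun x => psi x * f x); last by apply/funext => x; rewrite mulrC.
exact: (L1M (test1_M1 tp) HC Lf).
Qed.

Lemma LL_test L (f : R -> R -> R) psi : test1 psi -> LL (lebI L) mX f ->
  LL (lebI L) mX (fun t x => f t x * psi x).
Proof.
move=> tp Lf; have [C C0 HC] := test1_bounded tp; have mp := test1_M1 tp.
have mf : M2 f := L1_meas Lf.
apply: (@L1_le _ _ _ (pr (lebI L) mX) _ (fun z => C * `|f z.1 z.2|)).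
- by meas.
- exact/L1Z/L1_abs.
- by move=> z /=; rewrite normrM mulrC ler_wpM2r.
Qed.

(** As the bumps converge to indicators, the primitive of [k] is constant inside [(0, T)]; it is
    continuous and vanishes at [0], so the constant is zero. *)
Lemma bump_tests_ae (T : R) (k : R -> R) : L1 (lebI T) k ->
  (forall a b n, 0 < a -> a < b -> b < T ->
    Int (lebI T) (fun t => bump a b n t * k t) = 0) ->
  {ae lebI T, forall t, k t = 0}.
Proof.
move=> Lk H; have mk : M1 k := L1_meas Lk.
have sub a b : 0 < a -> a < b -> b < T -> prim T k b = prim T k a.
  move=> a0 ab bT; apply/eqP; rewrite -subr_eq0 prim_sub//; last exact: ltW.
  apply/eqP; have [] := @L1_dct _ _ _ (lebI T) (fun n t => bump a b n t * k t)
    (fun t => when (t < b) (when (a < t) (k t))) (fun t => `|k t|).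
  - by move=> n; have ? := smooth_M1 (@bump_smooth R a b n); meas.
  - by meas.
  - exact: L1_abs.
  - apply: aeW => t.
    rewrite [X in _ --> X](_ : _ = (a < t < b)%R%:R * k t); last first.
      by rewrite /when andbC; case: (t < b); case: (a < t) => /=; rewrite ?mul1r ?mul0r.
    by apply: cvgMl; apply: bump_cvg; exact: ltW.
  - apply: aeW => t n; rewrite normrM ler_piMl//.
    by have /andP[h0 h1] := flat0_bnd (n%:R * ((t - a) * (b - t))); rewrite ger0_norm.
  move=> _ c.
  have c0 : Int (lebI T) (fun t => bump a b n t * k t) @[n --> \oo] --> (0 : R).
    by apply: cvg_near_cst; apply: nearW => n; exact: H.
  by apply: (@cvg_unique _ (@Rhausdorff R) _ _ _ _ c c0).
apply: prim_eq0_ae => // q /andP[q0 qT].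
have c : prim T k x @[x --> (0 : R)] --> (0 : R).
  by rewrite -[X in _ --> X](prim_le0 T mk (lexx 0)); exact: prim_continuous.
have hc : (@harmonic R) n @[n --> \oo] --> (0 : R) by exact: cvg_harmonic.
have cs := cvg_comp _ _ hc c.
apply/esym; apply: (@cvg_unique _ (@Rhausdorff R) _ _ _ _ cs).
apply: cvg_near_cst.
have hq : \forall n \near \oo, (@harmonic R) n < ratr q by exact: (cvgr_lt 0 hc _ q0).
apply: (@filterS _ \oo _ _ _ _ hq) => n hn /=.
by apply/esym; apply: sub => //; rewrite /harmonic/= invr_gt0 ltr0n.
Qed.

Lemma ae_rat d (X : measurableType d) (mu : {finite_measure set X -> \bar R})
    (P : rat -> X -> Prop) : (forall q, {ae mu, forall x, P q x}) ->
  {ae mu, forall x, forall q, P q x}.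
Proof.
move=> H; have := @ae_nat _ _ _ mu
  (fun n x => if unpickle n is Some q then P q x else True).
have Hn n : {ae mu, forall x, if unpickle n is Some q then P q x else True}.
  by case: (unpickle n) => [q|]; [exact: H|exact: aeW].
move=> /(_ Hn); apply: aeS => x Px q.
by have := Px (pickle q); rewrite pickleK.
Qed.

(** The exceptional set of times depends on the test function. Only the countable family
    [pbump 0 q n] with [q] rational is tested; in the limit it gives the integrals of [D t] over
    [(0, q)], which determine [D t]. *)
Lemma test1_complete (T : R) (D : R -> R -> R) : M2 D ->
  {ae lebI T, forall t, L1 mX (D t)} ->
  (forall psi, test1 psi -> {ae lebI T, forall t, Int mX (fun x => D t x * psi x) = 0}) ->
  {ae lebI T, forall t, {ae mX, forall x, D t x = 0}}.
Proof.
move=> mD LD H.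
have Hb : {ae lebI T, forall t, forall (q : rat) (n : nat),
    Int mX (fun x => D t x * pbump 0 (ratr q) n x) = 0}.
  apply: ae_rat => q; apply: ae_nat => n; apply: H; exact: pbump_test.
apply: aeS2 LD Hb => t LDt Ht.
apply: prim_eq0_ae => // q /andP[q0 q1].
have mDt : M1 (D t) := L1_meas LDt.
have [] := @L1_dct _ _ _ mX (fun n x => D t x * pbump 0 (ratr q) n x)
    (fun x => when (x < ratr q) (D t x)) (fun x => `|D t x|).
- by move=> n; have ? := test1_M1 (@pbump_test R 0 (ratr q) n); meas.
- by meas.
- exact: L1_abs.
- apply: aeS2 (lebI_in 1) (lebI_neq 1 0) => x x01 x0.
  have x0' : 0 < x by rewrite lt_neqAle eq_sym x0; case/andP: x01.
  rewrite [X in _ --> X](_ : _ = D t x * (0 < x < ratr q)%R%:R); last first.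
    by rewrite /when x0'/=; case: (x < ratr q); rewrite ?mulr1 ?mulr0.
  by apply: cvgMr; apply: pbump_cvg => //; exact: ltW.
- apply: aeW => x n; rewrite normrM ler_piMr//.
  by have /andP[h0 h1] := flat0_bnd (n%:R * (sin (pi * (x - 0)) * sin (pi * (ratr q - x)))); rewrite ger0_norm.
move=> _ c.
have c0 : Int mX (fun x => D t x * pbump 0 (ratr q) n x) @[n --> \oo] --> (0 : R).
  by apply: cvg_near_cst; apply: nearW => n; exact: Ht.
by apply: (@cvg_unique _ (@Rhausdorff R) _ _ _ _ c c0).
Qed.

(** The law integrated in time against a test function of [x] alone. The exceptional times may
    depend on [psi], and likewise in [wdx]. *)
Definition claw (T : R) (q F : R -> R -> R) (q0 : R -> R) := forall psi, test1 psi ->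
  {ae lebI T, forall t, Int mX (fun x => q t x * psi x) =
    Int mX (fun x => q0 x * psi x) +
    prim T (fun s => Int mX (fun x => F s x * derive1 psi x)) t}.

Definition wdx (T : R) (f g : R -> R -> R) := forall psi, test1 psi ->
  {ae lebI T, forall t, Int mX (fun x => f t x * derive1 psi x) =
    - Int mX (fun x => g t x * psi x)}.

(** The antiderivative is normalised to vanish after [b], so that [N t * psi x] is an admissible
    test function although [N 0] does not vanish; its time derivative is a bump. *)
Lemma bump_anti (T a b : R) n : 0 < a -> a < b -> b < T -> exists N,
  [/\ smooth1 N, derive1 N = bump a b n, forall t, b <= t -> N t = 0 &
     forall t, 0 <= t <= T -> N t = N 0 + prim T (bump a b n) t].
Proof.
move=> a0 ab bT; have sb := @bump_smooth R a b n; have mb := smooth_M1 sb.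
have cb := smooth_cont sb.
have [F dF] := antiderivative cb.
have b0 s : b <= s -> bump a b n s = 0.
  move=> bs; rewrite /bump /flat ltNge mulr_ge0_le0// mulr_ge0_le0 ?subr_le0// subr_ge0.
  by rewrite ltW// (lt_le_trans ab bs).
have dN : der (fun t => F t + - F b) (bump a b n).
  by move=> t; apply: (is_derive_eq (derD dF (der_cst (- F b)) t)); rewrite addr0.
exists (fun t => F t + - F b); split.
- exact: smooth_anti dN sb.
- exact: der_derive1 dN.
- move=> t bt.
  have t0 : 0 <= t by lra.
  have E1 : prim t (bump a b n) t = F t - F 0 by apply: FTC => //; rewrite t0 lexx.
  have E2 : prim t (bump a b n) b = F b - F 0.
    by apply: FTC => //; rewrite bt andbT; lra.
  have : prim t (bump a b n) t = prim t (bump a b n) b.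
    apply: Int_eq => s; rewrite /when; have [sb'|sb'] := ltP s b.
      by rewrite (lt_le_trans sb' bt).
    by rewrite b0//; case: ifP.
  by rewrite E1 E2; lra.
- by move=> t tT; rewrite (FTC dF cb tT); ring.
Qed.

Lemma ext_N T (q F : R -> R -> R) (N psi : R -> R) : test1 psi -> smooth1 N ->
  ext T (fun t x => q t x * pdt (fun t x => N t * psi x) t x +
    F t x * pdx (fun t x => N t * psi x) t x) =
  (fun t x => derive1 N t * (ext T q t x * psi x) + N t * (ext T F t x * derive1 psi x)).
Proof.
move=> [sp pp] sN; apply/funext => t; apply/funext => x.
rewrite (pdt_mul psi sN) (pdx_mul N sp) /ext; case: ifP => _; last by ring.
by rewrite (periodic_frac pp) (periodic_frac (derive1_periodic sp pp)); ring.
Qed.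

Lemma LL_time L (f : R -> R -> R) (N : R -> R) : 0 <= L -> smooth1 N ->
  LL (lebI L) mX f -> LL (lebI L) mX (fun t x => N t * f t x).
Proof.
move=> L0 sN Lf; have [C C0 HC] := continuous_bounded L0 (smooth_cont sN).
have mf : M2 f := L1_meas Lf; have mN := smooth_M1 sN.
have LI := (LL_Int1 (LL_abs Lf)).1.
apply: (@LL_iter _ _ _ _ _ (lebI L) mX _ (fun t => C * Int mX (fun x => `|f t x|))).
- by meas.
- apply: aeS2 (LL1 Lf) (lebI_in L) => t Lft /andP[t0 tL]; split; first exact: L1Z.
  rewrite (@Int_eq _ _ _ mX _ (fun x => `|N t| * `|f t x|)); last by move=> x; rewrite normrM.
  rewrite IntZ; last exact: L1_abs.
  by rewrite ler_wpM2r ?Int_ge0// HC// t0 ltW.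
- exact: L1Z.
Qed.

(** Test with [N t * psi x], where [N' = bump]. Writing [N] as [N 0] plus a primitive and
    integrating the flux term by parts in time with [prim_mul] leaves the bump tested against the
    difference of the two sides. Only the product of [F] with [psi'] is assumed integrable, so that
    [psi = 1] can be used before anything is known of [F]. *)
Lemma cons_law_slice T q F q0 psi : 0 < T -> cons_law T q F q0 ->
  LL (lebI T) mX (ext T q) -> L1 mX (ext1 q0) -> test1 psi ->
  LL (lebI T) mX (fun t x => ext T F t x * derive1 psi x) ->
  {ae lebI T, forall t, Int mX (fun x => ext T q t x * psi x) =
    Int mX (fun x => ext1 q0 x * psi x) +
    prim T (fun s => Int mX (fun x => ext T F s x * derive1 psi x)) t}.
Proof.
move=> T0 H Lq Lq0 tp LF; have [sp pp] := tp.
have tp' := test1_derive1 tp.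
pose k t := Int mX (fun x => ext T q t x * psi x).
pose l t := Int mX (fun x => ext T F t x * derive1 psi x).
pose k0 := Int mX (fun x => ext1 q0 x * psi x).
have Lk : L1 (lebI T) k by have [] := LL_Int1 (LL_test tp Lq).
have Ll : L1 (lebI T) l by have [] := LL_Int1 LF.
have mk : M1 k := L1_meas Lk; have ml : M1 l := L1_meas Ll.
have mpl := measurable_prim T ml.
have Lpl : L1 (lebI T) (prim T l).
  by apply: (@L1_bnd _ _ _ (lebI T)) => // t; exact: prim_abs.
suff : {ae lebI T, forall t, k t - (k0 + prim T l t) = 0}.
  by apply: aeS => t /eqP; rewrite subr_eq0 => /eqP.
have LD : L1 (lebI T) (fun t => k t - (k0 + prim T l t)).
  by apply: L1B => //; apply: L1D => //; exact: L1_cst.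
apply: bump_tests_ae => // a b n a0 ab bT.
have [N [sN N' Nb NE]] := bump_anti n a0 ab bT.
pose eta := bump a b n.
have seta : smooth1 eta by exact: bump_smooth.
have meta := smooth_M1 seta; have mN := smooth_M1 sN.
have eta1 t : `|eta t| <= 1.
  by have /andP[h0 h1] := flat0_bnd (n%:R * ((t - a) * (b - t))); rewrite ger0_norm.
have Leta : L1 (lebI T) eta by apply: (@L1_bnd _ _ _ (lebI T)) => //.
have tphi : test_init T (fun t x => N t * psi x).
  split; first exact: (smooth2_mul sN sp).
  split; first by move=> t x; rewrite pp.
  by exists b; split => // t x bt; rewrite Nb// mul0r.
have [i1 [i2 E]] := H _ tphi.
have [_ E1] := @ext_LL _ T (fun t x => q t x * pdt (fun t x => N t * psi x) t x +
    F t x * pdx (fun t x => N t * psi x) t x) T0 i1.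
have [_ E2] := @ext1_L1 _ (fun x => q0 x * (N 0 * psi x)) i2.
rewrite E1 E2 in E; move: E; rewrite -EFinD => -[].
rewrite (ext_N T q F tp sN) N'.
have -> : Int mX (ext1 (fun x => q0 x * (N 0 * psi x))) = N 0 * k0.
  rewrite /k0 -IntZ; last exact: L1_test.
  by apply: Int_eq => x; rewrite /ext1 (periodic_frac pp); ring.
have La : LL (lebI T) mX (fun t x => eta t * (ext T q t x * psi x)).
  by apply: LL_time; [exact: ltW|exact: seta|exact: LL_test].
have Lb : LL (lebI T) mX (fun t x => N t * (ext T F t x * derive1 psi x)).
  by apply: LL_time; [exact: ltW|exact: sN|exact: LF].
have EIa : IInt (lebI T) mX (fun t x => eta t * (ext T q t x * psi x)) =
    Int (lebI T) (fun t => eta t * k t).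
  have [_ <-] := LL_Int1 La; apply: Int_ae.
  - by have [/L1_meas] := LL_Int1 La.
  - by meas.
  by apply: aeS (LL1 (LL_test tp Lq)) => t Lt; rewrite IntZ.
have EIb : IInt (lebI T) mX (fun t x => N t * (ext T F t x * derive1 psi x)) =
    Int (lebI T) (fun t => N t * l t).
  have [_ <-] := LL_Int1 Lb; apply: Int_ae.
  - by have [/L1_meas] := LL_Int1 Lb.
  - by meas.
  by apply: aeS (LL1 LF) => t Lt; rewrite IntZ.
have -> : IInt (lebI T) mX (fun t x => eta t * (ext T q t x * psi x) +
    N t * (ext T F t x * derive1 psi x)) = Int (lebI T) (fun t => eta t * k t) +
    Int (lebI T) (fun t => N t * l t) by rewrite -EIa -EIb; exact: (IntD La Lb).
have NT : prim T eta T = - N 0.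
  by have := NE T; rewrite (ltW T0) lexx Nb ?ltW// => /(_ isT); rewrite -/eta; lra.
have NlE : Int (lebI T) (fun t => N t * l t) =
    Int (lebI T) (fun t => N 0 * l t + l t * prim T eta t).
  apply: Int_ae; [by meas|by have ? := measurable_prim T meta; meas|].
  apply: aeS (lebI_in T) => t /andP[t0 tT]; rewrite NE ?t0 ?ltW// -/eta; ring.
have Lle := L1_mul_prim Ll Leta; have Lel := L1_mul_prim Leta Ll.
have P := prim_mul T Ll Leta.
rewrite (prim_ge ml (lexx T)) (prim_ge meta (lexx T)) in P.
rewrite (prim_ge (L1_meas (L1D Lle Lel)) (lexx T)) (IntD Lle Lel) in P.
rewrite (prim_ge meta (lexx T)) in NT.
rewrite NlE (IntD (L1Z (N 0) Ll) Lle) (IntZ (N 0) Ll) => E.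
rewrite (@Int_eq _ _ _ (lebI T) _ (fun t => eta t * k t - (k0 * eta t + eta t * prim T l t))); last first.
  by move=> t; rewrite -/eta; ring.
have Lek : L1 (lebI T) (fun t => eta t * k t) by exact: (L1M meta eta1 Lk).
rewrite (IntB Lek (L1D (L1Z k0 Leta) Lel)) (IntD (L1Z k0 Leta) Lel) (IntZ k0 Leta).
rewrite NT in P *; move: E P.
move: (Int (lebI T) (fun t => eta t * k t)) (Int (lebI T) l)
  (Int (lebI T) (fun t => eta t * prim T l t))
  (Int (lebI T) (fun t => l t * prim T eta t)) (N 0) => x1 x2 x3 x4 x5.
by clearbody k0; clear; move: k0 => x6 E P; lra.
Qed.

Lemma cons_law_claw T q F q0 : 0 < T -> cons_law T q F q0 ->
  LL (lebI T) mX (ext T q) -> LL (lebI T) mX (ext T F) -> L1 mX (ext1 q0) ->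
  claw T (ext T q) (ext T F) (ext1 q0).
Proof.
move=> T0 H Lq LF Lq0 psi tp; apply: cons_law_slice => //.
exact: LL_test (test1_derive1 tp) LF.
Qed.

Lemma weak_dx_wdx T f g : 0 < T -> weak_dx T f g ->
  LL (lebI T) mX (ext T f) -> LL (lebI T) mX (ext T g) -> wdx T (ext T f) (ext T g).
Proof.
move=> T0 H Lf Lg psi tp; have [sp pp] := tp; have tp' := test1_derive1 tp.
pose k t := Int mX (fun x => ext T f t x * derive1 psi x).
pose l t := Int mX (fun x => ext T g t x * psi x).
have Lk : L1 (lebI T) k by have [] := LL_Int1 (LL_test tp' Lf).
have Ll : L1 (lebI T) l by have [] := LL_Int1 (LL_test tp Lg).
suff : {ae lebI T, forall t, k t + l t = 0}.
  by apply: aeS => t /eqP; rewrite addr_eq0 => /eqP.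
apply: bump_tests_ae; first exact: L1D.
move=> a b n a0 ab bT; pose eta := bump a b n.
have seta : smooth1 eta by exact: bump_smooth.
have meta := smooth_M1 seta.
have eta1 t : `|eta t| <= 1.
  by have /andP[h0 h1] := flat0_bnd (n%:R * ((t - a) * (b - t))); rewrite ger0_norm.
have z0 t : (t - a) * (b - t) <= 0 -> eta t = 0.
  by move=> h; rewrite /eta /bump /flat ltNge mulr_ge0_le0.
have tphi : test_int T (fun t x => eta t * psi x).
  split; first exact: (smooth2_mul seta sp).
  split; first by move=> t x; rewrite pp.
  exists a, b; split => //; split => // t x [ta|bt]; rewrite z0 ?mul0r//.
    by rewrite mulr_le0_ge0 ?subr_le0// subr_ge0; lra.
  by rewrite mulr_ge0_le0 ?subr_le0// subr_ge0; lra.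
have [i1 [i2 E]] := H _ tphi.
have [_ E1] := @ext_LL _ T (fun t x => f t x * pdx (fun t x => eta t * psi x) t x) T0 i1.
have [_ E2] := @ext_LL _ T (fun t x => g t x * (eta t * psi x)) T0 i2.
rewrite E1 E2 -EFinN in E; move: E => -[].
have -> : ext T (fun t x => f t x * pdx (fun t x => eta t * psi x) t x) =
    fun t x => eta t * (ext T f t x * derive1 psi x).
  apply/funext => t; apply/funext => x; rewrite (pdx_mul eta sp) /ext.
  by case: ifP => _; [rewrite (periodic_frac (derive1_periodic sp pp))|]; ring.
have -> : ext T (fun t x => g t x * (eta t * psi x)) =
    fun t x => eta t * (ext T g t x * psi x).
  apply/funext => t; apply/funext => x; rewrite /ext.
  by case: ifP => _; [rewrite (periodic_frac pp)|]; ring.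
have La : LL (lebI T) mX (fun t x => eta t * (ext T f t x * derive1 psi x)).
  by apply: LL_time; [exact: ltW|exact: seta|exact: LL_test].
have Lb : LL (lebI T) mX (fun t x => eta t * (ext T g t x * psi x)).
  by apply: LL_time; [exact: ltW|exact: seta|exact: LL_test].
have mk : M1 k := L1_meas Lk; have ml : M1 l := L1_meas Ll.
have [_ <-] := LL_Int1 La; have [_ <-] := LL_Int1 Lb.
have -> : Int (lebI T) (fun t => Int mX (fun x => eta t * (ext T f t x * derive1 psi x))) =
    Int (lebI T) (fun t => eta t * k t).
  apply: Int_ae; [by have [/L1_meas] := LL_Int1 La|by meas|].
  by apply: aeS (LL1 (LL_test tp' Lf)) => t Lt; rewrite IntZ.
have -> : Int (lebI T) (fun t => Int mX (fun x => eta t * (ext T g t x * psi x))) =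
    Int (lebI T) (fun t => eta t * l t).
  apply: Int_ae; [by have [/L1_meas] := LL_Int1 Lb|by meas|].
  by apply: aeS (LL1 (LL_test tp Lg)) => t Lt; rewrite IntZ.
move=> E; rewrite (@Int_eq _ _ _ (lebI T) _ (fun t => eta t * k t + eta t * l t)); last first.
  by move=> t; rewrite mulrDr.
rewrite IntD ?E ?addNr//; first exact: (L1M meta eta1 Lk).
exact: (L1M meta eta1 Ll).
Qed.

End weak_slices.

(** * Weak derivatives as primitives *)

Section primitives.
Context (R : realType).
Local Notation RR := (measurableTypeR R).
Local Notation mX := (@lebI R 1).
Implicit Types (T : R).

Lemma ibp0 (a b : R -> R) : L1 mX a -> L1 mX b -> Int mX a = 0 ->
  Int mX (fun x => a x * prim 1 b x) = - Int mX (fun x => b x * prim 1 a x).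
Proof.
move=> La Lb Ia; have P := prim_mul 1 La Lb.
have L1ab := L1_mul_prim La Lb; have L1ba := L1_mul_prim Lb La.
rewrite (prim_ge (L1_meas La) (lexx 1)) Ia mul0r in P.
rewrite (prim_ge (L1_meas (L1D L1ab L1ba)) (lexx 1)) (IntD L1ab L1ba) in P.
by apply/eqP; rewrite -addr_eq0 -P.
Qed.

Lemma ibp_test (b psi : R -> R) : L1 mX b -> test1 psi ->
  Int mX (fun x => prim 1 b x * derive1 psi x) =
  psi 0 * Int mX b - Int mX (fun x => b x * psi x).
Proof.
move=> Lb tp; have [sp pp] := tp; have tp' := test1_derive1 tp.
have [C C0 HC] := test1_bounded tp'; have mp' : M1 (derive1 psi) := test1_M1 tp'.
have Lp' : L1 mX (derive1 psi) := L1_bnd _ mp' HC.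
have cp' : continuous (derive1 psi) by case: tp' => s _; exact: smooth_cont.
have E x : 0 <= x <= 1 -> psi x = psi 0 + prim 1 (derive1 psi) x.
  by move=> x01; rewrite (FTC (smooth_der sp) cp' x01); ring.
have I0 : Int mX (derive1 psi) = 0.
  rewrite -(prim_ge mp' (lexx 1)); have := E 1; rewrite ler01 lexx => /(_ isT).
  by have := pp 0; rewrite add0r => ->; lra.
have := ibp0 Lp' Lb I0.
rewrite (@Int_eq _ _ _ mX _ (fun x => prim 1 b x * derive1 psi x)); last first.
  by move=> x; rewrite mulrC.
move=> ->; have mb : M1 b := L1_meas Lb; have mp := test1_M1 tp.
have mpp := measurable_prim 1 mp'.
rewrite (_ : Int mX (fun x => b x * psi x) =
    Int mX (fun x => psi 0 * b x + b x * prim 1 (derive1 psi) x)); last first.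
  apply: Int_ae; [by meas|by meas|].
  by apply: aeS (lebI_in 1) => x /andP[x0 x1]; rewrite E ?x0 ?ltW//; ring.
rewrite (IntD (L1Z _ Lb) (L1_mul_prim Lb Lp')) (IntZ _ Lb); ring.
Qed.

(** The constant of integration: if [A t] is a constant plus [prim 1 (B t)], comparing means over
    the circle shows that the constant is this one. *)
Definition kap (A B : R -> R -> R) (t : R) := Int mX (A t) - Int mX (prim 1 (B t)).

Lemma M2_primx (B : R -> R -> R) : M2 B -> M2 (fun t x => prim 1 (B t) x).
Proof.
move=> mB; apply: (@measurable_prim2 R _ (RR * RR)%type 1 (fun z => B z.1) (fun z => z.2)).
  by meas.
exact: measurable_snd.
Qed.

Lemma M2_primt T (F : R -> R -> R) : M2 F -> M2 (fun t x => prim T (F^~ x) t).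
Proof.
move=> mF.
apply: (@measurable_prim2 R _ (RR * RR)%type T (fun z s => F s z.2) (fun z => z.1)).
  by meas.
exact: measurable_fst.
Qed.

Lemma M1_kap A B : M2 A -> M2 B -> M1 (kap A B).
Proof. by move=> mA mB; have ? := M2_primx mB; rewrite /kap; meas. Qed.

Lemma L1_primx (b : R -> R) : L1 mX b -> L1 mX (prim 1 b).
Proof.
move=> Lb; apply: (@L1_bnd _ _ _ mX _ (Int mX (fun x => `|b x|))).
  by apply: measurable_prim; exact: L1_meas Lb.
by move=> x; exact: prim_abs.
Qed.

(** The lemma of du Bois-Reymond. Testing with [1] gives [B t] mean zero; then [A - prim B] is
    orthogonal to every derivative of a test function, that is by [mean_zero_primitive] to every
    test function of mean zero, hence it is constant in [x]. *)
Lemma wdx_prim T A B : LL (lebI T) mX A -> LL (lebI T) mX B -> wdx T A B ->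
  {ae lebI T, forall t, Int mX (B t) = 0 /\
    {ae mX, forall x, A t x = kap A B t + prim 1 (B t) x}}.
Proof.
move=> LA LB H; have mA : M2 A := L1_meas LA; have mB : M2 B := L1_meas LB.
have mP := M2_primx mB; have mk := M1_kap mA mB.
have B0 : {ae lebI T, forall t, Int mX (B t) = 0}.
  apply: aeS (H _ (test1_cst 1)) => t.
  rewrite (der_derive1 (der_cst 1)).
  rewrite (@Int_eq _ _ _ mX _ (fun=> 0)); last by move=> x; rewrite mulr0.
  rewrite Int0 (@Int_eq _ _ _ mX _ (B t)); last by move=> x; rewrite mulr1.
  by move=> /esym/eqP; rewrite oppr_eq0 => /eqP.
have key psi : test1 psi -> {ae lebI T, forall t, L1 mX (A t) /\ L1 mX (B t) /\
    Int mX (fun x => (A t x - prim 1 (B t) x) * derive1 psi x) = 0}.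
  move=> tp; have tp' := test1_derive1 tp.
  have LAB : {ae lebI T, forall t, L1 mX (A t) /\ L1 mX (B t)}.
    by apply: aeS2 (LL1 LA) (LL1 LB) => t.
  apply: aeS3 (H _ tp) B0 LAB => t Ht Bt [LAt LBt]; split => //; split => //.
  have Lp := L1_primx LBt.
  rewrite (@Int_eq _ _ _ mX _ (fun x => A t x * derive1 psi x - prim 1 (B t) x * derive1 psi x)); last first.
    by move=> x; rewrite mulrBl.
  rewrite (IntB (L1_test tp' LAt) (L1_test tp' Lp)) Ht (ibp_test LBt tp) Bt; ring.
suff D0 : {ae lebI T, forall t, {ae mX, forall x, A t x - kap A B t - prim 1 (B t) x = 0}}.
  apply: aeS2 B0 D0 => t Bt Dt; split => //; apply: aeS Dt => x; lra.
apply: test1_complete; first by meas.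
  apply: aeS2 (LL1 LA) (LL1 LB) => t LAt LBt.
  by apply: L1B; [apply: L1B => //; exact: L1_cst|exact: L1_primx].
move=> psi tp; have [Psi tP PE] := mean_zero_primitive tp.
apply: aeS (key _ tP) => t [LAt [LBt]]; rewrite PE => E.
have Lp := L1_primx LBt; have LD := L1B LAt Lp.
have [C C0 HC] := test1_bounded tp; have Lpsi : L1 mX psi := L1_bnd _ (test1_M1 tp) HC.
move: E; rewrite (@Int_eq _ _ _ mX _ (fun x => (A t x - prim 1 (B t) x) * psi x -
  Int mX psi * (A t x - prim 1 (B t) x))); last by move=> x; ring.
rewrite (IntB (L1_test tp LD) (L1Z _ LD)) (IntZ _ LD) (IntB LAt Lp) -/(kap A B t) => E.
rewrite (@Int_eq _ _ _ mX _ (fun x => (A t x - prim 1 (B t) x) * psi x -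
  kap A B t * psi x)); last by move=> x; ring.
rewrite (IntB (L1_test tp LD) (L1Z _ Lpsi)) (IntZ _ Lpsi); lra.
Qed.

Lemma LL_primt T F : LL (lebI T) mX F -> LL (lebI T) mX (fun t x => prim T (F^~ x) t).
Proof.
move=> LF; have mF : M2 F := L1_meas LF; have mP := M2_primt T mF.
apply: LL_swap; have LI := (LL_Int1 (LL_swap (LL_abs LF))).1.
apply: (@LL_iter _ _ _ _ _ mX (lebI T) _
  (fun x => Int (lebI T) (fun s => `|F s x|) * fine (lebI T setT))).
- by meas.
- apply: aeS (LL2 LF) => x LFx; split.
    apply: (@L1_bnd _ _ _ (lebI T) _ (Int (lebI T) (fun s => `|F s x|))).
      by apply: measurable_prim; exact: L1_meas LFx.
    by move=> t; exact: prim_abs.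
  rewrite -Int_cst; apply: Int_le => [||t]; [|exact: L1_cst|exact: prim_abs].
  apply: L1_abs; apply: (@L1_bnd _ _ _ (lebI T) _ (Int (lebI T) (fun s => `|F s x|))).
    by apply: measurable_prim; exact: L1_meas LFx.
  by move=> t; exact: prim_abs.
- rewrite (_ : (fun x => _) = fun x => fine (lebI T setT) * Int (lebI T) (fun s => `|F s x|)).
    exact: L1Z.
  by apply/funext => x; rewrite mulrC.
Qed.

Lemma Int_primt T F t : LL (lebI T) mX F ->
  Int mX (fun x => prim T (F^~ x) t) = prim T (fun s => Int mX (F s)) t.
Proof.
move=> LF; have mF : M2 F := L1_meas LF.
have Lw : LL (lebI T) mX (fun s x => when (s < t) (F s x)).
  apply: (@LL_le _ _ _ _ _ _ _ _ (fun s x => `|F s x|)).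
  - by meas.
  - exact: LL_abs.
  - by move=> s x; rewrite /when; case: ifP; rewrite ?normr0.
rewrite /prim -(Int_swap Lw); apply: Int_eq => s.
by rewrite /when; case: (s < t) => //; rewrite Int0.
Qed.

(** The law read at a fixed time: [q t - q0] is the space derivative of [- int_0^t F]. Together with
    [wdx_prim] it becomes a pointwise formula, obtained without regularising. *)
Lemma claw_wdx T q F q0 : LL (lebI T) mX q -> LL (lebI T) mX F -> L1 mX q0 ->
  claw T q F q0 -> wdx T (fun t x => - prim T (F^~ x) t) (fun t x => q t x - q0 x).
Proof.
move=> Lq LF Lq0 H psi tp; have tp' := test1_derive1 tp.
have LFp := LL_test tp' LF.
apply: aeS3 (H _ tp) (LL1 Lq) (LL1 (LL_primt LF)) => t Ht Lqt Lpt.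
rewrite (@Int_eq _ _ _ mX _ (fun x => - (prim T (F^~ x) t * derive1 psi x))); last first.
  by move=> x; rewrite mulNr.
rewrite (IntN (L1_test tp' Lpt)); congr (- _).
rewrite (@Int_eq _ _ _ mX (fun x => (q t x - q0 x) * psi x)
  (fun x => q t x * psi x - q0 x * psi x)); last by move=> x; rewrite mulrBl.
rewrite (IntB (L1_test tp Lqt) (L1_test tp Lq0)) Ht addrAC subrr add0r.
rewrite -(Int_primt t LFp); apply: Int_ae.
- by apply: L1_meas; exact: (L1_test tp' Lpt).
- have mF : M2 F := L1_meas LF; have mp' : M1 (derive1 psi) := test1_M1 tp'.
  by meas.
apply: aeS (LL2 LF) => x LFx.
rewrite mulrC -primZ//; congr (prim T _ t); apply/funext => s; ring.
Qed.

(** Step lengths of difference quotients; the offset [2] keeps them strictly below one period. *)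
Definition hn (n : nat) : R := n.+2%:R^-1.

Lemma hn_itv n : 0 < hn n < 1.
Proof. by rewrite /hn invr_gt0 ltr0n /= invf_lt1 ?ltr0n// ltr1n. Qed.

Lemma hn_cvg : hn @ \oo --> (0 : R).
Proof.
have := @cvg_harmonic R; rewrite -(cvg_shiftn 1); apply: cvg_trans.
by apply: near_eq_cvg; apply: nearW => n; rewrite /hn /harmonic/= addn1.
Qed.

Lemma fracB1 (x : R) : 1 <= x < 2 -> frac x = x - 1.
Proof.
by move=> /andP[x1 x2]; rewrite -[x in LHS](subrK 1) fracD1 fracE//; apply/andP; split; lra.
Qed.

Lemma fracN (x : R) : -1 <= x < 0 -> frac x = x + 1.
Proof. by move=> /andP[x1 x2]; rewrite -fracD1 fracE//; apply/andP; split; lra. Qed.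

(** As [b] has mean zero, its primitive takes the same value at [0] and at [1]; a step that wraps
    around is split at the seam and obeys the same Lipschitz bound. *)
Lemma steklov_bnd (b : R -> R) K h (x : R) : M1 b -> (forall x, `|b x| <= K) ->
  Int mX b = 0 -> -1 < h < 1 -> 0 <= x < 1 ->
  `|prim 1 b (frac (x + h)) - prim 1 b x| <= K * `|h|.
Proof.
move=> mb bK I0 /andP[h1 h2] /andP[x0 x1].
have lip u v : `|prim 1 b u - prim 1 b v| <= K * `|u - v|.
  have [uv|uv] := leP u v.
    by rewrite distrC [`|u - v|]distrC (ger0_norm (_ : 0 <= v - u)) ?subr_ge0// prim_lip.
  by rewrite (gtr0_norm (_ : 0 < u - v)) ?subr_gt0// prim_lip// ltW.
have P0 : prim 1 b 0 = 0 by exact: prim_le0.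
have P1 : prim 1 b 1 = 0 by rewrite prim_ge.
have [xh|xh] := ltP (x + h) 0.
  rewrite fracN; last by apply/andP; split; lra.
  have -> : prim 1 b (x + h + 1) - prim 1 b x =
    (prim 1 b (x + h + 1) - prim 1 b 1) + (prim 1 b 0 - prim 1 b x) by rewrite P0 P1; ring.
  apply: le_trans (ler_normD _ _) _; apply: le_trans (lerD (lip _ _) (lip _ _)) _.
  rewrite -mulrDr; have K0 : 0 <= K by exact: le_trans (bK 0).
  apply: ler_wpM2l => //; rewrite (ltr0_norm (_ : h < 0)); last by lra.
  by rewrite !ler0_norm; lra.
have [xh1|xh1] := ltP (x + h) 1.
  rewrite fracE; last by apply/andP; split; lra.
  by apply: le_trans (lip _ _) _; rewrite addrAC subrr add0r.
rewrite fracB1; last by apply/andP; split; lra.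
have -> : prim 1 b (x + h - 1) - prim 1 b x =
  (prim 1 b (x + h - 1) - prim 1 b 0) + (prim 1 b 1 - prim 1 b x) by rewrite P0 P1; ring.
apply: le_trans (ler_normD _ _) _; apply: le_trans (lerD (lip _ _) (lip _ _)) _.
rewrite -mulrDr; have K0 : 0 <= K by exact: le_trans (bK 0).
apply: ler_wpM2l => //; rewrite (gtr0_norm (_ : 0 < h)); last by lra.
by rewrite !ger0_norm; lra.
Qed.

(** The factor [s] covers forward and backward quotients. At an interior point small steps do not
    wrap, and the Lebesgue differentiation theorem applies. *)
Lemma steklov_cvg (b : R -> R) (s : R) : L1 mX b -> s != 0 ->
  {ae mX, forall x, (prim 1 b (frac (x + s * hn n)) - prim 1 b x) / (s * hn n)
    @[n --> \oo] --> b x}.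
Proof.
move=> Lb s0.
apply: aeS3 (prim_is_derive Lb) (lebI_in 1) (lebI_neq 1 0) => x dx /andP[x0 x1] xn0.
have {xn0}x0 : 0 < x by rewrite lt_neqAle eq_sym xn0 x0.
have h0 : (s * hn n) @[n --> \oo] --> (0 : R).
  by rewrite -(mulr0 s); apply: cvgMr; exact: hn_cvg.
have hN n : s * hn n != 0.
  by rewrite mulf_neq0//; have /andP[h _] := hn_itv n; rewrite gt_eqF.
have := is_derive_seq dx h0 hN; apply: cvg_trans; apply: near_eq_cvg.
have xh : x + s * hn n @[n --> \oo] --> x + 0 by apply: cvgD => //; exact: cvg_cst.
rewrite addr0 in xh.
have A1 : \forall n \near \oo, x + s * hn n < 1 by exact: (cvgr_lt x xh _ x1).
have A2 : \forall n \near \oo, 0 < x + s * hn n by exact: (cvgr_gt x xh _ x0).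
near=> n; rewrite fracE//; apply/andP; split; last by near: n.
by apply: ltW; near: n.
Unshelve. all: by end_near. Qed.

End primitives.

(** * Change of variables on the circle *)

Section test_functions_taylor.
Context (R : realType).

Lemma mean_value (f f' : R -> R) (C : R) : der f f' -> (forall x, `|f' x| <= C) ->
  forall x y, `|f x - f y| <= C * `|x - y|.
Proof.
move=> df f'C.
have H x y : x <= y -> `|f x - f y| <= C * `|x - y|.
  move=> xy; have [c _ E] := @MVT_segment R f f' x y xy (fun z _ => df z)
    (continuous_subspaceT (der_continuous df)).
  by rewrite distrC E normrM [`|x - y|]distrC ler_wpM2r.
move=> x y; have [/H//|/ltW/H] := leP x y.
by rewrite distrC [`|y - x|]distrC.
Qed.

Lemma test1_taylor (g : R -> R) : test1 g -> exists2 C, 0 <= C &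
  [/\ (forall x, `|g x| <= C), (forall x, `|derive1 g x| <= C),
      (forall x y, `|derive1 g x - derive1 g y| <= C * `|x - y|) &
      (forall x y, `|g x - g y - derive1 g y * (x - y)| <= C * (x - y) ^+ 2)].
Proof.
move=> tg; have tg' := test1_derive1 tg; have tg'' := test1_derive1 tg'.
have [C0 C00 H0] := test1_bounded tg.
have [C1 C10 H1] := test1_bounded tg'; have [C2 C20 H2] := test1_bounded tg''.
have [sg _] := tg; have [sg' _] := tg'.
have C012 : C0 <= C0 + C1 + C2 by rewrite -addrA lerDl addr_ge0.
have C112 : C1 <= C0 + C1 + C2 by rewrite addrAC lerDr addr_ge0.
have C212 : C2 <= C0 + C1 + C2 by rewrite lerDr addr_ge0.
have L2 x y : `|derive1 g x - derive1 g y| <= (C0 + C1 + C2) * `|x - y|.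
  apply: le_trans (mean_value (smooth_der sg') H2 x y) _.
  by rewrite ler_wpM2r.
exists (C0 + C1 + C2); first by rewrite !addr_ge0.
split=> //.
- by move=> x; exact: le_trans (H0 x) C012.
- by move=> x; exact: le_trans (H1 x) C112.
move=> x y.
have dg : der (fun z => g z + (- derive1 g y) * z) (fun z => derive1 g z - derive1 g y).
  move=> z; apply: (is_derive_eq (derD (smooth_der sg)
    (derM (der_cst (- derive1 g y)) (@der_id R)) z)).
  by rewrite mul0r add0r mulr1.
have MV u v w : u <= v -> (u = x /\ v = y \/ u = y /\ v = x) -> u < w < v ->
    `|derive1 g w - derive1 g y| <= (C0 + C1 + C2) * `|x - y|.
  move=> uv E /andP[uw wv]; apply: le_trans (L2 w y) _; rewrite ler_wpM2l ?addr_ge0//.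
  case: E => -[E1 E2]; rewrite E1 in uw; rewrite E2 in wv.
    by rewrite !ltr0_norm; lra.
  by rewrite !gtr0_norm; lra.
have sq : (C0 + C1 + C2) * (x - y) ^+ 2 = ((C0 + C1 + C2) * `|x - y|) * `|x - y|.
  by rewrite -mulrA -expr2 real_normK// num_real.
have E : g x - g y - derive1 g y * (x - y) =
  (g x + (- derive1 g y) * x) - (g y + (- derive1 g y) * y) by ring.
have cG := continuous_subspaceT (der_continuous dg).
have [xy|yx|->] := ltgtP x y; last by rewrite !subrr mulr0 subrr normr0 expr0n mulr0.
- have [c] := @MVT R _ _ x y xy (fun z _ => dg z) (cG _).
  rewrite in_itv/= => cxy Ec; rewrite E distrC Ec sq normrM distrC [`|y - x|]distrC.
  by rewrite ler_wpM2r// distrC; apply: (MV x y c (ltW xy)) => //; left.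
- have [c] := @MVT R _ _ y x yx (fun z _ => dg z) (cG _).
  rewrite in_itv/= => cxy Ec; rewrite E Ec sq normrM.
  by rewrite ler_wpM2r//; apply: (MV y x c (ltW yx)) => //; right.
Qed.

End test_functions_taylor.

Section circle.
Context (R : realType).
Local Notation RR := (measurableTypeR R).
Local Notation mX := (@lebI R 1).
Variables (b : R -> R) (k Jl Jh : R).
Hypotheses (mb : M1 b) (Jl0 : 0 < Jl) (bJ : forall x, Jl <= b x <= Jh) (Ib : Int mX b = 1).

(** As [b] has integral one, this map gains exactly [1] over a period and so descends to a bijection
    of the circle, with Jacobian [b]. *)
Let mm x := k + prim 1 b x.
Let Y x := frac (mm x).

Let b0 x : 0 < b x. Proof. by have /andP[+ _] := bJ x; exact: lt_le_trans. Qed.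
Let Jh0 : 0 < Jh. Proof. by have /andP[_] := bJ 0; exact: lt_le_trans. Qed.
Let bh x : `|b x| <= Jh.
Proof. by rewrite gtr0_norm//; have /andP[] := bJ x. Qed.
Let Lb : L1 mX b := L1_bnd _ mb bh.
Let mmm : M1 mm. Proof. by rewrite /mm; meas. Qed.
Let mY : M1 Y. Proof. by have ? := @M1_frac R; rewrite /Y; meas. Qed.

Lemma circle_chain g : test1 g -> forall x,
  g (mm x) = g k + prim 1 (fun x => derive1 g (mm x) * b x) x.
Proof.
move=> tg x; have [C C0 [_ H1 H2 H3]] := test1_taylor tg.
exact: (@prim_chain R 1 b Jh g (derive1 g) C k mb bh (test1_M1 (test1_derive1 tg)) H1 H2 H3 x).
Qed.

(** Up to its mean, [g] is the derivative of a periodic [G], and [G (mm x)] returns to its value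
    after one period. *)
Lemma circle_change_test g : test1 g -> Int mX (fun x => g (mm x) * b x) = Int mX g.
Proof.
move=> tg; have [G tG GE] := mean_zero_primitive tg.
have := circle_chain tG 1; rewrite GE /mm (prim_ge mb (lexx 1)) Ib.
have [C C0 HC] := test1_bounded tg; have mg := test1_M1 tg.
rewrite prim_ge; [|by meas|exact: lexx].
case: tG => _ ->; have Lgb : L1 mX (fun x => g (mm x) * b x).
  by apply: (@L1M _ _ _ mX _ _ C) => //; meas.
rewrite (@Int_eq _ _ _ mX _ (fun x => g (mm x) * b x - Int mX g * b x)); last first.
  by move=> x; rewrite /mm; ring.
rewrite (IntB Lgb (L1Z _ Lb)) (IntZ _ Lb) Ib mulr1 => E; lra.
Qed.

Let Y01 x : 0 <= Y x < 1. Proof. exact: frac_itv. Qed.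

Let indicM (W w : R -> R) a c : (fun x => (a < W x < c)%R%:R * w x) =
  (fun x => when (a < W x) (when (W x < c) (w x))).
Proof.
apply/funext => x; rewrite /when.
by case: (a < W x); case: (W x < c) => /=; rewrite ?mul1r ?mul0r.
Qed.

Let lim a c (W w : R -> R) K : 0 <= a -> a < c -> c <= 1 ->
  M1 W -> M1 w -> (forall x, `|w x| <= K) -> {ae mX, forall x, 0 <= W x < 1} ->
  Int mX (fun x => pbump a c n (W x) * w x) @[n --> \oo] -->
  Int mX (fun x => (a < W x < c)%R%:R * w x).
Proof.
move=> a0 ac c1 mW mw wK W01.
have [] := @L1_dct _ _ _ mX (fun n x => pbump a c n (W x) * w x)
  (fun x => (a < W x < c)%R%:R * w x) (fun=> K); last by move=> _ cI; exact: cI.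
- by move=> n; have ? := test1_M1 (@pbump_test R a c n); meas.
- by rewrite indicM; meas.
- exact: L1_cst.
- by apply: aeS W01 => x W01; apply: cvgMl; exact: pbump_cvg.
- apply: aeW => x n; rewrite normrM -[K]mul1r ler_pM//.
  by have /andP[h0 h1] := flat0_bnd (n%:R * (sin (pi * (W x - a)) * sin (pi * (c - W x)))); rewrite ger0_norm.
Qed.

Let cdf_id (L x : R) : 0 <= x <= L -> prim L (fun=> 1) x = x.
Proof.
move=> xL; rewrite (FTC (@der_id R) _ xL) ?subr0//.
by move=> y; exact: cvg_cst.
Qed.

(** The formula for the test functions [pbump a c n] passes to the limit on both sides. *)
Let open_itv (a c : R) : 0 <= a -> a < c -> c <= 1 ->
  Int mX (fun x => (a < Y x < c)%R%:R * b x) = c - a.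
Proof.
move=> a0 ac c1.
have aY : {ae mX, forall x, 0 <= Y x < 1} by apply: aeW.
have c1' := lim a0 ac c1 mY mb bh aY.
have n1 (x : R) : `|1 : R| <= 1 by rewrite normr1.
have c2' := lim a0 ac c1 (@measurable_id _ RR setT) (@measurable_cst _ _ RR R setT 1) n1 (lebI_in 1).
have E : Int mX (fun x => (a < x < c)%R%:R * 1) = c - a.
  have Ec : prim 1 (fun=> 1) c = c by apply: cdf_id; rewrite c1 andbT (le_trans a0)// ltW.
  have Ea : prim 1 (fun=> 1) a = a by apply: cdf_id; rewrite a0 (le_trans (ltW ac) c1).
  rewrite (indicM id (fun=> 1)) -[in RHS]Ec -[in RHS]Ea prim_sub; [|exact: L1_cst|exact: ltW].
  by apply: Int_eq => x; rewrite /when /=; case: (a < x); case: (x < c).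
rewrite -E; apply: (@cvg_unique _ (@Rhausdorff R) _ _ _ _ c1').
move: c2'; apply: cvg_trans; apply: near_eq_cvg; apply: nearW => n.
have tp := @pbump_test R a c n; have [_ pp] := tp.
rewrite (@Int_eq _ _ _ mX _ (pbump a c n)); last by move=> x; rewrite mulr1.
by rewrite -(circle_change_test tp); apply: Int_eq => x; rewrite /Y (periodic_frac pp).
Qed.

Let L1i (a c : R) : L1 mX (fun x => (a < Y x < c)%R%:R * b x).
Proof.
rewrite indicM; apply: (@L1_bnd _ _ _ mX _ Jh); first by meas.
by move=> x; rewrite /when; case: ifP => _; [case: ifP => _|]; rewrite ?normr0// ltW.
Qed.

(** The open intervals [(0, c)] and [(c, 1)] already carry total mass one, so nothing remains for
    the points [0] and [c]. *)
Let atom (c : R) : 0 < c -> c < 1 -> {ae mX, forall x, Y x != 0 /\ Y x != c}.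
Proof.
move=> c0 c1.
pose r x := b x - ((0 < Y x < c)%R%:R * b x + (c < Y x < 1)%R%:R * b x).
have rE x : r x = if (Y x == 0) || (Y x == c) then b x else 0.
  rewrite /r; have /andP[y0 y1] := Y01 x; rewrite y1 andbT.
  have [->|yn] := eqVneq (Y x) 0; first by rewrite ltxx/= ltNge (ltW c0)/= !mul0r addr0 subr0.
  rewrite /= lt_neqAle eq_sym yn y0 /=.
  by case: ltgtP => _; rewrite ?mul1r ?mul0r ?addr0 ?add0r ?subrr ?subr0.
have Lr : L1 mX r := L1B Lb (L1D (L1i 0 c) (L1i c 1)).
have r0 x : 0 <= r x by rewrite rE; case: ifP => // _; exact: ltW.
have := Int_eq0_ae Lr r0.
rewrite /r (IntB Lb (L1D (L1i 0 c) (L1i c 1))) (IntD (L1i 0 c) (L1i c 1)) Ib.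
rewrite open_itv//; last exact: ltW.
rewrite open_itv//; last exact: ltW.
rewrite (_ : 1 - (c - 0 + (1 - c)) <= 0); last by apply/idP; lra.
move=> /(_ isT); apply: aeS => x; rewrite -/(r x) rE.
case: (eqVneq (Y x) 0) => [_|_] /=; first by move=> /eqP; rewrite gt_eqF.
by case: (eqVneq (Y x) c) => [_|_] //= /eqP; rewrite gt_eqF.
Qed.

Let cdf (c : R) : Int mX (fun x => when (Y x < c) (b x)) = prim 1 (fun=> 1) c.
Proof.
have [c0|c0] := leP c 0.
  rewrite prim_le0//; last exact: measurable_cst.
  rewrite (@Int_eq _ _ _ mX _ (fun=> 0)) ?Int0// => x.
  by rewrite /when ltNge (le_trans c0)//; case/andP: (Y01 x).
have [c1|c1] := leP 1 c.
  rewrite prim_ge//; last exact: measurable_cst.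
  rewrite (Int_lebI_cst _ ler01) mulr1 -[RHS]Ib; apply: Int_eq => x.
  by rewrite /when (lt_le_trans _ c1)//; case/andP: (Y01 x).
rewrite cdf_id; last by rewrite (ltW c0) (ltW c1).
rewrite -[RHS]subr0 -(open_itv (lexx 0) c0 (ltW c1)).
apply: Int_ae; [by meas|by rewrite indicM; meas|].
apply: aeS (atom c0 c1) => x [x0 _]; rewrite /when.
have -> : 0 < Y x by rewrite lt_neqAle eq_sym x0; have /andP[-> _] := Y01 x.
by case: (Y x < c); rewrite ?mul1r ?mul0r.
Qed.

Let neq_ae (c : R) : {ae mX, forall x, Y x != c}.
Proof.
have [c0|c0] := ltP c 0.
  apply: aeW => x; have /andP[y0 _] := Y01 x.
  by rewrite gt_eqF// (lt_le_trans c0).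
have [c1|c1] := leP 1 c.
  apply: aeW => x; have /andP[_ y1] := Y01 x.
  by rewrite lt_eqF// (lt_le_trans y1).
have [->|cn] := eqVneq c 0.
  (* Excluding any interior point with [atom] excludes [0] too; the midpoint serves. *)
  apply: aeS (atom (c := 2^-1) _ _) => [x []//||]; lra.
by apply: aeS (atom (c := c) _ c1) => [x []//|]; rewrite lt_neqAle eq_sym cn.
Qed.

(** The measure [b dx] is encoded as the area below the graph of [b], a restriction of a product
    measure, so that its image [nu] under [Y] is a measure by construction. *)
Let kappa2 := pr mX (@lebI R Jh).
Let S2 : set (RR * RR) := [set z | z.2 < b z.1].
Let mS2 : measurable S2.
Proof.
rewrite -[S2]setTI.
have : measurable_fun [set: RR * RR] (fun z : RR * RR => z.2 < b z.1).
  by apply: measurable_fun_ltr; meas.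
by move=> /(_ measurableT [set true]) H; apply: H.
Qed.

Let Phi (z : RR * RR) : RR := Y z.1.
Let mPhi : measurable_fun setT Phi.
Proof. exact: (M1_comp mY measurable_fst). Qed.

Let nu : {measure set RR -> \bar R} :=
  measure_function_pushforward__canonical__measure_function_Measure (mrestr kappa2 mS2) mPhi.

Let nuE A : nu A = kappa2 (Phi @^-1` A `&` S2). Proof. by []. Qed.

Let nu_integral (f : R -> R) : M1 f -> (forall x, 0 <= f x) ->
  (\int[nu]_y (f y)%:E = \int[mX]_x (f (Y x) * b x)%:E)%E.
Proof.
move=> mf f0; have mfE : measurable_fun [set: RR] (fun y => (f y)%:E) by exact/measurable_EFinP.
rewrite (@ge0_integral_pushforward _ _ _ _ _ Phi mPhi (mrestr kappa2 mS2) setT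
  (fun y => (f y)%:E) measurableT mfE (fun y _ => f0 y)) preimage_setT.
pose g z := f (Y z.1) * when (z.2 < b z.1) 1.
have g0 z : 0 <= g z by rewrite /g mulr_ge0// /when; case: ifP.
have mg : measurable_fun [set: RR * RR] g by rewrite /g; meas.
have mgE : measurable_fun [set: RR * RR] (fun z => (g z)%:E) by exact/measurable_EFinP.
transitivity (\int[kappa2]_z (g z)%:E)%E; last first.
  have := @fubini_tonelli1 _ _ _ _ _ mX (lebI Jh) (fun z => (g z)%:E) mgE (fun z => g0 z).
  move=> ->; apply: eq_integral => x _; rewrite /fubini_F /g /=.
  have Lw : L1 (lebI Jh) (fun r => when (r < b x) 1).
    by apply: L1_when1; exact: L1_cst.
  rewrite (L1_fin (L1Z _ Lw)) (IntZ _ Lw); congr (_ * _)%:E.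
  by apply: (@cdf_id Jh (b x)); rewrite ltW//=; have /andP[] := bJ x.
have D0 : mrestr kappa2 mS2 (~` S2) = 0%E by rewrite /mrestr setICl; exact: (measure0 kappa2).
rewrite (@ge0_negligible_integral _ _ _ (mrestr kappa2 mS2) setT (~` S2)
  (fun z => (f (Phi z))%:E) (measurableC mS2) measurableT
  (measurableT_comp mfE mPhi) (fun z _ => f0 (Phi z)) D0) setDE setCK setTI.
rewrite (@eq_measure_integral _ _ _ S2 kappa2); last first.
  by move=> A mA AS; exact: (congr1 (fun B => kappa2 B) (setIidl AS)).
rewrite [LHS]integral_mkcond; apply: eq_integral => z _.
rewrite patchE /g /when; case: ifPn => [/set_mem|/negP] zS.
  by rewrite (zS : z.2 < b z.1) mulr1.
by case: ifPn => [zb|_]; [exfalso; apply: zS; exact: mem_set|rewrite mulr0].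
Qed.

Let nu_indic (A : set RR) : measurable A -> nu A = (\int[mX]_x (\1_A (Y x) * b x)%:E)%E.
Proof.
move=> mA; rewrite -nu_integral; last by move=> x; rewrite indicE.
  by rewrite integral_indic ?setIT.
exact: measurable_indic.
Qed.

Let nu_itv (a c : R) : nu `]a, c]%classic = mX `]a, c]%classic.
Proof.
have mA : measurable (`]a, c]%classic : set RR) by exact: measurable_itv.
rewrite nu_indic//; have [ac|ca] := leP c a.
  have E : `]a, c]%classic = set0 :> set RR.
    by apply/seteqP; split => x //=; rewrite in_itv/= => /andP[ax xc]; lra.
  rewrite E measure0; under eq_integral do rewrite indic0 mul0r.
  by rewrite integral0.
have wL (W w : R -> R) K (e : R) : M1 W -> M1 w -> (forall x, `|w x| <= K) ->
    L1 mX (fun x => when (W x < e) (w x)).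
  move=> mW mw wK; apply: (@L1_bnd _ _ _ mX _ `|K|); first by meas.
  move=> x; rewrite /when; case: ifP => _; rewrite ?normr0//.
  exact: le_trans (wK x) (ler_norm _).
have ind (W w : R -> R) x : W x != a -> W x != c ->
    \1_(`]a, c]%classic : set RR) (W x) * w x = when (W x < c) (w x) - when (W x < a) (w x).
  move=> Wa Wc; rewrite indicE /when.
  have -> : (W x \in (`]a, c]%classic : set RR)) = (a < W x < c).
    rewrite mem_setE in_itv/=; congr (_ && _).
    by rewrite [RHS]lt_neqAle Wc.
  have [Wxa|Wxa|/eqP] := ltgtP (W x) a; last by rewrite (negbTE Wa).
    by rewrite (lt_trans Wxa ca) mul0r subrr.
  by case: (W x < c); rewrite /= ?mul1r ?mul0r subr0.
have m1 : M1 (fun=> 1 : R) by exact: measurable_cst.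
have n1 (x : R) : `|1 : R| <= 1 by rewrite normr1.
have L1Y : L1 mX (fun x => \1_(`]a, c]%classic : set RR) (Y x) * b x).
  apply: (@L1M _ _ _ mX _ _ 1) => //.
    have mi : M1 (\1_(`]a, c]%classic : set RR) : R -> R) by exact: measurable_indic.
    exact: (M1_comp mi mY).
  by move=> x; rewrite indicE; case: (_ \in _); rewrite ?normr1 ?normr0.
rewrite (L1_fin L1Y).
have -> : Int mX (fun x => \1_(`]a, c]%classic : set RR) (Y x) * b x) =
    prim 1 (fun=> 1) c - prim 1 (fun=> 1) a.
  rewrite -!cdf -(IntB (wL _ _ _ c mY mb bh) (wL _ _ _ a mY mb bh)); apply: Int_ae.
  - exact: L1_meas L1Y.
  - by meas.
  by apply: aeS2 (neq_ae a) (neq_ae c) => x; exact: ind.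
have mid : M1 (@id R) by exact: measurable_id.
rewrite /prim -(IntB (wL id _ _ c mid m1 n1) (wL id _ _ a mid m1 n1)).
rewrite (@Int_ae _ _ _ mX _ (\1_(`]a, c]%classic : set RR))).
- by rewrite /Int /Rintegral integral_indic// setIT fineK// fin_num_measure.
- by meas.
- exact: measurable_indic.
apply: aeS2 (lebI_neq 1 a) (lebI_neq 1 c) => x xa xc.
by rewrite -[RHS]mulr1 (ind id (fun=> 1)).
Qed.

(** Completed by Lebesgue measure outside [[0, 1)], the measure [nu] agrees with Lebesgue measure on
    all intervals []a, c]], hence on all measurable sets by uniqueness. *)
Let nu_lebI (A : set RR) : measurable A -> nu A = mX A.
Proof.
move=> mA.
have mI : measurable (`[0%R, 1%R[%classic : set RR) by exact: measurable_itv.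
pose out := mrestr (@lebesgue_measure R) (measurableC mI).
have H (B : set RR) : measurable B -> (lebesgue_measure B = nu B + out B)%E.
  move=> mB; rewrite -measure_addE; apply: lebesgue_measure_unique => //.
  move=> _ [[a c]] _ <-; set A0 := (X in lebesgue_measure X).
  transitivity (nu A0 + out A0)%E; last by rewrite -measure_addE.
  have mA0 : measurable (A0 : set RR) by exact: measurable_itv.
  rewrite /A0 nu_itv lebIE -/A0 /out /mrestr.
  rewrite -(@measureU _ _ _ (@lebesgue_measure R)); last 3 first.
  - exact: measurableI.
  - by apply: measurableI => //; exact: measurableC.
  - by rewrite setIACA setICr setI0.
  by rewrite -setIUr setUv setIT.
have mAI : measurable (A `&` `[0%R, 1%R[%classic : set RR) by exact: measurableI.
have EA : Phi @^-1` A = Phi @^-1` (A `&` `[0%R, 1%R[%classic).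
  apply/seteqP; split => z /=; last by case.
  by move=> Az; split => //=; rewrite in_itv/=; exact: Y01.
rewrite [RHS]lebIE H// /out /mrestr -setIA setICr setI0 measure0 adde0 !nuE.
by rewrite EA.
Qed.

Lemma circle_change_ge0 (f : R -> R) : M1 f -> (forall x, 0 <= f x) ->
  (\int[mX]_x (f (Y x) * b x)%:E = \int[mX]_y (f y)%:E)%E.
Proof.
move=> mf f0; rewrite -nu_integral//; apply: eq_measure_integral => A mA _.
exact: nu_lebI.
Qed.

Lemma circle_change_L1 (f : R -> R) : M1 f -> L1 mX f <-> L1 mX (fun x => f (Y x) * b x).
Proof.
move=> mf; have E := circle_change_ge0 (measurable_abs mf) (fun x => normr_ge0 (f x)).
have E' : (\int[mX]_x `|(f (Y x) * b x)%:E| = \int[mX]_y `|(f y)%:E|)%E.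
  transitivity (\int[mX]_y (`|f y|)%:E)%E; last by [].
  rewrite -E; apply: eq_integral => x _.
  by rewrite /= normrM (gtr0_norm (b0 x)).
have mfY : M1 (fun x => f (Y x) * b x) by meas.
split=> /integrableP[_ fi]; apply/integrableP; split; try exact/measurable_EFinP.
- by rewrite E'.
- by rewrite -E'.
Qed.

Lemma circle_change (f : R -> R) : L1 mX f -> Int mX (fun x => f (Y x) * b x) = Int mX f.
Proof.
move=> Lf; have mf : M1 f := L1_meas Lf.
have Habs := circle_change_ge0 (measurable_abs mf) (fun x => normr_ge0 (f x)).
pose g x := `|f x| + f x.
have mg : M1 g by rewrite /g; meas.
have g0 x : 0 <= g x by rewrite /g -lerBlDr sub0r -normrN ler_norm.
have Hg := circle_change_ge0 mg g0.
have La := L1_abs Lf; have Lg : L1 mX g := L1D La Lf.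
have LaY := (circle_change_L1 (measurable_abs mf)).1 La; have LgY := (circle_change_L1 mg).1 Lg.
rewrite (L1_fin LaY) (L1_fin La) in Habs; rewrite (L1_fin LgY) (L1_fin Lg) in Hg.
move: Habs Hg => [Ha] [Hg].
have -> : Int mX f = Int mX g - Int mX (fun x => `|f x|).
  by rewrite -(IntB Lg La); apply: Int_eq => x; rewrite /g; ring.
rewrite -Ha -Hg -(IntB LgY LaY); apply: Int_eq => x; rewrite /g; ring.
Qed.

(** The inverse of an increasing function as the length of a sublevel set. Being an integral, it is
    measurable in [y] and also in any parameter on which [b] and [k] depend. The representative
    [frac (y - k)] of the level is measured from the image of [x = 0]. *)
Definition circle_inv (y : R) : R :=
  Int mX (fun x => when (k + prim 1 b x < k + frac (y - k)) 1).

Lemma circle_invK x : 0 <= x < 1 -> circle_inv (Y x) = x.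
Proof.
move=> /andP[x0 x1].
have lip u v : u < v -> v <= 1 -> 0 <= u -> prim 1 b u < prim 1 b v.
  move=> uv v1 u0; rewrite -subr_gt0 prim_sub//; last exact: ltW.
  apply: (@lt_le_trans _ _ (Jl * (v - u))); first by rewrite mulr_gt0// subr_gt0.
  have Lw : L1 mX (fun s => when (s < v) (when (u < s) (1 : R))).
    by apply: L1_when1; apply: L1_when; [exact: measurable_cst|exact: measurable_id|exact: L1_cst].
  have -> : Jl * (v - u) = Int mX (fun s => Jl * when (s < v) (when (u < s) 1)).
    rewrite (IntZ _ Lw); congr (_ * _); rewrite -[LHS](_ : prim 1 (fun=> 1) v - prim 1 (fun=> 1) u = _).
      by rewrite prim_sub//; [exact: L1_cst|exact: ltW].
    rewrite cdf_id; last by rewrite v1 andbT (le_trans u0)// ltW.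
    by rewrite cdf_id// u0 (le_trans (ltW uv)).
  apply: Int_le; first exact: L1Z.
    by apply: L1_when1; apply: L1_when => //; meas.
  move=> s; rewrite /when; case: ifP => _; last by rewrite mulr0.
  by case: ifP => _; rewrite ?mulr0// mulr1; have /andP[] := bJ s.
have P0 : prim 1 b 0 = 0 by exact: prim_le0.
have P1 : prim 1 b 1 = 1 by rewrite prim_ge.
have px : 0 <= prim 1 b x < 1.
  apply/andP; split; last by have := lip x 1 x1 (lexx 1) x0; rewrite P1.
  move: x0; rewrite le_eqVlt => /predU1P[<-|x0]; first by rewrite P0.
  by have := lip 0 x x0 (ltW x1) (lexx 0); rewrite P0 => /ltW.
have E : frac (Y x - k) = prim 1 b x.
  rewrite -(fracE px); have pf (y : R) : frac (y + 1 - k) = frac (y - k) by rewrite addrAC fracD1.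
  by rewrite /Y (periodic_frac (f := fun y => frac (y - k)) pf) /mm addrAC subrr add0r.
rewrite /circle_inv E.
rewrite (@Int_ae _ _ _ mX _ (fun z => when (z < x) 1)).
- by rewrite -[LHS]/(prim 1 (fun=> 1) x) cdf_id// x0 ltW.
- by meas.
- by meas.
apply: aeS (lebI_in 1) => z /andP[z0 z1]; rewrite ltrD2l; congr (when _ _).
have [zx|xz|->] := ltgtP z x; last by rewrite ltxx.
- by rewrite lip// ltW.
- by apply/negbTE; rewrite -leNgt ltW// lip// ltW.
Qed.

Lemma circle_change_inv (f g : R -> R) : M1 f -> (forall y, g (y + 1) = g y) ->
  M1 g -> L1 mX (fun x => f x * g (mm x) * b x) ->
  L1 mX (fun y => f (circle_inv y) * g y) /\
  Int mX (fun y => f (circle_inv y) * g y) = Int mX (fun x => f x * g (mm x) * b x).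
Proof.
move=> mf pg mg Lfg.
have mX' : M1 circle_inv by have ? := @M1_frac R; rewrite /circle_inv; meas.
have mh : M1 (fun y => f (circle_inv y) * g y) by meas.
have E : {ae mX, forall x, f x * g (mm x) * b x = f (circle_inv (Y x)) * g (Y x) * b x}.
  by apply: aeS (lebI_in 1) => x x01; rewrite circle_invK// /Y (periodic_frac pg).
have LY : L1 mX (fun x => f (circle_inv (Y x)) * g (Y x) * b x).
  by apply: L1_ae Lfg E; meas.
have Lh := (circle_change_L1 mh).2 LY; split => //.
rewrite -(circle_change Lh); apply: Int_ae; [exact: L1_meas LY|exact: L1_meas Lfg|].
by apply: aeS E => x ->.
Qed.

(** The change of variables applied to the indicator of the exceptional set: a null set has a null
    preimage under the inverse. *)
Lemma ae_circle (P : R -> Prop) : {ae mX, forall x, P x} ->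
  {ae mX, forall y, P (circle_inv y)}.
Proof.
move=> [N [mN N0 PN]].
have mX' : M1 circle_inv by have ? := @M1_frac R; rewrite /circle_inv; meas.
have mi : M1 (\1_N : R -> R) by exact: measurable_indic.
have aeN : {ae mX, forall x, \1_N x = 0 :> R}.
  exists N; split => // x /= nx; apply: contrapT => nN; apply: nx.
  by rewrite indicE memNset.
have Z : {ae mX, forall x, \1_N x * 1 * b x = 0 :> R}.
  by apply: aeS aeN => x ->; rewrite !mul0r.
have L0 : L1 mX (fun x => \1_N x * 1 * b x).
  apply: (L1_ae (f := fun=> 0)); [by meas|exact: L1_cst|].
  by apply: aeS Z => x ->.
have [Li Ii] := @circle_change_inv (\1_N) (fun=> 1) mi (fun=> erefl) (measurable_cst _) L0.
have i0 y : 0 <= \1_N (circle_inv y) * 1 :> R by rewrite mulr1 indicE.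
have := Int_eq0_ae Li i0; rewrite Ii (@Int_ae _ _ _ mX _ (fun=> 0)) ?Int0 ?lexx//; last by meas.
move=> /(_ isT); apply: aeS => y; rewrite mulr1 indicE => h.
apply: contrapT => nP; have /mem_set yN := PN _ nP.
by move: h; rewrite yN => /eqP; rewrite oner_eq0.
Qed.

(** The same argument in the other direction; here the weight [b] has to be positive for its
    vanishing integral to give a null set. *)
Lemma circle_ae (P : R -> Prop) : {ae mX, forall y, P y} -> {ae mX, forall x, P (Y x)}.
Proof.
move=> [N [mN N0 PN]].
have mi : M1 (\1_N : R -> R) by exact: measurable_indic.
have aeN : {ae mX, forall x, \1_N x = 0 :> R}.
  exists N; split => // x /= nx; apply: contrapT => nN; apply: nx.
  by rewrite indicE memNset.
have Li : L1 mX (\1_N : R -> R).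
  by apply: (L1_ae (f := fun=> 0)); [by []|exact: L1_cst|apply: aeS aeN => x ->].
have LY := (circle_change_L1 mi).1 Li.
have i0 x : 0 <= \1_N (Y x) * b x by rewrite mulr_ge0 ?indicE// ltW.
have := Int_eq0_ae LY i0; rewrite (circle_change Li) (@Int_ae _ _ _ mX _ (fun=> 0)) ?Int0 ?lexx//.
move=> /(_ isT); apply: aeS => x; rewrite indicE => h.
apply: contrapT => nP; have /mem_set yN := PN _ nP.
by move: h; rewrite yN mul1r => /eqP; rewrite gt_eqF.
Qed.

End circle.

(** * Translations of the circle *)

Section shift.
Context (R : realType).
Local Notation RR := (measurableTypeR R).
Local Notation mX := (@lebI R 1).
Implicit Types (f : R -> R) (h : R).

Let m1 : M1 (fun=> 1 : R). Proof. exact: measurable_cst. Qed.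
Let b1 (x : R) : 1 <= (1 : R) <= 1. Proof. by rewrite lexx. Qed.
Let I1 : Int mX (fun=> 1) = 1. Proof. by rewrite (Int_lebI_cst _ ler01) mulr1. Qed.

Lemma prim_cst1 (L x : R) : 0 <= x <= L -> prim L (fun=> 1) x = x.
Proof.
move=> xL; rewrite (FTC (@der_id R) _ xL) ?subr0//.
by move=> y; exact: cvg_cst.
Qed.

(** With weight [b = 1] the circle map is the translation by [h], so translation invariance is a
    special case of the change of variables. *)
Let shiftE h : {ae mX, forall x, frac (h + prim 1 (fun=> 1) x) = frac (x + h)}.
Proof.
apply: aeS (lebI_in 1) => x /andP[x0 x1].
by rewrite prim_cst1 1?addrC// x0 ltW.
Qed.

Lemma shift_ae h (P : R -> Prop) : {ae mX, forall x, P x} ->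
  {ae mX, forall x, P (frac (x + h))}.
Proof.
move=> aP; have := @circle_ae R (fun=> 1) h 1 1 m1 ltr01 b1 I1 _ aP.
by apply: aeS2 (shiftE h) => x ->.
Qed.

Let mshift h f : M1 f -> M1 (fun x => f (frac (x + h))).
Proof. by move=> mf; have ? := @M1_frac R; meas. Qed.

Lemma shift_L1 h f : L1 mX f -> L1 mX (fun x => f (frac (x + h))).
Proof.
move=> Lf; have mf : M1 f := L1_meas Lf.
have := (@circle_change_L1 R (fun=> 1) h 1 1 m1 ltr01 b1 I1 _ mf).1 Lf.
move=> /L1_ae; apply; first exact: mshift.
by apply: aeS (shiftE h) => x ->; rewrite mulr1.
Qed.

Lemma shift_Int h f : L1 mX f -> Int mX (fun x => f (frac (x + h))) = Int mX f.
Proof.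
move=> Lf; have mf : M1 f := L1_meas Lf.
rewrite -(@circle_change R (fun=> 1) h 1 1 m1 ltr01 b1 I1 _ Lf); apply: Int_ae.
- exact: mshift.
- by have ? := @M1_frac R; meas.
by apply: aeS (shiftE h) => x ->; rewrite mulr1.
Qed.

Lemma shift_LL T h (F : R -> R -> R) : LL (lebI T) mX F ->
  LL (lebI T) mX (fun t x => F t (frac (x + h))).
Proof.
move=> LF; have mF : M2 F := L1_meas LF.
have [La _] := LL_Int1 (LL_abs LF).
apply: (@LL_iter _ _ _ _ _ (lebI T) mX _ (fun t => Int mX (fun x => `|F t x|))) La.
  by have ? := @M1_frac R; meas.
apply: aeS (LL1 LF) => t LFt; split; first exact: shift_L1.
by rewrite (shift_Int h (L1_abs LFt)).
Qed.

Lemma fracK h (x : R) : 0 <= x < 1 -> frac (frac (x + h) - h) = x.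
Proof.
move=> x01; have pf (y : R) : frac (y + 1 - h) = frac (y - h) by rewrite addrAC fracD1.
by rewrite (periodic_frac (f := fun y => frac (y - h)) pf) addrK fracE.
Qed.

Lemma prim_mulc L (f g : R -> R) (a c t : R) : L1 (lebI L) f -> L1 (lebI L) g ->
  (a + prim L f t) * (c + prim L g t) =
  a * c + prim L (fun s => f s * (c + prim L g s) + g s * (a + prim L f s)) t.
Proof.
move=> Lf Lg; rewrite mulrDl !mulrDr (prim_mul t Lf Lg).
have Lfg := L1_mul_prim Lf Lg; have Lgf := L1_mul_prim Lg Lf.
rewrite (_ : prim L (fun s => f s * (c + _) + _) t =
  prim L (fun s => (c * f s + a * g s) + (f s * prim L g s + g s * prim L f s)) t); last first.
  by congr (prim L _ t); apply/funext => s; ring.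
rewrite (primD _ (L1D (L1Z _ Lf) (L1Z _ Lg)) (L1D Lfg Lgf)) (primD _ (L1Z _ Lf) (L1Z _ Lg)).
rewrite (primZ _ _ Lf) (primZ _ _ Lg); ring.
Qed.

Lemma prim_dct L (f_ : nat -> R -> R) f g t :
  (forall n, M1 (f_ n)) -> M1 f -> L1 (lebI L) g ->
  {ae lebI L, forall s, f_ ^~ s @ \oo --> f s} ->
  {ae lebI L, forall s, forall n, `|f_ n s| <= g s} ->
  prim L (f_ n) t @[n --> \oo] --> prim L f t.
Proof.
move=> mf_ mf Lg cf fg.
have [] := @L1_dct _ _ _ (lebI L) (fun n s => when (s < t) (f_ n s))
  (fun s => when (s < t) (f s)) g; last by move=> _ cI; exact: cI.
- by move=> n; have ? := mf_ n; meas.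
- by meas.
- by [].
- apply: aeS cf => s cs; rewrite /when; case: (s < t) => //; exact: cvg_cst.
- apply: aeS fg => s gs n; rewrite /when; case: (s < t) => //.
  by rewrite normr0; exact: le_trans (gs n).
Qed.

Lemma M2_1 (f : R -> R -> R) t : M2 f -> M1 (f t).
Proof. by move=> mf; have : M1 (fun x => f t x) by meas. Qed.

Lemma M2_2 (f : R -> R -> R) x : M2 f -> M1 (f^~ x).
Proof. by move=> mf; meas. Qed.

Lemma L1Mr d (X : measurableType d) (mu : {finite_measure set X -> \bar R})
    (f g : X -> R) (C : R) : L1 mu f -> measurable_fun setT g ->
  (forall x, `|g x| <= C) -> L1 mu (fun x => f x * g x).
Proof.
move=> Lf mg gC; have := L1M mg gC Lf.
by congr (L1 mu _); apply/funext => x; rewrite mulrC.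
Qed.

Lemma LLMr T (f g : R -> R -> R) (C : R) : LL (lebI T) mX f -> M2 g ->
  (forall t x, `|g t x| <= C) -> LL (lebI T) mX (fun t x => f t x * g t x).
Proof. by move=> Lf mg gC; exact: (L1Mr Lf mg (fun z => gC z.1 z.2)). Qed.

Lemma L1_le_ae d (X : measurableType d) (mu : {finite_measure set X -> \bar R})
    (f g : X -> R) : measurable_fun setT f -> L1 mu g ->
  {ae mu, forall x, `|f x| <= g x} -> L1 mu f.
Proof.
move=> mf Lg fg; have mg := L1_meas Lg.
apply: (@L1_ae _ _ _ mu (fun x => Num.max (- `|g x|) (Num.min (f x) `|g x|))) => //.
  apply: (@L1_le _ _ _ mu _ (fun x => `|g x|)); [by meas|exact: L1_abs|].
  move=> x; rewrite ler_norml le_max lexx /= ge_max ge_min lexx orbT andbT.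
  by rewrite lerNl (le_trans _ (normr_ge0 _))// oppr_le0.
apply: aeS fg => x fg; have := le_trans fg (ler_norm _).
by rewrite ler_norml => /andP[f1 f2]; rewrite min_l// max_r.
Qed.

End shift.

(** * Conservation laws along the flow *)

Section flow.
Context (R : realType).
Local Notation RR := (measurableTypeR R).
Local Notation mX := (@lebI R 1).

(** The bounds and the unit mass are demanded at every time, so that [J t] defines a change of
    variables on the circle for all [t]; only the law itself is weak. *)
Record flow (T Jl Jh Uh : R) (J u : R -> R -> R) (J0 : R -> R) : Prop := Flow {
  flow_J : M2 J; flow_J0 : M1 J0; flow_u : M2 u;
  flow_Jl : 0 < Jl;
  flow_Jb : forall t x, Jl <= J t x <= Jh;
  flow_J0b : forall x, Jl <= J0 x <= Jh;
  flow_ub : forall t x, `|u t x| <= Uh;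
  flow_IJ : forall t, Int mX (J t) = 1;
  flow_IJ0 : Int mX J0 = 1;
  flow_law : claw T J (fun t x => J t x * u t x) J0 }.

Variables (T Jl Jh Uh : R) (J u : R -> R -> R) (J0 : R -> R).
Hypothesis fl : flow T Jl Jh Uh J u J0.
Local Notation mT := (lebI T).

(* [flow_m] is the mass coordinate; [flow_k] is chosen so that it has time derivative [- J u]. *)
Definition flow_k t := kap (fun t x => - prim T (fun s => J s x * u s x) t)
  (fun t x => J t x - J0 x) t.
Definition flow_m t x := flow_k t + prim 1 (J t) x.
(** The summand [0] gives it the shape [k + prim 1 b] of the circle maps. *)
Definition flow_m0 x := 0 + prim 1 J0 x.
(** The mass coordinate once more, now integrated in time. For fixed [x] it is Lipschitz in [t], as
    [flow_m] is in [x] for fixed [t]; the two agree almost everywhere by [nm], and each provides the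
    chain rule in its own variable. *)
Let n t x := flow_m0 x + prim T (fun s => - (J s x * u s x)) t.

Let mJ := flow_J fl.
Let mJ0 := flow_J0 fl.
Let mu := flow_u fl.
Let Jl0 := flow_Jl fl.

Let Jp t x : 0 < J t x.
Proof. by have /andP[+ _] := flow_Jb fl t x; exact: lt_le_trans. Qed.
Let J0p x : 0 < J0 x.
Proof. by have /andP[+ _] := flow_J0b fl x; exact: lt_le_trans. Qed.
Let Jn t x : `|J t x| <= Jh.
Proof. by rewrite gtr0_norm//; have /andP[] := flow_Jb fl t x. Qed.
Let J0n x : `|J0 x| <= Jh.
Proof. by rewrite gtr0_norm//; have /andP[] := flow_J0b fl x. Qed.
Let Jun t x : `|J t x * u t x| <= Jh * Uh.
Proof. by rewrite normrM ler_pM// (flow_ub fl). Qed.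

Lemma flow_M1k : M1 flow_k.
Proof. by apply: M1_kap; meas. Qed.
Let mk := flow_M1k.

Lemma flow_M2m : M2 flow_m.
Proof. by rewrite /flow_m; meas. Qed.
Let mm := flow_M2m.
Let mm0 : M1 flow_m0.
Proof. by rewrite /flow_m0; meas. Qed.
Let mn : M2 n.
Proof. by rewrite /n; meas. Qed.

Let nm : {ae mT, forall t, {ae mX, forall x, n t x = flow_m t x}}.
Proof.
have LJ : LL mT mX J by apply: (@LL_bnd _ _ _ _ _ mT mX _ Jh).
have LJ0 : L1 mX J0 by apply: (@L1_bnd _ _ _ mX _ Jh).
have LJu : LL mT mX (fun t x => J t x * u t x).
  by apply: (@LL_bnd _ _ _ _ _ mT mX _ (Jh * Uh)) => //; meas.
have LA := LLN (LL_primt LJu).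
have LB : LL mT mX (fun t x => J t x - J0 x).
  apply: (@LL_bnd _ _ _ _ _ mT mX _ (Jh + Jh)); first by meas.
  by move=> t x; apply: le_trans (ler_normB _ _) _; exact: lerD.
have := wdx_prim LA LB (claw_wdx LJ LJu LJ0 (flow_law fl)).
apply: aeS => t [_]; apply: aeS => x E.
rewrite /n /flow_m /flow_m0 primN; last first.
  by apply: (@L1_bnd _ _ _ mT _ (Jh * Uh)) => //; meas.
rewrite E primB//; last by apply: (@L1_bnd _ _ _ mX _ Jh) => //; exact: M2_1.
by rewrite -/(flow_k t); ring.
Qed.

Section weak_law.
Variables (q F : R -> R -> R) (q0 : R -> R) (Q : R).
Hypotheses (mq : M2 q) (qQ : forall t x, `|q t x| <= Q).
Hypotheses (mq0 : M1 q0) (q0Q : forall x, `|q0 x| <= Q).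
Hypotheses (LF : LL mT mX F) (law : claw T q F q0).
Variable g : R -> R.
Hypothesis tg : test1 g.

Let mF : M2 F := L1_meas LF.
Let mg := test1_M1 tg.
Let mg' := test1_M1 (test1_derive1 tg).
(** [g1] and [b] are the time and space derivatives of [g] of the mass coordinate. [A] has time
    derivative [- F] and, by [AD], space derivative [D]. *)
Let g1 t x := derive1 g (n t x) * - (J t x * u t x).
Let b t x := derive1 g (flow_m t x) * J t x.
Let D t x := q t x - q0 x.
Let A t x := - prim T (F^~ x) t.

Let mg1 : M2 g1. Proof. by rewrite /g1; meas. Qed.
Let mb : M2 b. Proof. by rewrite /b; meas. Qed.
Let mD : M2 D. Proof. by rewrite /D; meas. Qed.
Let mA : M2 A. Proof. by rewrite /A; meas. Qed.

Let Db t x : `|D t x| <= Q + Q.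
Proof. by apply: le_trans (ler_normB _ _) _; exact: lerD. Qed.

Let bnds : exists2 C, 0 <= C & [/\ forall x, `|g x| <= C,
  forall t x, `|g1 t x| <= C & forall t x, `|b t x| <= C].
Proof.
have [C C0 [g0 g1' _ _]] := test1_taylor tg.
have U0 : 0 <= Uh := le_trans (normr_ge0 _) (flow_ub fl 0 0).
have Jh0 : 0 <= Jh := le_trans (normr_ge0 _) (Jn 0 0).
exists (C + C * (Jh * Uh) + C * Jh); first by rewrite !addr_ge0 ?mulr_ge0.
split=> [x|t x|t x].
- by apply: le_trans (g0 x) _; rewrite -addrA lerDl addr_ge0 ?mulr_ge0.
- apply: (@le_trans _ _ (C * (Jh * Uh))); last by rewrite addrAC lerDr addr_ge0 ?mulr_ge0.
  by rewrite /g1 normrM normrN ler_pM.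
- apply: (@le_trans _ _ (C * Jh)); last by rewrite lerDr addr_ge0 ?mulr_ge0.
  by rewrite /b normrM ler_pM.
Qed.

Let gn t x : g (n t x) = g (flow_m0 x) + prim T (g1^~ x) t.
Proof.
have [C C0 [_ H1 H2 H3]] := test1_taylor tg.
have mf : M1 (fun s => - (J s x * u s x)) by meas.
have fb s : `|- (J s x * u s x)| <= Jh * Uh by rewrite normrN.
exact: (@prim_chain R T _ _ g _ C (flow_m0 x) mf fb mg' H1 H2 H3 t).
Qed.

Lemma flow_chain t x : g (flow_m t x) = g (flow_k t) + prim 1 (b t) x.
Proof.
have mJt : M1 (J t) by exact: M2_1.
exact: (circle_chain (flow_k t) mJt Jl0 (flow_Jb fl t) tg x).
Qed.

(** The mass coordinate gains one over a period and [g] is periodic, so [g (flow_m t x)] is a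
    periodic function of [x]. *)
Lemma flow_chain0 t : Int mX (b t) = 0.
Proof.
have mbt : M1 (b t) by exact: M2_1.
have mJt : M1 (J t) by exact: M2_1.
have := flow_chain t 1; rewrite (prim_ge mbt (lexx 1)) /flow_m (prim_ge mJt (lexx 1)) (flow_IJ fl).
by case: tg => _ -> E; lra.
Qed.

Let LD : LL mT mX D := LL_bnd mT mX mD Db.
Let LA : LL mT mX A := LLN (LL_primt LF).

Let AD : {ae mT, forall t, Int mX (D t) = 0 /\
  {ae mX, forall x, A t x = kap A D t + prim 1 (D t) x}}.
Proof.
apply: wdx_prim => //; apply: claw_wdx => //.
- exact: (LL_bnd mT mX mq qQ).
- exact: (L1_bnd mX mq0 q0Q).
Qed.

(** A backward quotient for [g (flow_m)], a forward one for [A]: moving a translation from one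
    factor of an integral to the other reverses its direction. *)
Let eG i s x := (prim 1 (b s) (frac (x + -1 * hn R i)) - prim 1 (b s) x) / (-1 * hn R i).
Let eD i s x := (prim 1 (D s) (frac (x + 1 * hn R i)) - prim 1 (D s) x) / (1 * hn R i).
Let meG i : M2 (eG i). Proof. by have ? := @M1_frac R; rewrite /eG; meas. Qed.
Let meD i : M2 (eD i). Proof. by have ? := @M1_frac R; rewrite /eD; meas. Qed.
Let K i s := Int mX (fun x => F s x * eG i s x + g1 s x * eD i s x).
Let K0 s := Int mX (fun x => F s x * b s x + g1 s x * D s x).

Let hp i : 0 < hn R i. Proof. by have /andP[] := hn_itv R i. Qed.

Let eD_bnd i s x : Int mX (D s) = 0 -> 0 <= x < 1 -> `|eD i s x| <= Q + Q.
Proof.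
move=> I0 x01; have /andP[h0 h1] := hn_itv R i.
have mDs : M1 (D s) by exact: M2_1.
have hh : -1 < 1 * hn R i < 1 by rewrite mul1r h1 andbT (lt_trans _ h0)// ltrN10.
have := steklov_bnd mDs (Db s) I0 hh x01.
rewrite /eD !mul1r => H; rewrite normrM normfV ler_pdivrMr ?normr_gt0 ?gt_eqF//.
Qed.

Let eG_bnd C i s x : (forall t x, `|b t x| <= C) -> 0 <= x < 1 -> `|eG i s x| <= C.
Proof.
move=> bC x01; have /andP[h0 h1] := hn_itv R i.
have mbs : M1 (b s) by exact: M2_1.
have hh : -1 < -1 * hn R i < 1 by rewrite mulN1r; apply/andP; split; lra.
have := steklov_bnd mbs (bC s) (flow_chain0 s) hh x01.
rewrite /eG !mulN1r => H; rewrite normrM normfV ler_pdivrMr ?normr_gt0 ?oppr_eq0 ?gt_eqF//.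
Qed.

Let Kb : exists2 G, L1 mT G & {ae mT, forall s, forall i, `|K i s| <= G s}.
Proof.
have [C C0 [gC g1C bC]] := bnds.
have [La _] := LL_Int1 (LL_abs LF).
exists (fun s => Int mX (fun x => C * `|F s x| + C * (Q + Q))).
  by have [] := LL_Int1 (LLD (LLZ C (LL_abs LF))
    (@LL_bnd _ _ _ _ _ mT mX (fun _ _ => C * (Q + Q)) _ (measurable_cst _) (fun _ _ => lexx _))).
apply: aeS2 (LL1 LF) AD => s LFs [I0 _] i.
have LG : L1 mX (fun x => C * `|F s x| + C * (Q + Q)).
  by apply: L1D; [exact: L1Z (L1_abs LFs)|exact: L1_cst].
have [mFs mGs mDs mgs] : [/\ M1 (F s), M1 (eG i s), M1 (eD i s) & M1 (g1 s)].
  by split; exact: M2_1.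
have HG : {ae mX, forall x, `|F s x * eG i s x + g1 s x * eD i s x| <=
    C * `|F s x| + C * (Q + Q)}.
  apply: aeS (lebI_in 1) => x x01; apply: le_trans (ler_normD _ _) _.
  rewrite (normrM (F s x)) (normrM (g1 s x)); apply: lerD; first by rewrite mulrC ler_wpM2r//; exact: eG_bnd.
  by rewrite ler_pM//; exact: eD_bnd.
have LK : L1 mX (fun x => F s x * eG i s x + g1 s x * eD i s x).
  by apply: L1_le_ae LG HG; meas.
apply: le_trans (Int_abs LK) _; apply: Int_le_ae => //; exact: L1_abs.
Qed.

(** For almost every [x] the increment of [A] over the step is the time primitive of an increment of
    [F], and [g (n t x)] is a time primitive up to a constant; the product rule is [prim_mulc]. *)
Let step1 i t : Int mX (fun x => (A t (frac (x + hn R i)) - A t x) * g (n t x)) =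
  prim T (fun s => Int mX (fun x => (F s x - F s (frac (x + hn R i))) * g (n s x) +
    g1 s x * (A s (frac (x + hn R i)) - A s x))) t.
Proof.
have mfr := @M1_frac R.
have [C C0 [gC g1C _]] := bnds.
have LFh := shift_LL (hn R i) LF; have LAh := shift_LL (hn R i) LA.
have LH : LL mT mX (fun s x => (F s x - F s (frac (x + hn R i))) * g (n s x) +
    g1 s x * (A s (frac (x + hn R i)) - A s x)).
  have mgn : M2 (fun s x => g (n s x)) by meas.
  exact: LLD (LLMr (LLB LF LFh) mgn (fun s x => gC _)) (LLM mg1 g1C (LLB LAh LA)).
rewrite -(Int_primt t LH); apply: Int_ae; [by meas|by meas|].
have a2 := LL2 LF; apply: aeS2 a2 (shift_ae (hn R i) a2) => x Fx Fhx.
have Lg1 : L1 mT (g1^~ x) by apply: (@L1_bnd _ _ _ mT _ C) => //; meas.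
have Lf := L1B Fx Fhx.
have E s : A s (frac (x + hn R i)) - A s x =
    prim T (fun s => F s x - F s (frac (x + hn R i))) s.
  by rewrite primB// /A; ring.
have := prim_mulc 0 (g (flow_m0 x)) t Lf Lg1.
rewrite mul0r !add0r -E -gn => ->.
congr (prim T _ t); apply/funext => s.
by rewrite -gn add0r -E.
Qed.

(** Translation invariance moves the shift from [F] to [g (flow_m)]. Every increment then falls on a
    Lipschitz function and is [hn] times a bounded quotient. *)
Let step2 : {ae mT, forall s, forall i,
  Int mX (fun x => (F s x - F s (frac (x + hn R i))) * g (n s x) +
    g1 s x * (A s (frac (x + hn R i)) - A s x)) = hn R i * K i s}.
Proof.
have mfr := @M1_frac R.
have [C C0 [gC g1C bC]] := bnds.
apply: aeS3 (LL1 LF) nm AD => s LFs nms [I0 ADs] i.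
set h := hn R i; have h0 : h != 0 by rewrite gt_eqF// hp.
have LFh := shift_L1 h LFs.
have mms : M1 (flow_m s) by exact: M2_1.
have mns : M1 (n s) by exact: M2_1.
have mbs : M1 (b s) by exact: M2_1.
have mg1s : M1 (g1 s) by exact: M2_1.
have mDs : M1 (D s) by exact: M2_1.
have mAs : M1 (A s) by exact: M2_1.
have mFs : M1 (F s) := L1_meas LFs.
have meGs : M1 (eG i s) by exact: M2_1.
have meDs : M1 (eD i s) by exact: M2_1.
have LFe : L1 mX (fun x => F s x * eG i s x).
  apply: (@L1_le_ae _ _ _ mX _ (fun x => C * `|F s x|)); first by meas.
    exact: L1Z (L1_abs LFs).
  apply: aeS (lebI_in 1) => x x01; rewrite normrM mulrC ler_wpM2r//.
  exact: eG_bnd.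
have Lge : L1 mX (fun x => g1 s x * eD i s x).
  apply: (@L1_le_ae _ _ _ mX _ (fun=> C * (Q + Q))); first by meas.
    exact: L1_cst.
  apply: aeS (lebI_in 1) => x x01; rewrite normrM ler_pM//.
  exact: eD_bnd.
pose G x := g (flow_m s x); have mG : M1 G by rewrite /G; meas.
have LGF f : L1 mX f -> L1 mX (fun x => f x * G x).
  by move=> Lf; exact: L1Mr Lf mG (fun x => gC _).
have LFs' : L1 mX (fun x => F s x * G (frac (x - h))).
  have mG' : M1 (fun x => G (frac (x - h))) by meas.
  exact: L1Mr LFs mG' (fun x => gC _).
have shiftF : Int mX (fun x => F s (frac (x + h)) * G x) =
    Int mX (fun x => F s x * G (frac (x - h))).
  rewrite -(shift_Int h LFs'); apply: Int_ae; [by meas|by meas|].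
  by apply: aeS (lebI_in 1) => x x01; rewrite fracK.
transitivity (Int mX (fun x => F s x * G x - F s (frac (x + h)) * G x +
    h * (g1 s x * eD i s x))).
  apply: Int_ae; [by meas|by meas|].
  apply: aeS3 nms ADs (shift_ae h ADs) => x -> -> ->; rewrite /G /eD mul1r.
  by rewrite -/h; field.
rewrite (IntD (L1B (LGF _ LFs) (LGF _ LFh)) (L1Z h Lge)) (IntB (LGF _ LFs) (LGF _ LFh)).
rewrite (IntZ h Lge) shiftF -(IntB (LGF _ LFs) LFs') /K (IntD LFe Lge) mulrDr; congr (_ + _).
rewrite -(IntZ h LFe); apply: Int_eq => x; rewrite /G !flow_chain /eG mulN1r.
by rewrite -/h; field.
Qed.

Let step3 : {ae mT, forall t, forall i,
  Int mX (fun x => eD i t x * g (flow_m t x)) = prim T (K i) t}.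
Proof.
have mfr := @M1_frac R.
apply: aeS2 nm AD => t nmt [I0 ADt] i.
have h0 : hn R i != 0 by rewrite gt_eqF// hp.
have mK : M1 (K i) by have ? := meG i; have ? := meD i; rewrite /K; meas.
have mns : M1 (n t) by exact: M2_1.
have mms : M1 (flow_m t) by exact: M2_1.
have mDs : M1 (D t) by exact: M2_1.
have mAs : M1 (A t) by exact: M2_1.
have meDs : M1 (eD i t) by exact: M2_1.
have [C C0 [gC g1C bC]] := bnds.
have Le : L1 mX (fun x => eD i t x * g (flow_m t x)).
  apply: (@L1_le_ae _ _ _ mX _ (fun=> (Q + Q) * C)); first by meas.
    exact: L1_cst.
  apply: aeS (lebI_in 1) => x x01; rewrite normrM ler_pM//.
  exact: eD_bnd.
apply: (mulfI h0); rewrite -(IntZ _ Le).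
transitivity (Int mX (fun x => (A t (frac (x + hn R i)) - A t x) * g (n t x))).
  apply: Int_ae; [by meas|by meas|].
  apply: aeS3 nmt ADt (shift_ae (hn R i) ADt) => x -> -> ->; rewrite /eD mul1r.
  by field.
rewrite step1 (@prim_ae R T _ (fun s => hn R i * K i s)).
- have [G LG KG] := Kb; have LK : L1 mT (K i).
    by apply: L1_le_ae LG _ => //; apply: aeS KG => s.
  by rewrite (primZ _ _ LK).
- by meas.
- by meas.
- by apply: aeS step2 => s.
Qed.

(** The quotients converge almost everywhere and are bounded uniformly in the step, so dominated
    convergence applies in [x] at fixed time and then in time. *)
Let step4 : {ae mT, forall t, Int mX (fun x => D t x * g (flow_m t x)) = prim T K0 t}.
Proof.
have [C C0 [gC g1C bC]] := bnds.
have [G LG KG] := Kb.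
have mK0 : M1 K0 by rewrite /K0; meas.
have mK i : M1 (K i) by have ? := meG i; have ? := meD i; rewrite /K; meas.
have n1 : (1 : R) != 0 by exact: oner_neq0.
have n1' : (-1 : R) != 0 by rewrite oppr_eq0 oner_neq0.
have LDs s : L1 mX (D s) by apply: (@L1_bnd _ _ _ mX _ (Q + Q)) => //; exact: M2_1.
have Lbs s : L1 mX (b s) by apply: (@L1_bnd _ _ _ mX _ C) => //; exact: M2_1.
have cK : {ae mT, forall s, K ^~ s @ \oo --> K0 s}.
  apply: aeS2 (LL1 LF) AD => s LFs [I0 _].
  have [mFs mgs mDs mbs] : [/\ M1 (F s), M1 (g1 s), M1 (D s) & M1 (b s)].
    by split; exact: M2_1.
  have [] := @L1_dct _ _ _ mX (fun i x => F s x * eG i s x + g1 s x * eD i s x)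
    (fun x => F s x * b s x + g1 s x * D s x)
    (fun x => C * `|F s x| + C * (Q + Q)); last by move=> _ cI; exact: cI.
  - by move=> i; have ? := M2_1 s (meG i); have ? := M2_1 s (meD i); meas.
  - by meas.
  - by apply: L1D; [exact: L1Z (L1_abs LFs)|exact: L1_cst].
  - apply: aeS2 (steklov_cvg (Lbs s) n1') (steklov_cvg (LDs s) n1) => x cG cD.
    by apply: cvgD; apply: cvgMr.
  - apply: aeS (lebI_in 1) => x x01 i; apply: le_trans (ler_normD _ _) _.
    rewrite (normrM (F s x)) (normrM (g1 s x)); apply: lerD; first by rewrite mulrC ler_wpM2r//; exact: eG_bnd.
    by rewrite ler_pM//; exact: eD_bnd.
apply: aeS2 step3 AD => t E [I0 _].
have cR := @prim_dct R T K K0 G t mK mK0 LG cK KG.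
have [mms mDs] : M1 (flow_m t) /\ M1 (D t) by split; exact: M2_1.
have cL : Int mX (fun x => eD i t x * g (flow_m t x)) @[i --> \oo] -->
    Int mX (fun x => D t x * g (flow_m t x)).
  have [] := @L1_dct _ _ _ mX (fun i x => eD i t x * g (flow_m t x))
    (fun x => D t x * g (flow_m t x)) (fun=> (Q + Q) * C); last by move=> _ cI; exact: cI.
  - by move=> i; have ? := M2_1 t (meD i); meas.
  - by meas.
  - exact: L1_cst.
  - by apply: aeS (steklov_cvg (LDs t) n1) => x cD; apply: cvgMl.
  - by apply: aeS (lebI_in 1) => x x01 i; rewrite normrM ler_pM//; exact: eD_bnd.
apply: (@cvg_unique _ (@Rhausdorff R) _ _ _ _ cL).
by apply: cvg_trans cR; apply: near_eq_cvg; apply: nearW => i; rewrite E.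
Qed.

(** [step4] concerns [D = q - q0] only. The part of [q0] is added back through the chain rule of
    [g (n t x)] in time; its [g1] term completes [D] to [q]. *)
Lemma flow_weak : {ae mT, forall t, Int mX (fun x => q t x * g (flow_m t x)) =
  Int mX (fun x => q0 x * g (flow_m0 x)) +
  prim T (fun s => Int mX (fun x => (F s x - q s x * u s x) *
    (derive1 g (flow_m s x) * J s x))) t}.
Proof.
have [C C0 [gC g1C bC]] := bnds.
have Lq0 : LL mT mX (fun t x => q0 x * g1 t x).
  apply: (@LL_bnd _ _ _ _ _ mT mX _ (Q * C)); first by meas.
  by move=> t x; rewrite normrM ler_pM.
have LK0 : LL mT mX (fun s x => F s x * b s x + g1 s x * D s x).
  exact: LLD (LLMr LF mb bC) (LLM mg1 g1C LD).
have [Lq0' _] := LL_Int1 Lq0; have [LK0' _] := LL_Int1 LK0.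
apply: aeS2 step4 nm => t E nmt.
have [mns mms mDs mqs] : [/\ M1 (n t), M1 (flow_m t), M1 (D t) & M1 (q t)].
  by split; exact: M2_1.
have LDg : L1 mX (fun x => D t x * g (flow_m t x)).
  apply: (@L1_bnd _ _ _ mX _ ((Q + Q) * C)); first by meas.
  by move=> x; rewrite normrM ler_pM.
have Lqg w : M1 w -> L1 mX (fun x => q0 x * g (w x)).
  move=> mw; apply: (@L1_bnd _ _ _ mX _ (Q * C)); first by meas.
  by move=> x; rewrite normrM ler_pM.
have -> : Int mX (fun x => q t x * g (flow_m t x)) =
    Int mX (fun x => D t x * g (flow_m t x)) + Int mX (fun x => q0 x * g (flow_m t x)).
  by rewrite -(IntD LDg (Lqg _ mms)); apply: Int_eq => x; rewrite /D; ring.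
have -> : Int mX (fun x => q0 x * g (flow_m t x)) = Int mX (fun x => q0 x * g (flow_m0 x)) +
    prim T (fun s => Int mX (fun x => q0 x * g1 s x)) t.
  have Lp : L1 mX (fun x => prim T (fun s => q0 x * g1 s x) t).
    apply: (@L1_ae _ _ _ mX (fun x => q0 x * g (n t x) - q0 x * g (flow_m0 x))).
    - by meas.
    - by apply: L1B; exact: Lqg.
    apply: aeW => x; rewrite primZ; last first.
      by apply: (@L1_bnd _ _ _ mT _ C) => //; exact: M2_2.
    by rewrite gn; ring.
  rewrite -(Int_primt t Lq0) -(IntD (Lqg _ mm0) Lp); apply: Int_ae; [by meas|by meas|].
  apply: aeS nmt => x <-; rewrite primZ; last first.
    by apply: (@L1_bnd _ _ _ mT _ C) => //; exact: M2_2.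
  by rewrite gn; ring.
rewrite E addrCA -primD//; congr (_ + _); apply: prim_ae.
- by rewrite /K0; meas.
- by meas.
apply: aeS3 (LL1 Lq0) (LL1 LK0) nm => s L0 LK nms.
rewrite -(IntD LK L0); apply: Int_ae.
- have [? ? ? ?] : [/\ M1 (F s), M1 (b s), M1 (g1 s) & M1 (D s)] by split; exact: M2_1.
  by meas.
- by have ? := M2_1 s mF; have ? := M2_1 s mm; meas.
by apply: aeS nms => x nx; rewrite /b /g1 nx /D; ring.
Qed.

End weak_law.

Definition flow_X t y := circle_inv (J t) (flow_k t) y.
Definition flow_X0 y := circle_inv J0 0 y.

Lemma flow_M2X : M2 flow_X.
Proof.
have M2_inv (k : R -> R) (P : R -> R -> R) : M1 k -> M2 P ->
    M2 (fun t y => Int mX (fun x => when (k t + P t x < k t + frac (y - k t)) 1)).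
  by have ? := @M1_frac R; move=> ? ?; meas.
exact: (M2_inv flow_k (fun t x => prim 1 (J t) x) mk (M2_primx mJ)).
Qed.

Lemma flow_M1X0 : M1 flow_X0.
Proof. by have ? := @M1_frac R; rewrite /flow_X0 /circle_inv; meas. Qed.
Let mX1 := flow_M2X.
Let mX0 := flow_M1X0.

Lemma flow_CV t f g : L1 mX f -> M1 g -> (forall y, g (y + 1) = g y) ->
  (exists C, forall y, `|g y| <= C) ->
  L1 mX (fun y => f (flow_X t y) / J t (flow_X t y) * g y) /\
  Int mX (fun y => f (flow_X t y) / J t (flow_X t y) * g y) =
  Int mX (fun x => f x * g (flow_m t x)).
Proof.
move=> Lf mg pg [C gC]; have [mJt mmt] : M1 (J t) /\ M1 (flow_m t) by split; exact: M2_1.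
have mf : M1 (fun x => f x / J t x) by have ? : M1 f := L1_meas Lf; meas.
have E : (fun x => f x * g (flow_m t x)) =
    (fun x => f x / J t x * g (flow_k t + prim 1 (J t) x) * J t x).
  by apply/funext => x; rewrite [RHS]mulrAC divfK// gt_eqF.
have LE : L1 mX (fun x => f x / J t x * g (flow_k t + prim 1 (J t) x) * J t x).
  rewrite -E; apply: (L1Mr Lf _ (fun x => gC _)).
  by meas.
have [H1 H2] := circle_change_inv mJt Jl0 (flow_Jb fl t) (flow_IJ fl t) mf pg mg LE.
by split; [exact: H1|rewrite E; exact: H2].
Qed.

Let CV0 f g : L1 mX f -> M1 g -> (forall y, g (y + 1) = g y) ->
  (exists C, forall y, `|g y| <= C) ->
  L1 mX (fun y => f (flow_X0 y) / J0 (flow_X0 y) * g y) /\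
  Int mX (fun y => f (flow_X0 y) / J0 (flow_X0 y) * g y) =
  Int mX (fun x => f x * g (flow_m0 x)).
Proof.
move=> Lf mg pg [C gC].
have mf : M1 (fun x => f x / J0 x) by have ? : M1 f := L1_meas Lf; meas.
have E : (fun x => f x * g (flow_m0 x)) =
    (fun x => f x / J0 x * g (0 + prim 1 J0 x) * J0 x).
  by apply/funext => x; rewrite [RHS]mulrAC divfK// gt_eqF.
have LE : L1 mX (fun x => f x / J0 x * g (0 + prim 1 J0 x) * J0 x).
  rewrite -E; apply: (L1Mr Lf _ (fun x => gC _)).
  by meas.
have [H1 H2] := circle_change_inv mJ0 Jl0 (flow_J0b fl) (flow_IJ0 fl) mf pg mg LE.
by split; [exact: H1|rewrite E; exact: H2].
Qed.

Lemma flow_LL f : LL mT mX f ->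
  LL mT mX (fun t y => f t (flow_X t y) / J t (flow_X t y)).
Proof.
move=> Lf; have mf : M2 f := L1_meas Lf.
have [La _] := LL_Int1 (LL_abs Lf).
apply: (@LL_iter _ _ _ _ _ mT mX _ (fun t => Int mX (fun x => `|f t x|))) La.
  by meas.
have B1 : exists C : R, forall y : R, `|1 : R| <= C by exists 1 => y; rewrite normr1.
apply: aeS (LL1 Lf) => t Lft.
have [H1 _] := flow_CV t Lft (measurable_cst _) (fun=> erefl) B1.
have [_ H2] := flow_CV t (L1_abs Lft) (measurable_cst _) (fun=> erefl) B1.
split.
  by move: H1; congr (L1 mX _); apply/funext => y; rewrite mulr1.
rewrite [leRHS](_ : _ = Int mX (fun x => `|f t x| * 1)); last first.
  by apply: Int_eq => x; rewrite mulr1.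
rewrite -H2; apply: Int_le => [||y]; last by rewrite mulr1 normrM normfV (gtr0_norm (Jp _ _)).
- by apply: L1_abs; move: H1; congr (L1 mX _); apply/funext => y; rewrite mulr1.
- by have [] := flow_CV t (L1_abs Lft) (measurable_cst _) (fun=> erefl) B1.
Qed.

(** The function [g (flow_m r x)] is only Lipschitz, hence no test function for [wdx]. Both factors
    are written as a constant plus a primitive, and the constants drop out because [fx] and [b] have
    mean zero. *)
Lemma flow_ibp f fx g : LL mT mX f -> LL mT mX fx -> wdx T f fx -> test1 g ->
  {ae mT, forall r, Int mX (fun x => f r x * (derive1 g (flow_m r x) * J r x)) =
    - Int mX (fun x => fx r x * g (flow_m r x))}.
Proof.
move=> Lf Lfx wf tg; have mg := test1_M1 tg; have mg' := test1_M1 (test1_derive1 tg).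
have [C C0 gC] := test1_bounded tg; have [C' C'0 g'C] := test1_bounded (test1_derive1 tg).
pose b t x := derive1 g (flow_m t x) * J t x.
have mb : M2 b by rewrite /b; meas.
have bC t x : `|b t x| <= C' * Jh by rewrite normrM ler_pM.
apply: aeS3 (LL1 Lf) (LL1 Lfx) (wdx_prim Lf Lfx wf) => r Lfr Lfxr [I0 fE].
have [mbr mmr] : M1 (b r) /\ M1 (flow_m r) by split; exact: M2_1.
have mfr : M1 (f r) := L1_meas Lfr; have mfxr : M1 (fx r) := L1_meas Lfxr.
have Lb : L1 mX (b r) := L1_bnd mX mbr (bC r).
have Lpb : L1 mX (fun x => b r x * prim 1 (fx r) x) := L1M mbr (bC r) (L1_primx Lfxr).
have Lsp : L1 mX (fun x => fx r x * g (flow_m r x)).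
  by apply: (L1Mr Lfxr _ (fun x => gC _)); meas.
transitivity (Int mX (fun x => kap f fx r * b r x + b r x * prim 1 (fx r) x)).
  by apply: Int_ae; [by have ? := M2_1 r mJ; meas|by meas|]; apply: aeS fE => x ->; rewrite /b; ring.
rewrite (IntD (L1Z _ Lb) Lpb) (IntZ _ Lb) (flow_chain0 tg) mulr0 add0r.
have -> : Int mX (fun x => fx r x * g (flow_m r x)) = Int mX (fun x => fx r x * prim 1 (b r) x).
  have Lp : L1 mX (fun x => fx r x * prim 1 (b r) x).
    exact: (L1Mr Lfxr (measurable_prim 1 mbr) (fun x => prim_abs x Lb)).
  transitivity (Int mX (fun x => g (flow_k r) * fx r x + fx r x * prim 1 (b r) x)).
    by apply: Int_eq => x; rewrite (flow_chain tg) -/(b r); ring.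
  by rewrite (IntD (L1Z _ Lfxr) Lp) (IntZ _ Lfxr) I0 mulr0 add0r.
by rewrite (ibp0 Lfxr Lb I0) opprK.
Qed.

(** In [flow_weak] the convective flux [q u] cancels and [- s] alone meets the derivative of
    [g (flow_m)]. That derivative is moved onto [s] by [flow_ibp], [flow_CV] passes to the mass
    coordinate, and [test1_complete] removes [g]. *)
Theorem flow_lagrange (q s sx : R -> R -> R) (q0 : R -> R) (Q : R) :
  M2 q -> (forall t x, `|q t x| <= Q) -> M1 q0 -> (forall x, `|q0 x| <= Q) ->
  LL mT mX s -> LL mT mX sx -> wdx T s sx ->
  claw T q (fun t x => q t x * u t x - s t x) q0 ->
  {ae mT, forall t, {ae mX, forall y, q t (flow_X t y) / J t (flow_X t y) =
    q0 (flow_X0 y) / J0 (flow_X0 y) +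
    prim T (fun s => sx s (flow_X s y) / J s (flow_X s y)) t}}.
Proof.
move=> mq qQ mq0 q0Q Ls Lsx ws law.
have Lq t : L1 mX (q t) by apply: (@L1_bnd _ _ _ mX _ Q) => //; exact: M2_1.
have Lq0 : L1 mX q0 := L1_bnd mX mq0 q0Q.
have [ms msx] : M2 s /\ M2 sx by split; [exact: L1_meas Ls|exact: L1_meas Lsx].
have LF : LL mT mX (fun t x => q t x * u t x - s t x).
  apply: LLB => //; apply: (@LL_bnd _ _ _ _ _ mT mX _ (Q * Uh)); first by meas.
  by move=> t x; rewrite normrM ler_pM// (flow_ub fl).
have LS := flow_LL Lsx.
pose S t y := sx t (flow_X t y) / J t (flow_X t y).
have mS : M2 S by rewrite /S; meas.
pose Df t y := q t (flow_X t y) / J t (flow_X t y) -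
  (q0 (flow_X0 y) / J0 (flow_X0 y) + prim T (S^~ y) t).
have mDf : M2 Df by rewrite /Df; meas.
have B1 : exists C : R, forall y : R, `|1 : R| <= C by exists 1 => y; rewrite normr1.
have LPS := LL_primt LS.
have LDt : {ae mT, forall t, L1 mX (Df t)}.
  apply: aeS (LL1 LPS) => t LPt; apply: L1B; last apply: L1D => //.
  - have [H _] := flow_CV t (Lq t) (measurable_cst _) (fun=> erefl) B1.
    by move: H; congr (L1 mX _); apply/funext => y; rewrite mulr1.
  - have [H _] := CV0 Lq0 (measurable_cst _) (fun=> erefl) B1.
    by move: H; congr (L1 mX _); apply/funext => y; rewrite mulr1.
suff : {ae mT, forall t, {ae mX, forall y, Df t y = 0}}.
  by apply: aeS => t; apply: aeS => y /eqP; rewrite subr_eq0 => /eqP.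
apply: test1_complete => // g tg.
have mg := test1_M1 tg; have mg' := test1_M1 (test1_derive1 tg).
have [C C0 gC] := test1_bounded tg; have [C' C'0 g'C] := test1_bounded (test1_derive1 tg).
have pg : forall y, g (y + 1) = g y by case: tg.
have Bg : exists C, forall y, `|g y| <= C by exists C.
have LSg : LL mT mX (fun t y => S t y * g y).
  by apply: (LLMr LS _ (fun _ y => gC y)); meas.
pose b t x := derive1 g (flow_m t x) * J t x.
have mb : M2 b by rewrite /b; meas.
have bC t x : `|b t x| <= C' * Jh by rewrite normrM ler_pM.
have H := flow_weak mq qQ mq0 q0Q LF law tg.
apply: aeS2 H (LL1 LPS) => t E LPt.
have [Lq1 Iq1] := flow_CV t (Lq t) mg pg Bg.
have [L01 I01'] := CV0 Lq0 mg pg Bg.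
have LP1 : L1 mX (fun y => prim T (S^~ y) t * g y) := L1Mr LPt mg gC.
have -> : Int mX (fun x => Df t x * g x) =
    Int mX (fun y => q t (flow_X t y) / J t (flow_X t y) * g y) -
    (Int mX (fun y => q0 (flow_X0 y) / J0 (flow_X0 y) * g y) +
     Int mX (fun y => prim T (S^~ y) t * g y)).
  rewrite -(IntD L01 LP1) -(IntB Lq1 (L1D L01 LP1)); apply: Int_eq => y.
  by rewrite /Df; ring.
rewrite Iq1 I01' E; apply/eqP; rewrite subr_eq0 (inj_eq (addrI _)); apply/eqP.
transitivity (prim T (fun s => Int mX (fun y => S s y * g y)) t); last first.
  rewrite -(Int_primt t LSg); apply: Int_ae; [by meas|by meas|].
  by apply: aeS (LL2 LS) => y Ly; rewrite mulrC -primZ//; congr (prim T _ t); apply/funext => r; rewrite mulrC.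
apply: prim_ae; [by have ? := flow_M2m; meas|by meas|].
apply: aeS3 (LL1 Ls) (LL1 Lsx) (flow_ibp Ls Lsx ws tg) => r Lsr Lsxr ibp.
have [_ ->] := flow_CV r Lsxr mg pg Bg.
have [mbr msr] : M1 (b r) /\ M1 (s r) by split; exact: M2_1.
have Lsb : L1 mX (fun x => s r x * b r x) := L1Mr Lsr mbr (bC r).
rewrite -[RHS]opprK -[X in _ = - X]ibp -(IntN Lsb); apply: Int_eq => x; rewrite /b; ring.
Qed.

Lemma flow_wdx f fx : LL mT mX f -> LL mT mX fx -> wdx T f fx ->
  LL mT mX (fun t y => f t (flow_X t y)) /\
  wdx T (fun t y => f t (flow_X t y)) (fun t y => fx t (flow_X t y) / J t (flow_X t y)).
Proof.
move=> Lf Lfx wf; have LfJ : LL mT mX (fun t x => f t x * J t x) := LLMr Lf mJ Jn.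
have E t y : f t (flow_X t y) = f t (flow_X t y) * J t (flow_X t y) / J t (flow_X t y).
  by rewrite mulfK// gt_eqF.
split.
  by have := flow_LL LfJ; congr (L1 _ _); apply/funext => z; rewrite -E.
move=> g tg; have tg' := test1_derive1 tg.
have [mg mg'] := (test1_M1 tg, test1_M1 tg').
have [C C0 gC] := test1_bounded tg; have [C' C'0 g'C] := test1_bounded tg'.
have Bg : exists C, forall y, `|g y| <= C by exists C.
have Bg' : exists C, forall y, `|derive1 g y| <= C by exists C'.
have [_ pg] := tg; have [_ pg'] := tg'.
apply: aeS3 (LL1 LfJ) (LL1 Lfx) (flow_ibp Lf Lfx wf tg) => t Lt Lxt ibp.
have [_ ->] := flow_CV t Lxt mg pg Bg; rewrite -ibp.
have [_ H] := flow_CV t Lt mg' pg' Bg'.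
rewrite [RHS](@Int_eq _ _ _ mX _ (fun x => f t x * J t x * derive1 g (flow_m t x))); last first.
  by move=> x; ring.
by rewrite -H; apply: Int_eq => y; rewrite -E.
Qed.

Lemma flow_ae_eq f g : M2 f -> M2 g -> {ae pr mT mX, forall z, f z.1 z.2 = g z.1 z.2} ->
  {ae pr mT mX, forall z, f z.1 (flow_X z.1 z.2) = g z.1 (flow_X z.1 z.2)}.
Proof.
move=> mf mg E.
apply: (@ae_pr_eq _ _ _ _ _ mT mX (fun t y => f t (flow_X t y)) (fun t y => g t (flow_X t y))).
- by meas.
- by meas.
apply: aeS (ae_pr1 E) => t Et.
exact: (ae_circle (flow_k t) (M2_1 t mJ) Jl0 (flow_Jb fl t) (flow_IJ fl t) Et).
Qed.

Lemma flow_eq_ae f g : M2 f -> M2 g ->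
  {ae pr mT mX, forall z, f z.1 (flow_X z.1 z.2) = g z.1 (flow_X z.1 z.2)} ->
  {ae pr mT mX, forall z, f z.1 z.2 = g z.1 z.2}.
Proof.
move=> mf mg E; apply: (@ae_pr_eq _ _ _ _ _ mT mX f g) => //.
apply: aeS (ae_pr1 E) => t Et.
have := circle_ae (flow_k t) (M2_1 t mJ) Jl0 (flow_Jb fl t) (flow_IJ fl t) Et.
apply: aeS2 (lebI_in 1) => x x01 /=.
by rewrite /flow_X (circle_invK (flow_k t) (M2_1 t mJ) Jl0 (flow_Jb fl t) (flow_IJ fl t) x01).
Qed.

(** As a length, [flow_X] could reach the value [1]; pulling back [frac x = x], which holds almost
    everywhere, excludes it up to a null set. *)
Lemma flow_X_itv : {ae pr mT mX, forall z, 0 <= flow_X z.1 z.2 < 1}.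
Proof.
have mfr := @M1_frac R.
have H : {ae pr mT mX, forall z, flow_X z.1 z.2 = frac (flow_X z.1 z.2)}.
  apply: (@ae_pr_eq _ _ _ _ _ mT mX flow_X (fun t y => frac (flow_X t y))) => //; first by meas.
  apply: aeW => t.
  have := ae_circle (flow_k t) (M2_1 t mJ) Jl0 (flow_Jb fl t) (flow_IJ fl t) (@frac_ae R).
  by apply: aeS => y ->.
by apply: aeS H => z ->; exact: frac_itv.
Qed.

End flow.

(** * Uniqueness in Lagrangian coordinates *)

Section gronwall.
Context (R : realType).

Lemma prim_pow (T : R) (h : R -> R) k t : L1 (lebI T) h ->
  L1 (lebI T) (fun s => h s * prim T h s ^+ k) /\
  prim T (fun s => h s * prim T h s ^+ k) t *+ k.+1 = prim T h t ^+ k.+1.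
Proof.
move=> Lh; elim: k t => [|k IH] t.
  have E : (fun s => h s * prim T h s ^+ 0) = h.
    by apply/funext => s; rewrite expr0 mulr1.
  by rewrite E expr1 mulr1n.
have [Lk _] := IH t.
have LZ := L1Z k.+1%:R Lk.
have EZ s : prim T (fun s => k.+1%:R * (h s * prim T h s ^+ k)) s = prim T h s ^+ k.+1.
  by rewrite primZ// mulr_natl; case: (IH s).
have L2 : L1 (lebI T) (fun s => h s * prim T h s ^+ k.+1).
  have := L1_mul_prim Lh LZ; congr (L1 _ _).
  by apply/funext => s; rewrite EZ.
split=> //; rewrite exprS -[in RHS](EZ t) prim_mul//.
rewrite -[LHS]mulr_natl -(primZ _ _ L2); congr (prim T _ t); apply/funext => s.
by rewrite EZ exprS -[k.+2%:R]natr1; ring.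
Qed.

(** Iterating the inequality [k] times gives [e <= B (prim T h)^k / k!], the general term of an
    exponential series up to a factor. The iteration respects null sets, as is required of an [e]
    controlled at almost every time only. *)
Lemma gronwall (T B : R) (h e : R -> R) : L1 (lebI T) h -> (forall t, 0 <= h t) ->
  M1 e -> (forall t, 0 <= e t <= B) ->
  {ae lebI T, forall t, e t <= prim T (fun s => h s * e s) t} ->
  {ae lebI T, forall t, e t = 0}.
Proof.
move=> Lh h0 me eB le.
have Lhe : L1 (lebI T) (fun s => h s * e s).
  have eb s : `|e s| <= B by have /andP[e0 eb] := eB s; rewrite ger0_norm.
  exact: L1Mr Lh me eb.
have p0 t : 0 <= prim T h t by apply: Int_ge0 => s; rewrite /when; case: ifP.
pose H := Int (lebI T) h.
have pH t : prim T h t <= H.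
  by apply: Int_le => // [|s]; [exact: L1_when1|rewrite /when; case: ifP].
have H0 : 0 <= H := le_trans (p0 0) (pH 0).
have B0 : 0 <= B by have /andP[] := eB 0; exact: le_trans.
have step k : {ae lebI T, forall t, e t <= B * (prim T h t ^+ k / k`!%:R)}.
  elim: k => [|k IH].
    by apply: aeW => t; rewrite expr0 fact0 divr1 mulr1; have /andP[] := eB t.
  apply: aeS le => t et; apply: le_trans et _.
  have [Lk Ek] := prim_pow k t Lh.
  apply: (@le_trans _ _ (prim T (fun s => (B / k`!%:R) * (h s * prim T h s ^+ k)) t)).
    apply: prim_le_ae => //; first exact: L1Z.
    apply: aeS IH => s es _; apply: le_trans (ler_wpM2l (h0 s) es) _.
    by rewrite le_eqVlt; apply/orP; left; apply/eqP; ring.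
  rewrite (primZ _ _ Lk) -Ek factS natrM; set p := prim T _ t.
  rewrite -[p *+ _]mulr_natl le_eqVlt; apply/orP; left; apply/eqP.
  have : k`!%:R != 0 :> R by rewrite pnatr_eq0 -lt0n fact_gt0.
  have : k.+1%:R != 0 :> R by rewrite pnatr_eq0.
  by move: (k`!%:R) (k.+1%:R) => f N N0 f0; field; rewrite N0 f0.
have := ae_nat step; apply: aeS => t et.
apply/eqP; rewrite eq_le; have /andP[-> _] := eB t; rewrite andbT.
have c0 : B * exp_coeff H k @[k --> \oo] --> B * 0.
  by apply: cvgMr; exact: cvg_series_cvg_0 (is_cvg_series_exp_coeff H).
rewrite mulr0 in c0; rewrite -(cvg_lim (@Rhausdorff R) c0).
apply: limr_ge; first by apply/cvg_ex; exists 0.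
apply: nearW => k; apply: le_trans (et k) _; rewrite ler_wpM2l// /exp_coeff.
by rewrite ler_wpM2r ?invr_ge0// lerXn2r// nnegrE.
Qed.

End gronwall.

(** * The pointwise energy inequality *)

Section energy_inequality.
Context (R : realType).

Lemma quadratic_le (al b p : R) : 0 < al -> b * p - al * p ^+ 2 <= b ^+ 2 / (4 * al).
Proof.
move=> al0; have -> : b ^+ 2 / (4 * al) = b * p - al * p ^+ 2 + al * (p - b / (2 * al)) ^+ 2.
  by field; rewrite gt_eqF.
by rewrite lerDl mulr_ge0 ?sqr_ge0// ltW.
Qed.

(** Seen as a polynomial in [p = P1 - P2], the left side has leading coefficient [- mu / v1], at
    most [- al]. With [V] and [z] the differences of volume and of [cv] times temperature, the
    linear coefficient is [O((1 + a)(|V| + |z|))] and the free term [O] of the square of that;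
    completing the square absorbs [p]. *)
Lemma stress_inequality (K ml mh kh cl : R) : 0 < K -> 0 < ml -> 0 < cl -> 0 <= kh -> ml <= mh ->
  exists2 C, 0 <= C & forall a v1 v2 S1 S2 P1 P2 t1 t2 mu k cv : R,
  K^-1 <= v1 <= K -> ml <= mu <= mh -> `|k| <= kh -> cl <= cv ->
  `|S1| <= a -> `|S2| <= a -> `|t1| <= K ->
  v1 * S1 = mu * P1 - k * t1 -> v2 * S2 = mu * P2 - k * t2 ->
  - ((S1 - S2) * (P1 - P2)) + (v1 - v2) * (P1 - P2) +
    cv * (t1 - t2) * (S1 * P1 - S2 * P2) <=
  C * (1 + a ^+ 2) * ((v1 - v2) ^+ 2 + (cv * (t1 - t2)) ^+ 2).
Proof.
move=> K0 ml0 cl0 kh0 mlh.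
have mh0 : 0 < mh by exact: lt_le_trans mlh.
have [K0' ml0'] := (ltW K0, ltW ml0); have [cl0' mh0'] := (ltW cl0, ltW mh0).
(* In units of [A = 1 + a] and [q = |V| + |z|]: [c1] bounds the part [w] of the stress difference
   free of [p], [c2] bounds [P1], [c3] the linear coefficient and [c4] the free term. *)
pose c1 := kh / cl + 1; pose c2 := K * (1 + kh) / ml.
pose c3 := K * c1 + 1 + (K * mh * c2 + 1); pose c4 := c2 * K * c1; pose al := K^-1 * ml.
have c10 : 0 <= c1 by rewrite addr_ge0// divr_ge0// ltW.
have c20 : 0 <= c2 by rewrite divr_ge0 ?mulr_ge0 ?addr_ge0// ltW.
have c30 : 0 <= c3 := addr_ge0 (addr_ge0 (mulr_ge0 K0' c10) ler01)
  (addr_ge0 (mulr_ge0 (mulr_ge0 K0' mh0') c20) ler01).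
have c40 : 0 <= c4 := mulr_ge0 (mulr_ge0 c20 K0') c10.
have al0 : 0 < al by rewrite mulr_gt0 ?invr_gt0.
(* The factor [4] comes from [(x + y)^2 <= 2 (x^2 + y^2)], applied to [1 + a] and to [|V| + |z|]. *)
exists (4 * (c3 ^+ 2 / (4 * al) + c4)).
  by rewrite mulr_ge0// (addr_ge0 _ c40)// divr_ge0 ?sqr_ge0// mulr_ge0// ltW.
move=> a v1 v2 S1 S2 P1 P2 t1 t2 mu k cv /andP[v1l v1h] /andP[mul muh] kb cvl S1a S2a t1b E1 E2.
have v10 : 0 < v1 by apply: lt_le_trans v1l; rewrite invr_gt0.
have mu0 : 0 < mu by exact: lt_le_trans mul.
have cv0 : 0 < cv by exact: lt_le_trans cvl.
have a0 : 0 <= a := le_trans (normr_ge0 _) S1a.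
set p := P1 - P2; set V := v1 - v2; set z := cv * (t1 - t2).
pose i := v1^-1; have i0 : 0 < i by rewrite invr_gt0.
have iK : i <= K by rewrite -[K]invrK lef_pV2 ?posrE ?invr_gt0.
have Ki : K^-1 <= i by rewrite lef_pV2 ?posrE.
pose w := k * (t1 - t2) + S2 * V.
have Ed : S1 - S2 = i * (mu * p - w).
  have v1n : v1 != 0 by rewrite gt_eqF.
  apply: (mulfI v1n); rewrite mulrA divff ?gt_eqF// mul1r /w /p /V.
  rewrite mulrBr E1; have -> : v1 * S2 = (v1 - v2) * S2 + (mu * P2 - k * t2) by rewrite -E2; ring.
  by ring.
pose be := i * w + V + z * (i * mu * P1 + S2); pose ga := - (z * P1 * (i * w)).
have -> : - ((S1 - S2) * p) + V * p + z * (S1 * P1 - S2 * P2) =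
    (be * p - (i * mu) * p ^+ 2) + ga.
  have -> : S1 * P1 - S2 * P2 = (S1 - S2) * P1 + S2 * p by rewrite /p; ring.
  by rewrite Ed /be /ga; ring.
pose q := `|V| + `|z|; pose A := 1 + a.
have q0 : 0 <= q by rewrite addr_ge0.
have A1 : 1 <= A by rewrite lerDl.
have A0 : 0 <= A by apply: le_trans A1.
have Vq : `|V| <= q by rewrite lerDl.
have zq : `|z| <= q by rewrite lerDr.
have tq : `|t1 - t2| <= q / cl.
  rewrite ler_pdivlMr// mulrC; apply: le_trans zq; rewrite normrM (gtr0_norm cv0).
  by rewrite ler_wpM2r.
have aA : a <= A by rewrite lerDr.
have wb : `|w| <= c1 * (A * q).
  apply: le_trans (ler_normD _ _) _; rewrite !normrM /c1 mulrDl mul1r; apply: lerD.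
    rewrite mulrAC; apply: (@le_trans _ _ (kh * (q / cl))); first by rewrite ler_pM.
    rewrite mulrA ler_wpM2r ?invr_ge0// ler_wpM2l//.
    by rewrite -[leLHS]mul1r ler_wpM2r.
  by apply: ler_pM => //; exact: le_trans aA.
have Pb : `|P1| <= c2 * A.
  have -> : P1 = (v1 * S1 + k * t1) / mu.
    by rewrite E1 subrK mulrC mulKf// gt_eqF.
  rewrite normrM normfV (gtr0_norm mu0) /c2 mulrAC; apply: ler_pM => //; first by rewrite invr_ge0 ltW.
    apply: le_trans (ler_normD _ _) _; rewrite !normrM (gtr0_norm v10).
    apply: (@le_trans _ _ (K * a + kh * K)).
      by apply: lerD; apply: ler_pM => //; exact: ltW.
    rewrite /A; have -> : K * (1 + kh) * (1 + a) = K * a + kh * K + (K + K * kh * a) by ring.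
    by rewrite lerDl addr_ge0 ?mulr_ge0// ltW.
  by rewrite lef_pV2 ?posrE.
have beb : `|be| <= c3 * (A * q).
  apply: le_trans (ler_normD _ _) _; rewrite /c3 mulrDl; apply: lerD.
    apply: le_trans (ler_normD _ _) _; rewrite mulrDl mul1r; apply: lerD.
      by rewrite normrM (gtr0_norm i0) -mulrA; apply: ler_pM => //; exact: ltW.
    by apply: le_trans Vq _; rewrite -[leLHS]mul1r ler_wpM2r.
  rewrite normrM [leRHS](_ : _ = q * ((K * mh * c2 + 1) * A)); last by ring.
  apply: ler_pM => //; apply: le_trans (ler_normD _ _) _; rewrite mulrDl mul1r; apply: lerD.
    rewrite !normrM (gtr0_norm i0) (gtr0_norm mu0) -[leRHS]mulrA.
    apply: ler_pM => //; first by rewrite mulr_ge0// ltW.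
    by apply: ler_pM => //; exact: ltW.
  exact: le_trans aA.
have gab : ga <= c4 * (A * q) ^+ 2.
  apply: le_trans (ler_norm _) _; rewrite normrN (normrM (z * P1)) (normrM z) (normrM i) (gtr0_norm i0).
  have -> : c4 * (A * q) ^+ 2 = (q * (c2 * A)) * (K * (c1 * (A * q))) by rewrite /c4; ring.
  have i0' := ltW i0; apply: ler_pM; [exact: mulr_ge0|exact: mulr_ge0|exact: ler_pM|].
  exact: ler_pM.
have qb : be * p - (i * mu) * p ^+ 2 <= c3 ^+ 2 / (4 * al) * (A * q) ^+ 2.
  apply: (@le_trans _ _ (be * p - al * p ^+ 2)).
    rewrite lerD2l lerN2 ler_wpM2r ?sqr_ge0//; apply: ler_pM => //.
    by rewrite invr_ge0.
  apply: le_trans (quadratic_le be p al0) _.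
  rewrite -[leRHS]mulrAC ler_wpM2r ?invr_ge0 ?(mulr_ge0 _ (ltW al0))//.
  by rewrite -exprMn -[be ^+ 2]real_normK ?num_real// lerXn2r ?nnegrE ?mulr_ge0.
apply: le_trans (lerD qb gab) _; rewrite -mulrDl.
set c5 := _ + c4; have c50 : 0 <= c5 by rewrite addr_ge0// divr_ge0 ?sqr_ge0// mulr_ge0// ltW.
have -> : 4 * c5 * (1 + a ^+ 2) * (V ^+ 2 + z ^+ 2) =
  c5 * ((2 * (1 + a ^+ 2)) * (2 * (`|V| ^+ 2 + `|z| ^+ 2))).
  by rewrite !real_normK ?num_real//; ring.
rewrite ler_wpM2l// exprMn; have sq2 (x y : R) : (x + y) ^+ 2 <= 2 * (x ^+ 2 + y ^+ 2).
  rewrite -subr_ge0 (_ : _ - _ = (x - y) ^+ 2) ?sqr_ge0//; ring.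
apply: ler_pM; [exact: sqr_ge0|exact: sqr_ge0| |exact: sq2].
by have := sq2 1 a; rewrite expr1n.
Qed.

End energy_inequality.

(** * The difference of two Lagrangian solutions *)

Section lagrangian_uniqueness.
Context (R : realType).
Local Notation RR := (measurableTypeR R).
Local Notation mX := (@lebI R 1).

Lemma wdxB T (f g f' g' : R -> R -> R) : LL (lebI T) mX f -> LL (lebI T) mX g ->
  LL (lebI T) mX f' -> LL (lebI T) mX g' -> wdx T f g -> wdx T f' g' ->
  wdx T (fun t x => f t x - f' t x) (fun t x => g t x - g' t x).
Proof.
move=> Lf Lg Lf' Lg' H H' psi tp; have tp' := test1_derive1 tp.
have HL := aeS2 (fun t a b => conj a b) (LL1 Lf) (LL1 Lg).
have HL' := aeS2 (fun t a b => conj a b) (LL1 Lf') (LL1 Lg').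
have HH := aeS2 (fun t a b => conj a b) (H _ tp) (H' _ tp).
apply: aeS3 HL HL' HH => t [ft gt] [ft' gt'] [E E'].
transitivity (Int mX (fun x => f t x * derive1 psi x) - Int mX (fun x => f' t x * derive1 psi x)).
  rewrite -(IntB (L1_test tp' ft) (L1_test tp' ft')); apply: Int_eq => x; ring.
rewrite E E' [in RHS](@Int_eq _ _ _ mX _ (fun x => g t x * psi x - g' t x * psi x)).
  by rewrite (IntB (L1_test tp gt) (L1_test tp gt')); ring.
by move=> x; ring.
Qed.

(** Integration by parts between two weakly differentiable functions, neither of which is a test
    function: each is a constant plus a primitive, and the constants meet derivatives of mean
    zero. *)
Lemma wdx_pairing T (f g f' g' : R -> R -> R) : LL (lebI T) mX f -> LL (lebI T) mX g ->
  LL (lebI T) mX f' -> LL (lebI T) mX g' -> wdx T f g -> wdx T f' g' ->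
  {ae lebI T, forall t, Int mX (fun x => f t x * g' t x) = - Int mX (fun x => g t x * f' t x)}.
Proof.
move=> Lf Lg Lf' Lg' H H'.
have HL := aeS2 (fun t a b => conj a b) (LL1 Lg) (LL1 Lg').
have HM := aeS2 (fun t a b => conj a b) (LL1 Lf) (LL1 Lf').
have HH := aeS2 (fun t a b => conj a b) (wdx_prim Lf Lg H) (wdx_prim Lf' Lg' H').
apply: aeS3 HL HM HH => t [gt gt'] [ft ft'] [[I0 E] [I0' E']].
have [mg mg'] : M1 (g t) /\ M1 (g' t) by split; [exact: L1_meas gt|exact: L1_meas gt'].
have [mf mf'] : M1 (f t) /\ M1 (f' t) by split; [exact: L1_meas ft|exact: L1_meas ft'].
have Lm a b : L1 mX a -> L1 mX b -> L1 mX (fun x => a x * prim 1 b x).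
  move=> La Lb; have mb : M1 b := L1_meas Lb.
  exact: (L1Mr La (measurable_prim 1 mb) (fun x => prim_abs x Lb)).
transitivity (Int mX (fun x => kap f g t * g' t x + g' t x * prim 1 (g t) x)).
  by apply: Int_ae; [by meas|by meas|]; apply: aeS E => x ->; ring.
transitivity (- Int mX (fun x => kap f' g' t * g t x + g t x * prim 1 (g' t) x)); last first.
  congr (- _); apply: Int_ae; [by meas|by meas|].
  by apply: aeS E' => x ->; ring.
rewrite (IntD (L1Z _ gt') (Lm _ _ gt' gt)) (IntD (L1Z _ gt) (Lm _ _ gt gt')).
by rewrite (IntZ _ gt) (IntZ _ gt') I0 I0' (ibp0 gt gt' I0); move: (Int _ _) => w; ring.
Qed.

Lemma energy_identity T (D f : R -> R -> R) (B : R) : M2 D -> (forall t y, `|D t y| <= B) ->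
  LL (lebI T) mX f -> {ae pr (lebI T) mX, forall z, D z.1 z.2 = prim T (f^~ z.2) z.1} ->
  {ae lebI T, forall t, Int mX (fun y => D t y ^+ 2) =
    prim T (fun s => Int mX (fun y => 2 * (D s y * f s y))) t}.
Proof.
move=> mD DB Lf E; have mf : M2 f := L1_meas Lf.
have LDf := LLZ 2 (LLM mD DB Lf).
apply: aeS (ae_pr1 E) => t Et; rewrite -(Int_primt t LDf).
have mDt : M1 (D t) by exact: M2_1.
apply: Int_ae; [by meas|by meas|].
apply: aeS3 Et (ae_pr2 E) (LL2 Lf) => y /= -> Ey Lfy.
rewrite expr2 (prim_mul t Lfy Lfy); apply: prim_ae; [by meas|by meas|].
by apply: aeS Ey => s /= ->; ring.
Qed.

(* [v], [U], [Th], [Sg] are specific volume, velocity, temperature and stress as functions of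
   time and mass coordinate; [Pp] and [S] are the derivatives of [U] and [Sg] in the latter. *)
Record lsol (P : params R) (T K : R) (a v0 C0 u0 e0 : R -> R)
    (v U Th Sg Pp S : R -> R -> R) : Prop := Lsol {
  ls_v : M2 v; ls_U : M2 U; ls_Th : M2 Th;
  ls_vb : forall t y, K^-1 <= v t y <= K;
  ls_Ub : forall t y, `|U t y| <= K;
  ls_Thb : forall t y, `|Th t y| <= K;
  ls_Sg : LL (lebI T) mX Sg; ls_Pp : LL (lebI T) mX Pp; ls_S : LL (lebI T) mX S;
  ls_wU : wdx T U Pp; ls_wS : wdx T Sg S;
  ls_stress : {ae pr (lebI T) mX, forall z, v z.1 z.2 * Sg z.1 z.2 =
    muc P (C0 z.2) * Pp z.1 z.2 - (gamc P (C0 z.2) - 1) * Th z.1 z.2};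
  ls_a : {ae pr (lebI T) mX, forall z, `|Sg z.1 z.2| <= a z.1};
  ls_ev : {ae pr (lebI T) mX, forall z, v z.1 z.2 = v0 z.2 + prim T (Pp^~ z.2) z.1};
  ls_eU : {ae pr (lebI T) mX, forall z, U z.1 z.2 = u0 z.2 + prim T (S^~ z.2) z.1};
  ls_eTh : {ae pr (lebI T) mX, forall z, cvc P (C0 z.2) * Th z.1 z.2 =
    e0 z.2 + prim T (fun s => Sg s z.2 * Pp s z.2) z.1} }.

Lemma primB_ae T (f g : R -> R -> R) : LL (lebI T) mX f -> LL (lebI T) mX g ->
  {ae pr (lebI T) mX, forall z, prim T (f^~ z.2) z.1 - prim T (g^~ z.2) z.1 =
    prim T (fun s => f s z.2 - g s z.2) z.1}.
Proof.
move=> Lf Lg; have [mf mg] : M2 f /\ M2 g by split; [exact: L1_meas Lf|exact: L1_meas Lg].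
apply: (@ae_pr_eq _ _ _ _ _ (lebI T) mX
  (fun t y => prim T (f^~ y) t - prim T (g^~ y) t)
  (fun t y => prim T (fun s => f s y - g s y) t)); [by meas|by meas|].
by apply: aeW => t; apply: aeS2 (LL2 Lf) (LL2 Lg) => y fy gy; rewrite primB.
Qed.

Lemma params_bounds (P : params R) : params_ok P -> exists ml mh kh cl ch : R,
  [/\ 0 < ml, ml <= mh, 0 <= kh, 0 < cl & 0 <= ch] /\ forall c : R, 0 <= c <= 1 ->
  [/\ ml <= muc P c <= mh, `|gamc P c - 1| <= kh & cl <= cvc P c <= ch].
Proof.
move=> [m1 [m2 [g1 [g2 [c1 c2]]]]].
have mix (p q c : R) : 0 < p -> 0 < q -> 0 <= c <= 1 ->
    Num.min p q <= c * p + (1 - c) * q <= p + q.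
  move=> p0 q0 /andP[c0 c1']; apply/andP; split; last by nra.
  by rewrite ge_min; case: (leP p q) => pq; apply/orP; [left|right]; nra.
exists (Num.min (mu_p P) (mu_m P)), (mu_p P + mu_m P),
  (gam_p P - 1 + (gam_m P - 1)), (Num.min (cv_p P) (cv_m P)), (cv_p P + cv_m P).
split.
  split; [by rewrite lt_min m1 m2|by rewrite ge_min lerDl (ltW m2)|lra|by rewrite lt_min c1 c2|lra].
move=> c c01; split; [exact: mix| |exact: mix].
have g1' : 0 < gam_p P - 1 by rewrite subr_gt0.
have g2' : 0 < gam_m P - 1 by rewrite subr_gt0.
have /andP[h1 h2] := mix _ _ c g1' g2' c01.
have -> : gamc P c - 1 = c * (gam_p P - 1) + (1 - c) * (gam_m P - 1) by rewrite /gamc; ring.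
by rewrite ger0_norm// (le_trans _ h1)// le_min !ltW.
Qed.

Section two_solutions.
Variables (P : params R) (T K : R) (a v0 C0 u0 e0 : R -> R).
Variables (v1 U1 Th1 Sg1 Pp1 S1 v2 U2 Th2 Sg2 Pp2 S2 : R -> R -> R).
Hypotheses (okP : params_ok P) (K0 : 0 < K) (mC : M1 C0) (C01 : forall y, 0 <= C0 y <= 1).
Hypotheses (a0 : forall t, 0 <= a t) (ma : M1 a) (La2 : L1 (lebI T) (fun t => a t ^+ 2)).
Hypothesis (s1 : lsol P T K a v0 C0 u0 e0 v1 U1 Th1 Sg1 Pp1 S1).
Hypothesis (s2 : lsol P T K a v0 C0 u0 e0 v2 U2 Th2 Sg2 Pp2 S2).
Local Notation mT := (lebI T).

Let mcv : M1 (fun y => cvc P (C0 y)). Proof. by rewrite /cvc; meas. Qed.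
Let W t y := U1 t y - U2 t y.
Let V t y := v1 t y - v2 t y.
(** It is [cv] times the temperature that is a time integral; the weight is common to both solutions
    and independent of time. *)
Let Z t y := cvc P (C0 y) * (Th1 t y - Th2 t y).
Let mW : M2 W. Proof. by have [? ?] := (ls_U s1, ls_U s2); rewrite /W; meas. Qed.
Let mV : M2 V. Proof. by have [? ?] := (ls_v s1, ls_v s2); rewrite /V; meas. Qed.
Let mZ : M2 Z.
Proof.
have [? ?] := (ls_Th s1, ls_Th s2).
by apply: measurable_funM; [exact: (M1_comp mcv measurable_snd)|meas].
Qed.

Let Wb t y : `|W t y| <= K + K.
Proof. by apply: le_trans (ler_normB _ _) _; apply: lerD; [exact: ls_Ub s1 _ _|exact: ls_Ub s2 _ _]. Qed.
Let vK (w : R) : K^-1 <= w <= K -> `|w| <= K.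
Proof. by move=> /andP[vl vh]; rewrite gtr0_norm// (lt_le_trans _ vl)// invr_gt0. Qed.
Let Vb t y : `|V t y| <= K + K.
Proof.
by apply: le_trans (ler_normB _ _) _; apply: lerD; apply: vK;
  [exact: ls_vb s1 _ _|exact: ls_vb s2 _ _].
Qed.
Let Zb : exists B, forall t y, `|Z t y| <= B.
Proof.
have [ml [mh [kh [cl [ch [[? ? ? cl0 ch0] H]]]]]] := params_bounds okP.
exists (ch * (K + K)) => t y; have [_ _ /andP[c1 c2]] := H _ (C01 y).
rewrite normrM; apply: ler_pM => //.
  by rewrite ger0_norm// (le_trans _ c1)// ltW.
by apply: le_trans (ler_normB _ _) _; apply: lerD; [exact: ls_Thb s1 _ _|exact: ls_Thb s2 _ _].
Qed.

Let LL_a C : LL mT mX (fun t _ => C * (1 + a t ^+ 2)).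
Proof.
have La : L1 mT (fun t => C * (1 + a t ^+ 2)) by apply: L1Z; apply: L1D => //; exact: L1_cst.
by have := LL_prod La (L1_cst mX 1); congr (L1 _ _); apply/funext => z; rewrite mulr1.
Qed.

(** The stress law bounds [Pp] by a constant times [1 + a], so its product with any stress bounded
    by [a] is [O(1 + a^2)]. Taking [Sg'] from the other solution covers the mixed products in
    [dP * dSg]. *)
Let LL_SP Sg Pp v Th Sg' : LL mT mX Sg' -> LL mT mX Pp ->
  (forall t y : R, K^-1 <= v t y <= K) -> (forall t y : R, `|Th t y| <= K) ->
  {ae pr mT mX, forall z, v z.1 z.2 * Sg z.1 z.2 =
    muc P (C0 z.2) * Pp z.1 z.2 - (gamc P (C0 z.2) - 1) * Th z.1 z.2} ->
  {ae pr mT mX, forall z, `|Sg z.1 z.2| <= a z.1} ->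
  {ae pr mT mX, forall z, `|Sg' z.1 z.2| <= a z.1} ->
  LL mT mX (fun t y => Sg' t y * Pp t y).
Proof.
move=> LS LP vb Thb st Sa S'a.
have [ml [mh [kh [cl [ch [[ml0 mlh kh0 cl0 ch0] H]]]]]] := params_bounds okP.
have [mS mP] : M2 Sg' /\ M2 Pp by split; [exact: L1_meas LS|exact: L1_meas LP].
apply: (@L1_le_ae _ _ _ (pr mT mX) _ (fun z => K * (1 + kh) / ml * (1 + a z.1 ^+ 2))).
- by meas.
- exact: LL_a.
apply: aeS3 st Sa S'a => z E Sz S'z; have [/andP[m1 m2] k1 _] := H _ (C01 z.2).
have mu0 : 0 < muc P (C0 z.2) by exact: lt_le_trans m1.
have -> : Pp z.1 z.2 = (v z.1 z.2 * Sg z.1 z.2 + (gamc P (C0 z.2) - 1) * Th z.1 z.2) / muc P (C0 z.2).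
  by rewrite E subrK mulrC mulKf// gt_eqF.
have Pb : `|v z.1 z.2 * Sg z.1 z.2 + (gamc P (C0 z.2) - 1) * Th z.1 z.2| <= K * a z.1 + kh * K.
  apply: le_trans (ler_normD _ _) _; rewrite !normrM.
  by apply: lerD; apply: ler_pM => //; exact: vK.
rewrite normrM normrM normfV (gtr0_norm mu0) mulrA [leRHS]mulrAC.
have A0 := a0 z.1.
apply: ler_pM; [by rewrite mulr_ge0|by rewrite invr_ge0 ltW| |by rewrite lef_pV2 ?posrE].
apply: (@le_trans _ _ (a z.1 * (K * a z.1 + kh * K))); first by apply: ler_pM.
(* The difference is [K (1 + kh (a^2 - a + 1))], and [a^2 - a + 1] is [(a - 1/2)^2 + 3/4]. *)
rewrite -subr_ge0 (_ : _ - _ = K * (1 + kh * (a z.1 - 2^-1) ^+ 2 + kh * (3/4))); last by field.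
have q34 : 0 <= 3 / 4 :> R by lra.
exact: mulr_ge0 (ltW K0) (addr_ge0 (addr_ge0 ler01 (mulr_ge0 kh0 (sqr_ge0 _))) (mulr_ge0 kh0 q34)).
Qed.

Let dP t y := Pp1 t y - Pp2 t y.
Let dSg t y := Sg1 t y - Sg2 t y.
Let dS t y := S1 t y - S2 t y.
Let dN t y := Sg1 t y * Pp1 t y - Sg2 t y * Pp2 t y.
Let LdP : LL mT mX dP := LLB (ls_Pp s1) (ls_Pp s2).
Let LdSg : LL mT mX dSg := LLB (ls_Sg s1) (ls_Sg s2).
Let LdS : LL mT mX dS := LLB (ls_S s1) (ls_S s2).
Let L11 : LL mT mX (fun t y => Sg1 t y * Pp1 t y) :=
  LL_SP (ls_Sg s1) (ls_Pp s1) (ls_vb s1) (ls_Thb s1) (ls_stress s1) (ls_a s1) (ls_a s1).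
Let L22 : LL mT mX (fun t y => Sg2 t y * Pp2 t y) :=
  LL_SP (ls_Sg s2) (ls_Pp s2) (ls_vb s2) (ls_Thb s2) (ls_stress s2) (ls_a s2) (ls_a s2).
Let L12 : LL mT mX (fun t y => Sg1 t y * Pp2 t y) :=
  LL_SP (ls_Sg s1) (ls_Pp s2) (ls_vb s2) (ls_Thb s2) (ls_stress s2) (ls_a s2) (ls_a s1).
Let L21 : LL mT mX (fun t y => Sg2 t y * Pp1 t y) :=
  LL_SP (ls_Sg s2) (ls_Pp s1) (ls_vb s1) (ls_Thb s1) (ls_stress s1) (ls_a s1) (ls_a s2).
Let LdN : LL mT mX dN := LLB L11 L22.
Let LdSP : LL mT mX (fun t y => dP t y * dSg t y).
Proof.
have := LLB (LLB L11 L12) (LLB L21 L22).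
by congr (L1 _ _); apply/funext => z; rewrite /dP /dSg; ring.
Qed.

Let e t := Int mX (fun y => W t y ^+ 2) + Int mX (fun y => V t y ^+ 2) + Int mX (fun y => Z t y ^+ 2).

(** [W * dS] is the only term with a derivative of the stress. By [wdx_pairing] its integral is that
    of [- dP * dSg], after which the whole integrand is bounded pointwise by [stress_inequality]. *)
Let rate : exists2 C, 0 <= C & {ae mT, forall s,
  Int mX (fun y => 2 * (W s y * dS s y)) + Int mX (fun y => 2 * (V s y * dP s y)) +
  Int mX (fun y => 2 * (Z s y * dN s y)) <= C * (1 + a s ^+ 2) * e s}.
Proof.
have [ml [mh [kh [cl [ch [[ml0 mlh kh0 cl0 ch0] H]]]]]] := params_bounds okP.
have [C C0' HC] := stress_inequality K0 ml0 cl0 kh0 mlh.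
have [B ZB] := Zb.
exists (2 * C); first by rewrite mulr_ge0.
have LWS := LLM mW Wb LdS; have LVP := LLM mV Vb LdP; have LZN := LLM mZ ZB LdN.
have LW : LL mT mX W := LL_bnd mT mX mW Wb.
have pair : {ae mT, forall s, Int mX (fun y => W s y * dS s y) = - Int mX (fun y => dP s y * dSg s y)}.
  apply: wdx_pairing => //.
  - exact: (wdxB (LL_bnd mT mX (ls_U s1) (ls_Ub s1)) (ls_Pp s1)
      (LL_bnd mT mX (ls_U s2) (ls_Ub s2)) (ls_Pp s2) (ls_wU s1) (ls_wU s2)).
  - exact: (wdxB (ls_Sg s1) (ls_S s1) (ls_Sg s2) (ls_S s2) (ls_wS s1) (ls_wS s2)).
have pointwise : {ae pr mT mX, forall z,
    V z.1 z.2 * dP z.1 z.2 + Z z.1 z.2 * dN z.1 z.2 - dP z.1 z.2 * dSg z.1 z.2 <=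
    C * (1 + a z.1 ^+ 2) * (V z.1 z.2 ^+ 2 + Z z.1 z.2 ^+ 2)}.
  have A12 := aeS2 (fun z a b => conj a b) (ls_a s1) (ls_a s2).
  apply: aeS3 (ls_stress s1) (ls_stress s2) A12 => z E1 E2 [Sa1 Sa2].
  have [m1 k1 /andP[c1 _]] := H _ (C01 z.2).
  have := HC (a z.1) _ _ _ _ _ _ _ _ _ _ _ (ls_vb s1 z.1 z.2) m1 k1 c1 Sa1 Sa2 (ls_Thb s1 z.1 z.2) E1 E2.
  by rewrite -/(V z.1 z.2) -/(Z z.1 z.2) -/(dP z.1 z.2) -/(dN z.1 z.2) -/(dSg z.1 z.2); lra.
have HL := aeS3 (fun t a b c => And3 a b c) (LL1 LWS) (LL1 LVP) (LL1 LZN).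
have HL2 := aeS2 (fun t a b => conj a b) (LL1 LdSP) pair.
apply: aeS3 HL HL2 (ae_pr1 pointwise) => s [l1 l2 l3] [l4 pairs] pw.
rewrite (IntZ _ l1) (IntZ _ l2) (IntZ _ l3) pairs.
have LV2 : L1 mX (fun y => V s y ^+ 2).
  apply: (@L1_bnd _ _ _ mX _ ((K + K) ^+ 2)).
    by have ? : M1 (V s) := M2_1 s mV; meas.
  by move=> y; rewrite normrX lerXn2r// nnegrE// addr_ge0// ltW.
have B0 : 0 <= B := le_trans (normr_ge0 _) (ZB 0 0).
have LZ2 : L1 mX (fun y => Z s y ^+ 2).
  apply: (@L1_bnd _ _ _ mX _ (B ^+ 2)).
    by have ? : M1 (Z s) := M2_1 s mZ; meas.
  by move=> y; rewrite normrX lerXn2r// nnegrE.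
have W0 : 0 <= Int mX (fun y => W s y ^+ 2) by apply: Int_ge0 => y; exact: sqr_ge0.
have Hle : Int mX (fun y => V s y * dP s y + Z s y * dN s y - dP s y * dSg s y) <=
    Int mX (fun y => C * (1 + a s ^+ 2) * (V s y ^+ 2 + Z s y ^+ 2)).
  by apply: Int_le_ae; [exact: L1B (L1D l2 l3) l4|exact: (L1Z _ (L1D LV2 LZ2))|exact: pw].
rewrite (IntB (L1D l2 l3) l4) (IntD l2 l3) (IntZ _ (L1D LV2 LZ2)) (IntD LV2 LZ2) in Hle.
have A0 : 0 <= C * (1 + a s ^+ 2) by rewrite mulr_ge0// addr_ge0 ?sqr_ge0.
have := mulr_ge0 A0 W0; rewrite /e; move: Hle; set c := C * _.
rewrite -[2 * C * _]mulrA -/c.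
by move: (Int _ _) (Int _ _) (Int _ _) (Int _ _) (Int _ _) (Int _ _); clearbody c; intros; nra.
Qed.

Theorem lsol_unique : {ae pr mT mX, forall z, [/\ v1 z.1 z.2 = v2 z.1 z.2,
  U1 z.1 z.2 = U2 z.1 z.2 & Th1 z.1 z.2 = Th2 z.1 z.2]}.
Proof.
have [B ZB] := Zb; have [C C0' HC] := rate.
have B0 : 0 <= B := le_trans (normr_ge0 _) (ZB 0 0).
have eV : {ae pr mT mX, forall z, V z.1 z.2 = prim T (dP^~ z.2) z.1}.
  apply: aeS3 (ls_ev s1) (ls_ev s2) (primB_ae (ls_Pp s1) (ls_Pp s2)) => z E1 E2 E3.
  by rewrite -[RHS]E3 /V E1 E2; ring.
have eW : {ae pr mT mX, forall z, W z.1 z.2 = prim T (dS^~ z.2) z.1}.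
  apply: aeS3 (ls_eU s1) (ls_eU s2) (primB_ae (ls_S s1) (ls_S s2)) => z E1 E2 E3.
  by rewrite -[RHS]E3 /W E1 E2; ring.
have eZ : {ae pr mT mX, forall z, Z z.1 z.2 = prim T (dN^~ z.2) z.1}.
  apply: aeS3 (ls_eTh s1) (ls_eTh s2) (primB_ae L11 L22) => z E1 E2 E3.
  by rewrite -[RHS]E3 /Z mulrBr E1 E2; ring.
have iW := energy_identity mW Wb LdS eW.
have iV := energy_identity mV Vb LdP eV.
have iZ := energy_identity mZ ZB LdN eZ.
have [lW _] := LL_Int1 (LLZ 2 (LLM mW Wb LdS)).
have [lV _] := LL_Int1 (LLZ 2 (LLM mV Vb LdP)).
have [lZ _] := LL_Int1 (LLZ 2 (LLM mZ ZB LdN)).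
have sq (D : R -> R -> R) b t : M2 D -> (forall t y, `|D t y| <= b) ->
    L1 mX (fun y => D t y ^+ 2) /\ Int mX (fun y => D t y ^+ 2) <= b ^+ 2.
  move=> mD Db; have b0 : 0 <= b := le_trans (normr_ge0 _) (Db 0 0).
  have D2 y : `|D t y ^+ 2| <= b ^+ 2 by rewrite normrX lerXn2r// nnegrE.
  have LD : L1 mX (fun y => D t y ^+ 2).
    by apply: (@L1_bnd _ _ _ mX _ (b ^+ 2)) => //; have ? : M1 (D t) := M2_1 t mD; meas.
  split=> //; rewrite -[leRHS]mulr1 -(Int_lebI_cst (b ^+ 2) ler01).
  by apply: Int_le => // [|y]; [exact: L1_cst|exact: le_trans (ler_norm _) (D2 y)].
have sq0 (D : R -> R -> R) t : 0 <= Int mX (fun y => D t y ^+ 2).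
  by apply: Int_ge0 => y; exact: sqr_ge0.
have Lh : L1 mT (fun t => C * (1 + a t ^+ 2)) by apply: L1Z; apply: L1D => //; exact: L1_cst.
have h0 t : 0 <= C * (1 + a t ^+ 2) by rewrite mulr_ge0// addr_ge0 ?sqr_ge0.
have me : M1 e by rewrite /e; meas.
have eB t : 0 <= e t <= (K + K) ^+ 2 + (K + K) ^+ 2 + B ^+ 2.
  have [_ ?] := sq _ _ t mW Wb; have [_ ?] := sq _ _ t mV Vb; have [_ ?] := sq _ _ t mZ ZB.
  by rewrite /e !addr_ge0//=; apply: lerD => //; exact: lerD.
have Lhe : L1 mT (fun s => C * (1 + a s ^+ 2) * e s).
  have eb t : `|e t| <= (K + K) ^+ 2 + (K + K) ^+ 2 + B ^+ 2.
    by have /andP[e0' eb] := eB t; rewrite ger0_norm.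
  exact: L1Mr Lh me eb.
have le : {ae mT, forall t, e t <= prim T (fun s => C * (1 + a s ^+ 2) * e s) t}.
  apply: aeS3 iW iV iZ => t Ew Ev Ez.
  rewrite {1}/e Ew Ev Ez -(primD _ lW lV) -(primD _ (L1D lW lV) lZ).
  apply: prim_le_ae => //; first exact: (L1D (L1D lW lV) lZ).
  by apply: aeS HC => s.
have ez := gronwall Lh h0 me eB le.
have zero (D : R -> R -> R) b : M2 D -> (forall t y, `|D t y| <= b) ->
    (forall t, Int mX (fun y => D t y ^+ 2) <= e t) ->
    {ae pr mT mX, forall z, D z.1 z.2 = 0}.
  move=> mD Db De; apply: (@ae_pr_eq _ _ _ _ _ mT mX D (fun _ _ => 0)) => //.
  apply: aeS ez => t et; have [LD _] := sq _ _ t mD Db.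
  have := Int_eq0_ae LD (fun y => sqr_ge0 _); have := De t; rewrite et => De0 /(_ De0).
  by apply: aeS => y /eqP; rewrite sqrf_eq0 => /eqP.
have We t : Int mX (fun y => W t y ^+ 2) <= e t by rewrite /e -addrA lerDl addr_ge0.
have Ve t : Int mX (fun y => V t y ^+ 2) <= e t by rewrite /e addrAC lerDr addr_ge0.
have Ze t : Int mX (fun y => Z t y ^+ 2) <= e t by rewrite /e lerDr addr_ge0.
apply: aeS3 (zero _ _ mW Wb We) (zero _ _ mV Vb Ve) (zero _ _ mZ ZB Ze) => z W0 V0 Z0.
have [ml [mh [kh [cl [ch [[? ? ? cl0 ch0] H]]]]]] := params_bounds okP.
have [_ _ /andP[c1 _]] := H _ (C01 z.2).
split; apply/eqP; rewrite -subr_eq0; apply/eqP => //.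
by apply/eqP; move/eqP: Z0; rewrite mulf_eq0 gt_eqF//; exact: lt_le_trans c1.
Qed.

End two_solutions.

End lagrangian_uniqueness.

(** * Functions of the position along the flow *)

Section flow_transport.
Context (R : realType).
Local Notation RR := (measurableTypeR R).
Local Notation mX := (@lebI R 1).

Lemma test1_mul (f g : R -> R) : test1 f -> test1 g ->
  test1 (fun x => f x * g x) /\
  derive1 (fun x => f x * g x) = (fun x => derive1 f x * g x + f x * derive1 g x).
Proof.
move=> [sf pf] [sg pg]; split; last by rewrite (der_derive1 (derM (smooth_der sf) (smooth_der sg))).
split; last by move=> x; rewrite pf pg.
by apply: sm_smooth; apply: sm_mul; exact: sm_base.
Qed.

Lemma prim_wdx T (b : R -> R -> R) : LL (lebI T) mX b ->
  {ae lebI T, forall t, Int mX (b t) = 0} -> wdx T (fun t x => prim 1 (b t) x) b.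
Proof.
move=> Lb I0 psi tp; apply: aeS2 (LL1 Lb) I0 => t Lt It.
by rewrite (ibp_test Lt tp) It mulr0 sub0r.
Qed.

Variables (T Jl Jh Uh : R) (J u : R -> R -> R) (J0 : R -> R).
Hypothesis fl : flow T Jl Jh Uh J u J0.
Local Notation mT := (lebI T).
Local Notation X := (flow_X T J u J0).
Local Notation X0 := (flow_X0 J0).
Let mJ := flow_J fl.
Let mJ0 := flow_J0 fl.
Let mu := flow_u fl.
Let mX1 : M2 X := flow_M2X fl.
Let mX0 : M1 X0 := flow_M1X0 fl.

Let Jp t x : 0 < J t x.
Proof. by have /andP[+ _] := flow_Jb fl t x; apply: lt_le_trans; exact: flow_Jl fl. Qed.
Let J0p x : 0 < J0 x.
Proof. by have /andP[+ _] := flow_J0b fl x; apply: lt_le_trans; exact: flow_Jl fl. Qed.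
Let Jn t x : `|J t x| <= Jh.
Proof. by rewrite gtr0_norm//; have /andP[] := flow_Jb fl t x. Qed.
Let J0n x : `|J0 x| <= Jh.
Proof. by rewrite gtr0_norm//; have /andP[] := flow_J0b fl x. Qed.
Let Jun t x : `|J t x * u t x| <= Jh * Uh.
Proof. by rewrite normrM ler_pM// (flow_ub fl). Qed.

(* [J e(x)] is not transported as a conserved quantity of zero mean, so the time primitive of the
   mean of its source is subtracted before the Lagrangian form of the law is used. *)
Lemma flow_transport (e : R -> R) : test1 e ->
  {ae pr mT mX, forall z, e (X z.1 z.2) = e (X0 z.2) +
    prim T (fun s => u s (X s z.2) * derive1 e (X s z.2)) z.1}.
Proof.
move=> te; have te' := test1_derive1 te; have [me me'] := (test1_M1 te, test1_M1 te').
have [C C0 eC] := test1_bounded te; have [C' C'0 e'C] := test1_bounded te'.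
pose mean s := Int mX (fun x => J s x * u s x * derive1 e x).
have mmean : M1 mean by rewrite /mean; meas.
have Jue s x : `|J s x * u s x * derive1 e x| <= Jh * Uh * C'.
  by rewrite normrM ler_pM.
have LJue s : L1 mX (fun x => J s x * u s x * derive1 e x).
  by apply: (@L1_bnd _ _ _ mX _ (Jh * Uh * C')) => //;
    have ? := M2_1 s mJ; have ? := M2_1 s mu; meas.
have meanb s : `|mean s| <= Jh * Uh * C'.
  apply: le_trans (Int_abs (LJue s)) _; rewrite -[leRHS]mulr1 -(Int_lebI_cst _ ler01).
  by apply: Int_le => //; [exact: L1_abs|exact: L1_cst].
have Lmean : L1 mT mean := L1_bnd mT mmean meanb.
pose p := prim T mean; have mp : M1 p := measurable_prim T mmean.
have pb t : `|p t| <= Int mT (fun s => `|mean s|) := prim_abs t Lmean.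
set Bp := Int _ _ in pb; have Bp0 : 0 <= Bp := le_trans (normr_ge0 _) (pb 0).
pose sx t x := J t x * u t x * derive1 e x - mean t * J t x.
have msx : M2 sx by rewrite /sx; meas.
have sxb t x : `|sx t x| <= Jh * Uh * C' + Jh * Uh * C' * Jh.
  by apply: le_trans (ler_normB _ _) _; rewrite lerD// normrM ler_pM.
have Lsx : LL mT mX sx := LL_bnd mT mX msx sxb.
have LJ t : L1 mX (J t) := L1_bnd mX (M2_1 t mJ) (Jn t).
have I0 t : Int mX (sx t) = 0.
  by rewrite (IntB (LJue t) (L1Z _ (LJ t))) (IntZ _ (LJ t)) (flow_IJ fl) mulr1 subrr.
pose s t x := prim 1 (sx t) x.
have ms : M2 s by exact: M2_primx.
have Lsxt t : L1 mX (sx t) := L1_bnd mX (M2_1 t msx) (sxb t).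
have sb t x : `|s t x| <= Jh * Uh * C' + Jh * Uh * C' * Jh.
  apply: le_trans (prim_abs x (Lsxt t)) _; rewrite -[leRHS]mulr1 -(Int_lebI_cst _ ler01).
  by apply: Int_le => //; [exact: L1_abs|exact: L1_cst].
have Ls : LL mT mX s := LL_bnd mT mX ms sb.
have ws : wdx T s sx by apply: prim_wdx => //; exact: aeW.
pose q t x := J t x * (e x - p t).
have mq : M2 q by rewrite /q; meas.
have qb t x : `|q t x| <= Jh * (C + Bp).
  by rewrite normrM ler_pM//; apply: le_trans (ler_normB _ _) _; exact: lerD.
have q0b x : `|J0 x * e x| <= Jh * (C + Bp).
  by rewrite normrM ler_pM//; apply: le_trans (eC x) _; rewrite lerDl.
(* For [J e] this is the mass law tested with [e psi]; for [p J] it is the mass law tested with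
   [psi] and multiplied by [p], with the product rule in time. *)
have law : claw T q (fun t x => q t x * u t x - s t x) (fun x => J0 x * e x).
  move=> psi tp; have tp' := test1_derive1 tp; have [mpsi mpsi'] := (test1_M1 tp, test1_M1 tp').
  have [D D0 pD] := test1_bounded tp; have [D' D'0 p'D] := test1_bounded tp'.
  have [tep Eep] := test1_mul te tp.
  pose A := Int mX (fun x => J0 x * psi x).
  pose B r := Int mX (fun x => J r x * u r x * derive1 psi x).
  pose B1 r := Int mX (fun x => J r x * u r x * (derive1 e x * psi x)).
  pose B2 r := Int mX (fun x => J r x * u r x * (e x * derive1 psi x)).
  have mB : M1 B by clear mmean Lmean; rewrite /B; meas.
  have mB1 : M1 B1 by clear mmean Lmean; rewrite /B1; meas.
  have mB2 : M1 B2 by clear mmean Lmean; rewrite /B2; meas.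
  have mflux : M1 (fun r => Int mX (fun x => (q r x * u r x - s r x) * derive1 psi x)).
    by clear mmean Lmean mB mB1 mB2; meas.
  have mAB : M1 (fun r => A + prim T B r).
    exact: measurable_funD (measurable_cst A) (measurable_prim T mB).
  have mep : M1 (fun x => e x * psi x) by meas.
  have mep1 : M1 (fun x => derive1 e x * psi x) by meas.
  have mep2 : M1 (fun x => e x * derive1 psi x) by meas.
  have L1J t f b : M1 f -> (forall x, `|f x| <= b) -> L1 mX (fun x => J t x * f x).
    by move=> mf fb; exact: L1Mr (LJ t) mf fb.
  have LJu t : L1 mX (fun x => J t x * u t x).
    exact: L1Mr (LJ t) (M2_1 t mu) (flow_ub fl t).
  have L1Ju t f b : M1 f -> (forall x, `|f x| <= b) -> L1 mX (fun x => J t x * u t x * f x).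
    by move=> mf fb; exact: L1Mr (LJu t) mf fb.
  have ep x : `|e x * psi x| <= C * D by rewrite normrM ler_pM.
  have ep1 x : `|derive1 e x * psi x| <= C' * D by rewrite normrM ler_pM.
  have ep2 x : `|e x * derive1 psi x| <= C * D' by rewrite normrM ler_pM.
  have bnd f c r : M1 f -> (forall x, `|f x| <= c) ->
      `|Int mX (fun x => J r x * u r x * f x)| <= Jh * Uh * c.
    move=> mf fc; have L := L1Ju r f c mf fc.
    apply: le_trans (Int_abs L) _; rewrite -[leRHS]mulr1 -(Int_lebI_cst _ ler01).
    by apply: Int_le; [exact: L1_abs|exact: L1_cst|move=> x; rewrite normrM ler_pM].
  have LB : L1 mT B := L1_bnd mT mB (fun r => bnd _ _ r mpsi' p'D).
  have LB1 : L1 mT B1 := L1_bnd mT mB1 (fun r => bnd _ _ r mep1 ep1).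
  have LB2 : L1 mT B2 := L1_bnd mT mB2 (fun r => bnd _ _ r mep2 ep2).
  have ABb r : `|A + prim T B r| <= `|A| + Int mT (fun s => `|B s|).
    by apply: le_trans (ler_normD _ _) _; rewrite lerD2l; exact: prim_abs.
  have LG : L1 mT (fun r => mean r * (A + prim T B r) + B r * p r).
    exact: L1D (L1Mr Lmean mAB ABb) (L1Mr LB mp pb).
  have L12 : L1 mT (fun r => B1 r + B2 r) := L1D LB1 LB2.
  have PM t : p t * (A + prim T B t) = prim T (fun r => mean r * (A + prim T B r) + B r * p r) t.
    have := prim_mulc 0 A t Lmean LB; rewrite (mul0r A) (add0r (prim T mean t)).
    rewrite [0 + _](add0r (prim T _ t)) => E0; etransitivity; first exact: E0.
    by congr (prim T _ t); apply/funext => r; rewrite (add0r (prim T mean r)).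
  have EB r : Int mX (fun x => J r x * u r x * derive1 (fun x => e x * psi x) x) = B1 r + B2 r.
    rewrite -(IntD (L1Ju r _ _ mep1 ep1) (L1Ju r _ _ mep2 ep2)); apply: Int_eq => x.
    by rewrite Eep; ring.
  have flux : {ae mT, forall r, B1 r + B2 r - (mean r * (A + prim T B r) + B r * p r) =
      Int mX (fun x => (q r x * u r x - s r x) * derive1 psi x)}.
    apply: aeS2 (flow_law fl tp) (ws _ tp) => r Er wr.
    have Lsr : L1 mX (fun x => s r x * derive1 psi x) := L1_test tp' (L1_bnd mX (M2_1 r ms) (sb r)).
    have LBr := L1Ju r _ _ mpsi' p'D; have LJp := L1J r _ _ mpsi pD.
    have L2r := L1Ju r _ _ mep2 ep2.
    transitivity (B2 r - p r * B r - Int mX (fun x => s r x * derive1 psi x)); last first.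
      rewrite -(IntZ _ LBr) -(IntB L2r (L1Z _ LBr)) -(IntB (L1B L2r (L1Z _ LBr)) Lsr).
      by apply: Int_eq => x; rewrite /q; ring.
    have Ep : Int mX (fun x => sx r x * psi x) = B1 r - mean r * Int mX (fun x => J r x * psi x).
      rewrite -(IntZ _ LJp) -(IntB (L1Ju r _ _ mep1 ep1) (L1Z _ LJp)).
      by apply: Int_eq => x; rewrite /sx; ring.
    rewrite -[A + prim T B r]Er wr Ep.
    by move: (Int _ _) (B1 r) (B2 r) (B r) (mean r) (p r); intros; ring.
  apply: aeS2 (flow_law fl tep) (flow_law fl tp) => t Et1 Et2.
  have Lq1 := L1J t _ _ mep ep; have Lq2 := L1J t _ _ mpsi pD.
  transitivity (Int mX (fun x => J t x * (e x * psi x)) - p t * Int mX (fun x => J t x * psi x)).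
    by rewrite -(IntZ _ Lq2) -(IntB Lq1 (L1Z _ Lq2)); apply: Int_eq => x; rewrite /q; ring.
  transitivity (Int mX (fun x => J0 x * (e x * psi x)) +
      prim T (fun r => B1 r + B2 r - (mean r * (A + prim T B r) + B r * p r)) t).
    rewrite (primB t L12 LG) -PM addrA; congr (_ - p t * _); last exact: Et2.
    by rewrite Et1; congr (_ + prim T _ t); apply/funext => r; exact: EB.
  congr (_ + _); first by apply: Int_eq => x; ring.
  by apply: prim_ae flux => //; exact: L1_meas (L1B L12 LG).
have mq0 : M1 (fun x => J0 x * e x) by meas.
have H := flow_lagrange fl mq qb mq0 q0b Ls Lsx ws law.
apply: (@ae_pr_eq _ _ _ _ _ mT mX (fun t y => e (X t y))
  (fun t y => e (X0 y) + prim T (fun s => u s (X s y) * derive1 e (X s y)) t)); [by meas|by meas|].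
apply: aeS H => t; apply: aeS => y.
rewrite /q mulrC mulKf; last by rewrite gt_eqF.
rewrite [J0 _ * _ / _]mulrC mulKf; last by rewrite gt_eqF.
move=> E; have Lue : L1 mT (fun r => u r (X r y) * derive1 e (X r y)).
  apply: (@L1_bnd _ _ _ mT _ (Uh * C')); first by meas.
  by move=> r; rewrite normrM ler_pM// (flow_ub fl).
(* The subtracted mean contributes [- p t] here and also in [q / J = e - p], so it cancels. *)
have : prim T (fun r => sx r (X r y) / J r (X r y)) t =
    prim T (fun r => u r (X r y) * derive1 e (X r y)) t - p t.
  rewrite /p -primB//; congr (prim T _ t); apply/funext => r; rewrite /sx.
  by field; rewrite gt_eqF.
by move=> E2; rewrite E2 in E; lra.
Qed.

End flow_transport.

(** * Uniqueness of the flow *)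

Section flow_uniqueness.
Context (R : realType).
Local Notation RR := (measurableTypeR R).
Local Notation mX := (@lebI R 1).
Local Notation w := (pi *+ 2 : R).

Lemma test1_cos : test1 (fun x : R => cos (w * x)) /\
  derive1 (fun x : R => cos (w * x)) = (fun x => - (w * sin (w * x))).
Proof.
have dw : der (fun x : R => w * x) (fun=> w).
  by move=> x; apply: (is_derive_eq (derM (der_cst w) (@der_id R) x)); rewrite mul0r add0r mulr1.
have dc : der (@cos R) (fun x => - sin x) by move=> x; exact: is_derive_cos.
split; [split|].
- by apply: sm_smooth; apply: sm_cos; apply: sm_mul; [exact: sm_cst|exact: sm_id].
- by move=> x; rewrite mulrDr mulr1 cosD cos2pi sin2pi mulr1 mulr0 subr0.
- by rewrite (der_derive1 (der_comp dc dw)); apply/funext => x; rewrite mulNr mulrC.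
Qed.

Lemma test1_sin : test1 (fun x : R => sin (w * x)) /\
  derive1 (fun x : R => sin (w * x)) = (fun x => w * cos (w * x)).
Proof.
have dw : der (fun x : R => w * x) (fun=> w).
  by move=> x; apply: (is_derive_eq (derM (der_cst w) (@der_id R) x)); rewrite mul0r add0r mulr1.
have dc : der (@sin R) (@cos R) by move=> x; exact: is_derive_sin.
split; [split|].
- by apply: sm_smooth; apply: sm_sin; apply: sm_mul; [exact: sm_cst|exact: sm_id].
- by move=> x; rewrite mulrDr mulr1 sinD cos2pi sin2pi mulr1 mulr0 addr0.
- by rewrite (der_derive1 (der_comp dc dw)); apply/funext => x; rewrite mulrC.
Qed.

(** Equal sines and cosines give [cos (2 pi (x - y)) = 1], hence [sin (pi (x - y)) = 0], while
    [|x - y| < 1]. *)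
Lemma circle_inj (x y : R) : 0 <= x < 1 -> 0 <= y < 1 ->
  cos (w * x) = cos (w * y) -> sin (w * x) = sin (w * y) -> x = y.
Proof.
have H (a b : R) : 0 <= a < 1 -> 0 <= b < 1 -> cos (w * a) = cos (w * b) ->
    sin (w * a) = sin (w * b) -> ~~ (b < a).
  move=> /andP[a0 a1] /andP[b0 b1] Ec Es; apply/negP => ba.
  have : cos (w * a - w * b) = 1.
    by rewrite cosB Ec Es -!expr2 cos2Dsin2.
  rewrite (_ : w * a - w * b = (pi * (a - b)) *+ 2); last by rewrite -mulrBr mulrnAl.
  rewrite cos_mulr2n cos2sin2 => E.
  have : 0 < sin (pi * (a - b)) by rewrite sin_pi_gt0; [apply/andP; split|apply/andP; split]; lra.
  move=> /(exprn_gt0 2); move: E; rewrite mulr2n; lra.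
move=> x01 y01 Ec Es; apply/eqP; rewrite eq_le !leNgt.
by rewrite (H _ _ x01 y01 Ec Es) (H _ _ y01 x01 (esym Ec) (esym Es)).
Qed.

Section transport.
Variables (T Uh : R) (u1 u2 X1 X2 : R -> R -> R) (X0 : R -> R).
Local Notation mT := (lebI T).
Hypotheses (mX1 : M2 X1) (mX2 : M2 X2) (mu1 : M2 u1) (mu2 : M2 u2).
Hypotheses (u1b : forall t x, `|u1 t x| <= Uh) (u2b : forall t x, `|u2 t x| <= Uh).
Hypothesis X1_itv : {ae pr mT mX, forall z, 0 <= X1 z.1 z.2 < 1}.
Hypothesis X2_itv : {ae pr mT mX, forall z, 0 <= X2 z.1 z.2 < 1}.
Hypothesis X1_eq : forall e, test1 e -> {ae pr mT mX, forall z, e (X1 z.1 z.2) = e (X0 z.2) +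
  prim T (fun s => u1 s (X1 s z.2) * derive1 e (X1 s z.2)) z.1}.
Hypothesis X2_eq : forall e, test1 e -> {ae pr mT mX, forall z, e (X2 z.1 z.2) = e (X0 z.2) +
  prim T (fun s => u2 s (X2 s z.2) * derive1 e (X2 s z.2)) z.1}.

Let flow_diff e : test1 e ->
  {ae mT, forall t, Int mX (fun y => (e (X1 t y) - e (X2 t y)) ^+ 2) =
    prim T (fun s => Int mX (fun y => 2 * ((e (X1 s y) - e (X2 s y)) *
      (u1 s (X1 s y) * derive1 e (X1 s y) - u2 s (X2 s y) * derive1 e (X2 s y))))) t} /\
  LL mT mX (fun s y => 2 * ((e (X1 s y) - e (X2 s y)) *
      (u1 s (X1 s y) * derive1 e (X1 s y) - u2 s (X2 s y) * derive1 e (X2 s y)))).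
Proof.
move=> te; have te' := test1_derive1 te; have [me me'] := (test1_M1 te, test1_M1 te').
have [C C0 eC] := test1_bounded te; have [C' C'0 e'C] := test1_bounded te'.
pose f1 s y := u1 s (X1 s y) * derive1 e (X1 s y).
pose f2 s y := u2 s (X2 s y) * derive1 e (X2 s y).
pose D s y := e (X1 s y) - e (X2 s y).
have [mf1 mf2 mD] : [/\ M2 f1, M2 f2 & M2 D] by split; rewrite /f1 /f2 /D; meas.
have b1 t y : `|f1 t y| <= Uh * C' by rewrite normrM ler_pM.
have b2 t y : `|f2 t y| <= Uh * C' by rewrite normrM ler_pM.
have bD t y : `|D t y| <= C + C by apply: le_trans (ler_normB _ _) _; exact: lerD.
have L1' : LL mT mX f1 := LL_bnd mT mX mf1 b1.
have L2' : LL mT mX f2 := LL_bnd mT mX mf2 b2.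
have Lf := LLB L1' L2'.
split; last exact: (LLZ 2 (LLM mD bD Lf)).
apply: (@energy_identity R T D (fun s y => f1 s y - f2 s y) (C + C)) => //.
apply: aeS3 (X1_eq te) (X2_eq te) (primB_ae L1' L2') => z E1 E2 E3.
rewrite -[RHS]E3 /D E1 E2.
by move: (prim T _ _) (prim T _ _) (e _) => a b c; ring.
Qed.

Lemma transport_unique :
  {ae pr mT mX, forall z, u1 z.1 (X1 z.1 z.2) = u2 z.1 (X2 z.1 z.2)} ->
  {ae pr mT mX, forall z, X1 z.1 z.2 = X2 z.1 z.2}.
Proof.
move=> Eu; have [tc Ec] := test1_cos; have [ts Es] := test1_sin.
have [ic Lc] := flow_diff tc; have [is' Ls] := flow_diff ts.
have [mc ms] := (test1_M1 tc, test1_M1 ts).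
pose D (e : R -> R) t y := e (X1 t y) - e (X2 t y).
(* Derivation exchanges cosine and sine up to sign and both come with the same velocity, so the
   derivatives of the two squares are opposite at each point. *)
have z0 : {ae mT, forall t, Int mX (fun y => D (fun x => cos (w * x)) t y ^+ 2) +
    Int mX (fun y => D (fun x => sin (w * x)) t y ^+ 2) = 0}.
  have [Lc' _] := LL_Int1 Lc; have [Ls' _] := LL_Int1 Ls.
  apply: aeS2 ic is' => t -> ->; rewrite -(primD t Lc' Ls').
  transitivity (prim T (fun=> 0) t); last first.
    rewrite /prim -[RHS](Int0 mT); apply: Int_eq => s.
    by rewrite /when; case: ifP.
  apply: prim_ae; [exact: L1_meas (L1D Lc' Ls')|exact: measurable_cst|].
  apply: aeS3 (LL1 Lc) (LL1 Ls) (ae_pr1 Eu) => s Lcs Lss Eus.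
  rewrite -(IntD Lcs Lss) -[RHS](Int0 mX); apply: Int_ae.
  - exact: L1_meas (L1D Lcs Lss).
  - exact: measurable_cst.
  apply: aeS Eus => y /= ->; rewrite Ec Es.
  by move: (cos _) (cos _) (sin _) (sin _) (u2 _ _) => a b c d v; ring.
have sq (e : R -> R) t : M1 e -> test1 e -> L1 mX (fun y => D e t y ^+ 2).
  move=> me te; have [C C0 eC] := test1_bounded te.
  apply: (@L1_bnd _ _ _ mX _ ((C + C) ^+ 2)).
    by rewrite /D; have [? ?] := (M2_1 t mX1, M2_1 t mX2); meas.
  move=> y; rewrite normrX lerXn2r// ?nnegrE ?addr_ge0//.
  by apply: le_trans (ler_normB _ _) _; exact: lerD.
have H e : M1 e -> test1 e -> {ae mT, forall t, Int mX (fun y => D e t y ^+ 2) <= 0} ->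
    {ae pr mT mX, forall z, e (X1 z.1 z.2) = e (X2 z.1 z.2)}.
  move=> me te De.
  apply: (@ae_pr_eq _ _ _ _ _ mT mX (fun t y => e (X1 t y)) (fun t y => e (X2 t y))); [by meas|by meas|].
  apply: aeS De => t D0; have := Int_eq0_ae (sq e t me te) (fun y => sqr_ge0 _) D0.
  by apply: aeS => y /eqP; rewrite sqrf_eq0 subr_eq0 => /eqP.
have p (e : R -> R) t : 0 <= Int mX (fun y => D e t y ^+ 2) by apply: Int_ge0 => y; exact: sqr_ge0.
have dc : {ae mT, forall t, Int mX (fun y => D (fun x => cos (w * x)) t y ^+ 2) <= 0}.
  by apply: aeS z0 => t E; have := p (fun x => sin (w * x)) t; lra.
have ds : {ae mT, forall t, Int mX (fun y => D (fun x => sin (w * x)) t y ^+ 2) <= 0}.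
  by apply: aeS z0 => t E; have := p (fun x => cos (w * x)) t; lra.
have I12 := aeS2 (fun z a b => conj a b) X1_itv X2_itv.
apply: aeS3 (H _ mc tc dc) (H _ ms ts ds) I12 => z Ecz Esz [i1 i2].
exact: circle_inj.
Qed.

End transport.

Lemma flow_unique (T Jl Jh Uh : R) (J1 u1 J2 u2 : R -> R -> R) (J0 : R -> R) :
  flow T Jl Jh Uh J1 u1 J0 -> flow T Jl Jh Uh J2 u2 J0 ->
  {ae pr (lebI T) mX, forall z, u1 z.1 (flow_X T J1 u1 J0 z.1 z.2) =
    u2 z.1 (flow_X T J2 u2 J0 z.1 z.2)} ->
  {ae pr (lebI T) mX, forall z, flow_X T J1 u1 J0 z.1 z.2 = flow_X T J2 u2 J0 z.1 z.2}.
Proof.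
move=> fl1 fl2; exact: (transport_unique (flow_M2X fl1) (flow_M2X fl2) (flow_u fl1) (flow_u fl2)
  (flow_ub fl1) (flow_ub fl2) (flow_X_itv fl1) (flow_X_itv fl2)
  (flow_transport fl1) (flow_transport fl2)).
Qed.

End flow_uniqueness.

(** * From Eulerian to Lagrangian solutions *)

Section eulerian_uniqueness.
Context (R : realType).
Local Notation RR := (measurableTypeR R).
Local Notation mX := (@lebI R 1).

(** Provides the derivative of [sg * u], the source of the energy law, in the form required by
    [flow_lagrange]. Both factors are primitives in [x], so the product rule is [prim_mulc]. *)
Lemma wdx_mul T (f fx g gx : R -> R -> R) : LL (lebI T) mX f -> LL (lebI T) mX fx ->
  LL (lebI T) mX g -> LL (lebI T) mX gx -> wdx T f fx -> wdx T g gx ->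
  wdx T (fun t x => f t x * g t x) (fun t x => fx t x * g t x + f t x * gx t x).
Proof.
move=> Lf Lfx Lg Lgx wf wg psi tp.
have tp' := test1_derive1 tp; have [mp mp'] := (test1_M1 tp, test1_M1 tp').
have HL := aeS2 (fun t a b => conj a b) (LL1 Lfx) (LL1 Lgx).
have HM := aeS2 (fun t a b => conj a b) (LL1 Lf) (LL1 Lg).
have HH := aeS2 (fun t a b => conj a b) (wdx_prim Lf Lfx wf) (wdx_prim Lg Lgx wg).
apply: aeS3 HL HM HH => t [Lft Lgt] [Lf0 Lg0] [[If Ef] [Ig Eg]].
have [mft mgt] : M1 (f t) /\ M1 (g t) by split; [exact: L1_meas Lf0|exact: L1_meas Lg0].
have [mfxt mgxt] : M1 (fx t) /\ M1 (gx t) by split; [exact: L1_meas Lft|exact: L1_meas Lgt].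
set k1 := kap f fx t in Ef; set k2 := kap g gx t in Eg.
pose B x := fx t x * (k2 + prim 1 (gx t) x) + gx t x * (k1 + prim 1 (fx t) x).
have mB : M1 B by rewrite /B; meas.
have LB : L1 mX B.
  have Lm a b k : L1 mX a -> L1 mX b -> L1 mX (fun x => a x * (k + prim 1 b x)).
    move=> La Lb; have mb : M1 b := L1_meas Lb.
    have bb x : `|k + prim 1 b x| <= `|k| + Int mX (fun s => `|b s|).
      by apply: le_trans (ler_normD _ _) _; rewrite lerD2l; exact: prim_abs.
    by apply: (L1Mr La _ bb); meas.
  by apply: L1D; exact: Lm.
have PM x := prim_mulc k1 k2 x Lft Lgt.
have IB : Int mX B = 0.
  have E1 : (k1 + prim 1 (fx t) 1) * (k2 + prim 1 (gx t) 1) = k1 * k2 + prim 1 B 1 := PM 1.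
  rewrite (prim_ge mfxt (lexx 1)) (prim_ge mgxt (lexx 1)) (prim_ge mB (lexx 1)) If Ig in E1.
  by rewrite (addr0 k1) (addr0 k2) in E1; move: E1; set I := Int _ _; lra.
have I0 : Int mX (derive1 psi) = 0.
  have [sp pp] := tp; have := FTC (smooth_der sp) (smooth_cont (smooth_derive1 sp)).
  move=> /(_ 1 1); rewrite ler01 lexx => /(_ isT).
  by rewrite (prim_ge mp' (lexx 1)) -[X in psi X - _]add0r pp subrr.
have Lp' : L1 mX (derive1 psi) by have [C C0 pC] := test1_bounded tp'; exact: L1_bnd mp' pC.
have LBp : L1 mX (fun x => prim 1 B x * derive1 psi x) := L1_test tp' (L1_primx LB).
transitivity (Int mX (fun x => (k1 * k2) * derive1 psi x + prim 1 B x * derive1 psi x)).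
  apply: Int_ae; [by meas|by meas|].
  by apply: aeS2 Ef Eg => x -> ->; rewrite PM mulrDl.
rewrite (IntD (L1Z _ Lp') LBp) (IntZ _ Lp') I0 mulr0 add0r (ibp_test LB tp) IB mulr0 sub0r.
congr (- _); apply: Int_ae; [by meas|by meas|].
by apply: aeS2 Ef Eg => x Efx Egx; rewrite /B -Efx -Egx; ring.
Qed.

(** The balance of kinetic energy, to be subtracted from that of total energy. *)
Lemma half_square_ae T (D f : R -> R -> R) (d0 : R -> R) (B : R) : M2 D -> M1 d0 ->
  (forall t y, `|D t y| <= B) -> LL (lebI T) mX f ->
  {ae pr (lebI T) mX, forall z, D z.1 z.2 = d0 z.2 + prim T (f^~ z.2) z.1} ->
  {ae pr (lebI T) mX, forall z, D z.1 z.2 ^+ 2 / 2 =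
    d0 z.2 ^+ 2 / 2 + prim T (fun s => D s z.2 * f s z.2) z.1}.
Proof.
move=> mD md0 DB Lf E; have mf : M2 f := L1_meas Lf.
have LDf := LLM mD DB Lf.
apply: (@ae_pr_eq _ _ _ _ _ (lebI T) mX (fun t y => D t y ^+ 2 / 2)
  (fun t y => d0 y ^+ 2 / 2 + prim T (fun s => D s y * f s y) t)); [by meas|by meas|].
have Hy := aeS2 (fun t a b => conj a b) (LL2 Lf) (LL2 LDf).
apply: aeS (ae_pr1 E) => t Et.
apply: aeS3 Et (ae_pr2 E) Hy => y /= Ety Ey [Lfy LDfy].
have := prim_mulc (d0 y) (d0 y) t Lfy Lfy; rewrite -!Ety => PM.
have {}PM : D t y * D t y = d0 y * d0 y + 2 * prim T (fun s => D s y * f s y) t.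
  rewrite PM -(primZ _ _ LDfy); congr (_ + _); apply: prim_ae; [by meas|by meas|].
  by apply: aeS Ey => s /= ->; ring.
by rewrite expr2 PM; field.
Qed.

Lemma M2_energy (P : params R) (c th u : R -> R -> R) :
  M2 c -> M2 th -> M2 u -> M2 (energy P c th u).
Proof. by move=> mc mth mu; rewrite /energy /cvc; meas. Qed.

Lemma M1_energy0 (P : params R) (c th u : R -> R) :
  M1 c -> M1 th -> M1 u -> M1 (energy0 P c th u).
Proof. by move=> mc mth mu; rewrite /energy0 /cvc; meas. Qed.

Lemma M2_sigma (P : params R) (c J th ux : R -> R -> R) :
  M2 c -> M2 J -> M2 th -> M2 ux -> M2 (sigma P c J th ux).
Proof. by move=> mc mJ mth mux; rewrite /sigma /pres /muc /gamc; meas. Qed.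

(* [J] is the density of a solution divided by its mass and [sg] the stress divided by the mass. *)
Record nsol (P : params R) (T K : R) (a J0 c0 th0 u0 : R -> R)
    (c J th u ux sg sx : R -> R -> R) : Prop := Nsol {
  ns_flow : flow T K^-1 K K J u J0;
  ns_c : M2 c; ns_th : M2 th;
  ns_cb : forall t x, `|c t x| <= K; ns_thb : forall t x, `|th t x| <= K;
  ns_c0 : M1 c0; ns_th0 : M1 th0; ns_u0 : M1 u0;
  ns_c0b : forall x, 0 <= c0 x <= 1;
  ns_th0b : forall x, `|th0 x| <= K; ns_u0b : forall x, `|u0 x| <= K;
  ns_ux : LL (lebI T) mX ux; ns_sg : LL (lebI T) mX sg; ns_sx : LL (lebI T) mX sx;
  ns_sgux : LL (lebI T) mX (fun t x => sg t x * ux t x);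
  ns_wu : wdx T u ux; ns_ws : wdx T sg sx;
  ns_stress : {ae pr (lebI T) mX, forall z, sg z.1 z.2 = sigma P c J th ux z.1 z.2};
  ns_a : {ae pr (lebI T) mX, forall z, `|sg z.1 z.2| <= a z.1};
  ns_lc : claw T (fun t x => J t x * c t x) (fun t x => J t x * c t x * u t x - 0)
    (fun x => J0 x * c0 x);
  ns_lu : claw T (fun t x => J t x * u t x) (fun t x => J t x * u t x * u t x - sg t x)
    (fun x => J0 x * u0 x);
  ns_lE : claw T (fun t x => J t x * energy P c th u t x)
    (fun t x => J t x * energy P c th u t x * u t x - sg t x * u t x)
    (fun x => J0 x * energy0 P c0 th0 u0 x) }.

Section to_lagrange.
Variables (P : params R) (T K : R) (a J0 c0 th0 u0 : R -> R).
Variables (c J th u ux sg sx : R -> R -> R).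
Hypotheses (okP : params_ok P) (K0 : 0 < K) (ma : M1 a).
Hypothesis s : nsol P T K a J0 c0 th0 u0 c J th u ux sg sx.
Local Notation mT := (lebI T).
Local Notation X := (flow_X T J u J0).
Local Notation X0 := (flow_X0 J0).
Let fl := ns_flow s.
Let mJ := flow_J fl.
Let mJ0 := flow_J0 fl.
Let mu := flow_u fl.
Let mX1 : M2 X := flow_M2X fl.
Let mX0 : M1 X0 := flow_M1X0 fl.
Let mc := ns_c s.
Let mth := ns_th s.
Let mc0 := ns_c0 s.
Let mth0 := ns_th0 s.
Let mu0 := ns_u0 s.
Let Jp t x : 0 < J t x.
Proof. by have /andP[+ _] := flow_Jb fl t x; apply: lt_le_trans; exact: flow_Jl fl. Qed.
Let J0p x : 0 < J0 x.
Proof. by have /andP[+ _] := flow_J0b fl x; apply: lt_le_trans; exact: flow_Jl fl. Qed.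
Let Jn t x : `|J t x| <= K.
Proof. by rewrite gtr0_norm//; have /andP[] := flow_Jb fl t x. Qed.
Let J0n x : `|J0 x| <= K.
Proof. by rewrite gtr0_norm//; have /andP[] := flow_J0b fl x. Qed.
Let ub := flow_ub fl.
Let Lu : LL mT mX u := LL_bnd mT mX mu ub.

Lemma nsol_c : {ae pr mT mX, forall z, c z.1 (X z.1 z.2) = c0 (X0 z.2)}.
Proof.
have L0 : LL mT mX (fun _ _ => 0) := L1_cst _ 0.
have w0 : wdx T (fun _ _ => 0) (fun _ _ => 0).
  move=> psi _; apply: aeW => t.
  rewrite (@Int_eq _ _ _ mX _ (fun=> 0)) ?Int0; last by move=> x; rewrite mul0r.
  by rewrite (@Int_eq _ _ _ mX _ (fun=> 0)) ?Int0 ?oppr0// => x; rewrite mul0r.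
have mq : M2 (fun t x => J t x * c t x) by meas.
have mq0 : M1 (fun x => J0 x * c0 x) by meas.
have qb t x : `|J t x * c t x| <= K * (K + 1).
  rewrite normrM ler_pM//; apply: le_trans (ns_cb s t x) _; lra.
have q0b x : `|J0 x * c0 x| <= K * (K + 1).
  rewrite normrM ler_pM//; have /andP[x0 x1] := ns_c0b s x; rewrite (ger0_norm x0).
  by apply: le_trans x1 _; rewrite lerDr ltW.
have H := flow_lagrange fl mq qb mq0 q0b L0 L0 w0 (ns_lc s).
apply: (@ae_pr_eq _ _ _ _ _ mT mX (fun t y => c t (X t y)) (fun t y => c0 (X0 y))); [by meas|by meas|].
apply: aeS H => t; apply: aeS => y.
rewrite mulrC mulKf; last by rewrite gt_eqF.
rewrite [J0 _ * _ / _]mulrC mulKf; last by rewrite gt_eqF.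
move=> ->; rewrite (_ : prim T _ t = 0) ?addr0//.
rewrite /prim -[RHS](Int0 mT); apply: Int_eq => r.
by rewrite /when mul0r; case: ifP.
Qed.

Lemma nsol_lsol : lsol P T K a (fun y => (J0 (X0 y))^-1) (fun y => c0 (X0 y))
  (fun y => u0 (X0 y)) (fun y => cvc P (c0 (X0 y)) * th0 (X0 y))
  (fun t y => (J t (X t y))^-1) (fun t y => u t (X t y)) (fun t y => th t (X t y))
  (fun t y => sg t (X t y)) (fun t y => ux t (X t y) / J t (X t y))
  (fun t y => sx t (X t y) / J t (X t y)).
Proof.
have [msg msx mux] : [/\ M2 sg, M2 sx & M2 ux].
  by split; [exact: L1_meas (ns_sg s)|exact: L1_meas (ns_sx s)|exact: L1_meas (ns_ux s)].
have K0' := ltW K0.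
have Kb x : K^-1 <= x <= K -> K^-1 <= x^-1 <= K.
  move=> /andP[x1 x2]; have x0 : 0 < x by apply: lt_le_trans x1; rewrite invr_gt0.
  by rewrite lef_pV2 ?posrE// x2 -[K in _ <= K]invrK lef_pV2 ?posrE ?invr_gt0.
have [_ wU] := flow_wdx fl Lu (ns_ux s) (ns_wu s).
have [LSg wS] := flow_wdx fl (ns_sg s) (ns_sx s) (ns_ws s).
have LS := flow_LL fl (ns_sx s); have LP := flow_LL fl (ns_ux s).
have eU : {ae pr mT mX, forall z, u z.1 (X z.1 z.2) = u0 (X0 z.2) +
    prim T (fun r => sx r (X r z.2) / J r (X r z.2)) z.1}.
  have mq : M2 (fun t x => J t x * u t x) by meas.
  have mq0 : M1 (fun x => J0 x * u0 x) by meas.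
  have qb t x : `|J t x * u t x| <= K * K by rewrite normrM ler_pM.
  have q0b x : `|J0 x * u0 x| <= K * K by rewrite normrM ler_pM// (ns_u0b s).
  have H := flow_lagrange fl mq qb mq0 q0b (ns_sg s) (ns_sx s) (ns_ws s) (ns_lu s).
  apply: (@ae_pr_eq _ _ _ _ _ mT mX (fun t y => u t (X t y)) (fun t y => u0 (X0 y) +
    prim T (fun r => sx r (X r y) / J r (X r y)) t)); [by meas|by meas|].
  apply: aeS H => t; apply: aeS => y.
  rewrite mulrC mulKf; last by rewrite gt_eqF.
  by rewrite [J0 _ * _ / _]mulrC mulKf; last by rewrite gt_eqF.
split=> //.
- by meas.
- by meas.
- by meas.
- by move=> t y; apply: Kb; exact: flow_Jb fl _ _.
- by move=> t y; exact: ns_thb s _ _.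
- have mh : M2 (sigma P c J th ux) by exact: M2_sigma.
  have H := flow_ae_eq fl msg mh (ns_stress s).
  apply: aeS2 H nsol_c => z -> Ec; rewrite /sigma /pres Ec.
  by field; rewrite gt_eqF.
(* [flow_ae_eq] transports equalities, so the bound is stated as the vanishing of an indicator. *)
- have mw : M2 (fun t x => when (a t < `|sg t x|) 1) by meas.
  have H0 : {ae pr mT mX, forall z, when (a z.1 < `|sg z.1 z.2|) (1 : R) = 0}.
    by apply: aeS (ns_a s) => z za; rewrite /when ltNge za.
  have m0 : M2 (fun _ _ => 0 : R) by exact: measurable_cst.
  have H := flow_ae_eq fl mw m0 H0.
  apply: aeS H => z; rewrite /when ltNge; case: leP => // _ /eqP.
  by rewrite oner_eq0.
- have m1 : M2 (fun _ _ => 1 : R) by exact: measurable_cst.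
  have m1' : M1 (fun _ => 1 : R) by exact: measurable_cst.
  have b1 (t x : R) : `|1 : R| <= 1 by rewrite normr1.
  (* The flux is zero and the law trivial; it is written this way to enter [u] as the stress [s] of
     [flow_lagrange], with source [ux]. *)
  have law1 : claw T (fun _ _ => 1) (fun t x => 1 * u t x - u t x) (fun=> 1).
    move=> psi tp; apply: aeW => t; rewrite (_ : prim T _ t = 0) ?addr0//.
    rewrite /prim -[RHS](Int0 mT); apply: Int_eq => r.
    rewrite /when; case: ifP => // _; rewrite -[RHS](Int0 mX); apply: Int_eq => x; ring.
  have H := flow_lagrange fl m1 b1 m1' (b1 0) Lu (ns_ux s) (ns_wu s) law1.
  apply: (@ae_pr_eq _ _ _ _ _ mT mX (fun t y => (J t (X t y))^-1) (fun t y => (J0 (X0 y))^-1 +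
    prim T (fun r => ux r (X r y) / J r (X r y)) t)); [by meas|by meas|].
  by apply: aeS H => t; apply: aeS => y; rewrite !mul1r.
have Lsu : LL mT mX (fun t x => sg t x * u t x) := LLMr (ns_sg s) mu ub.
have Lsxu : LL mT mX (fun t x => sx t x * u t x + sg t x * ux t x) :=
  LLD (LLMr (ns_sx s) mu ub) (ns_sgux s).
have wsu := wdx_mul (ns_sg s) (ns_sx s) Lu (ns_ux s) (ns_ws s) (ns_wu s).
(* The bound [K + 1] covers [c], bounded by [K], and [c0], bounded by [1]; the weight [1 - x] is
   then at most [K + 2]. *)
pose cc := (K + 2) * (cv_p P + cv_m P).
have [m1 [m2 [g1 [g2 [c1 c2]]]]] := okP.
have cvb x : `|x| <= K + 1 -> `|cvc P x| <= cc.
  move=> xK; apply: (@le_trans _ _ (`|x| * cv_p P + (1 + `|x|) * cv_m P)); last by rewrite /cc; nra.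
  apply: le_trans (ler_normD _ _) _; rewrite !normrM (gtr0_norm c1) (gtr0_norm c2) lerD2l.
  by rewrite ler_wpM2r ?(ltW c2)//; apply: le_trans (ler_normB _ _) _; rewrite normr1.
have mE : M2 (energy P c th u) by exact: M2_energy.
have mE0 : M1 (energy0 P c0 th0 u0) by exact: M1_energy0.
have Ebb (x y z : R) : `|x| <= K -> `|y| <= cc -> `|z| <= K ->
    `|x ^+ 2 / 2 + y * z| <= K ^+ 2 / 2 + cc * K.
  move=> xK yc zK; apply: le_trans (ler_normD _ _) _; rewrite !normrM; apply: lerD.
    rewrite normfV (ger0_norm (_ : 0 <= 2)) ?ler0n// ler_wpM2r ?invr_ge0//.
    by rewrite ler_pM.
  by rewrite ler_pM.
have Eb t x : `|energy P c th u t x| <= K ^+ 2 / 2 + cc * K.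
  apply: Ebb; [exact: ub| |exact: ns_thb s _ _].
  by apply: cvb; apply: le_trans (ns_cb s t x) _; rewrite lerDl.
have E0b x : `|energy0 P c0 th0 u0 x| <= K ^+ 2 / 2 + cc * K.
  apply: Ebb; [exact: ns_u0b s _| |exact: ns_th0b s _].
  apply: cvb; have /andP[x0 x1] := ns_c0b s x; rewrite (ger0_norm x0).
  by apply: le_trans x1 _; rewrite lerDr.
have mq : M2 (fun t x => J t x * energy P c th u t x) by meas.
have mq0 : M1 (fun x => J0 x * energy0 P c0 th0 u0 x) by meas.
have qb t x : `|J t x * energy P c th u t x| <= K * (K ^+ 2 / 2 + cc * K).
  by rewrite normrM ler_pM.
have q0b x : `|J0 x * energy0 P c0 th0 u0 x| <= K * (K ^+ 2 / 2 + cc * K).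
  by rewrite normrM ler_pM.
have H := flow_lagrange fl mq qb mq0 q0b Lsu Lsxu wsu (ns_lE s).
pose W t y := (sx t (X t y) * u t (X t y) + sg t (X t y) * ux t (X t y)) / J t (X t y).
have LW : LL mT mX W := flow_LL fl Lsxu.
have mW : M2 W := L1_meas LW.
have eE : {ae pr mT mX, forall z, energy P c th u z.1 (X z.1 z.2) =
    energy0 P c0 th0 u0 (X0 z.2) + prim T (W^~ z.2) z.1}.
  apply: (@ae_pr_eq _ _ _ _ _ mT mX (fun t y => energy P c th u t (X t y))
    (fun t y => energy0 P c0 th0 u0 (X0 y) + prim T (W^~ y) t)); [by meas|by meas|].
  apply: aeS H => t; apply: aeS => y.
  rewrite mulrC mulKf; last by rewrite gt_eqF.
  by rewrite [J0 _ * _ / _]mulrC mulKf; last by rewrite gt_eqF.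
have mUX : M2 (fun t y => u t (X t y)) by meas.
have mu0X : M1 (fun y => u0 (X0 y)) by meas.
have UXb t y : `|u t (X t y)| <= K by exact: ub.
have hs := half_square_ae mUX mu0X UXb LS eU.
have LUS := LLM mUX UXb LS.
have pB := primB_ae LW LUS.
have ecc := aeS2 (fun z a b => conj a b) nsol_c eE.
apply: aeS3 ecc hs pB => z [Ec EE] hsz pBz.
(* The kinetic source [u sx] is removed from [sx u + sg ux], which leaves the work [sg ux] of the
   stress. *)
have -> : prim T (fun r => sg r (X r z.2) * (ux r (X r z.2) / J r (X r z.2))) z.1 =
    prim T (fun r => W r z.2 - u r (X r z.2) * (sx r (X r z.2) / J r (X r z.2))) z.1.
  by congr (prim T _ _); apply/funext => r; rewrite /W; ring.
rewrite -pBz; move: EE; rewrite /energy /energy0 hsz Ec.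
by move: (prim T _ _) (prim T _ _) => p1 p2 EE; lra.
Qed.

End to_lagrange.

Theorem nsol_unique (P : params R) (T K : R) (a J0 c0 th0 u0 : R -> R)
    (c1 J1 th1 u1 ux1 sg1 sx1 c2 J2 th2 u2 ux2 sg2 sx2 : R -> R -> R) :
  params_ok P -> 0 < K -> M1 a -> (forall t, 0 <= a t) -> L1 (lebI T) (fun t => a t ^+ 2) ->
  nsol P T K a J0 c0 th0 u0 c1 J1 th1 u1 ux1 sg1 sx1 ->
  nsol P T K a J0 c0 th0 u0 c2 J2 th2 u2 ux2 sg2 sx2 ->
  {ae pr (lebI T) mX, forall z, (c1 z.1 z.2 = c2 z.1 z.2 /\ J1 z.1 z.2 = J2 z.1 z.2) /\
    (th1 z.1 z.2 = th2 z.1 z.2 /\ u1 z.1 z.2 = u2 z.1 z.2)}.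
Proof.
move=> okP K0 ma a0 La s1 s2.
have [l1 l2] := (nsol_lsol okP K0 ma s1, nsol_lsol okP K0 ma s2).
have mC : M1 (fun y => c0 (flow_X0 J0 y)).
  by have ? := ns_c0 s1; have ? := flow_M1X0 (ns_flow s1); meas.
have H := lsol_unique okP K0 mC (fun y => ns_c0b s1 _) a0 La l1 l2.
have [Hv HU Ht] : [/\ {ae pr (lebI T) mX, forall z, J1 z.1 (flow_X T J1 u1 J0 z.1 z.2) =
    J2 z.1 (flow_X T J2 u2 J0 z.1 z.2)},
    {ae pr (lebI T) mX, forall z, u1 z.1 (flow_X T J1 u1 J0 z.1 z.2) =
    u2 z.1 (flow_X T J2 u2 J0 z.1 z.2)} &
    {ae pr (lebI T) mX, forall z, th1 z.1 (flow_X T J1 u1 J0 z.1 z.2) =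
    th2 z.1 (flow_X T J2 u2 J0 z.1 z.2)}].
  by split; apply: aeS H => z [/invr_inj].
have HX := flow_unique (ns_flow s1) (ns_flow s2) HU.
have Hc := aeS2 (fun z a b => etrans a (esym b)) (nsol_c K0 s1) (nsol_c K0 s2).
have tr f g : M2 f -> M2 g -> {ae pr (lebI T) mX, forall z,
    f z.1 (flow_X T J1 u1 J0 z.1 z.2) = g z.1 (flow_X T J2 u2 J0 z.1 z.2)} ->
    {ae pr (lebI T) mX, forall z, f z.1 z.2 = g z.1 z.2}.
  move=> mf mg fg; apply: (flow_eq_ae (ns_flow s1) mf mg).
  by apply: aeS2 fg HX => z -> ->.
have f1 := tr _ _ (ns_c s1) (ns_c s2) Hc.
have f2 := tr _ _ (flow_J (ns_flow s1)) (flow_J (ns_flow s2)) Hv.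
have f3 := tr _ _ (ns_th s1) (ns_th s2) Ht.
have f4 := tr _ _ (flow_u (ns_flow s1)) (flow_u (ns_flow s2)) HU.
have f12 := aeS2 (fun z a b => conj a b) f1 f2.
by apply: aeS3 f12 f3 f4 => z a12 a3 a4.
Qed.

End eulerian_uniqueness.

(** * Normalisation of solutions *)

Section square_integrable.
Context (R : realType).
Local Notation RR := (measurableTypeR R).
Local Notation mX := (@lebI R 1).

Lemma L1_square d (X : measurableType d) (mu : {finite_measure set X -> \bar R})
    (f : X -> R) (C : R) : measurable_fun setT f ->
  (\int[mu]_x (f x ^+ 2)%:E <= C%:E)%E ->
  [/\ L1 mu (fun x => f x ^+ 2), Int mu (fun x => f x ^+ 2) <= C & L1 mu f].
Proof.
move=> mf fC; have mf2 : measurable_fun setT (fun x => f x ^+ 2) by meas.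
have L2 : L1 mu (fun x => f x ^+ 2).
  apply/integrableP; split; first exact/measurable_EFinP.
  apply: le_lt_trans (_ : (C%:E < +oo)%E); last exact: ltry.
  apply: le_trans fC; rewrite le_eqVlt; apply/orP; left; apply/eqP.
  by apply: eq_integral => x _; rewrite /= ger0_norm// sqr_ge0.
split=> //; first by rewrite (L1_fin L2) lee_fin in fC.
apply: (@L1_le _ _ _ mu _ (fun x => 1 + f x ^+ 2)) => //; first exact: L1D (L1_cst _ _) L2.
move=> x; rewrite -[f x ^+ 2]real_normK ?num_real//.
by have := normr_ge0 (f x); move: `|f x| => y; nra.
Qed.

(** The variance of [|f|] is nonnegative, the circle having measure one. *)
Lemma Int_square (f : R -> R) : L1 mX f -> L1 mX (fun x => f x ^+ 2) ->
  Int mX (fun x => `|f x|) ^+ 2 <= Int mX (fun x => f x ^+ 2).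
Proof.
move=> Lf Lf2; set m := Int mX (fun x => `|f x|).
have La := L1_abs Lf.
have : 0 <= Int mX (fun x => f x ^+ 2 - (2 * m) * `|f x| + m ^+ 2).
  apply: Int_ge0 => x; rewrite -[f x ^+ 2]real_normK ?num_real//.
  by rewrite (_ : _ + _ = (`|f x| - m) ^+ 2) ?sqr_ge0//; ring.
rewrite (IntD (L1B Lf2 (L1Z _ La)) (L1_cst mX _)) (IntB Lf2 (L1Z _ La)) (IntZ _ La).
by rewrite (Int_lebI_cst _ ler01) -/m; lra.
Qed.

Lemma slice_square (T : R) (f : R -> R -> R) t : 0 <= t < T -> M2 (ext T f) ->
  (\int[mX]_x (ext T f t x ^+ 2)%:E = \int[leb R]_(x in I01 R) (f t x ^+ 2)%:E)%E.
Proof.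
move=> tT mf; have mt := M2_1 t mf.
rewrite lebI_integral; last by apply/measurable_EFinP; meas.
apply: eq_integral => x /set_mem; rewrite /= in_itv/= => x01.
by rewrite /ext tT fracE.
Qed.

Lemma ae_time (T : R) (Q : R -> Prop) : {ae leb R, forall t, Icc 0 T t -> Q t} ->
  {ae lebI T, forall t, 0 <= t < T /\ Q t}.
Proof.
move=> H; have H1 : {ae lebI T, forall t, 0 <= t < T -> Q t}.
  apply: ae_lebI; case: H => N [mN N0 HN]; exists N; split => // t nP; apply: HN => h.
  apply: nP => /andP[t0 tT] _; apply: h; rewrite /Icc /= in_itv/= t0 ltW//.
by apply: aeS2 (lebI_in T) H1 => t tT /(_ tT).
Qed.

Lemma ae_pick (T s : R) (Q : R -> Prop) : 0 <= s -> s < T ->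
  {ae leb R, forall t, Icc 0 T t -> Q t} -> exists2 t, s < t < T & Q t.
Proof.
move=> s0 sT [N [mN N0 HN]]; apply: contrapT => nex.
have sub : `]s, T[%classic `<=` N.
  move=> t; rewrite /= in_itv/= => /andP[st tT]; apply: HN => h.
  apply: nex; exists t; first by rewrite st.
  by apply: h; rewrite /Icc /= in_itv/= (le_trans s0 (ltW st)) ltW.
have : (lebesgue_measure (`]s, T[%classic : set RR) <= lebesgue_measure N)%E.
  have mI : measurable (`]s, T[%classic : set RR) by exact: measurable_itv.
  exact: (@le_measure _ _ _ lebesgue_measure _ _ (mem_set mI) (mem_set mN) sub).
rewrite lebesgue_measure_itv/= lte_fin sT [leRHS]N0 -EFinB lee_fin.
by rewrite leNgt subr_gt0 sT.
Qed.

(* The bound is only given for a.e. [t], so the box is exhausted by smaller ones. *)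
Lemma box_square (T C : R) (f : R -> R -> R) : 0 < T -> M2 (ext T f) ->
  measurable_fun (Dom T) (unc f) ->
  {ae leb R, forall t, Icc 0 T t ->
    (\int[leb2 R]_(z in Icc 0 t `*` I01 R) (f z.1 z.2 ^+ 2)%:E <= C%:E)%E} ->
  (\int[pr (lebI T) mX]_z (ext T f z.1 z.2 ^+ 2)%:E <= C%:E)%E.
Proof.
move=> T0 mf mfD H.
pose Tn n := T * (1 - hn R n).
have Tn_lt n : 0 <= Tn n < T.
  have /andP[h0 h1] := hn_itv R n; apply/andP; split; first by rewrite mulr_ge0 ?ltW// subr_gt0.
  by rewrite gtr_pMr// gtrBl.
pose F n : set (RR * RR) := Box (Tn n).
have FB n : F n `<=` Box T.
  move=> z /BoxP[/andP[z0 z1] z2]; apply/BoxP; split => //; rewrite z0.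
  by have /andP[_ TT] := Tn_lt n; exact: lt_trans TT.
have mE : measurable_fun [set: RR * RR] (fun z => (ext T f z.1 z.2 ^+ 2)%:E).
  by apply/measurable_EFinP; meas.
have ndF : nondecreasing_seq F.
  apply/nondecreasing_seqP => n; rewrite subsetEset => z /BoxP[/andP[z0 z1] z2].
  apply/BoxP; split => //; rewrite z0; apply: lt_le_trans z1 _.
  by rewrite (ler_wpM2l (ltW T0))// lerD2l lerN2 lef_pV2 ?posrE ?ltr0n// ler_nat.
have cF := @ge0_nondecreasing_set_cvg_integral _ _ _ F
  (fun z => (ext T f z.1 z.2 ^+ 2)%:E) (leb2 R) ndF (fun n => measurable_Box _)
  (fun n => measurable_funS measurableT (@subsetT _ _) mE) (fun n z _ => sqr_ge0 _).
have UF : \bigcup_i F i = Box T.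
  apply/seteqP; split => [z [n _]|z]; first exact: FB.
  move=> /BoxP[/andP[z0 z1] z2].
  have c : Tn n @[n --> \oo] --> T * (1 - 0).
    by apply: cvgMr; apply: cvgB; [exact: cvg_cst|exact: hn_cvg].
  rewrite subr0 mulr1 in c; have /cvgrPdist_lt/(_ (T - z.1)) := c.
  rewrite subr_gt0 => /(_ z1) [N _ /(_ N (leqnn _)) /= hN].
  exists N => //; apply/BoxP; split => //; rewrite z0 /=.
  by move: hN; rewrite ltr_norml => /andP[_]; lra.
rewrite pr_integral// -UF -(cvg_lim (@ereal_hausdorff R) cF).
apply: lime_le; first by apply/cvg_ex; eexists; exact: cF.
apply: nearW => n; have /andP[n0 nT] := Tn_lt n.
have [t /andP[nt tT] Ht] := ae_pick n0 nT H.
apply: le_trans Ht.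
have mD : measurable (Icc 0 t `*` I01 R : set (RR * RR)).
  by apply: measurableX; exact: measurable_itv.
have sD : Icc 0 t `*` I01 R `<=` Dom T.
  move=> z [/= + ?]; rewrite /Icc /= in_itv/= => /andP[z0 zt]; split => //=.
  by rewrite /Icc /= in_itv/= z0 (le_trans zt (ltW tT)).
have sF : F n `<=` Icc 0 t `*` I01 R.
  move=> z /BoxP[/andP[z0 z1] z2]; split; rewrite /Icc /I01 /= in_itv/=; last by [].
  by rewrite z0 ltW// (lt_trans z1).
have mf2 : measurable_fun (Icc 0 t `*` I01 R) (fun z : RR * RR => (f z.1 z.2 ^+ 2)%:E).
  apply/measurable_EFinP; apply: (@measurable_funX _ _ _ _ (fun z : RR * RR => f z.1 z.2)).
  exact: measurable_funS (measurable_Dom T) sD mfD.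
have -> : (\int[leb2 R]_(z in F n) (ext T f z.1 z.2 ^+ 2)%:E =
    \int[leb2 R]_(z in F n) (f z.1 z.2 ^+ 2)%:E)%E.
  apply: eq_integral => z /set_mem /FB /BoxP[z1 z2]; rewrite /ext z1 fracE//.
apply: ge0_subset_integral => //; first exact: measurable_Box.
by move=> z _; rewrite lee_fin sqr_ge0.
Qed.

End square_integrable.

(** * Rescaling and truncation *)

Section scaling.
Context (R : realType).
Local Notation RR := (measurableTypeR R).
Local Notation mX := (@lebI R 1).

Lemma pr_in (T : R) : {ae pr (lebI T) mX, forall z, 0 <= z.1 < T /\ 0 <= z.2 < 1}.
Proof.
exists (~` Box T); split; first exact: measurableC.
- by rewrite [LHS]pr_Box ?setICl ?measure0//; exact: measurableC.
- by move=> z nz Bz; apply: nz; exact/BoxP.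
Qed.

Lemma ext_ae (T : R) (f : R -> R -> R) :
  {ae pr (lebI T) mX, forall z, ext T f z.1 z.2 = f z.1 z.2}.
Proof. by apply: aeS (pr_in T) => z [z1 z2]; rewrite /ext z1 fracE. Qed.

(** Besides the factor [k], a change on null sets is allowed; this is how truncated representatives
    enter the laws. *)
Lemma claw_scale (T k : R) (q F q' F' : R -> R -> R) (q0 q0' : R -> R) :
  LL (lebI T) mX q -> LL (lebI T) mX F -> L1 mX q0 -> M2 q' -> M2 F' -> M1 q0' ->
  {ae pr (lebI T) mX, forall z, q' z.1 z.2 = k * q z.1 z.2} ->
  {ae pr (lebI T) mX, forall z, F' z.1 z.2 = k * F z.1 z.2} ->
  {ae mX, forall x, q0' x = k * q0 x} -> claw T q F q0 -> claw T q' F' q0'.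
Proof.
move=> Lq LF Lq0 mq' mF' mq0' Eq EF Eq0 law psi tp; have tp' := test1_derive1 tp.
have [mp mp'] := (test1_M1 tp, test1_M1 tp').
have [Lk _] := LL_Int1 (LL_test tp' LF).
apply: aeS3 (law _ tp) (ae_pr1 Eq) (LL1 Lq) => t E Eqt Lqt.
have Lqp := L1_test tp Lqt; have Lq0p := L1_test tp Lq0.
have mqt : M1 (q t) := L1_meas Lqt; have mq0 : M1 q0 := L1_meas Lq0.
have mF : M2 F := L1_meas LF.
transitivity (k * Int mX (fun x => q t x * psi x)).
  rewrite -(IntZ k Lqp); have ? := M2_1 t mq'; apply: Int_ae; [by meas|by meas|].
  by apply: aeS Eqt => x /= ->; rewrite mulrA.
rewrite E mulrDr; congr (_ + _).
  rewrite -(IntZ k Lq0p); apply: Int_ae; [by meas|by meas|].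
  by apply: aeS Eq0 => x ->; rewrite mulrA.
rewrite -(primZ _ _ Lk); apply: prim_ae; [by meas|by meas|].
apply: aeS2 (ae_pr1 EF) (LL1 LF) => s EFs LFs; have Lp := L1_test tp' LFs.
rewrite -(IntZ k Lp); have [? ?] := (M2_1 s mF', M2_1 s mF).
by apply: Int_ae; [by meas|by meas|]; apply: aeS EFs => x /= ->; rewrite mulrA.
Qed.

Lemma wdx_scale (T k : R) (f g f' g' : R -> R -> R) :
  LL (lebI T) mX f -> LL (lebI T) mX g -> M2 f' -> M2 g' ->
  {ae pr (lebI T) mX, forall z, f' z.1 z.2 = k * f z.1 z.2} ->
  {ae pr (lebI T) mX, forall z, g' z.1 z.2 = k * g z.1 z.2} ->
  wdx T f g -> wdx T f' g'.
Proof.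
move=> Lf Lg mf' mg' Ef Eg H psi tp; have tp' := test1_derive1 tp.
have [mp mp'] := (test1_M1 tp, test1_M1 tp').
have HL := aeS2 (fun t a b => conj a b) (LL1 Lf) (LL1 Lg).
have HE := aeS2 (fun t a b => conj a b) (ae_pr1 Ef) (ae_pr1 Eg).
apply: aeS3 HL HE (H _ tp) => t [Lft Lgt] [Eft Egt] E.
have Lfp := L1_test tp' Lft; have Lgp := L1_test tp Lgt.
have [mft mgt] : M1 (f t) /\ M1 (g t) by split; [exact: L1_meas Lft|exact: L1_meas Lgt].
have [? ?] := (M2_1 t mf', M2_1 t mg').
transitivity (k * Int mX (fun x => f t x * derive1 psi x)).
  rewrite -(IntZ k Lfp); apply: Int_ae; [by meas|by meas|].
  by apply: aeS Eft => x /= ->; rewrite mulrA.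
rewrite E mulrN; congr (- _); rewrite -(IntZ k Lgp); apply: Int_ae; [by meas|by meas|].
by apply: aeS Egt => x /= ->; rewrite mulrA.
Qed.

(** Turns a bound valid almost everywhere into one valid everywhere, at the cost of a change on a
    null set. *)
Definition clamp (l h x : R) : R := Num.max l (Num.min x h).

Lemma clamp_itv l h x : l <= h -> l <= clamp l h x <= h.
Proof. by move=> lh; rewrite /clamp le_max lexx ge_max lh ge_min lexx orbT. Qed.

Lemma clampK l h x : l <= x <= h -> clamp l h x = x.
Proof. by move=> /andP[lx xh]; rewrite /clamp min_l// max_r. Qed.

Lemma clamp_abs B x : 0 <= B -> `|clamp (- B) B x| <= B.
Proof. by move=> B0; rewrite ler_norml clamp_itv//; lra. Qed.

Lemma clamp_absK B x : `|x| <= B -> clamp (- B) B x = x.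
Proof. by rewrite ler_norml; exact: clampK. Qed.

Lemma M2_clamp l h (f : R -> R -> R) : M2 f -> M2 (fun t x => clamp l h (f t x)).
Proof. by move=> mf; rewrite /clamp; meas. Qed.

Lemma M1_clamp l h (f : R -> R) : M1 f -> M1 (fun x => clamp l h (f x)).
Proof. by move=> mf; rewrite /clamp; meas. Qed.

End scaling.

(** * Initial data *)

Section initial_data.
Context (R : realType).
Local Notation RR := (measurableTypeR R).
Local Notation mX := (@lebI R 1).

Lemma ext1_integral (f : R -> R) (h : R -> R -> R) : M1 (fun x => h (ext1 f x) x) ->
  (\int[mX]_x (h (ext1 f x) x)%:E = \int[leb R]_(x in I01 R) (h (f x) x)%:E)%E.
Proof.
move=> mh; rewrite lebI_integral; last by apply/measurable_EFinP.
by apply: eq_integral => x /set_mem; rewrite /= in_itv/= => x01; rewrite /ext1 fracE.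
Qed.

Lemma ext1_square (f : R -> R) : measurable_fun (I01 R) f ->
  (\int[leb R]_(x in I01 R) (f x ^+ 2)%:E < +oo)%E -> L1 mX (ext1 f).
Proof.
move=> mf fi; have me := M1_ext1 mf; have m2 : M1 (fun x => ext1 f x ^+ 2) by meas.
have E := @ext1_integral f (fun y _ => y ^+ 2) m2.
have fn : (\int[mX]_x (ext1 f x ^+ 2)%:E)%E \is a fin_num.
  by rewrite ge0_fin_numE ?E//; apply: integral_ge0 => x _; rewrite lee_fin sqr_ge0.
have le : (\int[mX]_x (ext1 f x ^+ 2)%:E <=
    (fine (\int[mX]_x (ext1 f x ^+ 2)%:E))%:E)%E by rewrite fineK.
by have [] := L1_square me le.
Qed.

(** Seen as a function of [(t, x)] constant in [t], the velocity falls under [wdx_prim]: it is a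
    constant plus the primitive of an integrable function. One good time, found by [ae_pick], is
    enough. *)
Lemma H1per_bounded (u0 : R -> R) : H1per u0 -> L1 mX (ext1 u0) /\
  exists2 B, 0 <= B & {ae mX, forall x, `|ext1 u0 x| <= B}.
Proof.
move=> [mu [u2 [v [mv [v2 H]]]]].
have [Lu Lv] := (ext1_square mu u2, ext1_square mv v2).
have [mu' mv'] : M1 (ext1 u0) /\ M1 (ext1 v) by split; exact: M1_ext1.
split=> //.
have lift (f : R -> R) : L1 mX f -> LL (lebI 1) mX (fun _ x => f x).
  move=> Lf; have := LL_prod (L1_cst (@lebI R 1) 1) Lf.
  by congr (L1 _ _); apply/funext => z; rewrite mul1r.
have w : wdx 1 (fun _ x => ext1 u0 x) (fun _ x => ext1 v x).
  move=> psi tp; apply: aeW => t; have tp' := test1_derive1 tp.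
  have [mp mp'] := (test1_M1 tp, test1_M1 tp').
  have E1 := @ext1_integral u0 (fun y x => y * derive1 psi x) ltac:(by meas).
  have E2 := @ext1_integral v (fun y x => y * psi x) ltac:(by meas).
  have := H psi tp; rewrite -E1 -E2 (L1_fin (L1_test tp' Lu)) (L1_fin (L1_test tp Lv)).
  by rewrite -EFinN => -[].
have := wdx_prim (lift _ Lu) (lift _ Lv) w; set k := kap _ _ => A.
have : {ae leb R, forall t, Icc 0 1 t -> t < 1 -> Int mX (ext1 v) = 0 /\
    {ae mX, forall x, ext1 u0 x = k t + prim 1 (ext1 v) x}}.
  have := lebI_ae A; case=> N [mN N0 HN]; exists N; split => // t nP; apply: HN => h.
  apply: nP; rewrite /Icc /= in_itv/= => /andP[t0 _] t1; apply: h; by rewrite t0.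
move=> /(ae_pick (lexx 0) ltr01) [t /andP[t0 t1] /(_ t1) [_ Et]].
exists (`|k t| + Int mX (fun s => `|ext1 v s|)).
  by rewrite addr_ge0// Int_ge0.
apply: aeS Et => x ->; apply: le_trans (ler_normD _ _) _.
by rewrite lerD2l prim_abs.
Qed.

Lemma ext1_ae (P : R -> Prop) (f : R -> R) : {ae leb R, forall x, I01 R x -> P (f x)} ->
  {ae mX, forall x, P (ext1 f x)}.
Proof.
move=> H; have H1 : {ae mX, forall x, P (f x)}.
  apply: ae_lebI; case: H => N [mN N0 HN]; exists N; split; [exact: mN|exact: N0|].
  move=> x nP; apply: HN => /= h.
  by apply: nP => x01; apply: h; rewrite /I01 /= in_itv.
by apply: aeS2 (@frac_ae R) H1 => x E; rewrite /ext1 E.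
Qed.


Lemma sum_bounds (x1 x2 x3 x4 x5 x6 k : R) :
  0 <= x1 -> 0 <= x2 -> 0 <= x3 -> 0 <= x4 -> 0 <= x5 -> 0 <= x6 ->
  x1 + x2 + x3 + x4 + x5 + x6 + 1 <= k ->
  [/\ x1 <= k, x2 <= k & x3 <= k] /\ [/\ x4 <= k, x5 <= k & x6 <= k].
Proof. by move=> *; split; split; lra. Qed.

End initial_data.

(** * Normalisation by the total mass *)

Section normalisation.
Context (R : realType).
Local Notation RR := (measurableTypeR R).
Local Notation mX := (@lebI R 1).
Variables (P : params R) (T : R) (rho0 c0 th0 u0 r0 k0 t0 v0 : R -> R) (rl0 rh0 B0 : R).
Hypotheses (okP : params_ok P) (T0 : 0 < T).
Hypotheses (mr0 : M1 r0) (mk0 : M1 k0) (mt0 : M1 t0) (mv0 : M1 v0).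
Hypotheses (rl0p : 0 < rl0) (r0b : forall x, rl0 <= r0 x <= rh0) (k0b : forall x, 0 <= k0 x <= 1).
Hypotheses (t0b : forall x, `|t0 x| <= B0) (v0b : forall x, `|v0 x| <= B0).
Hypotheses (Er0 : {ae mX, forall x, ext1 rho0 x = r0 x}) (Ek0 : {ae mX, forall x, ext1 c0 x = k0 x}).
Hypotheses (Et0 : {ae mX, forall x, ext1 th0 x = t0 x}) (Ev0 : {ae mX, forall x, ext1 u0 x = v0 x}).
Hypotheses (mrho0 : M1 (ext1 rho0)) (mc0 : M1 (ext1 c0)) (mth0 : M1 (ext1 th0)) (mu0 : M1 (ext1 u0)).

Definition mass := Int mX r0.
(** With density and stress divided by the mass, the viscosity is divided as well; the pressure is
    linear in the density, so [gamma] is unchanged. *)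
Definition mass_params := Params (mu_p P / mass) (mu_m P / mass) (gam_p P) (gam_m P) (cv_p P) (cv_m P).
Local Notation mT := (lebI T).

Let r0p x : 0 < r0 x. Proof. by have /andP[+ _] := r0b x; exact: lt_le_trans. Qed.
Let Lr0 : L1 mX r0.
Proof.
apply: (@L1_bnd _ _ _ mX _ rh0) => // x; rewrite gtr0_norm//.
by have /andP[] := r0b x.
Qed.
Let mass_itv (f : R -> R) l h : L1 mX f -> (forall x, l <= f x <= h) -> l <= Int mX f <= h.
Proof.
move=> Lf fb; have E k : Int mX (fun=> k) = k by rewrite (Int_lebI_cst _ ler01) mulr1.
apply/andP; split; [rewrite -[leLHS]E|rewrite -[leRHS]E].
- by apply: Int_le => // [|x]; [exact: L1_cst|have /andP[] := fb x].
- by apply: Int_le => // [|x]; [exact: L1_cst|have /andP[] := fb x].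
Qed.
Lemma mass_gt0 : 0 < mass.
Proof. by have /andP[+ _] := mass_itv Lr0 r0b; exact: lt_le_trans. Qed.
Let M0 := mass_gt0.

Lemma mass_params_ok : params_ok mass_params.
Proof. by move: okP; rewrite /params_ok /= => -[? [? ?]]; split; [|split]; rewrite ?divr_gt0. Qed.

Section one_solution.
Variables (c rho th u ux sx : R -> R -> R) (rl rh Bt C5 C8 Mc : R).
Let sig := sigma P c rho th ux.
Hypotheses (mc : measurable_fun (Dom T) (unc c)) (mrho : measurable_fun (Dom T) (unc rho)).
Hypotheses (mth : measurable_fun (Dom T) (unc th)) (msx : measurable_fun (Dom T) (unc sx)).
Hypotheses (hW : L1_W11 T u ux) (ws : weak_dx T sig sx).
Hypothesis lrho : cons_law T rho (fun t x => rho t x * u t x) rho0.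
Hypothesis lc : cons_law T (fun t x => rho t x * c t x) (fun t x => rho t x * c t x * u t x)
  (fun x => rho0 x * c0 x).
Hypothesis lu : cons_law T (fun t x => rho t x * u t x)
  (fun t x => rho t x * u t x ^+ 2 - sig t x) (fun x => rho0 x * u0 x).
Hypothesis lE : cons_law T (fun t x => rho t x * energy P c th u t x)
  (fun t x => rho t x * energy P c th u t x * u t x - sig t x * u t x)
  (fun x => rho0 x * energy0 P c0 th0 u0 x).
Hypotheses (rlp : 0 < rl) (rlh : rl <= rh) (Mc0 : 0 <= Mc) (Bt0 : 0 <= Bt).
Hypothesis cb : {ae leb2 R, forall z, Dom T z -> `|c z.1 z.2| <= Mc}.
Hypothesis bnd : {ae leb2 R, forall z, Dom T z ->
  rl <= rho z.1 z.2 <= rh /\ `|th z.1 z.2| <= Bt}.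
Hypothesis hC5 : {ae leb R, forall t, Icc 0 T t ->
  (\int[leb R]_(x in I01 R) (sig t x ^+ 2)%:E
   + \int[leb2 R]_(z in Icc 0 t `*` (I01 R)) (sx z.1 z.2 ^+ 2)%:E <= C5%:E)%E}.
Hypothesis hC8 : {ae leb R, forall t, Icc 0 T t ->
  (\int[leb R]_(x in I01 R) (ux t x ^+ 2)%:E <= C8%:E)%E}.

Let ec := ext T c.
Let er := ext T rho.
Let et := ext T th.
Let eu := ext T u.
Let ex := ext T ux.
Let es := ext T sx.
Let eS := ext T sig.
Let mec : M2 ec := M2_ext mc.
Let mer : M2 er := M2_ext mrho.
Let met : M2 et := M2_ext mth.
Let mes : M2 es := M2_ext msx.
Let Leu : LL mT mX eu.
Proof. by have [iu _] := hW; have [] := ext_LL T0 iu. Qed.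
Let Lex : LL mT mX ex.
Proof. by have [_ [ix _]] := hW; have [] := ext_LL T0 ix. Qed.
Let meu : M2 eu := L1_meas Leu.
Let mex : M2 ex := L1_meas Lex.

Let eSE : eS = sigma P ec er et ex.
Proof.
apply/funext => t; apply/funext => x; rewrite /eS /sigma /pres /ec /er /et /ex /ext.
by case: ifP => // _; rewrite !mulr0 subr0.
Qed.
Let meS : M2 eS. Proof. by rewrite eSE; exact: M2_sigma. Qed.

Let r t x := clamp rl rh (er t x).
Let cc t x := clamp (- Mc) Mc (ec t x).
Let tt t x := clamp (- Bt) Bt (et t x).
Let mr : M2 r := M2_clamp rl rh mer.
Let mcc : M2 cc := M2_clamp (- Mc) Mc mec.
Let mtt : M2 tt := M2_clamp (- Bt) Bt met.
Let rb t x : rl <= r t x <= rh. Proof. exact: clamp_itv. Qed.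
Let rp t x : 0 < r t x. Proof. by have /andP[+ _] := rb t x; exact: lt_le_trans. Qed.
Let rh_p : 0 < rh. Proof. exact: lt_le_trans rlh. Qed.
Let rn t x : `|r t x| <= rh. Proof. by rewrite gtr0_norm//; have /andP[] := rb t x. Qed.
Let ccb t x : `|cc t x| <= Mc. Proof. exact: clamp_abs. Qed.
Let ttb t x : `|tt t x| <= Bt. Proof. exact: clamp_abs. Qed.

Let r_ae : {ae pr mT mX, forall z, r z.1 z.2 = er z.1 z.2}.
Proof. by apply: aeS2 (ae_Dom bnd) (ext_ae T rho) => z [b _] E; rewrite /r clampK// [er _ _]E. Qed.
Let tt_ae : {ae pr mT mX, forall z, tt z.1 z.2 = et z.1 z.2}.
Proof. by apply: aeS2 (ae_Dom bnd) (ext_ae T th) => z [_ b] E; rewrite /tt clamp_absK// [et _ _]E. Qed.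
Let cc_ae : {ae pr mT mX, forall z, cc z.1 z.2 = ec z.1 z.2}.
Proof. by apply: aeS2 (ae_Dom cb) (ext_ae T c) => z b E; rewrite /cc clamp_absK// [ec _ _]E. Qed.

Let Lr : LL mT mX r := LL_bnd mT mX mr rn.
Let Ler : LL mT mX er := LL_ae mer Lr r_ae.
Let Lrt t : L1 mX (r t) := L1_bnd mX (M2_1 t mr) (rn t).
Let Lru : LL mT mX (fun t x => er t x * eu t x).
Proof.
have m : M2 (fun t x => er t x * eu t x) by meas.
have E : {ae pr mT mX, forall z, r z.1 z.2 * eu z.1 z.2 = er z.1 z.2 * eu z.1 z.2}.
  by apply: aeS r_ae => z ->.
exact: (LL_ae m (LLM mr rn Leu) E).
Qed.

Let ux_slice : {ae mT, forall t, [/\ L1 mX (fun x => ex t x ^+ 2),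
  Int mX (fun x => ex t x ^+ 2) <= C8 & L1 mX (ex t)]}.
Proof.
apply: aeS (ae_time hC8) => t [tT]; rewrite -(slice_square tT mex).
by move=> h; exact: (L1_square (M2_1 t mex) h).
Qed.

Let sx_ge0 t : (0 <= \int[leb2 R]_(z in Icc 0 t `*` (I01 R)) (sx z.1 z.2 ^+ 2)%:E)%E.
Proof. by apply: integral_ge0 => z _; rewrite lee_fin sqr_ge0. Qed.
Let sig_ge0 t : (0 <= \int[leb R]_(x in I01 R) (sig t x ^+ 2)%:E)%E.
Proof. by apply: integral_ge0 => z _; rewrite lee_fin sqr_ge0. Qed.

Let sig_slice : {ae mT, forall t, [/\ L1 mX (fun x => eS t x ^+ 2),
  Int mX (fun x => eS t x ^+ 2) <= C5 & L1 mX (eS t)]}.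
Proof.
apply: aeS (ae_time hC5) => t [tT h]; apply: (L1_square (M2_1 t meS)).
by rewrite (slice_square tT meS); apply: le_trans h; rewrite leeDl.
Qed.

Let Les2 : LL mT mX (fun t x => es t x ^+ 2) /\ LL mT mX es.
Proof.
have h : {ae leb R, forall t, Icc 0 T t ->
    (\int[leb2 R]_(z in Icc 0 t `*` I01 R) (sx z.1 z.2 ^+ 2)%:E <= C5%:E)%E}.
  case: hC5 => N [mN N0 HN]; exists N; split; [exact: mN|exact: N0|].
  move=> t nP; apply: HN => /= h; apply: nP => tT; apply: le_trans (h tT).
  by rewrite -[leLHS]add0e; apply: leeD; [exact: sig_ge0|exact: lexx].
have [] := @L1_square _ _ _ (pr mT mX) (fun z => es z.1 z.2) C5 mes (box_square T0 mes msx h).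
by [].
Qed.

Let square_LL (f : R -> R -> R) C : M2 f -> {ae mT, forall t, [/\ L1 mX (fun x => f t x ^+ 2),
  Int mX (fun x => f t x ^+ 2) <= C & L1 mX (f t)]} -> LL mT mX (fun t x => f t x ^+ 2).
Proof.
move=> mf H; apply: (@LL_iter _ _ _ _ _ mT mX _ (fun=> C)); [by meas| |exact: L1_cst].
apply: aeS H => t [L2 I2 _]; split=> //.
by rewrite (@Int_eq _ _ _ mX _ (fun x => f t x ^+ 2))// => x; rewrite ger0_norm ?sqr_ge0.
Qed.
Let LeS2 := square_LL meS sig_slice.
Let Lex2 := square_LL mex ux_slice.
Let abs_sq (y : R) : `|y| <= 1 + y ^+ 2.
Proof. by rewrite -[y ^+ 2]real_normK ?num_real//; have := normr_ge0 y; move: `|y| => z; nra. Qed.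
Let LeS : LL mT mX eS.
Proof.
apply: (@LL_le _ _ _ _ _ mT mX _ (fun t x => 1 + eS t x ^+ 2)) => //.
by apply: LLD => //; exact: (L1_cst (pr mT mX) 1).
Qed.
Let LeSx : LL mT mX (fun t x => eS t x * ex t x).
Proof.
apply: (@LL_le _ _ _ _ _ mT mX _ (fun t x => eS t x ^+ 2 + ex t x ^+ 2)).
- by meas.
- exact: LLD.
move=> t x; rewrite normrM -[eS _ _ ^+ 2]real_normK ?num_real// -[ex _ _ ^+ 2]real_normK ?num_real//.
by move: `|eS t x| `|ex t x| => y z; nra.
Qed.

Let wu : wdx T eu ex. Proof. by have [_ [_ w]] := hW; exact: weak_dx_wdx. Qed.
Let wS : wdx T eS es. Proof. by have [_ L] := Les2; exact: weak_dx_wdx. Qed.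

Let mean_slice q F q0 : cons_law T q F q0 -> LL mT mX (ext T q) -> L1 mX (ext1 q0) ->
  {ae mT, forall t, Int mX (ext T q t) = Int mX (ext1 q0)}.
Proof.
move=> law Lq Lq0; have t1 := @test1_cst R 1.
have d1 : derive1 (fun=> 1 : R) = fun=> 0 by rewrite (der_derive1 (der_cst 1)).
have E : (fun t x => ext T F t x * derive1 (fun=> 1 : R) x) = fun _ _ => 0.
  by apply/funext => t; apply/funext => x; rewrite d1 mulr0.
have LF : LL mT mX (fun t x => ext T F t x * derive1 (fun=> 1 : R) x).
  by rewrite E; exact: (L1_cst (pr mT mX) 0).
apply: aeS (cons_law_slice T0 law Lq Lq0 t1 LF) => t Et.
have m1 f : Int mX (fun x => f x * 1) = Int mX f by apply: Int_eq => x; rewrite mulr1.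
rewrite -(m1 (ext T q t)) -(m1 (ext1 q0)) Et (_ : prim T _ t = 0) ?addr0//.
rewrite /prim -[RHS](Int0 mT); apply: Int_eq => s; rewrite /when; case: ifP => // _.
rewrite -[RHS](Int0 mX); apply: Int_eq => x.
by rewrite d1 mulr0.
Qed.

Let Lrho0 : L1 mX (ext1 rho0). Proof. by apply: L1_ae mrho0 Lr0 _; apply: aeS Er0 => x ->. Qed.

Let mass_ae : {ae mT, forall t, Int mX (r t) = mass}.
Proof.
have E : Int mX (ext1 rho0) = mass by apply: Int_ae.
apply: aeS2 (mean_slice lrho Ler Lrho0) (ae_pr1 r_ae) => t; rewrite E => <- Et.
by apply: Int_ae => //; exact: M2_1.
Qed.

Let Lrho0u0 : L1 mX (ext1 (fun x => rho0 x * u0 x)).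
Proof.
apply: (@L1_ae _ _ _ mX (fun x => r0 x * v0 x)); first exact: measurable_funM mrho0 mu0.
  apply: (L1Mr Lr0 mv0 v0b).
by apply: aeS2 Er0 Ev0 => x <- <-.
Qed.

Let ext_ru : ext T (fun t x => rho t x * u t x) = fun t x => er t x * eu t x.
Proof.
apply/funext => t; apply/funext => x; rewrite /er /eu /ext.
by case: ifP => // _; rewrite mul0r.
Qed.

(** In [u = k + prim ux] the primitive is bounded by the integral of [|ux|]. The constant [k] is
    controlled by the conserved momentum [m], since [k] times the mass is [m] minus the momentum of
    the primitive and the density is bounded below. *)
Let u_bnd : exists2 Uh, 0 <= Uh & {ae pr mT mX, forall z, clamp (- Uh) Uh (eu z.1 z.2) = eu z.1 z.2}.
Proof.
pose m := Int mX (ext1 (fun x => rho0 x * u0 x)).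
have mom : {ae mT, forall t, Int mX (fun x => er t x * eu t x) = m}.
  have L : LL mT mX (ext T (fun t x => rho t x * u t x)) by rewrite ext_ru.
  by have := mean_slice lu L Lrho0u0; rewrite ext_ru.
(* A bound for the integral of [|ux|], from [|y| <= 1 + y^2]. *)
pose b := 1 + `|C8|; have b0 : 0 <= b by rewrite addr_ge0.
pose Uh := (`|m| + rh * b) / rl + b.
have U0 : 0 <= Uh by rewrite addr_ge0// divr_ge0 ?addr_ge0 ?mulr_ge0// ltW.
exists Uh => //.
apply: (@ae_pr_eq _ _ _ _ _ mT mX (fun t x => clamp (- Uh) Uh (eu t x)) eu) => //.
  exact: M2_clamp.
have HL := aeS2 (fun t a b => conj a b) mom ux_slice.
apply: aeS3 HL (ae_pr1 r_ae) (wdx_prim Leu Lex wu) => t [Em [L2 I2 Lx]] Er [I0 Eu].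
set k := kap eu ex t in Eu.
have Ib : Int mX (fun x => `|ex t x|) <= b.
  apply: (@le_trans _ _ (Int mX (fun x => 1 + ex t x ^+ 2))).
    by apply: Int_le => //; [exact: L1_abs|exact: L1D (L1_cst _ _) L2].
  rewrite (IntD (L1_cst mX 1) L2) (Int_lebI_cst _ ler01) mulr1 lerD2l.
  exact: le_trans I2 (ler_norm _).
have pb x : `|prim 1 (ex t) x| <= b := le_trans (prim_abs x Lx) Ib.
have mxt : M1 (ex t) := L1_meas Lx.
have Lrp : L1 mX (fun x => r t x * prim 1 (ex t) x).
  exact: L1Mr (Lrt t) (measurable_prim 1 mxt) pb.
have Ek : k * Int mX (r t) + Int mX (fun x => r t x * prim 1 (ex t) x) = m.
  rewrite -Em -(IntZ k (Lrt t)) -(IntD (L1Z k (Lrt t)) Lrp).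
  have [? ? ?] : [/\ M1 (r t), M1 (er t) & M1 (eu t)] by split; exact: M2_1.
  apply: Int_ae; [by meas|by meas|].
  by apply: aeS2 Er Eu => x /= <- ->; ring.
have /andP[I1 _] := mass_itv (Lrt t) (rb t).
have Irp : `|Int mX (fun x => r t x * prim 1 (ex t) x)| <= rh * b.
  apply: le_trans (Int_abs Lrp) _; rewrite -[leRHS]mulr1 -(Int_lebI_cst _ ler01).
  by apply: Int_le; [exact: L1_abs|exact: L1_cst|move=> x; rewrite normrM ler_pM].
have kb : `|k| <= (`|m| + rh * b) / rl.
  rewrite ler_pdivlMr//; apply: (@le_trans _ _ (`|k| * Int mX (r t))); first by rewrite ler_wpM2l.
  have I0' : 0 <= Int mX (r t) by exact: le_trans (ltW rlp) I1.
  rewrite -[X in _ * X](ger0_norm I0') -normrM.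
  have -> : k * Int mX (r t) = m - Int mX (fun x => r t x * prim 1 (ex t) x) by rewrite -Ek addrK.
  by apply: le_trans (ler_normB _ _) _; rewrite lerD2l.
apply: aeS Eu => x ->; apply: clamp_absK; apply: le_trans (ler_normD _ _) _.
exact: lerD kb (pb x).
Qed.


Let M2_ext_of F G : M2 G -> (forall t x, 0 <= t < T -> F t (frac x) = G t x) -> M2 (ext T F).
Proof.
move=> mG FG; have m1 : M2 (ext T (fun _ _ => 1)) by apply: M2_ext; exact: measurable_cst.
have -> : ext T F = fun t x => ext T (fun _ _ => 1) t x * G t x.
  apply/funext => t; apply/funext => x; rewrite /ext; case: ifP => tT; rewrite ?mul0r//.
  by rewrite mul1r FG.
by meas.
Qed.

(** Integrability is checked on the truncated side, where it follows from the bounds, and carried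
    back to [q], [F] and [q0] by multiplying with the mass. *)
Let claw_nice q F q0 q' F' q0' : cons_law T q F q0 -> M2 (ext T q) -> M2 (ext T F) ->
  M1 (ext1 q0) -> LL mT mX q' -> LL mT mX F' -> L1 mX q0' ->
  {ae pr mT mX, forall z, q' z.1 z.2 = mass^-1 * ext T q z.1 z.2} ->
  {ae pr mT mX, forall z, F' z.1 z.2 = mass^-1 * ext T F z.1 z.2} ->
  {ae mX, forall x, q0' x = mass^-1 * ext1 q0 x} -> claw T q' F' q0'.
Proof.
move=> law mq mF mq0 Lq LF Lq0 Eq EF Eq0.
have un f : M2 f -> forall g, LL mT mX g ->
    {ae pr mT mX, forall z, g z.1 z.2 = mass^-1 * f z.1 z.2} -> LL mT mX f.
  move=> mf g Lg E; have E' : {ae pr mT mX, forall z, mass * g z.1 z.2 = f z.1 z.2}.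
    by apply: aeS E => z ->; rewrite mulVKf// gt_eqF.
  exact: (LL_ae mf (LLZ mass Lg) E').
have Lq0' : L1 mX (ext1 q0).
  apply: (L1_ae mq0 (L1Z mass Lq0)); apply: aeS Eq0 => x ->.
  by rewrite mulVKf// gt_eqF.
have [L1' L2'] := (un _ mq _ Lq Eq, un _ mF _ LF EF).
exact: (claw_scale L1' L2' Lq0' (L1_meas Lq) (L1_meas LF) (L1_meas Lq0) Eq EF Eq0
  (cons_law_claw T0 law L1' L2' Lq0')).
Qed.

Let ratio (l h x y K : R) : 0 < l -> l <= x <= h -> l <= y <= h -> h / l <= K ->
  K^-1 <= x / y <= K.
Proof.
move=> l0 /andP[lx xh] /andP[ly yh] hK.
have [x0 y0] : 0 < x /\ 0 < y by split; [exact: lt_le_trans lx|exact: lt_le_trans ly].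
have h0 : 0 < h by exact: lt_le_trans xh.
apply/andP; split.
  apply: (@le_trans _ _ (h / l)^-1); first by rewrite lef_pV2 ?posrE ?divr_gt0// (lt_le_trans _ hK)// divr_gt0.
  by rewrite invf_div; apply: ler_pM; [exact: ltW|by rewrite invr_ge0 ltW|by []|by rewrite lef_pV2 ?posrE].
apply: le_trans hK.
by apply: ler_pM; [exact: ltW|by rewrite invr_ge0 ltW|by []|by rewrite lef_pV2 ?posrE].
Qed.

(** [K] and [a] are left free above thresholds [K0] and [a0], so that two solutions can be given
    common ones. *)
Lemma normalised_solution : exists (k J t v y sg s : R -> R -> R) (K0 : R) (a0 : R -> R),
  [/\ 0 < K0, M1 a0, forall t, 0 <= a0 t & L1 mT (fun t => a0 t ^+ 2)] /\
  (forall K a, K0 <= K -> M1 a -> (forall t, a0 t <= a t) ->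
    nsol mass_params T K a (fun x => r0 x / mass) k0 t0 v0 k J t v y sg s) /\
  {ae pr mT mX, forall z, (c z.1 z.2 = k z.1 z.2 /\ rho z.1 z.2 = mass * J z.1 z.2) /\
    (th z.1 z.2 = t z.1 z.2 /\ u z.1 z.2 = v z.1 z.2)}.
Proof.
have [Uh Uh0 uu_ae] := u_bnd.
pose uu t x := clamp (- Uh) Uh (eu t x).
have muu : M2 uu := M2_clamp (- Uh) Uh meu.
have uub t x : `|uu t x| <= Uh by exact: clamp_abs.
(* Dividing by the mass at time [t], which equals [mass] for almost every [t] only, gives mean one
   at every time, as [flow] demands. *)
pose J t x := r t x / Int mX (r t).
have mJ : M2 J by rewrite /J; meas.
have Ir t := mass_itv (Lrt t) (rb t).
have J_ae : {ae pr mT mX, forall z, J z.1 z.2 = mass^-1 * er z.1 z.2}.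
  apply: (@ae_pr_eq _ _ _ _ _ mT mX J (fun t x => mass^-1 * er t x)) => //; first by meas.
  apply: aeS2 mass_ae (ae_pr1 r_ae) => t Et; apply: aeS => x /= Ex.
  by rewrite /J Et Ex mulrC.
pose sg t x := mass^-1 * eS t x; pose s t x := mass^-1 * es t x.
have [Les2' Les] := Les2.
have [Lsg Ls] : LL mT mX sg /\ LL mT mX s := conj (LLZ mass^-1 LeS) (LLZ mass^-1 Les).
have [msg ms] : M2 sg /\ M2 s by split; [exact: L1_meas Lsg|exact: L1_meas Ls].
have wsg : wdx T sg s.
  by apply: (wdx_scale (k := mass^-1) LeS Les msg ms _ _ wS); apply: aeW.
have sq (f : R -> R -> R) : LL mT mX (fun t x => f t x ^+ 2) ->
    LL mT mX (fun t x => (mass^-1 * f t x) ^+ 2).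
  move=> L; have := LLZ (mass^-1 ^+ 2) L; congr (L1 _ _).
  by apply/funext => z; rewrite exprMn.
have [Lsg2 Ls2] : LL mT mX (fun t x => sg t x ^+ 2) /\ LL mT mX (fun t x => s t x ^+ 2).
  by split; exact: sq.
(* In [sg = kap + prim s] the constant is a mean of [sg] minus a mean of [prim s]; the integral of
   [|s|] therefore enters twice. *)
pose a0 t := Int mX (fun x => `|sg t x|) + 2 * Int mX (fun x => `|s t x|).
have ma0 : M1 a0 by rewrite /a0; meas.
have a00 t : 0 <= a0 t by rewrite addr_ge0 ?mulr_ge0//; apply: Int_ge0.
have La0 : L1 mT (fun t => a0 t ^+ 2).
  have [I1 _] := LL_Int1 Lsg2; have [I2 _] := LL_Int1 Ls2.
  (* From [(x + 2 y)^2 <= 2 x^2 + 8 y^2] and [Int_square]. *)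
  apply: (@L1_le_ae _ _ _ mT _ (fun t => 2 * Int mX (fun x => sg t x ^+ 2) +
    8 * Int mX (fun x => s t x ^+ 2))); [by meas|exact: L1D (L1Z _ I1) (L1Z _ I2)|].
  have H1 := aeS2 (fun t a b => conj a b) (LL1 Lsg) (LL1 Lsg2).
  have H2 := aeS2 (fun t a b => conj a b) (LL1 Ls) (LL1 Ls2).
  apply: aeS2 H1 H2 => t [l1 l2] [l3 l4]; rewrite ger0_norm ?sqr_ge0//.
  have := Int_square l1 l2; have := Int_square l3 l4; rewrite /a0.
  move: (Int mX (fun x => `|sg t x|)) (Int mX (fun x => `|s t x|)) => x y h1 h2.
  apply: (@le_trans _ _ (2 * x ^+ 2 + 8 * y ^+ 2)); last by lra.
  by rewrite -subr_ge0 (_ : _ - _ = (x - 2 * y) ^+ 2) ?sqr_ge0//; ring.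
have sga : {ae pr mT mX, forall z, `|sg z.1 z.2| <= a0 z.1}.
  have H : {ae pr mT mX, forall z, when (a0 z.1 < `|sg z.1 z.2|) (1 : R) = 0}.
    apply: (@ae_pr_eq _ _ _ _ _ mT mX (fun t x => when (a0 t < `|sg t x|) 1) (fun _ _ => 0)) => //.
      by meas.
    apply: aeS3 (LL1 Lsg) (LL1 Ls) (wdx_prim Lsg Ls wsg) => t l1 l2 [_]; apply: aeS => x E.
    rewrite /when ltNge (_ : `|sg t x| <= a0 t)//; rewrite E /kap /a0.
    have Lp := L1_primx l2.
    have pb x' : `|prim 1 (s t) x'| <= Int mX (fun x => `|s t x|) := prim_abs x' l2.
    have Ip : `|Int mX (prim 1 (s t))| <= Int mX (fun x => `|s t x|).
      apply: le_trans (Int_abs Lp) _; rewrite -[leRHS]mulr1 -(Int_lebI_cst _ ler01).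
      by apply: Int_le; [exact: L1_abs|exact: L1_cst|].
    apply: le_trans (ler_normD _ _) _; apply: le_trans (lerD (ler_normB _ _) (pb x)) _.
    by have := Int_abs l1; lra.
  apply: aeS H => z; rewrite /when ltNge; case: leP => // _ /eqP.
  by rewrite oner_eq0.
have B00 : 0 <= B0 := le_trans (normr_ge0 _) (t0b 0).
have rh00 : 0 <= rh0 by have /andP[_] := r0b 0; apply: le_trans; exact: ltW.
have [rh0' [rl' rl0']] := (ltW rh_p, (ltW rlp, ltW rl0p)).
have [A1 e1] : exists A1, A1 = rh / rl by exists (rh / rl).
have [A2 e2] : exists A2, A2 = rh0 / rl0 by exists (rh0 / rl0).
(* A density between [rl] and [rh] divided by its mean lies between [rl / rh] and [rh / rl], and
   similarly for the data. The sum dominates every bound, and the final [1] makes it positive. *)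
pose K0 := A1 + A2 + Uh + Mc + Bt + B0 + 1.
have q1 : 0 <= A1 by rewrite e1 divr_ge0.
have q2 : 0 <= A2 by rewrite e2 divr_ge0.
have all : {ae pr mT mX, forall z, (J z.1 z.2 = mass^-1 * rho z.1 z.2 /\ cc z.1 z.2 = c z.1 z.2) /\
    (tt z.1 z.2 = th z.1 z.2 /\ uu z.1 z.2 = u z.1 z.2)}.
  have h1 := aeS2 (fun z a b => conj a b) J_ae cc_ae.
  have h2 := aeS2 (fun z a b => conj a b) tt_ae uu_ae.
  apply: aeS3 h1 h2 (pr_in T) => z [-> ->] [-> E] [z1 z2]; rewrite [uu _ _]E.
  by rewrite /er /ec /et /eu /ext z1 fracE.
have K0p : 0 < K0 := ltr_wpDl (addr_ge0 (addr_ge0 (addr_ge0 (addr_ge0 (addr_ge0 q1 q2) Uh0) Mc0) Bt0) B00) ltr01.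
exists cc, J, tt, uu, ex, sg, s, K0, a0; split; first by split.
split; last first.
  apply: aeS all => z [[-> ->] [-> ->]]; rewrite mulVKf//.
  by rewrite gt_eqF.
move=> K a K0K ma a0a.
have [[K1 K2 K3] [K4 K5 K6]] := sum_bounds q1 q2 Uh0 Mc0 Bt0 B00 K0K.
rewrite e1 in K1; rewrite e2 in K2.
have JK t x : K^-1 <= J t x <= K by exact: ratio (rb t x) (Ir t) K1.
have J0K x : K^-1 <= r0 x / mass <= K by exact: ratio (r0b x) (mass_itv Lr0 r0b) K2.
have Kp : 0 < K := lt_le_trans K0p K0K.
have Jn t x : `|J t x| <= K.
  by have /andP[h1 h2] := JK t x; rewrite ger0_norm// (le_trans _ h1)// invr_ge0 ltW.
have mJ0 : M1 (fun x => r0 x / mass) by meas.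
have J0n x : `|r0 x / mass| <= K.
  by have /andP[h1 h2] := J0K x; rewrite ger0_norm// (le_trans _ h1)// invr_ge0 ltW.
have LJ0 : L1 mX (fun x => r0 x / mass) := L1_bnd mX mJ0 J0n.
have LJ : LL mT mX J := LL_bnd mT mX mJ Jn.
have LJu : LL mT mX (fun t x => J t x * uu t x) := LLMr LJ muu uub.
have mru : M2 (ext T (fun t x => rho t x * u t x)) by rewrite ext_ru; meas.
have ext_in F z : 0 <= z.1 < T /\ 0 <= z.2 < 1 -> ext T F z.1 z.2 = F z.1 z.2.
  by move=> [z1 z2]; rewrite /ext z1 fracE.
have EJ0 : {ae mX, forall x, r0 x / mass = mass^-1 * ext1 rho0 x}.
  by apply: aeS Er0 => x ->; rewrite mulrC.
have law1 : claw T J (fun t x => J t x * uu t x) (fun x => r0 x / mass).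
  apply: (claw_nice lrho) => //.
  by apply: aeS2 all (pr_in T) => z [[-> _] [_ ->]] zi; rewrite ext_in// mulrA.
have [Lcc Lccu] : LL mT mX (fun t x => J t x * cc t x) /\
    LL mT mX (fun t x => J t x * cc t x * uu t x).
  by have L := LLMr LJ mcc ccb; split=> //; exact: LLMr L muu uub.
have lawc : claw T (fun t x => J t x * cc t x) (fun t x => J t x * cc t x * uu t x - 0)
    (fun x => r0 x / mass * k0 x).
  have m1 : M2 (ext T (fun t x => rho t x * c t x)).
    apply: (M2_ext_of (G := fun t x => er t x * ec t x)); first by meas.
    by move=> t x tT; rewrite /er /ec /ext tT.
  have m2 : M2 (ext T (fun t x => rho t x * c t x * u t x)).
    apply: (M2_ext_of (G := fun t x => er t x * ec t x * eu t x)); first by meas.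
    by move=> t x tT; rewrite /er /ec /eu /ext tT.
  have m3 : M1 (ext1 (fun x => rho0 x * c0 x)) by exact: measurable_funM mrho0 mc0.
  apply: (claw_nice lc m1 m2 m3) => //.
  - by move: Lccu; congr (L1 _ _); apply/funext => z; rewrite subr0.
  - apply: (L1Mr LJ0 mk0 (C := 1)) => x; have /andP[x0 x1] := k0b x.
    by rewrite ger0_norm.
  - by apply: aeS2 all (pr_in T) => z [[-> ->] _] zi; rewrite ext_in// mulrA.
  - by apply: aeS2 all (pr_in T) => z [[-> ->] [_ ->]] zi; rewrite ext_in//; ring.
  - apply: aeS2 EJ0 Ek0 => x -> <-; rewrite /ext1; ring.
have lawu : claw T (fun t x => J t x * uu t x) (fun t x => J t x * uu t x * uu t x - sg t x)
    (fun x => r0 x / mass * v0 x).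
  have m2 : M2 (ext T (fun t x => rho t x * u t x ^+ 2 - sig t x)).
    apply: (M2_ext_of (G := fun t x => er t x * eu t x ^+ 2 - eS t x)); first by meas.
    by move=> t x tT; rewrite /er /eu /eS /ext tT.
  have m3 : M1 (ext1 (fun x => rho0 x * u0 x)) by exact: measurable_funM mrho0 mu0.
  apply: (claw_nice lu mru m2 m3) => //.
  - exact: LLB (LLMr LJu muu uub) Lsg.
  - exact: L1Mr LJ0 mv0 v0b.
  - by apply: aeS2 all (pr_in T) => z [[-> _] [_ ->]] zi; rewrite ext_in// mulrA.
  - apply: aeS2 all (pr_in T) => z [[-> _] [_ ->]] zi.
    by rewrite ext_in// /sg [eS _ _]ext_in//; ring.
  - apply: aeS2 EJ0 Ev0 => x -> <-; rewrite /ext1; ring.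
have mE : M2 (energy P cc tt uu) by exact: M2_energy.
have mE0 : M1 (energy0 P k0 t0 v0) by exact: M1_energy0.
have cvb b x : `|x| <= b -> `|cvc P x| <= b * `|cv_p P| + (1 + b) * `|cv_m P|.
  move=> xb; apply: le_trans (ler_normD _ _) _; rewrite !normrM; apply: lerD; rewrite ler_wpM2r//.
  by apply: le_trans (ler_normB _ _) _; rewrite normr1 lerD2l.
have Eb b b' b'' (x y z : R) : `|x| <= b -> `|y| <= b' -> `|z| <= b'' ->
    `|x ^+ 2 / 2 + cvc P y * z| <= b * b / 2 + (b' * `|cv_p P| + (1 + b') * `|cv_m P|) * b''.
  move=> xb yb zb; apply: le_trans (ler_normD _ _) _; rewrite !normrM; apply: lerD.
    by rewrite normfV (ger0_norm (_ : 0 <= 2)) ?ler0n// ler_wpM2r ?invr_ge0// ler_pM.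
  by rewrite ler_pM//; exact: cvb.
have Ebd t x := Eb _ _ _ _ _ _ (uub t x) (ccb t x) (ttb t x).
have k0n x : `|k0 x| <= 1 by have /andP[x0 x1] := k0b x; rewrite ger0_norm.
have E0bd x := Eb _ _ _ _ _ _ (v0b x) (k0n x) (t0b x).
have LJE : LL mT mX (fun t x => J t x * energy P cc tt uu t x) := LLMr LJ mE Ebd.
have lawE : claw T (fun t x => J t x * energy P cc tt uu t x)
    (fun t x => J t x * energy P cc tt uu t x * uu t x - sg t x * uu t x)
    (fun x => r0 x / mass * energy0 P k0 t0 v0 x).
  have meE : M2 (energy P ec et eu) by exact: M2_energy.
  have m1 : M2 (ext T (fun t x => rho t x * energy P c th u t x)).
    apply: (M2_ext_of (G := fun t x => er t x * energy P ec et eu t x)).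
      exact: measurable_funM mer meE.
    by move=> t x tT; rewrite /energy /er /ec /et /eu /ext tT.
  have m2 : M2 (ext T (fun t x => rho t x * energy P c th u t x * u t x - sig t x * u t x)).
    apply: (M2_ext_of (G := fun t x => er t x * energy P ec et eu t x * eu t x - eS t x * eu t x)).
      exact: measurable_funB (measurable_funM (measurable_funM mer meE) meu) (measurable_funM meS meu).
    by move=> t x tT; rewrite /energy /er /ec /et /eu /eS /ext tT.
  have m3 : M1 (ext1 (fun x => rho0 x * energy0 P c0 th0 u0 x)).
    exact: measurable_funM mrho0 (M1_energy0 P mc0 mth0 mu0).
  apply: (claw_nice lE m1 m2 m3) => //.
  - exact: LLB (LLMr LJE muu uub) (LLMr Lsg muu uub).
  - exact: L1Mr LJ0 mE0 E0bd.
  - by apply: aeS2 all (pr_in T) => z [[-> Ec] [Et Eu]] zi; rewrite ext_in// /energy Ec Et Eu mulrA.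
  - apply: aeS2 all (pr_in T) => z [[-> Ec] [Et Eu]] zi.
    by rewrite ext_in// /sg [eS _ _]ext_in// /energy Ec Et Eu; ring.
  - have h := aeS2 (fun x a b => conj a b) Et0 Ev0.
    by apply: aeS3 EJ0 Ek0 h => x -> Ekx [Etx Evx]; rewrite /energy0 -Ekx -Etx -Evx /ext1; ring.
have fl : flow T K^-1 K K J uu (fun x => r0 x / mass).
  split=> //; first by rewrite invr_gt0.
  - by move=> t x; exact: le_trans (uub t x) K3.
  - move=> t; rewrite (IntZr _ (Lrt t)) divff// gt_eqF//.
    by have /andP[+ _] := Ir t; exact: lt_le_trans.
  - by rewrite (IntZr _ Lr0) divff// gt_eqF.
split.
- exact: fl.
- exact: mcc.
- exact: mtt.
- by move=> t x; exact: le_trans (ccb t x) K4.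
- by move=> t x; exact: le_trans (ttb t x) K5.
- exact: mk0.
- exact: mt0.
- exact: mv0.
- exact: k0b.
- by move=> x; exact: le_trans (t0b x) K6.
- by move=> x; exact: le_trans (v0b x) K6.
- exact: Lex.
- exact: Lsg.
- exact: Ls.
- by have := LLZ mass^-1 LeSx; congr (L1 _ _); apply/funext => z; rewrite /sg mulrA.
- apply: (wdx_scale (k := 1) Leu Lex muu mex _ _ wu); last by apply: aeW => z; rewrite mul1r.
  by apply: aeS uu_ae => z E; rewrite mul1r -[RHS]E.
- exact: wsg.
- apply: aeS3 all J_ae (pr_in T) => z [[_ Ec] [Et _]] Ej zi.
  rewrite /sigma /pres /muc /gamc /= Ec Et Ej /sg eSE /sigma /pres /muc /gamc /ec /et /er.
  rewrite !ext_in//; field.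
  by rewrite gt_eqF.
- by apply: aeS sga => z h; apply: le_trans h _.
- exact: lawc.
- exact: lawu.
- exact: lawE.
Qed.

End one_solution.
End normalisation.

Lemma leb2_aeS (R : realType) (P Q : R * R -> Prop) : (forall z, P z -> Q z) ->
  {ae leb2 R, forall z, P z} -> {ae leb2 R, forall z, Q z}.
Proof.
move=> PQ [N [mN N0 HN]]; exists N; split; [exact: mN|exact: N0|].
by move=> z nQ; apply: HN => /= Pz; apply: nQ; exact: PQ.
Qed.

Theorem mainTheorem3 (R : realType) (P : params R)
  (c0 rho0 th0 u0 : R -> R) (rho0l rho0h th0l th0h : R) :
  params_ok P ->
  Linf1 c0 -> Linf1 rho0 -> Linf1 th0 -> H1per u0 ->
  0 < rho0l -> 0 < rho0h -> 0 < th0l -> 0 < th0h ->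
  {ae leb R, forall x, I01 R x ->
     rho0l <= rho0 x <= rho0h /\ th0l <= th0 x <= th0h /\ 0 <= c0 x <= 1} ->
  forall T : R, 0 < T ->
  forall c1 rho1 th1 u1 c2 rho2 th2 u2 : R -> R -> R,
    hoff_solution P T c0 rho0 th0 u0 c1 rho1 th1 u1 ->
    hoff_solution P T c0 rho0 th0 u0 c2 rho2 th2 u2 ->
    {ae leb2 R, forall z, Dom T z ->
       c1 z.1 z.2 = c2 z.1 z.2 /\ rho1 z.1 z.2 = rho2 z.1 z.2 /\
       th1 z.1 z.2 = th2 z.1 z.2 /\ u1 z.1 z.2 = u2 z.1 z.2}.
Proof.
move=> okP [mc0 _] [mrho0 _] [mth0 _] hu0 rho0l0 rho0h0 th0l0 th0h0 bnd0 T T0.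
move=> c1 rho1 th1 u1 c2 rho2 th2 u2 h1 h2.
have [Lu0 [B B0 uB]] := H1per_bounded hu0.
have mu0 : M1 (ext1 u0) := L1_meas Lu0.
have split0 : {ae @lebI R 1, forall x, rho0l <= ext1 rho0 x <= rho0h /\
    th0l <= ext1 th0 x <= th0h /\ 0 <= ext1 c0 x <= 1}.
  have := @ext1_ae R (fun x => rho0l <= rho0 x <= rho0h /\ th0l <= th0 x <= th0h /\ 0 <= c0 x <= 1)
    id bnd0.
  by apply: aeS2 (@frac_ae R) => x E; rewrite /ext1 E.
have mrho0' := M1_ext1 mrho0; have mc0' := M1_ext1 mc0; have mth0' := M1_ext1 mth0.
(* The maximum makes the interval of truncation nonempty, as [clamp_itv] demands, without extracting
   a point from the almost-everywhere bounds. *)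
pose rhm := Num.max rho0l rho0h.
pose r0 x := clamp rho0l rhm (ext1 rho0 x); pose k0 x := clamp 0 1 (ext1 c0 x).
pose B1 := B + th0h.
pose t0 x := clamp (- B1) B1 (ext1 th0 x); pose v0 x := clamp (- B1) B1 (ext1 u0 x).
have B10 : 0 <= B1 by rewrite addr_ge0// ltW.
have [mr0 mk0] : M1 r0 /\ M1 k0 by split; exact: M1_clamp.
have [mt0 mv0] : M1 t0 /\ M1 v0 by split; exact: M1_clamp.
have r0b x : rho0l <= r0 x <= rhm by apply: clamp_itv; rewrite le_max lexx.
have k0b x : 0 <= k0 x <= 1 by apply: clamp_itv; exact: ler01.
have t0b x : `|t0 x| <= B1 by exact: clamp_abs.
have v0b x : `|v0 x| <= B1 by exact: clamp_abs.
have Er0 : {ae @lebI R 1, forall x, ext1 rho0 x = r0 x}.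
  apply: aeS split0 => x [/andP[b1 b2] _]; rewrite /r0 clampK// b1 /= /rhm le_max.
  by rewrite b2 orbT.
have Ek0 : {ae @lebI R 1, forall x, ext1 c0 x = k0 x}.
  by apply: aeS split0 => x [_ [_ b]]; rewrite /k0 clampK.
have Et0 : {ae @lebI R 1, forall x, ext1 th0 x = t0 x}.
  apply: aeS split0 => x [_ [/andP[b1 b2] _]]; rewrite /t0 clamp_absK//.
  rewrite ger0_norm; last exact: le_trans (ltW th0l0) b1.
  by apply: le_trans b2 _; rewrite lerDr.
have Ev0 : {ae @lebI R 1, forall x, ext1 u0 x = v0 x}.
  apply: aeS uB => x b; rewrite /v0 clamp_absK//; apply: le_trans b _.
  by rewrite lerDl ltW.
have M0 := mass_gt0 mr0 rho0l0 r0b.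
have key c rho th u : hoff_solution P T c0 rho0 th0 u0 c rho th u ->
  exists (k J t v y sg s : R -> R -> R) (K0 : R) (a0 : R -> R),
  [/\ 0 < K0, M1 a0, forall t, 0 <= a0 t & L1 (lebI T) (fun t => a0 t ^+ 2)] /\
  (forall K a, K0 <= K -> M1 a -> (forall t, a0 t <= a t) ->
    nsol (mass_params P r0) T K a (fun x => r0 x / mass r0) k0 t0 v0 k J t v y sg s) /\
  {ae pr (lebI T) (@lebI R 1), forall z, (c z.1 z.2 = k z.1 z.2 /\ rho z.1 z.2 = mass r0 * J z.1 z.2) /\
    (th z.1 z.2 = t z.1 z.2 /\ u z.1 z.2 = v z.1 z.2)}.
  move=> [ux [sx [sd [[[mc [Mc cMc]] [[mrho _] [[mth _] [hW [l1 [l2 [l3 l4]]]]]]] h]]]].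
  move: h => [msx [ws [_ [_ [rl [rh [tl [th' [C5 [C6 [C8 [C9 [C11 h]]]]]]]]]]]]].
  move: h => [rlp [_ [tlp [th'p [_ [_ [_ [_ [_ [b [h5 [h8 _]]]]]]]]]]]].
  have cb : {ae leb2 R, forall z, Dom T z -> `|c z.1 z.2| <= `|Mc|}.
    by apply: leb2_aeS cMc => z h /h {}h; exact: le_trans h (ler_norm _).
  have bnd : {ae leb2 R, forall z, Dom T z ->
      rl <= rho z.1 z.2 <= Num.max rl rh /\ `|th z.1 z.2| <= th'}.
    apply: leb2_aeS b => z h /h [/andP[b1 b2] /andP[b3 b4]]; split.
      by rewrite b1 le_max b2 orbT.
    by rewrite ger0_norm//; exact: le_trans (ltW tlp) b3.
  have rlh : rl <= Num.max rl rh by rewrite le_max lexx.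
  exact: (normalised_solution T0 mr0 mk0 mt0 mv0 rho0l0 r0b k0b t0b v0b Er0 Ek0 Et0 Ev0
    mrho0' mc0' mth0' mu0 mc mrho mth msx hW ws l1 l2 l3 l4 rlp rlh (normr_ge0 Mc) (ltW th'p)
    cb bnd h5 h8).
have [k1 [J1 [t1 [v1 [y1 [sg1 [s1 [K1 [a1 [[K10 ma1 a10 La1] [n1 E1]]]]]]]]]]] := key _ _ _ _ h1.
have [k2 [J2 [t2 [v2 [y2 [sg2 [s2 [K2 [a2 [[K20 ma2 a20 La2] [n2 E2]]]]]]]]]]] := key _ _ _ _ h2.
(* The sums [K1 + K2] and [a1 + a2] lie above the thresholds of both solutions. *)
have K0 : 0 < K1 + K2 by rewrite addr_gt0.
have ma : M1 (fun t => a1 t + a2 t) by meas.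
have a0 t : 0 <= a1 t + a2 t by rewrite addr_ge0.
have La : L1 (lebI T) (fun t => (a1 t + a2 t) ^+ 2).
  apply: (@L1_le _ _ _ (lebI T) _ (fun t => 2 * a1 t ^+ 2 + 2 * a2 t ^+ 2)); first by meas.
    exact: L1D (L1Z _ La1) (L1Z _ La2).
  move=> t; rewrite ger0_norm ?sqr_ge0// -subr_ge0 (_ : _ - _ = (a1 t - a2 t) ^+ 2) ?sqr_ge0//.
  by ring.
have K1K : K1 <= K1 + K2 by rewrite lerDl ltW.
have K2K : K2 <= K1 + K2 by rewrite lerDr ltW.
have a1a t : a1 t <= a1 t + a2 t by rewrite lerDl.
have a2a t : a2 t <= a1 t + a2 t by rewrite lerDr.
(* The mass is computed from the initial density, so both solutions are divided by the same factor
   and obey the same rescaled system. *)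
have okM : params_ok (mass_params P r0) := mass_params_ok okP mr0 rho0l0 r0b.
have U := nsol_unique okM K0 ma a0 La (n1 _ _ K1K ma a1a) (n2 _ _ K2K ma a2a).
apply: (Dom_ae T0); apply: aeS3 E1 E2 U => z [[-> ->] [-> ->]] [[-> ->] [-> ->]] [[-> ->] [-> ->]].
by [].
Qed.
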